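(* Let $p$ be an odd prime, let $L$ be a primitive ternary lattice with $\mathrm{ord}_p(dL)\ge 2$, and suppose $\Lambda_p(L)=N$. Then the label of $\Gamma_p^L(N)$ (the multiset of labels of the isometry classes of lattices in $\Gamma_p^L(N)$) can be computed effectively from the label of $N$ and a Jordan decomposition of $L_p$.
   Context: Quadratic spaces are positive definite over $\mathbb{Q}$; a lattice is a $\mathbb{Z}$-lattice on such a space with quadratic map $Q$ and bilinear form $B$, $Q(x)=B(x,x)$; primitive means the scale ideal (generated by $B(L,L)$) is $\mathbb{Z}$; $dL$ is the Gram determinant; $L_p=\mathbb{Z}_p\otimes L$; $O(L)$ is the isometry group; $\mathrm{gen}(L)$ is the set of lattices on the same space in the genus of $L$. $\Lambda_p(L)=\{x\in L: Q(x+y)\equiv Q(y)\pmod p\ \forall y\in L\}$ and $\Gamma_p^L(N)=\{M\in \mathrm{gen}(L):\Lambda_p(M)=N\}$. For nonzero $x$, $\tau_x(y)=y-\frac{2B(x,y)}{Q(x)}x$; for a symmetry $\sigma$ of a lattice $K$, $Q_K(\sigma)=Q(x)$ with $x$ primitive in $K$ and $\sigma=\tau_x$. The label of a ternary lattice $K$, whose symmetries in $O(K)$ are $\sigma_1,\dots,\sigma_t$ ordered so that $Q_K(\sigma_i)\le Q_K(\sigma_{i+1})$, is $[\,|O(K)|; Q_K(\sigma_1),\dots,Q_K(\sigma_t)\,]$; the label of an isometry class is the label of any of its lattices. *)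

(* Defs.v *)
From HB Require Import structures.
From mathcomp Require Import all_boot all_order all_algebra.
From mathcomp Require Import boolp classical_sets cardinality.

Set Implicit Arguments.
Unset Strict Implicit.
Unset Printing Implicit Defensive.

Import Order.TTheory GRing.Theory Num.Theory.
Local Open Scope classical_set_scope.
Local Open Scope ring_scope.

(** * The ring Z_p, as the inverse limit of the Z/p^k

  An element is the sequence of its canonical residues mod p^k, k = 0, 1, ... *)

Record padicInt (p : nat) := PadicInt {
  res : nat -> int;
  res_coh : forall k, res k = (res k.+1 %% (p ^ k)%N)%Z }.

HB.instance Definition _ p := gen_eqMixin (padicInt p).
HB.instance Definition _ p := gen_choiceMixin (padicInt p).

Section PadicIntRing.
Variable p : nat.
Implicit Types x y z : padicInt p.

Lemma padicInt_eq x y : res x =1 res y -> x = y.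
Proof.
case: x y => [f cf] [g cg] /= /funext fg; move: cf cg; rewrite {}fg => cf cg.
by rewrite (Prop_irrelevance cf cg).
Qed.

Lemma modz_dvd (m d e : int) : (d %| e)%Z -> ((m %% e)%Z %% d)%Z = (m %% d)%Z.
Proof.
by move=> /dvdzP[q ->]; rewrite {2}(divz_eq m (q * d)) mulrA modzMDl.
Qed.

Lemma res_mod x k : (res x k %% (p ^ k)%N)%Z = res x k.
Proof. by rewrite res_coh modz_mod. Qed.

Lemma dvdz_expS k : ((p ^ k)%N %| (p ^ k.+1)%N%:Z)%Z.
Proof. by rewrite dvdzE /= dvdn_exp2l. Qed.

Lemma const_coh (m : int) k :
  (m %% (p ^ k)%N)%Z = ((m %% (p ^ k.+1)%N)%Z %% (p ^ k)%N)%Z.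
Proof. by rewrite modz_dvd ?dvdz_expS. Qed.

Lemma add_coh x y k : ((res x k + res y k) %% (p ^ k)%N)%Z =
  (((res x k.+1 + res y k.+1) %% (p ^ k.+1)%N)%Z %% (p ^ k)%N)%Z.
Proof. by rewrite modz_dvd ?dvdz_expS// (res_coh x) (res_coh y) modzDm. Qed.

Lemma opp_coh x k : ((- res x k) %% (p ^ k)%N)%Z =
  (((- res x k.+1) %% (p ^ k.+1)%N)%Z %% (p ^ k)%N)%Z.
Proof. by rewrite modz_dvd ?dvdz_expS// (res_coh x) modzNm. Qed.

Lemma mul_coh x y k : ((res x k * res y k) %% (p ^ k)%N)%Z =
  (((res x k.+1 * res y k.+1) %% (p ^ k.+1)%N)%Z %% (p ^ k)%N)%Z.
Proof. by rewrite modz_dvd ?dvdz_expS// (res_coh x) (res_coh y) modzMm. Qed.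

Definition padic_const m := PadicInt (const_coh m).
Definition padic_add x y := PadicInt (add_coh x y).
Definition padic_opp x := PadicInt (opp_coh x).
Definition padic_mul x y := PadicInt (mul_coh x y).

Lemma padic_addA : associative padic_add.
Proof. by move=> x y z; apply: padicInt_eq => k /=; rewrite modzDml modzDmr addrA. Qed.

Lemma padic_addC : commutative padic_add.
Proof. by move=> x y; apply: padicInt_eq => k /=; rewrite addrC. Qed.

Lemma padic_add0 : left_id (padic_const 0) padic_add.
Proof. by move=> x; apply: padicInt_eq => k /=; rewrite mod0z add0r res_mod. Qed.

Lemma padic_addN : left_inverse (padic_const 0) padic_opp padic_add.
Proof. by move=> x; apply: padicInt_eq => k /=; rewrite modzDml addNr. Qed.

HB.instance Definition _ := GRing.isZmodule.Build (padicInt p)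
  padic_addA padic_addC padic_add0 padic_addN.

Lemma padic_mulA : associative padic_mul.
Proof. by move=> x y z; apply: padicInt_eq => k /=; rewrite modzMml modzMmr mulrA. Qed.

Lemma padic_mulC : commutative padic_mul.
Proof. by move=> x y; apply: padicInt_eq => k /=; rewrite mulrC. Qed.

Lemma padic_mul1 : left_id (padic_const 1) padic_mul.
Proof. by move=> x; apply: padicInt_eq => k /=; rewrite modzMml mul1r res_mod. Qed.

Lemma padic_mulDl : left_distributive padic_mul padic_add.
Proof. by move=> x y z; apply: padicInt_eq => k /=; rewrite modzMml modzDm mulrDl. Qed.

HB.instance Definition _ := GRing.Zmodule_isComPzRing.Build (padicInt p)
  padic_mulA padic_mulC padic_mul1 padic_mulDl.

End PadicIntRing.

(** * Quadratic spaces and lattices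

  The space is Q^n (row vectors) with the bilinear form of Gram matrix S;
  linear maps act on the right. *)

Section Lattices.
Variables (n : nat) (S : 'M[rat]_n).
Implicit Types (x y : 'rV[rat]_n) (L K M N : set 'rV[rat]_n) (T : 'M[rat]_n).

Definition bform x y : rat := (x *m S *m y^T) 0 0.
Definition qform x : rat := bform x x.

Definition posdef_space : Prop :=
  S^T = S /\ forall x, x != 0 -> 0 < qform x.

Definition lattice_basis L (A : 'M[rat]_n) : Prop :=
  A \in unitmx /\ L = range (fun z : 'rV[int]_n => map_mx intr z *m A).

Definition is_lattice L : Prop := exists A, lattice_basis L A.

Definition gram (A : 'M[rat]_n) : 'M[rat]_n := A *m S *m A^T.

(* Any two bases of a lattice have the same Gram determinant. *)
Definition disc L : rat := \det (gram (xget 1%:M (lattice_basis L))).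

Definition ordp (p : nat) (r : rat) : int :=
  (logn p `|numq r|)%:Z - (logn p `|denq r|)%:Z.

Definition scale L : set rat :=
  [set r | exists s : seq (int * ('rV[rat]_n * 'rV[rat]_n)),
     (forall t, t \in s -> L t.2.1 /\ L t.2.2) /\
     r = \sum_(t <- s) t.1%:~R * bform t.2.1 t.2.2].

Definition primitive_lattice L : Prop := scale L = range (intr : int -> rat).

Definition Lambda (p : nat) L : set 'rV[rat]_n :=
  [set x | L x /\ forall y, L y ->
     exists m : int, qform (x + y) - qform y = (p%:Z * m)%:~R].

Definition isometry T : Prop := T *m S *m T^T = S.

Definition image_by T L : set 'rV[rat]_n := [set x *m T | x in L].

Definition isometric L M : Prop := exists T, isometry T /\ image_by T L = M.

Definition isometry_group L : set 'M[rat]_n :=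
  [set T | isometry T /\ image_by T L = L].

(** ** Localization

  [local_gram p L G]: G is the Gram matrix of L_p = Z_p (x) L in a basis coming
  from a Z-basis of L. Integer entries are required of the Gram matrix of the
  Z-basis, so this is meant for lattices with B(L, L) contained in Z; in
  particular for primitive lattices and everything in their genera. *)

Definition local_gram (p : nat) L (G : 'M[padicInt p]_n) : Prop :=
  exists (A : 'M[rat]_n) (G0 : 'M[int]_n),
    [/\ lattice_basis L A, gram A = map_mx intr G0 & G = map_mx intr G0].

Definition padic_isometric (p : nat) (G H : 'M[padicInt p]_n) : Prop :=
  exists T T' : 'M[padicInt p]_n,
    [/\ T *m T' = 1%:M, T' *m T = 1%:M & T *m G *m T^T = H].

Definition genus L : set (set 'rV[rat]_n) :=
  [set M | is_lattice M /\ forall q, prime q ->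
     exists G H : 'M[padicInt q]_n,
       [/\ local_gram L G, local_gram M H & padic_isometric G H]].

Definition Gamma (p : nat) L N : set (set 'rV[rat]_n) :=
  [set M | genus L M /\ Lambda p M = N].

(* The finite data (e_i, a_i) presents the Jordan decomposition
     L_p = Z_p v_1 _|_ ... _|_ Z_p v_n,   Q(v_i) = p^(e_i) a_i,   p not dividing a_i,
   whose Jordan components are the spans of the v_i with a given e_i. For odd p
   every Jordan decomposition of L_p has such a presentation: its components have
   orthogonal bases, and any unit of Z_p is a natural number times a unit square. *)
Definition jordan_decomposition (p : nat) L (J : n.-tuple (nat * nat)) : Prop :=
  [/\ sorted leq [seq t.1 | t <- J],
      all (fun t => coprime p t.2) J
    & exists2 G : 'M[padicInt p]_n, local_gram L G &
        padic_isometric G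
          (diag_mx (\row_i (p ^ (tnth J i).1 * (tnth J i).2)%N%:R))].

(** ** Symmetries and labels *)

Definition tau x : 'M[rat]_n :=
  lin1_mx (fun y => y - (2 * bform x y / qform x) *: x).

Definition primitive_vector K x : Prop :=
  K x /\ forall (m : int) y, K y -> x = m%:~R *: y -> `|m|%N = 1%N.

Definition symmetry_of K : set 'M[rat]_n :=
  [set sigma | isometry_group K sigma /\ exists2 x, x != 0 & sigma = tau x].

(* [QK K sigma q]: Q_K(sigma) = q. *)
Definition QK K (sigma : 'M[rat]_n) (q : rat) : Prop :=
  exists x, [/\ primitive_vector K x, sigma = tau x & qform x = q].

End Lattices.

(* The label [h; q_1, ..., q_t]; natural numbers suffice, since labels are only
   taken of lattices with B(K, K) contained in Z. *)
Definition label : Type := (nat * seq nat)%type.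

Definition has_label (S : 'M[rat]_3) (K : set 'rV[rat]_3) (l : label) : Prop :=
  [/\ (isometry_group S K #= `I_(l.1))%card,
      sorted leq l.2
    & exists sigma : (size l.2).-tuple 'M[rat]_3,
        [/\ uniq sigma,
            (forall T, T \in (sigma : seq _) <-> symmetry_of S K T)
          & forall i, QK S K (tnth sigma i) (tnth (in_tuple l.2) i)%:R]].

(* [ms] lists, in some order and with multiplicity, the labels of the isometry
   classes in [X]; [Ms] is a system of representatives of these classes. *)
Definition class_labels (S : 'M[rat]_3) (X : set (set 'rV[rat]_3))
    (ms : seq label) : Prop :=
  exists Ms : 'I_(size ms) -> set 'rV[rat]_3,
    [/\ forall i, X (Ms i),
        forall i j, isometric S (Ms i) (Ms j) -> i = j,
        forall M, X M -> exists i, isometric S (Ms i) M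
      & forall i, has_label S (Ms i) (tnth (in_tuple ms) i)].

(** * Partial recursive functions

  Kleene's mu-recursive functions. Arities are not tracked: a program takes a
  list of arguments, and an absent argument reads as 0. *)

Inductive mu_code : Type :=
  | MuZero
  | MuSucc
  | MuProj of nat
  | MuComp of mu_code & seq mu_code
  | MuRec of mu_code & mu_code
  | MuMin of mu_code.

(* [mu_eval c s r]: the program [c] halts on the arguments [s] with value [r]. *)
Inductive mu_eval : mu_code -> seq nat -> nat -> Prop :=
  | EvalZero s : mu_eval MuZero s 0%N
  | EvalSucc s : mu_eval MuSucc s (nth 0%N s 0).+1
  | EvalProj i s : mu_eval (MuProj i) s (nth 0%N s i)
  | EvalComp f gs s ts r :
      size ts = size gs ->
      (forall i, (i < size gs)%N ->
         mu_eval (nth MuZero gs i) s (nth 0%N ts i)) ->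
      mu_eval f ts r ->
      mu_eval (MuComp f gs) s r
  | EvalRec0 f g s r : mu_eval f s r -> mu_eval (MuRec f g) (0%N :: s) r
  | EvalRecS f g m s a r :
      mu_eval (MuRec f g) (m :: s) a -> mu_eval g (m :: a :: s) r ->
      mu_eval (MuRec f g) (m.+1 :: s) r
  | EvalMin f s m :
      mu_eval f (m :: s) 0%N ->
      (forall k, (k < m)%N -> exists v, mu_eval f (k :: s) v.+1) ->
      mu_eval (MuMin f) s m.

Definition encode_label (l : label) : nat := CodeSeq.code (l.1 :: l.2).

Definition encode_labels (ms : seq label) : nat :=
  CodeSeq.code [seq encode_label l | l <- ms].

Definition encode_input (p : nat) (J : 3.-tuple (nat * nat)) (l : label) :
    seq nat :=
  [:: p, encode_label l & flatten [seq [:: t.1; t.2] | t <- J]].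

(* Main.v *)
(* The lattices M in Gamma_p^L(N) correspond to vectors u of N modulo p^(e+1):
   M is N + Z u/p, or { x | p x in N, B(x, u) in p^e Z }, according to the rank of
   the unimodular Jordan component of L_p, and u runs over the vectors with
   B(u, N) in p^e Z and Q(u) = p^e times a prescribed unit square class mod p.
   That all of them occur follows from the rational reflections in u - u', which
   are p-integral for a suitable sign of u'. Since Lambda_p(M) = N, two such
   lattices are isometric iff they are in one orbit of O(N), O(M) is the stabilizer
   of M in O(N), and the symmetries of M are those of N which preserve M, with
   Q_M = Q_N or Q_N / p^2.

   It remains to know N modulo p^(e+1) with the action of O(N). Up to sign every
   element of O(N) is 1, a symmetry or a product of two symmetries. The primitive
   vectors of symmetries form a root system of type 0, A1, A1^3, A2, B2 A1, G2 A1
   or B3, and |O(N)| = 2, 4, 8, 12, 16, 24, 48 tells these types apart. In each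
   case N has a basis at p in which the symmetries have fixed integral matrices,
   and whose Gram matrix modulo p^(e+1) is determined by the label of N and the
   Jordan form: it is explicit in the norms of the roots, except for A1 (where it
   is found by bounded search and Witt cancellation shows it is unique) and A2
   (bounded search, unique by comparison of determinants). *)
From mathcomp Require Import all_boot all_order all_algebra.
From mathcomp Require Import boolp classical_sets cardinality.
From mathcomp Require Import finmap.
From mathcomp Require Import zify ring lra.
Require Import Defs.

Set Implicit Arguments.
Unset Strict Implicit.
Unset Printing Implicit Defensive.

(** * Recursive functions *)

(** Two obstacles shape the proof. The label does not determine N, and lattices over Z_p are not
    finite data. The first is met by isolating, in [model], the residues that the enumeration reads;
    they are functions of the input alone, whatever N is behind it. The second is met by working
    with rational vectors only: a basis at p is a family of vectors of N that spans N after
    multiplication by integers prime to p, and local isometries are obtained from a rational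
    isometry T for which dT is integral in both directions, d prime to p. The modulus p^(e+1) keeps
    the class of Q(u)/p^e mod p. The two searches need more digits, because dividing by the norm of
    a root loses its p-part. Since ord_p(q) <= q, precisions such as q + e + 1 suffice, and they can
    be read in the label. So every loop has a bound computed from the input, and one program serves
    all p. *)

Definition computable k (f : seq nat -> nat) :=
  exists c, forall s, size s = k -> mu_eval c s (f s).

Section Computable.
Implicit Types (f g n : seq nat -> nat) (k : nat) (b c : seq nat -> bool).

Lemma comp_ext k f g : (forall s, size s = k -> f s = g s) -> computable k f -> computable k g.
Proof. by move=> E [c hc]; exists c => s hs; rewrite -E//; exact: hc. Qed.

Lemma comp_proj k i : computable k (fun s => nth 0 s i).
Proof. by exists (MuProj i) => s _; exact: EvalProj. Qed.

Lemma comp_subst k (f : seq nat -> nat) (gs : seq (seq nat -> nat)) : computable (size gs) f ->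
  (forall i, i < size gs -> computable k (nth (fun=> 0) gs i)) ->
  computable k (fun s => f [seq g s | g <- gs]).
Proof.
move=> [cf hf] H.
have [cs [scs hcs]] : exists cs : seq mu_code, size cs = size gs /\
    forall i, i < size gs -> forall s, size s = k -> mu_eval (nth MuZero cs i) s (nth (fun=> 0) gs i s).
  elim: gs {hf} H => [|g gs IH] H; first by exists [::].
  have [c hc] := H 0 isT.
  have [|cs [scs hcs]] := IH; first by move=> i hi; apply: (H i.+1).
  exists (c :: cs); split; first by rewrite /= scs.
  by case=> [|i] hi s hs /=; [exact: hc|exact: hcs].
exists (MuComp cf cs) => s hs; apply: (@EvalComp _ _ _ [seq g s | g <- gs]).
- by rewrite size_map scs.
- move=> i; rewrite scs => hi; rewrite (nth_map (fun=> 0))//; exact: hcs.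
- by apply: hf; rewrite size_map.
Qed.

Lemma comp_const k m : computable k (fun=> m).
Proof.
elim: m => [|m [c hc]]; first by exists MuZero => s _; exact: EvalZero.
exists (MuComp MuSucc [:: c]) => s hs; apply: (@EvalComp _ _ _ [:: m]) => //.
  by case=> // _; exact: hc.
exact: (EvalSucc [:: m]).
Qed.

Lemma comp_succ k f : computable k f -> computable k (fun s => (f s).+1).
Proof.
move=> hf; apply: (@comp_subst k (fun s => (nth 0 s 0).+1) [:: f]); last by case.
by exists MuSucc => s _; exact: EvalSucc.
Qed.

(** Discarding leading arguments is a substitution of projections. Recursion steps use it to reach
    the parameters behind the counter and the accumulator. *)
Lemma comp_shift j k f : computable k f -> computable (j + k) (fun s => f (drop j s)).
Proof.
move=> hf; pose gs := [seq (fun s => nth 0 s i) | i <- iota j k] : seq (seq nat -> nat).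
apply: (@comp_ext _ (fun s => f [seq g s | g <- gs])).
  move=> s hs; congr f; rewrite -map_comp; apply: (@eq_from_nth _ 0).
    by rewrite size_map size_iota size_drop hs addKn.
  by move=> i; rewrite size_map size_iota => hi; rewrite (nth_map 0) ?size_iota//= nth_iota// nth_drop.
apply: comp_subst; first by rewrite size_map size_iota.
move=> i; rewrite size_map size_iota => hi; rewrite (nth_map 0) ?size_iota//; exact: comp_proj.
Qed.

Lemma comp_behead k f : computable k f -> computable k.+1 (fun s => f (behead s)).
Proof. by move=> hf; apply: comp_ext (comp_shift 1 hf) => s _; rewrite drop1. Qed.

(** The step function takes its arguments in the order of [EvalRecS]: counter, previous value,
    parameters. *)
Fixpoint prec f g s m := if m is m'.+1 then g (m' :: prec f g s m' :: s) else f s.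

Lemma comp_prec k f g n : computable k f -> computable k.+2 g -> computable k n ->
  computable k (fun s => prec f g s (n s)).
Proof.
move=> [cf hf] [cg hg] hn.
have hr : computable k.+1 (fun s => prec f g (behead s) (head 0 s)).
  exists (MuRec cf cg) => -[//|m s] /= [hs]; elim: m => [|m IH] /=.
    by apply: EvalRec0; exact: hf.
  by apply: EvalRecS IH _; apply: hg; rewrite /= hs.
pose gs := n :: [seq (fun s => nth 0 s i) | i <- iota 0 k].
apply: (@comp_ext _ (fun s => prec f g (behead [seq h s | h <- gs]) (head 0 [seq h s | h <- gs]))).
  move=> s hs; congr (prec f g _ _); rewrite /= -map_comp; apply: (@eq_from_nth _ 0).
    by rewrite size_map size_iota hs.
  by move=> i; rewrite size_map size_iota => hi; rewrite (nth_map 0) ?size_iota//= nth_iota.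
apply: (@comp_subst k (fun s => prec f g (behead s) (head 0 s)) gs).
  by rewrite /= size_map size_iota.
case=> [|i] /=; first by [].
by rewrite ltnS size_map size_iota => hi; rewrite (nth_map 0) ?size_iota//; exact: comp_proj.
Qed.

Lemma comp_add k f g : computable k f -> computable k g -> computable k (fun s => f s + g s).
Proof.
move=> hf hg; apply: (@comp_ext _ (fun s => prec f (fun s' => (nth 0 s' 1).+1) s (g s))).
  by move=> s _; elim: (g s) => [|m /= ->]; rewrite ?addn0 ?addnS.
by apply: comp_prec => //; apply: comp_succ; exact: comp_proj.
Qed.

Lemma comp_pred k f : computable k f -> computable k (fun s => (f s).-1).
Proof.
move=> hf; apply: (@comp_ext _ (fun s => prec (fun=> 0) (fun s' => nth 0 s' 0) s (f s))).
  by move=> s _; case: (f s).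
by apply: comp_prec => //; [exact: comp_const|exact: comp_proj].
Qed.

Lemma comp_sub k f g : computable k f -> computable k g -> computable k (fun s => f s - g s).
Proof.
move=> hf hg; apply: (@comp_ext _ (fun s => prec f (fun s' => (nth 0 s' 1).-1) s (g s))).
  by move=> s _; elim: (g s) => [|m /= ->]; rewrite ?subn0 ?subnS.
by apply: comp_prec => //; apply: comp_pred; exact: comp_proj.
Qed.

Lemma comp_mul k f g : computable k f -> computable k g -> computable k (fun s => f s * g s).
Proof.
move=> hf hg; apply: (@comp_ext _ (fun s => prec (fun=> 0) (fun s' => nth 0 s' 1 + f (drop 2 s')) s (g s))).
  move=> s _; elim: (g s) => [|m /= ->]; first by rewrite muln0.
  by rewrite mulnS drop0 addnC.
apply: comp_prec => //; first exact: comp_const.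
by apply: comp_add; [exact: comp_proj|exact: (comp_shift 2)].
Qed.

Lemma comp_exp k f g : computable k f -> computable k g -> computable k (fun s => f s ^ g s).
Proof.
move=> hf hg; apply: (@comp_ext _ (fun s => prec (fun=> 1) (fun s' => nth 0 s' 1 * f (drop 2 s')) s (g s))).
  move=> s _; elim: (g s) => [|m /= ->]; first by rewrite expn0.
  by rewrite expnS drop0 mulnC.
apply: comp_prec => //; first exact: comp_const.
by apply: comp_mul; [exact: comp_proj|exact: (comp_shift 2)].
Qed.

Lemma comp_leq k f g : computable k f -> computable k g -> computable k (fun s => (f s <= g s : nat)).
Proof.
move=> hf hg; apply: (@comp_ext _ (fun s => 1 - (f s - g s))).
  by move=> s _; rewrite /leq; case: (f s - g s).
by apply: comp_sub; [exact: comp_const|exact: comp_sub].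
Qed.

Lemma comp_and k b c : computable k (fun s => b s : nat) -> computable k (fun s => c s : nat) ->
  computable k (fun s => (b s && c s : nat)).
Proof.
by move=> hb hc; apply: comp_ext (comp_mul hb hc) => s _; rewrite mulnb.
Qed.

Lemma comp_not k b : computable k (fun s => b s : nat) -> computable k (fun s => (~~ b s : nat)).
Proof.
move=> hb; apply: comp_ext (comp_sub (comp_const k 1) hb) => s _; by case: (b s).
Qed.

Lemma comp_or k b c : computable k (fun s => b s : nat) -> computable k (fun s => c s : nat) ->
  computable k (fun s => (b s || c s : nat)).
Proof.
move=> hb hc; apply: comp_ext (comp_not (comp_and (comp_not hb) (comp_not hc))) => s _.
by rewrite negb_and !negbK.
Qed.

Lemma comp_eqn k f g : computable k f -> computable k g -> computable k (fun s => (f s == g s : nat)).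
Proof.
move=> hf hg; apply: comp_ext (comp_and (comp_leq hf hg) (comp_leq hg hf)) => s _.
by rewrite -eqn_leq.
Qed.

Lemma comp_if k b f g : computable k (fun s => b s : nat) -> computable k f -> computable k g ->
  computable k (fun s => if b s then f s else g s).
Proof.
move=> hb hf hg; apply: comp_ext (comp_add (comp_mul hb hf) (comp_mul (comp_not hb) hg)) => s _.
by case: (b s); rewrite ?mul1n ?mul0n ?addn0.
Qed.

Lemma comp_ifb k b c (d : seq nat -> bool) : computable k (fun s => b s : nat) -> computable k (fun s => c s : nat) ->
  computable k (fun s => d s : nat) -> computable k (fun s => ((if b s then c s else d s) : bool) : nat).
Proof.
by move=> hb hf hg; apply: comp_ext (comp_if hb hf hg) => s _; case: (b s).
Qed.

(* The loop variable is the head of the environment of the body. *)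
Lemma comp_push k g (F : seq nat -> nat) : computable k.+1 F -> computable k g ->
  computable k (fun s => F (g s :: s)).
Proof.
move=> hF hg; pose gs := g :: [seq (fun s => nth 0 s i) | i <- iota 0 k].
apply: (@comp_ext _ (fun s => F [seq h s | h <- gs])).
  move=> s hs; rewrite /gs /=; congr (F (_ :: _)); rewrite -map_comp; apply: (@eq_from_nth _ 0).
    by rewrite size_map size_iota hs.
  by move=> i; rewrite size_map size_iota => hi; rewrite (nth_map 0) ?size_iota//= nth_iota.
apply: comp_subst; first by rewrite /= size_map size_iota.
case=> [|i] /=; first by [].
by rewrite ltnS size_map size_iota => hi; rewrite (nth_map 0) ?size_iota//; exact: comp_proj.
Qed.

(** For loops implemented by [prec]: the environment of a step is counter, accumulator, parameters,
    whereas the body [F] expects a computed value followed by the parameters. *)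
Lemma comp_push2 k g (F : seq nat -> nat) : computable k.+1 F -> computable k.+2 g ->
  computable k.+2 (fun s => F (g s :: drop 2 s)).
Proof.
move=> hF hg.
have h : computable k.+3 (fun s => F (nth 0 s 0 :: drop 3 s)).
  pose gs := [seq (fun s => nth 0 s i) | i <- 0 :: iota 3 k].
  apply: (@comp_ext _ (fun s => F [seq h s | h <- gs])).
    move=> s hs; rewrite /gs /=; congr (F (_ :: _)); rewrite -map_comp; apply: (@eq_from_nth _ 0).
      by rewrite size_map size_iota size_drop hs !subSS subn0.
    by move=> i; rewrite size_map size_iota => hi; rewrite (nth_map 0) ?size_iota//= nth_iota// nth_drop.
  apply: comp_subst; first by rewrite /= !size_map size_iota.
  move=> i hi; rewrite (nth_map 0) ?size_map ?size_iota//; first exact: comp_proj.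
  by move: hi; rewrite /= !size_map size_iota.
by apply: comp_ext (comp_push h hg) => s _ /=.
Qed.

Lemma comp_sum k n (F : seq nat -> nat) : computable k n -> computable k.+1 F ->
  computable k (fun s => \sum_(i < n s) F ((i : nat) :: s)).
Proof.
move=> hn hF; apply: (@comp_ext _ (fun s =>
  prec (fun=> 0) (fun s' => nth 0 s' 1 + F (nth 0 s' 0 :: drop 2 s')) s (n s))).
  move=> s _; elim: (n s) => [|m IH] /=; first by rewrite big_ord0.
  by rewrite big_ord_recr /= -IH drop0.
apply: comp_prec => //; first exact: comp_const.
by apply: comp_add; [exact: comp_proj|apply: comp_push2 => //; exact: comp_proj].
Qed.

Lemma comp_has k n (P : seq nat -> bool) : computable k n -> computable k.+1 (fun s => P s : nat) ->
  computable k (fun s => (has (fun i => P (i :: s)) (iota 0 (n s)) : nat)).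
Proof.
move=> hn hP; apply: comp_ext (comp_leq (comp_const k 1) (comp_sum hn hP)) => s _.
congr nat_of_bool; rewrite lt0n sum_nat_eq0 negb_forall.
apply/existsP/hasP => [[i /=]|[i]].
  by rewrite eqb0 negbK => h; exists (i : nat) => //; rewrite mem_iota /=.
by rewrite mem_iota /= add0n => hi h; exists (Ordinal hi); rewrite /= h.
Qed.

Lemma comp_all k n (P : seq nat -> bool) : computable k n -> computable k.+1 (fun s => P s : nat) ->
  computable k (fun s => (all (fun i => P (i :: s)) (iota 0 (n s)) : nat)).
Proof.
move=> hn hP; apply: comp_ext (comp_not (comp_has hn (comp_not hP))) => s _.
by rewrite -all_predC; congr nat_of_bool; apply: eq_all => i /=; rewrite negbK.
Qed.

(** The quotient counts the i with g (i + 1) <= f. The guard 0 < g makes the count 0 for a zero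
    divisor, in agreement with [%/]. *)
Lemma comp_divn k f g : computable k f -> computable k g -> computable k (fun s => f s %/ g s).
Proof.
move=> hf hg; apply: (@comp_ext _ (fun s => \sum_(i < f s) ((0 < g s) && (g s * i.+1 <= f s) : nat))).
  move=> s _; have [->|g0] := posnP (g s).
    by rewrite divn0 big1.
  rewrite -[RHS]card_ord -sum1_card.
  have h : f s %/ g s <= f s by exact: leq_div.
  rewrite (big_ord_widen _ (fun=> 1) h) [RHS]big_mkcond /=; apply: eq_bigr => i _.
  by rewrite mulnC -leq_divRL//; case: ltnP.
apply: (@comp_sum k f (fun s => (0 < g (behead s)) && (g (behead s) * (nth 0 s 0).+1 <= f (behead s)) : nat)) => //=.
have [hf' hg'] := (comp_behead hf, comp_behead hg).
apply: comp_and; first by apply: comp_leq => //; exact: comp_const.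
by apply: comp_leq => //; apply: comp_mul => //; apply: comp_succ; exact: comp_proj.
Qed.

Lemma comp_modn k f g : computable k f -> computable k g -> computable k (fun s => f s %% g s).
Proof.
move=> hf hg; apply: comp_ext (comp_sub hf (comp_mul (comp_divn hf hg) hg)) => s _.
by rewrite {1}(divn_eq (f s) (g s)) addKn.
Qed.

Lemma comp_dvdn k f g : computable k f -> computable k g -> computable k (fun s => (f s %| g s : nat)).
Proof. by move=> hf hg; apply: comp_eqn; [exact: comp_modn|exact: comp_const]. Qed.

(** The code of a :: s is 2^a (2 code(s) + 1), so a list is coded from its end: after m steps the
    accumulator codes the selected values at the last m indices, and [i'] is the index treated
    next. *)
Lemma comp_code k n c (v : seq nat -> nat) : computable k n -> computable k.+1 (fun s => c s : nat) ->
  computable k.+1 v ->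
  computable k (fun s => CodeSeq.code [seq v (i :: s) | i <- iota 0 (n s) & c (i :: s)]).
Proof.
move=> hn hc hv.
pose i' s' := (n (drop 2 s') - nth 0 s' 0).-1.
pose step s' := if c (i' s' :: drop 2 s') then 2 ^ v (i' s' :: drop 2 s') * (2 * nth 0 s' 1).+1 else nth 0 s' 1.
apply: (@comp_ext _ (fun s => prec (fun=> 0) step s (n s))).
  move=> s _.
  have H m : m <= n s -> prec (fun=> 0) step s m =
      CodeSeq.code [seq v (i :: s) | i <- iota (n s - m) m & c (i :: s)].
    elim: m => [//|m IH] mn; rewrite /= {1}/step /i' /= drop0 IH; last exact: ltnW.
    rewrite subnS prednK ?subn_gt0//; case: (c _) => //=.
    by rewrite -mul2n.
  by rewrite H// subnn.
have hi' : computable k.+2 i'.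
  by apply: comp_pred; apply: comp_sub; [exact: (comp_shift 2)|exact: comp_proj].
apply: comp_prec => //; first exact: comp_const.
apply: comp_if; first exact: (comp_push2 (F := fun s => c s : nat)).
  apply: comp_mul; last by apply: comp_succ; apply: comp_mul; [exact: comp_const|exact: comp_proj].
  by apply: comp_exp; [exact: comp_const|exact: comp_push2].
exact: comp_proj.
Qed.

End Computable.

(** For x > 0 this is the 2-adic valuation of x, hence the head of the list coded by x. The bound i
    < x loses nothing, as 2^(i+1) <= x forces i < x. *)
Definition chd x := \sum_(i < x) (2 ^ i.+1 %| x : nat).
Definition ctl x := x %/ 2 ^ chd x %/ 2.

Lemma chd_code a s : chd (CodeSeq.code (a :: s)) = a.
Proof.
rewrite /chd /=; set m := CodeSeq.code s; set x := 2 ^ a * m.*2.+1.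
have ax : a <= x by apply: ltnW; apply: leq_trans (ltn_expl a (ltnSn 1)) _; rewrite leq_pmulr.
rewrite -[RHS]card_ord -sum1_card (big_ord_widen _ (fun=> 1) ax) [RHS]big_mkcond /=.
apply: eq_bigr => i _; case: ltnP => ia; first by rewrite /x dvdn_mulr// dvdn_exp2l.
apply/eqP; rewrite eqb0; apply/negP => /(dvdn_trans (dvdn_exp2l 2 (_ : a.+1 <= i.+1))).
rewrite ltnS => /(_ ia); rewrite expnSr /x dvdn_pmul2l ?expn_gt0// dvdn2 /=.
by rewrite odd_double.
Qed.

Lemma ctl_code a s : ctl (CodeSeq.code (a :: s)) = CodeSeq.code s.
Proof.
by rewrite /ctl chd_code /= mulKn ?expn_gt0// divn2 /= uphalf_double.
Qed.

Definition cnth x i := chd (iter i ctl x).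

Lemma cnth_code l i : i < size l -> cnth (CodeSeq.code l) i = nth 0 l i.
Proof.
elim: l i => // a l IH [|i] hi; first exact: chd_code.
by rewrite /cnth iterSr ctl_code; exact: IH.
Qed.

Lemma comp_chd k f : computable k f -> computable k (fun s => chd (f s)).
Proof.
move=> hf; have hf' := comp_behead hf.
apply: (@comp_sum k f (fun s => (2 ^ (nth 0 s 0).+1 %| f (behead s) : nat))) => //.
apply: comp_dvdn => //; apply: comp_exp; first exact: comp_const.
by apply: comp_succ; exact: comp_proj.
Qed.

Lemma comp_cnth k f i : computable k f -> computable k (fun s => cnth (f s) i).
Proof.
move=> hf; apply: (@comp_chd k (fun s => iter i ctl (f s))).
elim: i => // i IH; apply: comp_divn; last exact: comp_const.
apply: comp_divn => //; apply: comp_exp; [exact: comp_const|exact: comp_chd].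
Qed.

Import Order.TTheory GRing.Theory Num.Theory.
Local Open Scope ring_scope.

(** * Reflections and roots *)

Section Bilinear.
Variables (n : nat) (S : 'M[rat]_n).
Implicit Types (x y z : 'rV[rat]_n) (T : 'M[rat]_n) (a : rat).
Local Notation B := (bform S).
Local Notation Q := (qform S).

Lemma bformDl x y z : B (x + y) z = B x z + B y z.
Proof. by rewrite /bform !mulmxDl mxE. Qed.
Lemma bformDr x y z : B x (y + z) = B x y + B x z.
Proof. by rewrite /bform linearD mulmxDr mxE. Qed.
Lemma bformZl a x y : B (a *: x) y = a * B x y.
Proof. by rewrite /bform -!scalemxAl mxE. Qed.
Lemma bformZr a x y : B x (a *: y) = a * B x y.
Proof. by rewrite /bform linearZ -scalemxAr mxE. Qed.
Lemma bformNl x y : B (- x) y = - B x y.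
Proof. by rewrite -scaleN1r bformZl mulN1r. Qed.
Lemma bformNr x y : B x (- y) = - B x y.
Proof. by rewrite -scaleN1r bformZr mulN1r. Qed.
Lemma bform0l x : B 0 x = 0.
Proof. by rewrite -[0](scale0r x) bformZl mul0r. Qed.
Lemma bform0r x : B x 0 = 0.
Proof. by rewrite -[0](scale0r x) bformZr mul0r. Qed.

Definition bformE := (bformDl, bformDr, bformZl, bformZr, bformNl, bformNr,
  bform0l, bform0r).

Lemma bform_delta i j : B (delta_mx 0 i) (delta_mx 0 j) = S i j.
Proof. by rewrite /bform -rowE trmx_delta -colE !mxE. Qed.

Lemma isometryP T :
  isometry S T <-> forall x y, B (x *m T) (y *m T) = B x y.
Proof.
have E x y : B (x *m T) (y *m T) = (x *m (T *m S *m T^T) *m y^T) 0 0.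
  by rewrite /bform trmx_mul !mulmxA.
split=> [iT x y|H]; first by rewrite E iT.
apply/matrixP=> i j; rewrite -bform_delta -H E -rowE trmx_delta -colE !mxE.
by [].
Qed.

Lemma isometry1 : isometry S 1%:M.
Proof. by rewrite /isometry mul1mx trmx1 mulmx1. Qed.

Lemma isometryM T T' : isometry S T -> isometry S T' -> isometry S (T *m T').
Proof. by move=> /isometryP H /isometryP H'; apply/isometryP=> x y; rewrite !mulmxA H' H. Qed.

Lemma isometryN T : isometry S T -> isometry S (- T).
Proof.
by move=> /isometryP H; apply/isometryP=> x y; rewrite !mulmxN !bformE H opprK.
Qed.

Lemma qform_scale a x : Q (a *: x) = a ^+ 2 * Q x.
Proof. by rewrite /qform !bformE mulrA. Qed.

Lemma tauE x y : y *m tau S x = y - (2 * B x y / Q x) *: x.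
Proof.
rewrite /tau mulmx_sum_row.
have E i : row i (tau S x) = delta_mx 0 i - (2 * B x (delta_mx 0 i) / Q x) *: x.
  by apply/rowP=> j; rewrite !mxE.
under eq_bigr => i _ do rewrite E scalerBr scalerA.
rewrite big_split /=; congr (_ + _); first by rewrite -row_sum_delta.
rewrite sumrN -scaler_suml; congr (- (_ *: _)).
under eq_bigr => i _ do rewrite 2!mulrA (mulrC _ 2) -(mulrA 2) -bformZr.
rewrite -mulr_suml -mulr_sumr [in RHS](row_sum_delta y); congr (_ * _ / _).
elim/big_ind2: _ => //; first by rewrite bform0r.
by move=> u c v d -> ->; rewrite bformDr.
Qed.

Hypothesis pS : posdef_space S.

Lemma bformC x y : B x y = B y x.
Proof.
have [sS _] := pS; rewrite /bform.
transitivity ((x *m S *m y^T)^T 0 0); first by rewrite [RHS]mxE.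
by rewrite !trmx_mul trmxK sS mulmxA.
Qed.

Lemma qform_gt0 x : x != 0 -> 0 < Q x. Proof. by case: pS => _; apply. Qed.

Lemma qform_ge0 x : 0 <= Q x.
Proof.
have [->|x0] := eqVneq x 0; first by rewrite /qform bform0l.
exact/ltW/qform_gt0.
Qed.

Lemma qform_eq0 x : (Q x == 0) = (x == 0).
Proof.
apply/idP/eqP => [|->]; last by rewrite /qform bform0l.
by case: (eqVneq x 0) => // /qform_gt0 /lt0r_neq0/negbTE ->.
Qed.

Lemma qformB x y : Q (x - y) = Q x - 2 * B x y + Q y.
Proof. by rewrite /qform !bformE (bformC y x); ring. Qed.

Lemma qformD x y : Q (x + y) = Q x + 2 * B x y + Q y.
Proof. by rewrite /qform !bformE (bformC y x); ring. Qed.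

Lemma cauchy x y : B x y ^+ 2 <= Q x * Q y.
Proof.
have [->|x0] := eqVneq x 0; first by rewrite /qform !bform0l mul0r expr0n.
have := qform_ge0 (Q x *: y - B x y *: x); rewrite qformB !qform_scale !bformE.
rewrite (bformC y x) => H.
have : 0 <= Q x * (Q x * Q y - B x y ^+ 2).
  by move: H; congr (0 <= _); rewrite /qform; ring.
by rewrite pmulr_rge0 ?qform_gt0// subr_ge0.
Qed.

Lemma cauchy_eq x y : x != 0 -> B x y ^+ 2 = Q x * Q y -> y = (B x y / Q x) *: x.
Proof.
move=> x0 H; apply/eqP; rewrite -subr_eq0 -qform_eq0 qformB !qform_scale !bformE.
rewrite (bformC y x); have := lt0r_neq0 (qform_gt0 x0) => q0; apply/eqP.
transitivity (Q y - B x y ^+ 2 / Q x); last by rewrite H; field.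
by field.
Qed.

Lemma tau_inv x y : y *m tau S x *m tau S x = y.
Proof.
have [->|x0] := eqVneq x 0; first by rewrite !tauE !scaler0 !subr0.
have q0 : B x x != 0 by rewrite qform_eq0.
rewrite !tauE !bformE -addrA -!scaleNr -scalerDl.
set c := (X in X *: x); have -> : c = 0 by rewrite /c /qform; field.
by rewrite scale0r addr0.
Qed.

Lemma tauK x : tau S x *m tau S x = 1%:M.
Proof. by apply/row_matrixP=> i; rewrite !rowE mulmxA tau_inv mulmx1. Qed.

Lemma isometry_tau x : isometry S (tau S x).
Proof.
apply/isometryP=> y z; have [->|x0] := eqVneq x 0.
  by rewrite !tauE !scaler0 !subr0.
have q0 : B x x != 0 by rewrite qform_eq0.
by rewrite !tauE !bformE (bformC y x) /qform; field.
Qed.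

Lemma bform_tau x y z : B (y *m tau S x) z = B y (z *m tau S x).
Proof. by rewrite -{1}(tau_inv x z); move/isometryP: (isometry_tau x) => ->. Qed.

Lemma tau_scale a x : a != 0 -> tau S (a *: x) = tau S x.
Proof.
move=> a0; apply/row_matrixP=> i; rewrite !rowE !tauE; congr (_ - _).
have [->|x0] := eqVneq x 0; first by rewrite !scaler0.
have q0 : B x x != 0 by rewrite qform_eq0.
by rewrite scalerA qform_scale !bformE /qform; congr (_ *: _); field; rewrite ?a0 ?q0.
Qed.

Lemma tau_self x : x *m tau S x = - x.
Proof.
have [->|x0] := eqVneq x 0; first by rewrite tauE scaler0 subr0 oppr0.
have q0 : B x x != 0 by rewrite qform_eq0.
rewrite tauE; have -> : 2 * B x x / Q x = 2 by rewrite /qform; field.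
by rewrite scaler_nat mulr2n opprD addrA subrr add0r.
Qed.

(** The line of x is recovered from its symmetry as the eigenspace for -1. *)
Lemma tau_eq x y : x != 0 -> y != 0 -> tau S x = tau S y -> exists a, y = a *: x.
Proof.
move=> x0 y0 E; have := tau_self y; rewrite -E tauE => H.
exists (B x y / Q x); apply: (scalerI (_ : 2 != 0 :> rat)) => //.
rewrite scalerA mulrA; move/eqP: H; rewrite subr_eq addrC -subr_eq opprK => /eqP <-.
by rewrite scaler_nat mulr2n.
Qed.

Lemma isometry_unit T : isometry S T -> T \in unitmx.
Proof.
move=> /isometryP H; rewrite -row_free_unit -kermx_eq0; apply/eqP/row_matrixP=> i.
rewrite row0; apply/eqP; rewrite -qform_eq0 /qform -H.
by rewrite -row_mul mulmx_ker row0 bform0l.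
Qed.

Lemma isometryV T : isometry S T -> isometry S (invmx T).
Proof.
move=> iT; have uT := isometry_unit iT; move/isometryP: iT => H; apply/isometryP=> x y.
by rewrite -H !mulmxKV.
Qed.

Lemma tau_conj T x : isometry S T -> invmx T *m tau S x *m T = tau S (x *m T).
Proof.
move=> iT; have uT := isometry_unit iT; have /isometryP H := iT.
apply/row_matrixP=> i; rewrite !rowE !mulmxA !tauE mulmxBl -scalemxAl mulmxKV//.
have -> : B (x *m T) (delta_mx 0 i) = B x (delta_mx 0 i *m invmx T).
  by rewrite -{1}[delta_mx 0 i](mulmxKV uT) H.
by rewrite /qform H.
Qed.

Lemma isometryP_eq T T' (a b c : 'rV[rat]_n) : 
  (forall v : 'rV[rat]_n, exists r s t, v = r *: a + s *: b + t *: c) ->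
  a *m T = a *m T' -> b *m T = b *m T' -> c *m T = c *m T' -> T = T'.
Proof.
move=> H ea eb ec; apply/row_matrixP=> i; rewrite !rowE.
have [r [s [t ->]]] := H (delta_mx 0 i).
by rewrite !mulmxDl -!scalemxAl ea eb ec.
Qed.

End Bilinear.

Lemma image_byP n (T : 'M[rat]_n) N : T \in unitmx ->
  (forall x, N x -> N (x *m T)) -> (forall x, N x -> N (x *m invmx T)) ->
  image_by T N = N.
Proof.
move=> uT H H'; apply/seteqP; split=> [_ [x Nx <-]|x Nx]; first exact: H.
by exists (x *m invmx T); [exact: H'|rewrite mulmxKV].
Qed.

Lemma image_by_in n (T : 'M[rat]_n) N x : image_by T N = N -> N x -> N (x *m T).
Proof. by move=> E Nx; rewrite -E; exists x. Qed.

Definition subgroup n (N : set 'rV[rat]_n) : Prop :=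
  N 0 /\ forall x y, N x -> N y -> N (x - y).

(** * Subgroups and primitive vectors *)

Section Subgroups.
Variables (n : nat) (N : set 'rV[rat]_n).
Hypothesis gN : subgroup N.

Lemma sub0 : N 0. Proof. by case: gN. Qed.
Lemma subB x y : N x -> N y -> N (x - y). Proof. by case: gN => _; apply. Qed.
Lemma subN x : N x -> N (- x).
Proof. by rewrite -sub0r => Nx; apply: subB => //; exact: sub0. Qed.
Lemma subD x y : N x -> N y -> N (x + y).
Proof. by move=> Nx Ny; rewrite -[y]opprK; apply: subB => //; exact: subN. Qed.
Lemma subMn x k : N x -> N (x *+ k).
Proof.
by move=> Nx; elim: k => [|k IH]; rewrite ?mulr0n ?mulrS; [exact: sub0|exact: subD].
Qed.
Lemma subZ (m : int) x : N x -> N (m%:~R *: x).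
Proof.
move=> Nx; case: m => k; first by rewrite -pmulrn scaler_nat; exact: subMn.
by rewrite NegzE mulrNz scaleNr; apply: subN; rewrite -pmulrn scaler_nat; exact: subMn.
Qed.
Lemma subZint (a : rat) x : a \is a Num.int -> N x -> N (a *: x).
Proof. by move=> /intrP[m ->]; exact: subZ. Qed.

Lemma sub_coprime (a b : int) x : coprimez a b ->
  N (a%:~R *: x) -> N (b%:~R *: x) -> N x.
Proof.
move=> /coprimezP[[u v] /= H] Na Nb.
have -> : x = u%:~R *: (a%:~R *: x) + v%:~R *: (b%:~R *: x).
  by rewrite !scalerA -scalerDl -!intrM -intrD H scale1r.
by apply: subD; exact: subZ.
Qed.

Lemma prim_int (c : rat) x : primitive_vector N x -> N (c *: x) -> c \is a Num.int.
Proof.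
move=> [Nx px] Nc; rewrite Qint_def; have d0 := denq_neq0 c.
have d0' : (denq c)%:~R != 0 :> rat by rewrite intr_eq0.
have Ny : N ((denq c)%:~R^-1 *: x).
  apply: (@sub_coprime (numq c) (denq c)); first exact: coprime_num_den.
    by rewrite scalerA divq_num_den.
  by rewrite scalerA divff// scale1r.
have := px (denq c) _ Ny; rewrite scalerA divff// scale1r => /(_ erefl).
by have := denq_gt0 c; case: (denq c) => //= k _ ->.
Qed.

End Subgroups.

(** * Orthogonal frames and rotations in dimension three *)

Section Frames.
Variables (S : 'M[rat]_3).
Hypothesis pS : posdef_space S.
Local Notation B := (bform S).
Local Notation Q := (qform S).

Lemma spanning3 (x y z : 'rV[rat]_3) :
  (forall a b c, a *: x + b *: y + c *: z = 0 -> [/\ a = 0, b = 0 & c = 0]) ->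
  forall v, exists a b c, v = a *: x + b *: y + c *: z.
Proof.
move=> H v; pose A : 'M[rat]_3 := \matrix_(i < 3) [:: x; y; z]`_i.
have E (u : 'rV_3) : u *m A = u 0 0 *: x + u 0 1 *: y + u 0 2 *: z.
  rewrite mulmx_sum_row !big_ord_recl big_ord0 addr0 !rowK /= addrA.
  by congr (u 0 _ *: _ + u 0 _ *: _ + u 0 _ *: _); exact: val_inj.
have uA : A \in unitmx.
  rewrite -row_free_unit -kermx_eq0; apply/eqP/row_matrixP=> i; rewrite row0.
  set u := row i _; have : u *m A = 0 by rewrite -row_mul mulmx_ker row0.
  rewrite E => /H [u0 u1 u2]; apply/rowP=> j; rewrite [RHS]mxE.
  case: j => [[|[|[|//]]] hj]; [rewrite -u0|rewrite -u1|rewrite -u2];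
    by congr (u _ _); exact: val_inj.
by exists ((v *m invmx A) 0 0), ((v *m invmx A) 0 1), ((v *m invmx A) 0 2);
  rewrite -E mulmxKV.
Qed.

Lemma orth_frame (x y z : 'rV[rat]_3) : x != 0 -> y != 0 -> z != 0 ->
  B x y = 0 -> B x z = 0 -> B y z = 0 ->
  forall v, v = (B x v / Q x) *: x + (B y v / Q y) *: y + (B z v / Q z) *: z.
Proof.
rewrite -!(qform_eq0 pS) => x0 y0 z0 xy xz yz v.
have [yx zx zy] : [/\ B y x = 0, B z x = 0 & B z y = 0] by rewrite !(bformC pS z) (bformC pS y).
have [] := @spanning3 x y z _ v.
  move=> a b c H.
  have Hx : B x (a *: x + b *: y + c *: z) = 0 by rewrite H bform0r.
  have Hy : B y (a *: x + b *: y + c *: z) = 0 by rewrite H bform0r.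
  have Hz : B z (a *: x + b *: y + c *: z) = 0 by rewrite H bform0r.
  move: Hx Hy Hz; rewrite !bformE xy xz yz yx zx zy !mulr0 !addr0 !add0r.
  by move=> /eqP + /eqP + /eqP; rewrite !mulf_eq0 (negbTE x0) (negbTE y0) (negbTE z0) !orbF
    => /eqP -> /eqP -> /eqP ->.
move=> a [b [c ->]]; rewrite !bformE xy xz yz yx zx zy !mulr0 !addr0 !add0r.
by rewrite -/(Q x) -/(Q y) -/(Q z) !mulfK.
Qed.

(** The vector is found in the kernel of a 3 x 2 matrix. *)
Lemma orth_ex (x y : 'rV[rat]_3) : exists2 z, z != 0 & B x z = 0 /\ B y z = 0.
Proof.
pose K := S *m (col_mx x y)^T; exists (nz_row (kermx K)).
  rewrite nz_row_eq0 -mxrank_eq0 mxrank_ker subn_eq0 -ltnNge.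
  exact: leq_ltn_trans (rank_leq_col _) _.
have : nz_row (kermx K) *m K = 0 by apply/sub_kermxP; exact: nz_row_sub.
rewrite /K tr_col_mx mul_mx_row mul_mx_row.
rewrite -(row_mx0 _ 1 1 1) => /eq_row_mx [H1 H2].
by rewrite !(bformC pS _ (nz_row _)) /bform -!mulmxA H1 H2 !mxE.
Qed.

(** Euler's theorem on the axis of a rotation: (R - 1) S R^T = -S (R - 1)^T, and determinants in the
    odd dimension 3 give det(R - 1) = -det(R - 1). *)
Lemma fixed_vector R : isometry S R -> \det R = 1 -> exists2 a : 'rV[rat]_3, a != 0 & a *m R = a.
Proof.
move=> iR dR.
have uS : S \in unitmx.
  rewrite -row_free_unit -kermx_eq0; apply/eqP/row_matrixP=> i; rewrite row0.
  apply/eqP; rewrite -(qform_eq0 pS) /qform /bform.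
  by rewrite -row_mul mulmx_ker row0 mul0mx mxE.
have : (R - 1%:M) *m S *m R^T = (-1) *: (S *m (R - 1%:M)^T).
  by rewrite scaleN1r !mulmxBl iR linearB /= trmx1 mulmxBr mul1mx mulmx1 opprB.
move/(congr1 determinant); rewrite detZ !det_mulmx !det_tr dR mulr1 => H.
have /det0P [a a0 Ha] : \det (R - 1%:M) == 0.
  have : 2 * (\det (R - 1%:M) * \det S) = 0.
    by rewrite mulr2n mulrDl !mul1r {1}H; ring.
  move=> /eqP; rewrite !mulf_eq0 /= => /orP[//|/eqP d0].
  by move: uS; rewrite unitmxE d0.
exists a => //; apply/eqP; rewrite -subr_eq0.
by move: Ha; rewrite mulmxBr mulmx1 => ->.
Qed.

End Frames.

(** A basis-free notion, which [Lambda] satisfies directly. The three properties together supply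
    shortest vectors, and primitive vectors on every line. *)
Record integral_lattice (S : 'M[rat]_3) (N : set 'rV[rat]_3) : Prop := IntegralLattice {
  il_sub : subgroup N;
  il_int : forall x y, N x -> N y -> bform S x y \is a Num.int;
  il_full : forall v, exists2 m : int, m != 0 & N (m%:~R *: v) }.

(** * Symmetries of a lattice and the structure of its isometry group *)

Section Roots.
Variables (S : 'M[rat]_3) (N : set 'rV[rat]_3).
Hypotheses (pS : posdef_space S) (lN : integral_lattice S N).
Local Notation B := (bform S).
Local Notation Q := (qform S).
Local Notation ON := (isometry_group S N).
Let gN : subgroup N := il_sub lN.
Implicit Types (x y z : 'rV[rat]_3) (T : 'M[rat]_3).

Lemma qform_nat x : N x -> exists k : nat, Q x = k%:R.
Proof.
move=> Nx; apply/natrP; rewrite -intrEge0 ?qform_ge0//; exact: (il_int lN Nx Nx).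
Qed.

(** Norms of vectors of N are natural numbers, so the descent on Q(v) terminates. *)
Lemma ex_min (A : set 'rV[rat]_3) : (exists2 v, N v & v != 0 /\ A v) ->
  exists v, [/\ N v, v != 0, A v & forall w, N w -> w != 0 -> A w -> Q v <= Q w].
Proof.
move=> [v Nv [v0 Av]]; have [k] := qform_nat Nv.
elim/ltn_ind: k v Nv v0 Av => k IH v Nv v0 Av Qv.
case: (pselect (exists w, [/\ N w, w != 0, A w & Q w < Q v])) => [[w [Nw w0 Aw]]|H].
  have [j Qw] := qform_nat Nw; rewrite Qv Qw ltr_nat => jk; exact: (IH j jk w).
exists v; split=> // w Nw w0 Aw; rewrite leNgt; apply/negP=> lt; apply: H.
by exists w.
Qed.

(** A shortest nonzero vector of N on the line of v is primitive, since a proper divisor of it would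
    be shorter. *)
Lemma ex_prim v : v != 0 -> exists x, [/\ primitive_vector N x, x != 0 &
  exists2 a, a != 0 & x = a *: v].
Proof.
move=> v0; have [m m0 Nm] := il_full lN v.
have [|x [Nx x0 [a a0 E] minx]] := @ex_min [set x | exists2 a, a != 0 & x = a *: v].
  exists (m%:~R *: v) => //; rewrite scaler_eq0 intr_eq0 negb_or m0 v0; split=> //.
  by exists m%:~R => //; rewrite intr_eq0.
exists x; split=> //; last by exists a.
split=> // k y Ny xy; have k0 : k%:~R != 0 :> rat.
  by apply: contraNneq x0 => k0; rewrite xy k0 scale0r.
have y0 : y != 0 by apply: contraNneq x0 => y0; rewrite xy y0 scaler0.
have Ay : exists2 b, b != 0 & y = b *: v.
  exists (k%:~R^-1 * a); first by rewrite mulf_neq0 ?invr_eq0.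
  by rewrite -scalerA -E xy scalerA mulVf// scale1r.
have := minx y Ny y0 Ay; rewrite xy qform_scale => H.
have H2 : k%:~R ^+ 2 <= 1 :> rat by rewrite -(ler_pM2r (qform_gt0 pS y0)) mul1r.
have k0' : k != 0 by rewrite -(intr_eq0 rat).
have {}H2 : (k ^+ 2 <= 1) by rewrite -(ler_int rat) rmorphXn /=.
by move: k0' H2; rewrite expr2; clear; nia.
Qed.

Lemma isogP T : isometry S T -> (forall x, N x -> N (x *m T)) ->
  (forall x, N x -> N (x *m invmx T)) -> ON T.
Proof. by move=> iT H1 H2; split=> //; apply: image_byP => //; exact: (isometry_unit pS). Qed.

Lemma isog_in T x : ON T -> N x -> N (x *m T).
Proof. by move=> [_ E]; exact: image_by_in. Qed.

Lemma isogV T : ON T -> ON (invmx T).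
Proof.
move=> [iT E]; have uT := isometry_unit pS iT; apply: isogP; first exact: isometryV.
  by move=> x; rewrite -{1}E => -[y Ny <-]; rewrite mulmxK.
by move=> x Nx; rewrite invmxK; exact: (image_by_in E).
Qed.

Lemma isogM T T' : ON T -> ON T' -> ON (T *m T').
Proof.
move=> h h'; have [uT uT'] := (isometry_unit pS h.1, isometry_unit pS h'.1).
apply: isogP; first by apply: isometryM; [exact: h.1|exact: h'.1].
  by move=> x Nx; rewrite mulmxA; do 2!apply: isog_in => //.
move=> x Nx; have -> : invmx (T *m T') = invmx T' *m invmx T.
  apply: (can_inj (mulmxK (_ : T *m T' \in unitmx))); first by rewrite unitmx_mul uT.
  by rewrite mulVmx ?unitmx_mul ?uT// mulmxA mulmxKV// mulVmx.
by rewrite mulmxA; apply: isog_in; [exact: isogV|apply: isog_in => //; exact: isogV].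
Qed.

Lemma isogN T : ON T -> ON (- T).
Proof.
move=> h; have uT := isometry_unit pS h.1.
apply: isogP; first exact: isometryN h.1.
  by move=> x Nx; rewrite mulmxN; apply: subN => //; exact: isog_in.
have uN := isometry_unit pS (isometryN h.1).
have -> : invmx (- T) = - invmx T.
  by apply: (can_inj (mulmxK uN)); rewrite mulVmx// mulNmx mulmxN opprK mulVmx.
move=> x Nx; rewrite mulmxN; apply: subN => //.
by apply: isog_in => //; exact: isogV.
Qed.

Lemma isog1 : ON 1%:M.
Proof. by apply: isogP; [exact: isometry1|move=> x; rewrite mulmx1|move=> x; rewrite invmx1 mulmx1]. Qed.

Lemma isog_tau x : (forall k, N k -> N (k *m tau S x)) -> ON (tau S x).
Proof.
move=> H; apply: isogP => //; first exact: isometry_tau.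
have -> : invmx (tau S x) = tau S x; last exact: H.
apply: (can_inj (mulmxK (isometry_unit pS (isometry_tau pS x)))).
by rewrite tauK// mulVmx//; exact: (isometry_unit pS (isometry_tau pS x)).
Qed.

Definition root x := [/\ primitive_vector N x, x != 0 & ON (tau S x)].

Lemma root_in x : root x -> N x. Proof. by case=> -[]. Qed.
Lemma root_neq0 x : root x -> x != 0. Proof. by case. Qed.

Lemma root_of v : v != 0 -> ON (tau S v) ->
  exists x, root x /\ exists2 a, a != 0 & x = a *: v.
Proof.
move=> v0 H; have [x [px x0 [a a0 E]]] := ex_prim v0; exists x; split; last by exists a.
by split=> //; rewrite E tau_scale.
Qed.

Lemma sym_root T : symmetry_of S N T -> exists2 x, root x & T = tau S x.
Proof.
move=> [hT [v v0 E]]; have := hT; rewrite E => /(root_of v0)[x [rx [a a0 Ex]]].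
by exists x => //; rewrite Ex tau_scale.
Qed.

(** k minus its mirror image is (2 B(x,k)/Q(x)) x, a vector of N on the line of the primitive vector
    x. This crystallographic condition drives the whole classification. *)
Lemma root_int x k : root x -> N k -> 2 * B x k / Q x \is a Num.int.
Proof.
move=> [px x0 H] Nk; apply: (prim_int gN px).
have := isog_in H Nk; rewrite tauE => H1; have := subB gN Nk H1.
by rewrite opprB addrCA subrr addr0.
Qed.

Lemma tau_isog x : N x -> (forall k, N k -> 2 * B x k / Q x \is a Num.int) -> ON (tau S x).
Proof.
move=> Nx H; apply: isog_tau => k Nk; rewrite tauE; apply: subB => //.
by apply: subZint => //; exact: H.
Qed.

Lemma prim_isog T x : ON T -> primitive_vector N x -> primitive_vector N (x *m T).
Proof.
move=> h [Nx px]; split; first exact: isog_in.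
have uT := isometry_unit pS h.1.
move=> m y Ny E; apply: (px m (y *m invmx T)); first by apply: isog_in => //; exact: isogV.
by rewrite scalemxAl -E mulmxK.
Qed.

Lemma root_isog T x : ON T -> root x -> root (x *m T).
Proof.
move=> h [px x0 H]; have uT := isometry_unit pS h.1.
split; first exact: prim_isog.
  by apply: contraNneq x0 => E; rewrite -(mulmxK uT x) E mul0mx.
rewrite -tau_conj//; last exact: h.1.
by apply: isogM => //; apply: isogM => //; exact: isogV.
Qed.

Lemma rootN x : root x -> root (- x).
Proof.
by move=> rx; have := root_isog (isogN isog1) rx; rewrite mulmxN mulmx1.
Qed.

Lemma root_pm x a : root x -> root (a *: x) -> a = 1 \/ a = -1.
Proof.
move=> [px x0 _] [pa ax0 _].
have a0 : a != 0 by apply: contraNneq ax0 => ->; rewrite scale0r.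
have [m am] : exists m : int, a = m%:~R by apply/intrP; apply: (prim_int gN px); case: pa.
have := pa.2 m x px.1; rewrite am => /(_ erefl).
by case: m {am} => [[|[|k]]|[|k]]//= _; [left|right].
Qed.

(** Up to sign the isometry is a rotation R with an axis a. Let e be a shortest vector of N in the
    plane orthogonal to a. The trace c of R on this plane is an integer with |c| <= 2. The values 2
    and -2 give 1 and minus the symmetry of the axis; for the others e and eR generate the plane
    lattice, and R is the product of the symmetries of e and of e + eR. *)
Lemma isom_decomp T : ON T -> exists T', [/\ T' = T \/ T' = - T, ON T' &
  [\/ T' = 1%:M, (exists2 x, root x & T' = tau S x)
    | exists x y, [/\ root x, root y & T' = tau S x *m tau S y]]].
Proof.
move=> hT.
have det2 : \det T ^+ 2 = 1.
  have uS : \det S != 0.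
    apply/negP=> /det0P [v v0 vS]; have := qform_gt0 pS v0.
    by rewrite /qform /bform vS mul0mx mxE ltxx.
  have := congr1 determinant hT.1; rewrite !det_mulmx det_tr => H.
  by apply: (mulfI uS); rewrite mulr1 -{2}H; ring.
have [R [RT hR dR]] : exists R, [/\ R = T \/ R = - T, ON R & \det R = 1].
  move/eqP: det2; rewrite sqrf_eq1 => /orP[/eqP d1|/eqP d1].
    by exists T; split=> //; left.
  exists (- T); split; [by right|exact: isogN|].
  by rewrite -scaleN1r detZ d1; ring.
have RTN : - R = T \/ - R = - T by case: RT => ->; [right|left; rewrite opprK].
have [a a0 aR] := fixed_vector pS hR.1 dR.
have /isometryP isoR := hR.1.
have [v0 v0n [_ av0]] := orth_ex pS a a.
have [m m0 Nmv] := il_full lN v0.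
have [|e [Ne e0 /= ae mine]] := @ex_min [set v | B a v = 0].
  exists (m%:~R *: v0) => //; rewrite scaler_eq0 intr_eq0 negb_or m0 v0n; split=> //=.
  by rewrite bformZr av0 mulr0.
have [e' e'0 [ae' ee']] := orth_ex pS a e.
have frame := orth_frame pS a0 e0 e'0 ae ae' ee'.
have [A0 E0 E'0] : [/\ B a a != 0, B e e != 0 & B e' e' != 0] by rewrite !(qform_eq0 pS).
have e'e : B e' e = 0 by rewrite (bformC pS).
have perpR v : B a v = 0 -> B a (v *m R) = 0 by move=> h; rewrite -{1}aR isoR.
pose al := B e (e *m R) / Q e; pose be := B e' (e *m R) / Q e'.
pose ga := B e (e' *m R) / Q e; pose de := B e' (e' *m R) / Q e'.
have eR : e *m R = al *: e + be *: e'.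
  by rewrite {1}(frame (e *m R)) perpR// mul0r scale0r add0r.
have e'R : e' *m R = ga *: e + de *: e'.
  by rewrite {1}(frame (e' *m R)) perpR// mul0r scale0r add0r.
clearbody al be ga de.
have h1 : al ^+ 2 * B e e + be ^+ 2 * B e' e' = B e e.
  by rewrite -[in RHS](isoR e e) eR !bformE ee' e'e; ring.
have h2 : al * ga * B e e + be * de * B e' e' = 0.
  by rewrite -ee' -(isoR e e') eR e'R !bformE ee' e'e; ring.
have h3 : ga ^+ 2 * B e e + de ^+ 2 * B e' e' = B e' e'.
  by rewrite -[in RHS](isoR e' e') e'R !bformE ee' e'e; ring.
have hd : (al * de - be * ga) ^+ 2 = 1.
  apply: (mulfI (mulf_neq0 E0 E'0)); rewrite mulr1.
  transitivity ((al ^+ 2 * B e e + be ^+ 2 * B e' e') * (ga ^+ 2 * B e e + de ^+ 2 * B e' e')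
    - (al * ga * B e e + be * de * B e' e') ^+ 2); first by ring.
  by rewrite h1 h2 h3; ring.
have eqR T1 : a *m T1 = a -> e *m T1 = e *m R -> e' *m T1 = e' *m R -> T1 = R.
  move=> i1 i2 i3; apply: (@isometryP_eq _ _ _ a e e') => //; last by rewrite aR.
  by move=> v; exists (B a v / Q a), (B e v / Q e), (B e' v / Q e').
have isymm f : f != 0 -> tau S f = R -> exists2 x, root x & R = tau S x.
  move=> f0 E; have [|x [rx [k k0 xk]]] := @root_of f f0; first by rewrite E.
  by exists x => //; rewrite xk tau_scale.
(* The Gram identities give the determinant of R on the plane only up to sign. With the value -1, R
   is the symmetry in e - eR, or in e' when eR = e; the conclusion allows this alternative. *)
move/eqP: hd; rewrite sqrf_eq1 => /orP[/eqP hd|/eqP hd]; last first.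
  exists R; split=> //; apply: Or32.
  have hde : de = - al.
    apply: (mulIf E0); rewrite -{1}h1.
    transitivity (al * (al * de) * B e e + be * (be * de * B e' e')); first by ring.
    have -> : be * de * B e' e' = - (al * ga * B e e) by move: h2; lra.
    have -> : al * de = be * ga - 1 by move: hd; lra.
    by ring.
  have hga : ga * B e e = be * B e' e'.
    have -> : ga * B e e = - (al * de - be * ga) * (ga * B e e) by rewrite hd; ring.
    transitivity (- de * (al * ga * B e e) + be * (ga ^+ 2 * B e e)); first by ring.
    have -> : al * ga * B e e = - (be * de * B e' e') by move: h2; lra.
    have -> : ga ^+ 2 * B e e = B e' e' - de ^+ 2 * B e' e' by move: h3; lra.
    by ring.
  have [al1|al1] := eqVneq al 1.
    have be0 : be = 0.
      have : be ^+ 2 * B e' e' = 0 by move: h1; rewrite al1 expr1n mul1r; lra.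
      by move=> /eqP; rewrite mulf_eq0 (negbTE E'0) orbF sqrf_eq0 => /eqP.
    have ga0 : ga = 0 by apply: (mulIf E0); rewrite hga be0 !mul0r.
    apply: (isymm _ e'0); apply: eqR.
    - by rewrite tauE (bformC pS) ae' mulr0 mul0r scale0r subr0.
    - by rewrite tauE e'e mulr0 mul0r scale0r subr0 eR al1 be0 scale1r scale0r addr0.
    - by rewrite (tau_self pS) e'R ga0 hde al1 scale0r add0r scaleN1r.
  pose f := (1 - al) *: e - be *: e'.
  have Qf : Q f = 2 * (1 - al) * B e e.
    rewrite /qform /f !bformE ee' e'e; move: h1; lra.
  have f0 : f != 0 by rewrite -(qform_eq0 pS) Qf !mulf_neq0// subr_eq0 eq_sym.
  have al1' : 1 - al != 0 by rewrite subr_eq0 eq_sym.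
  apply: (isymm _ f0); apply: eqR; rewrite tauE Qf /f !bformE.
  - set k := (X in X *: _); have -> : k = 0 by rewrite /k !(bformC pS _ a) ae ae'; ring.
    by rewrite scale0r subr0.
  - rewrite e'e mulr0 subr0 eR; apply/rowP=> j; rewrite !mxE; field; exact/andP.
  - rewrite ee' mulr0 add0r e'R hde; apply/rowP=> j; rewrite !mxE.
    have -> : ga = be * B e' e' / B e e by rewrite -hga mulfK.
    have hb : be ^+ 2 * B e' e' = (1 - al) * (1 + al) * B e e by move: h1; lra.
    transitivity (e' 0 j + be * B e' e' / B e e * e 0 j - be ^+ 2 * B e' e' / ((1 - al) * B e e) * e' 0 j).
      by field; exact/andP.
    by rewrite hb; field; exact/andP.
have hde : de = al.
  apply: (mulIf E0); rewrite -{1}h1.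
  transitivity (al * (al * de) * B e e + be * (be * de * B e' e')); first by ring.
  have -> : be * de * B e' e' = - (al * ga * B e e) by move: h2; lra.
  have -> : al * de = be * ga + 1 by move: hd; lra.
  by ring.
have hga : be * ga = al ^+ 2 - 1 by move: hd; rewrite hde expr2; lra.
(* Cayley-Hamilton for the plane rotation. *)
have eRR : e *m R *m R = (2 * al) *: (e *m R) - e.
  rewrite {1}eR mulmxDl -!scalemxAl e'R eR hde; apply/rowP=> j; rewrite !mxE.
  transitivity (al * (al * e 0 j + be * e' 0 j) + (be * ga) * e 0 j + be * al * e' 0 j); first by ring.
  by rewrite hga; ring.
have prim_min w : N w -> B a w = 0 -> Q w = Q e -> w != 0 -> primitive_vector N w.
  move=> Nw aw Qw w0; split=> // k y Ny wy.
  have k0 : k != 0 by apply: contraNneq w0 => k0; rewrite wy k0 scale0r.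
  have k0' : k%:~R != 0 :> rat by rewrite intr_eq0.
  have y0 : y != 0 by apply: contraNneq w0 => y0; rewrite wy y0 scaler0.
  have := mine y Ny y0; rewrite -Qw wy qform_scale.
  have -> : B a y = 0 by apply: (mulfI k0'); rewrite -bformZr -wy mulr0.
  move=> /(_ erefl) H.
  have H2 : k%:~R ^+ 2 <= 1 :> rat by rewrite -(ler_pM2r (qform_gt0 pS y0)) mul1r.
  have {}H2 : (k ^+ 2 <= 1) by rewrite -(ler_int rat) rmorphXn /=.
  by move: k0 H2; rewrite expr2; clear; nia.
have NeR : N (e *m R) by exact: isog_in.
have pe := prim_min e Ne ae erefl e0.
(* The trace is an integer: (2 al) eR = eRR + e lies in N, and eR is primitive. *)
have /intrP [c hc] : 2 * al \is a Num.int.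
  apply: (prim_int gN (prim_isog hR pe)).
  have -> : (2 * al) *: (e *m R) = e *m R *m R + e by rewrite eRR subrK.
  by apply: subD => //; exact: isog_in.
have Ep : 0 < B e e := qform_gt0 pS e0.
have al2 : al ^+ 2 <= 1.
  have := qform_ge0 pS e'; rewrite -/(Q _) => Ep'.
  rewrite -(ler_pM2r Ep) mul1r -[X in _ <= X]h1 lerDl mulr_ge0 ?sqr_ge0//; exact: qform_ge0.
have c2 : (c ^+ 2 <= 4).
  rewrite -(ler_int rat) rmorphXn /= -hc; move: al2; lra.
have be0 : al ^+ 2 = 1 -> be = 0 /\ ga = 0.
  move=> al21; have b0 : be = 0.
    have : be ^+ 2 * B e' e' = 0 by move: h1; rewrite al21 mul1r; lra.
    by move=> /eqP; rewrite mulf_eq0 (negbTE E'0) orbF sqrf_eq0 => /eqP.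
  split=> //; have al0 : al != 0 by apply: contra_eq_neq al21 => ->; rewrite expr0n.
  apply/eqP; have /eqP := h2; rewrite b0 !mul0r addr0 !mulf_eq0 (negbTE al0) (negbTE E0) orbF //.
have [c2'|] := eqVneq c 2.
  have al1 : al = 1 by move: hc; rewrite c2'; lra.
  have [b0 g0] : be = 0 /\ ga = 0 by apply: be0; rewrite al1 expr1n.
  exists R; split=> //; apply: Or31; apply/esym/eqR; rewrite mulmx1; first by [].
    by rewrite eR al1 b0 scale1r scale0r addr0.
  by rewrite e'R hde al1 g0 scale1r scale0r add0r.
have [c2' _|c2' c2''] := eqVneq c (-2).
  have al1 : al = -1 by move: hc; rewrite c2' -[(-2)%:~R]/(-2 : rat); lra.
  have [b0 g0] : be = 0 /\ ga = 0 by apply: be0; rewrite al1 sqrrN expr1n.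
  have RN : R = - tau S a.
    apply/esym/eqR; rewrite mulmxN.
    - by rewrite (tau_self pS) opprK.
    - by rewrite tauE ae mulr0 mul0r scale0r subr0 eR al1 b0 scaleN1r scale0r addr0.
    - by rewrite tauE ae' mulr0 mul0r scale0r subr0 e'R hde al1 g0 scaleN1r scale0r add0r.
  exists (- R); split=> //; first exact: isogN.
  apply: Or32; have [|x [rx [k k0 xk]]] := @root_of a a0.
    by rewrite -[tau S a]opprK -RN; exact: isogN.
  by exists x => //; rewrite RN opprK xk tau_scale.
have c1 : (-1 <= c <= 1) by move: c2 c2' c2''; rewrite expr2; clear; nia.
have beN : be != 0.
  apply/negP=> /eqP b0; have : al ^+ 2 = 1.
    by apply: (mulIf E0); rewrite mul1r -[in RHS]h1 b0; ring.
  move=> al21; have : c ^+ 2 = 4.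
    apply: (@intr_inj rat); rewrite rmorphXn /= -hc exprMn al21; ring.
  by move: c1; rewrite expr2; clear; nia.
have ce : B e (e *m R) = c%:~R / 2 * B e e.
  by rewrite eR !bformE ee' mulr0 addr0 -hc; field.
have QeR : B (e *m R) (e *m R) = B e e by rewrite isoR.
(* Rounding both coordinates to nearest integers leaves a vector of norm at most 3/4 Q(e), because
   |c| <= 1; by minimality of e it is 0. *)
have planeR v : N v -> B a v = 0 -> exists m n : int, v = m%:~R *: e + n%:~R *: (e *m R).
  move=> Nv av.
  have [s [t vst]] : exists s t, v = s *: e + t *: (e *m R).
    exists (B e v / Q e - B e' v / Q e' / be * al), (B e' v / Q e' / be).
    rewrite {1}(frame v) av mul0r scale0r add0r eR; apply/rowP=> j; rewrite !mxE; field.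
    by rewrite beN ?E0 ?E'0.
  have near (r : rat) : exists k : int, `|r - k%:~R| <= 1 / 2.
    exists (Num.floor (r + 1 / 2)); have := floor_itv (r + 1 / 2).
    by rewrite intrD ler_norml; move: (Num.floor _)%:~R => fl; lra.
  have [[k1 hk1] [k2 hk2]] := (near s, near t).
  pose s' := s - k1%:~R; pose t' := t - k2%:~R.
  have vE : v - (k1%:~R *: e + k2%:~R *: (e *m R)) = s' *: e + t' *: (e *m R).
    by rewrite vst /s' /t'; apply/rowP=> j; rewrite !mxE; ring.
  exists k1, k2; apply/eqP; rewrite -subr_eq0 vE; apply/negPn/negP=> w0.
  have Nw : N (s' *: e + t' *: (e *m R)).
    by rewrite -vE; apply: subB => //; apply: subD => //; exact: subZ.
  have aw : B a (s' *: e + t' *: (e *m R)) = 0.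
    by rewrite !bformE perpR ae// !mulr0 addr0.
  have := mine _ Nw w0 aw; rewrite /qform !bformE QeR (bformC pS (e *m R) e) ce.
  move=> H; have : B e e <= (s' ^+ 2 + c%:~R * (s' * t') + t' ^+ 2) * B e e.
    by apply: (le_trans H); rewrite le_eqVlt; apply/orP; left; apply/eqP; field.
  rewrite ler_pMl//.
  have c1' : `|c%:~R| <= 1 :> rat by rewrite -intr_norm (ler_int _ _ 1) ler_norml.
  have h5 : `|c%:~R * (s' * t')| <= 1 / 4.
    rewrite normrM; apply: le_trans (_ : 1 * `|s' * t'| <= _).
      by rewrite ler_wpM2r.
    rewrite mul1r normrM (_ : 1 / 4 = 1 / 2 * (1 / 2) :> rat)//; exact: ler_pM.
  have sq (r : rat) : `|r| <= 1 / 2 -> r ^+ 2 <= 1 / 4.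
    by rewrite ler_norml => /andP[h6 h7]; nra.
  have := sq _ hk1; have := sq _ hk2; move: h5; rewrite ler_norml -/s' -/t'; lra.
(* For k in N the vector k - kR lies in the plane lattice, and its product with e - eR is (2 - c)
   B(e,k). Expanding k - kR in e and eR turns 2 B(e,k)/Q(e) into an integer. *)
have he : ON (tau S e).
  apply: tau_isog => // k Nk.
  have [||m1 [n1 vE]] := planeR (k - k *m R).
  - by apply: subB => //; exact: isog_in.
  - by rewrite !bformE -{2}aR isoR subrr.
  have : B (k - k *m R) (e - e *m R) = (2 - c%:~R) * B e k.
    rewrite !bformE isoR.
    have -> : B (k *m R) e = c%:~R * B k e - B k (e *m R).
      rewrite -(isoR k (e *m R)) eRR !bformE isoR -hc; ring.
    by rewrite !(bformC pS _ k); ring.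
  rewrite vE !bformE QeR (bformC pS (e *m R) e) ce => H.
  have c2n : 2 - c%:~R != 0 :> rat.
    by rewrite subr_eq0 eq_sym (eqr_int _ c 2).
  have -> : 2 * B e k / Q e = m1%:~R - n1%:~R.
    have -> : B e k = (2 - c%:~R)^-1 * ((2 - c%:~R) * B e k) by rewrite mulKf.
    by rewrite -H /qform; field; exact/andP.
  by rewrite rpredB ?intr_int.
pose f := e + e *m R.
have Qf : Q f = (2 + c%:~R) * B e e.
  by rewrite /qform /f !bformE QeR (bformC pS (e *m R) e) ce; field.
have c2n : 2 + c%:~R != 0 :> rat by rewrite addrC addr_eq0 (eqr_int _ c (-2)).
have f0 : f != 0 by rewrite -(qform_eq0 pS) Qf mulf_neq0.
have fe : 2 * B f e / Q f = 1.
  by rewrite Qf /f !bformE (bformC pS (e *m R) e) ce; field; exact/andP.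
have feR : 2 * B f (e *m R) / Q f = 1.
  by rewrite Qf /f !bformE QeR ce; field; exact/andP.
have fa : B f a = 0 by rewrite /f !bformE !(bformC pS _ a) perpR// ae addr0.
have he2 : tau S e *m R = tau S f.
  apply: (@isometryP_eq _ _ _ a e (e *m R)).
  - move=> v; exists (B a v / Q a), (B e v / Q e - B e' v / Q e' / be * al), (B e' v / Q e' / be).
    by rewrite {1}(frame v) eR; apply/rowP=> j; rewrite !mxE; field; rewrite beN ?E0 ?E'0 ?A0.
  - by rewrite mulmxA !tauE (bformC pS e a) ae fa !mulr0 !mul0r !scale0r !subr0.
  - by rewrite mulmxA tau_self// mulNmx tauE fe scale1r /f opprD addrA subrr add0r.
  - rewrite mulmxA !tauE feR scale1r mulmxBl -scalemxAl eRR ce -hc /f /qform.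
    by apply/rowP=> j; rewrite !mxE; field.
have hf : ON (tau S f) by rewrite -he2; exact: isogM.
have [x [rx [k k0 xk]]] := root_of f0 hf.
exists R; split=> //; apply: Or33; exists e, x; split=> //.
by rewrite xk tau_scale// -he2 mulmxA tauK// mul1mx.
Qed.

End Roots.

(** * Root configurations around an orthogonal frame *)

Section Classification.
Variables (S : 'M[rat]_3) (N : set 'rV[rat]_3).
Hypotheses (pS : posdef_space S) (lN : integral_lattice S N).
Local Notation B := (bform S).
Local Notation Q := (qform S).
Local Notation ON := (isometry_group S N).
Local Notation root := (root S N).
Let gN : subgroup N := il_sub lN.
Implicit Types (x y z s e f u : 'rV[rat]_3).

Definition par s x := exists a : rat, s = a *: x.
(** Covering is by lines: a member of the list may be a proper multiple of a root, such as x + y in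
    [B3sys] when k = 1/2. *)
Definition covered (l : seq 'rV[rat]_3) :=
  forall s, root s -> exists2 r, r \in l & par s r.

Lemma root_refl x y (a : rat) : root x -> root y -> 2 * B x y = a * Q x ->
  root (y - a *: x).
Proof.
move=> rx ry E; case: (rx) => px x0 hx.
by have := root_isog pS hx ry; rewrite tauE E mulfK// (qform_eq0 pS).
Qed.

Lemma root_eqv x y : root x -> y = x -> root y. Proof. by move=> ? ->. Qed.

Lemma rootNK x y : root x -> y = - x -> root y.
Proof. by move=> rx ->; exact: (rootN pS lN). Qed.

Lemma root_flip y u (b : rat) : root y -> root (u + b *: y) -> B y u = 0 ->
  root (u - b *: y).
Proof.
move=> ry rs yu.
have -> : u - b *: y = u + b *: y - (2 * b) *: y by apply/rowP=> j; rewrite !mxE; ring.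
apply: root_refl => //; rewrite !bformE yu /qform; ring.
Qed.

Lemma root_Qgt0 x : root x -> 0 < Q x.
Proof. by move=> rx; exact: (qform_gt0 pS (root_neq0 rx)). Qed.

(** If z is orthogonal to x and y, its symmetry is minus the product of those of x and y, so it
    belongs to O(N) as well. Two orthogonal roots thus extend to a frame of roots. *)
Lemma root_orth_cross x y : root x -> root y -> B x y = 0 ->
  exists z, [/\ root z, B x z = 0 & B y z = 0].
Proof.
move=> rx ry xy; have [z z0 [xz yz]] := orth_ex pS x y.
have [x0 y0] := (root_neq0 rx, root_neq0 ry).
have zx : B z x = 0 by rewrite (bformC pS).
have zy : B z y = 0 by rewrite (bformC pS).
have yx : B y x = 0 by rewrite (bformC pS).
have E : tau S z = - (tau S x *m tau S y).
  apply: (@isometryP_eq _ _ _ x y z).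
  - by move=> v; exists (B x v / Q x), (B y v / Q y), (B z v / Q z); exact: orth_frame.
  - by rewrite mulmxN mulmxA (tau_self pS) mulNmx opprK !tauE zx yx !mulr0 !mul0r !scale0r !subr0.
  - rewrite mulmxN mulmxA [y *m tau S x]tauE xy mulr0 mul0r scale0r subr0 (tau_self pS) opprK.
    by rewrite tauE zy mulr0 mul0r scale0r subr0.
  - rewrite mulmxN mulmxA [z *m tau S x]tauE xz mulr0 mul0r scale0r subr0 (tau_self pS) tauE.
    by rewrite yz mulr0 mul0r scale0r subr0.
have [|r [rr [a a0 ra]]] := @root_of _ _ pS lN z z0.
  rewrite E; apply: (isogN pS lN); apply: (isogM pS).
    by case: rx. by case: ry.
by exists r; split=> //; rewrite ra bformZr ?xz ?yz mulr0.
Qed.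

(* The integers [a' = 2 B(x,s) / Q(s)] etc.; [a a' = 4 cos^2] of the angle of
   [x] and [s], so the three products sum to 4. *)
Lemma frame_coords x y z s : root x -> root y -> root z -> root s ->
  B x y = 0 -> B x z = 0 -> B y z = 0 ->
  exists a b c a' b' c' : int,
    [/\ s = (a%:~R / 2) *: x + (b%:~R / 2) *: y + (c%:~R / 2) *: z,
      [/\ a%:~R * Q x = a'%:~R * Q s, b%:~R * Q y = b'%:~R * Q s &
        c%:~R * Q z = c'%:~R * Q s],
      [/\ 0 <= a * a', 0 <= b * b' & 0 <= c * c'] & a * a' + b * b' + c * c' = 4].
Proof.
move=> rx ry rz rs xy xz yz.
have H t : root t -> exists m n : int, [/\ 2 * B t s = m%:~R * Q t,
    m%:~R * Q t = n%:~R * Q s & 0 <= m * n].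
  move=> rt; have /intrP [m hm] := root_int lN rt (root_in rs).
  have /intrP [n hn] := root_int lN rs (root_in rt).
  have [t0 s0] := (root_Qgt0 rt, root_Qgt0 rs).
  have e1 : 2 * B t s = m%:~R * Q t by rewrite -hm divfK ?gt_eqF.
  have e2 : m%:~R * Q t = n%:~R * Q s.
    by rewrite -e1 -hn divfK ?gt_eqF// (bformC pS).
  exists m, n; split=> //.
  rewrite -(ler_int rat) intrM -(pmulr_lge0 _ s0) -mulrA -e2.
  by rewrite mulrA -expr2 mulr_ge0 ?sqr_ge0 ?ltW.
have [[a [a' [a1 a2 a3]]] [b [b' [b1 b2 b3]]] [c [c' [c1 c2 c3]]]] := And3 (H x rx) (H y ry) (H z rz).
have K (m : int) t : root t -> 2 * B t s = m%:~R * Q t -> B t s / Q t = m%:~R / 2.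
  move=> rt E; have -> : B t s = m%:~R * Q t / 2 by rewrite -E; by field.
  by field; rewrite gt_eqF// root_Qgt0.
have sE : s = (a%:~R / 2) *: x + (b%:~R / 2) *: y + (c%:~R / 2) *: z.
  rewrite {1}(orth_frame pS (root_neq0 rx) (root_neq0 ry) (root_neq0 rz) xy xz yz s).
  by rewrite (K a)// (K b)// (K c).
exists a, b, c, a', b', c'; split=> //.
apply: (@intr_inj rat); rewrite !intrD !intrM.
have s0 : Q s != 0 by rewrite gt_eqF// root_Qgt0.
apply: (mulIf s0); rewrite !mulrDl -!mulrA -a2 -b2 -c2.
have -> : Q s = (a%:~R / 2) ^+ 2 * Q x + (b%:~R / 2) ^+ 2 * Q y + (c%:~R / 2) ^+ 2 * Q z.
  rewrite {1}sE /qform !bformE (bformC pS y x) (bformC pS z x) (bformC pS z y).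
  by rewrite xy xz yz; ring.
by field.
Qed.

(** Type B2 A1: x and y are the short roots of B2, x + y and x - y the long ones, z spans the A1. *)
Definition B2sys x y z := [/\ [/\ root x, root y & root z], [/\ B x y = 0, B x z = 0 & B y z = 0],
  Q x = Q y & root (x + y) /\ root (x - y)].

(** Type G2 A1: e, f, e - f are the short roots of G2, the last three vectors the long ones with
    three times the norm, z spans the A1. *)
Definition G2sys e f z := [/\ [/\ root e, root f & root z],
  [/\ B e z = 0, B f z = 0, Q f = Q e & 2 * B e f = Q e], root (e - f) &
  [/\ root (e + f), root (2 *: e - f) & root (2 *: f - e)]].

(** Both forms of the type: for k = 1 the roots x, y, z are short (B3), for k = 1/2 they are long
    (C3). *)
Definition B3sys k x y z := [/\ [/\ root x, root y & root z],
  [/\ B x y = 0, B x z = 0 & B y z = 0], Q x = Q y /\ Q x = Q z,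
  k = 1 \/ k = 1 / 2 &
  [/\ root (k *: (x + y)) /\ root (k *: (x - y)), root (k *: (x + z)) /\ root (k *: (x - z)) &
   root (k *: (y + z)) /\ root (k *: (y - z))]].

Lemma absz_factor (a a' : int) (k : nat) : (0 < k)%N -> a * a' = k%:Z -> (`|a| <= k)%N.
Proof.
move=> k0 /(congr1 absz); rewrite abszM /= => H; apply: dvdn_leq => //.
by rewrite -H dvdn_mulr.
Qed.

Lemma mul_eq1 (a a' : int) : a * a' = 1 -> a = 1 /\ a' = 1 \/ a = -1 /\ a' = -1.
Proof.
move=> H; have := @absz_factor a a' 1 isT H.
by case: a H => [[|[|n]]|[|n]]// H _; lia.
Qed.
Lemma mul_eq2 (a a' : int) : a * a' = 2 -> [\/ a = 1 /\ a' = 2, a = 2 /\ a' = 1,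
  a = -1 /\ a' = -2 | a = -2 /\ a' = -1].
Proof.
move=> H; have := @absz_factor a a' 2 isT H.
case: a H => [[|[|[|n]]]|[|[|n]]]// H _; try lia.
- by apply: Or41; lia.
- by apply: Or42; lia.
- by apply: Or43; lia.
- by apply: Or44; lia.
Qed.
Lemma mul_eq3 (a a' : int) : a * a' = 3 -> [\/ a = 1 /\ a' = 3, a = 3 /\ a' = 1,
  a = -1 /\ a' = -3 | a = -3 /\ a' = -1].
Proof.
move=> H; have := @absz_factor a a' 3 isT H.
case: a H => [[|[|[|[|n]]]]|[|[|[|n]]]]// H _; try lia.
- by apply: Or41; lia.
- by apply: Or42; lia.
- by apply: Or43; lia.
- by apply: Or44; lia.
Qed.

(* A root at 45 degrees from two orthogonal roots. *)
Lemma sys_diag y z s (b c b' : int) : root y -> root z -> root s -> B y z = 0 ->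
  s = (b%:~R / 2) *: y + (c%:~R / 2) *: z -> b%:~R * Q y = b'%:~R * Q s ->
  b * b' = 2 -> 
  Q y = Q z /\ exists k, [/\ k = 1 \/ k = 1 / 2, root (k *: (y + z)), root (k *: (y - z))
    & 2 * k = `|b|%:~R].
Proof.
move=> ry rz rs yz sE hb bb.
have zy : B z y = 0 by rewrite (bformC pS).
(* The mirror image of y in s is a multiple of z, hence z or -z. This yields c = b or c = -b, and
   Q(y) = Q(z). *)
have rt : root (y - b'%:~R *: s).
  apply: root_refl => //; rewrite -hb sE !bformE zy /qform; by field.
have tE : y - b'%:~R *: s = (- (b'%:~R * c%:~R / 2)) *: z.
  have h : b%:~R * b'%:~R = 2 :> rat by rewrite -intrM bb.
  rewrite sE; apply/rowP=> j; rewrite !mxE.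
  transitivity ((1 - b%:~R * b'%:~R / 2) * y 0 j - b'%:~R * c%:~R / 2 * z 0 j); first by field.
  by rewrite h; by field.
have h0 : - (b'%:~R * c%:~R / 2) = 1 :> rat \/ - (b'%:~R * c%:~R / 2) = -1 :> rat.
  by move: rt; rewrite tE; exact: (root_pm lN rz).
have h1 : b' * c = 2 \/ b' * c = -2.
  have : (b' * c)%:~R = 2 :> rat \/ (b' * c)%:~R = -2 :> rat.
    by rewrite intrM; case: h0 => h; [right|left]; lra.
  by case=> h; [left|right]; apply: (@intr_inj rat); rewrite h.
have cb : c = b \/ c = - b by nia.
have b0 : b != 0 by apply/eqP=> b0; move: bb; rewrite b0 mul0r.
have QE : Q y = Q z.
  have : Q (y *m tau S s) = Q y by rewrite /qform; move/isometryP: (isometry_tau pS s) => ->.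
  rewrite tauE; have -> : 2 * B s y / Q s = b'%:~R.
    have s0 : Q s != 0 by rewrite gt_eqF// root_Qgt0.
    apply: (mulIf s0); rewrite divfK// -hb sE !bformE zy /qform; by field.
  by rewrite tE qform_scale sqrrN; case: h0 => /(congr1 (fun r => r ^+ 2)); rewrite ?sqrrN expr1n => ->; rewrite mul1r.
split=> //; exists (`|b|%:~R / 2).
have hb1 : `|b| = 1 \/ `|b| = 2.
  by case: (mul_eq2 bb) => -[-> _]; [left|right|left|right].
have H : root ((`|b|%:~R / 2) *: (y + z)) \/ root ((`|b|%:~R / 2) *: (y - z)).
  have [bp|bn] := lerP 0 b.
    case: cb => cb; [left|right]; rewrite ?(ger0_norm bp); apply: (root_eqv rs);
    by rewrite sE cb ?mulrNz; apply/rowP=> j; rewrite !mxE; ring.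
  case: cb => cb; [left|right]; rewrite ?(ltr0_norm bn); apply: (rootNK rs);
    by rewrite sE cb ?mulrNz; apply/rowP=> j; rewrite !mxE; ring.
have [H1 H2] : root ((`|b|%:~R / 2) *: (y + z)) /\ root ((`|b|%:~R / 2) *: (y - z)).
  case: H => H; [split; first exact: H|split; last exact: H]; move: H; rewrite ?scalerDr ?scalerN -?scaleNr => H.
    by rewrite scaleNr; apply: (root_flip rz) => //; rewrite bformZr zy mulr0.
  by rewrite -[_ / 2 in X in _ + X]opprK scaleNr; apply: (root_flip rz) => //; rewrite bformZr zy mulr0.
split=> //; last by field.
by case: hb1 => ->; [right|left].
Qed.

(** The short roots are y and z when k = 1, and their half-sum and half-difference when k = 1/2. *)
Lemma B2_of y z x k : root x -> root y -> root z -> B x y = 0 -> B x z = 0 -> B y z = 0 ->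
  Q y = Q z -> k = 1 \/ k = 1 / 2 -> root (k *: (y + z)) -> root (k *: (y - z)) ->
  exists x y z, B2sys x y z.
Proof.
move=> rx ry rz xy xz yz QE [->|->]; rewrite ?scale1r => r1 r2.
  by exists y, z, x; split=> //; split=> //; rewrite (bformC pS).
exists ((1 / 2) *: (y + z)), ((1 / 2) *: (y - z)), x.
have zy : B z y = 0 by rewrite (bformC pS).
split; first by [].
- rewrite !bformE yz zy !(bformC pS _ x) xy xz -/(Q y) -/(Q z) QE; split; ring.
- by rewrite !qform_scale (qformB pS) (qformD pS) yz mulr0; ring.
- split; [apply: (root_eqv ry)|apply: (root_eqv rz)];
  by apply/rowP=> j; rewrite !mxE; by field.
Qed.

(** The line of s makes 60 degrees with y and 30 degrees with z. Whichever of y and z is the longer,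
    their plane carries a G2, which x completes. *)
Lemma sys_hex x y z s (b c b' c' : int) : root x -> root y -> root z -> root s ->
  B x y = 0 -> B x z = 0 -> B y z = 0 ->
  s = (b%:~R / 2) *: y + (c%:~R / 2) *: z ->
  b%:~R * Q y = b'%:~R * Q s -> c%:~R * Q z = c'%:~R * Q s ->
  b * b' = 1 -> c * c' = 3 -> exists e f x, G2sys e f x.
Proof.
move=> rx ry rz rs xy xz yz sE hb hc bb cc.
have zy : B z y = 0 by rewrite (bformC pS).
have yx : B y x = 0 by rewrite (bformC pS).
have zx : B z x = 0 by rewrite (bformC pS).
have flips (u v : rat) : root (u *: y + v *: z) ->
    [/\ root (u *: y - v *: z), root (- u *: y + v *: z) & root (- u *: y - v *: z)].
  move=> h; have h1 : root (u *: y - v *: z) by apply: root_flip => //; rewrite bformZr zy mulr0.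
  by split=> //; [apply: (rootNK h1)|apply: (rootNK h)];
    apply/rowP=> j; rewrite !mxE; ring.
have hs : root (1 / 2 *: y + (`|c|%:~R / 2) *: z).
  have [] := flips (b%:~R / 2) (c%:~R / 2); rewrite -?sE// => h1 h2 h3.
  have [b1|b1] : b = 1 \/ b = -1 by case: (mul_eq1 bb) => -[]; [left|right].
    have [c0|c0] := lerP 0 c.
      by apply: (root_eqv rs); rewrite sE b1 ger0_norm.
    apply: (root_eqv h1); rewrite b1 (ltr0_norm c0); apply/rowP=> j; rewrite !mxE mulrNz; ring.
  have [c0|c0] := lerP 0 c.
    by apply: (root_eqv h2); rewrite b1 ger0_norm//; apply/rowP=> j; rewrite !mxE; ring.
  apply: (root_eqv h3); rewrite b1 (ltr0_norm c0); apply/rowP=> j; rewrite !mxE mulrNz; ring.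
have Qs : Q y = Q s by case: (mul_eq1 bb) => -[eb eb']; move: hb; rewrite eb eb'; lra.
(* z is a long root in the first case, y in the second. *)
have [[c1 Qz]|[c1 Qz]] : `|c| = 1 /\ Q z = 3 * Q y \/ `|c| = 3 /\ Q y = 3 * Q z.
  by rewrite Qs; case: (mul_eq3 cc) => -[ec ec']; move: hc; rewrite ec ec' => h;
   [left|right|left|right]; (split; first by []); lra.
- rewrite c1 in hs; pose f := 1 / 2 *: y + (1%:~R / 2) *: z.
  have [h1 h2 h3] := flips _ _ hs.
  have h4 : root (3 / 2 *: y + 1 / 2 *: z).
    have : root (z - 3 *: f).
      by apply: root_refl => //; rewrite /f /qform !bformE yz zy -/(Q z) -/(Q y) Qz; by field.
    move=> h; apply: (rootNK h); rewrite /f; apply/rowP=> j; rewrite !mxE; by field.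
  exists y, f, x; split; first by split.
  + by rewrite /f /qform !bformE yz zy yx zx -/(Q z) -/(Q y) Qz; split; by field.
  + by apply: (root_eqv h1); rewrite /f; apply/rowP=> j; rewrite !mxE; by field.
  + split.
    * by apply: (root_eqv h4); rewrite /f; apply/rowP=> j; rewrite !mxE; by field.
    * have [h5 _ _] := flips _ _ h4.
      by apply: (root_eqv h5); rewrite /f; apply/rowP=> j; rewrite !mxE; by field.
    * by apply: (root_eqv rz); rewrite /f; apply/rowP=> j; rewrite !mxE; by field.
- rewrite c1 in hs; set s' := (X in root X) in hs.
  have Qs' : Q s' = 3 * Q z.
    by rewrite /s' /qform !bformE yz zy -/(Q z) -/(Q y) Qz; by field.
  have hf : root (1 / 2 *: y + 1 / 2 *: z).
    have : root (z - 1 *: s').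
      by apply: root_refl => //; rewrite Qs' /s' !bformE yz /qform; by field.
    move=> h; apply: (rootNK h); rewrite /s'; apply/rowP=> j; rewrite !mxE; by field.
  have [h1 h2 h3] := flips _ _ hf.
  exists z, (1 / 2 *: y + 1 / 2 *: z), x; split; first by split.
  + by rewrite /qform !bformE yz zy yx zx -/(Q z) -/(Q y) Qz; split; by field.
  + by apply: (root_eqv h2); apply/rowP=> j; rewrite !mxE; by field.
  + split.
    * by apply: (root_eqv hs); rewrite /s'; apply/rowP=> j; rewrite !mxE; by field.
    * have [_ h5 _] := flips _ _ hs.
      by apply: (root_eqv h5); apply/rowP=> j; rewrite !mxE; by field.
    * by apply: (root_eqv ry); apply/rowP=> j; rewrite !mxE; by field.
Qed.

End Classification.

(** * Completeness of the types B2 A1, G2 A1 and B3 *)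

Section Classification2.
Variables (S : 'M[rat]_3) (N : set 'rV[rat]_3).
Hypotheses (pS : posdef_space S) (lN : integral_lattice S N).
Local Notation B := (bform S).
Local Notation Q := (qform S).
Local Notation root := (root S N).
Local Notation covered := (covered S N).
Let gN : subgroup N := il_sub lN.
Implicit Types (x y z s e f u : 'rV[rat]_3).
Local Notation rgt0 := (root_Qgt0 pS).
Local Notation req := (@root_eqv S N _ _).
Local Notation rN := (rootNK pS lN).

(** The symmetries of the orthogonal roots y and z change the signs of the coordinates, so
    coordinates may be taken nonnegative. *)
Lemma root_flips y z (u v : rat) : root y -> root z -> B y z = 0 -> root (u *: y + v *: z) ->
  root (`|u| *: y + `|v| *: z) /\ root (`|u| *: y - `|v| *: z).
Proof.
move=> ry rz yz h.
have zy : B z y = 0 by rewrite (bformC pS).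
have h1 : root (u *: y - v *: z) by apply: (root_flip pS) => //; rewrite bformZr zy mulr0.
have [u0|u0] := lerP 0 u; have [v0|v0] := lerP 0 v; split.
all: rewrite ?(ger0_norm u0) ?(ger0_norm v0) ?(ltr0_norm u0) ?(ltr0_norm v0).
- by [].
- by [].
- by apply: (req h1); rewrite scaleNr.
- by apply: (req h); rewrite scaleNr opprK.
- by apply: (rN h1); rewrite scaleNr opprB addrC.
- by apply: (rN h); rewrite scaleNr opprD.
- by apply: (rN h); rewrite !scaleNr opprD.
- by apply: (rN h1); rewrite !scaleNr opprB opprK addrC.
Qed.

Lemma coord0 y s (b b' : int) : root y -> root s -> b%:~R * Q y = b'%:~R * Q s ->
  b * b' = 0 -> b = 0 /\ b' = 0.
Proof.
move=> ry rs E /eqP; rewrite mulf_eq0 => /orP[] /eqP z0; split=> //.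
  move: E; rewrite z0 mul0r => /esym/eqP; rewrite mulf_eq0 (gt_eqF (rgt0 rs)) orbF.
  by rewrite intr_eq0 => /eqP.
move: E; rewrite z0 mul0r => /eqP; rewrite mulf_eq0 (gt_eqF (rgt0 ry)) orbF.
by rewrite intr_eq0 => /eqP.
Qed.

(** The line of s makes 60 degrees with x and y, and 45 degrees with z. The mirror image of z in s
    has no z-component and is a root on a diagonal of the plane of x and y. *)
Lemma sys_112 x y z s (a b c a' b' c' : int) : root x -> root y -> root z -> root s ->
  B x y = 0 -> B x z = 0 -> B y z = 0 ->
  s = (a%:~R / 2) *: x + (b%:~R / 2) *: y + (c%:~R / 2) *: z ->
  a%:~R * Q x = a'%:~R * Q s -> b%:~R * Q y = b'%:~R * Q s -> c%:~R * Q z = c'%:~R * Q s ->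
  a * a' = 1 -> b * b' = 1 -> c * c' = 2 ->
  Q x = Q y /\ exists k, [/\ k = 1 \/ k = 1 / 2, root (k *: (x + y)), root (k *: (x - y))
   & 2 * k = `|c'|%:~R].
Proof.
move=> rx ry rz rs xy xz yz sE ha hb hc aa bb cc.
have zx : B x z = 0 -> B z x = 0 by rewrite (bformC pS).
have [QX QY] : Q x = Q s /\ Q y = Q s.
  split.
    by case: (mul_eq1 aa) => -[e1 e2]; move: ha; rewrite e1 e2; lra.
  by case: (mul_eq1 bb) => -[e1 e2]; move: hb; rewrite e1 e2; lra.
split; first by rewrite QX QY.
have rt : root (z - c'%:~R *: s).
  apply: (root_refl pS) => //; rewrite -hc sE !bformE xz yz /qform; by field.
have h : root ((c'%:~R * a%:~R / 2) *: x + (c'%:~R * b%:~R / 2) *: y).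
  have e2 : c%:~R * c'%:~R = 2 :> rat by rewrite -intrM cc.
  apply: (rN rt); rewrite sE; apply/rowP=> j; rewrite !mxE.
  transitivity (c'%:~R * a%:~R / 2 * x 0 j + c'%:~R * b%:~R / 2 * y 0 j +
    (c%:~R * c'%:~R / 2 - 1) * z 0 j); last by field.
  by rewrite e2; field.
have [h1 h2] := root_flips rx ry xy h.
have nrm (t : int) : t = 1 \/ t = -1 -> `|c'%:~R * t%:~R / 2| = `|c'|%:~R / 2 :> rat.
  by case=> ->; rewrite ?mulrN1 ?mulr1 ?mulNr ?normrN normrM ?normrN normfV intr_norm.
have [a1 b1] : (a = 1 \/ a = -1) /\ (b = 1 \/ b = -1).
  by case: (mul_eq1 aa) => -[-> _]; case: (mul_eq1 bb) => -[-> _]; auto.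
move: h1 h2; rewrite !nrm// -!scalerDr -scalerBr => h1 h2.
exists (`|c'|%:~R / 2); split=> //; last by field.
by case: (mul_eq2 cc) => -[_ ->]; [left|right|left|right].
Qed.

Lemma k_unique k x : root x -> root (k *: x) -> 0 < k -> k = 1.
Proof. by move=> rx rk k0; case: (root_pm lN rx rk) => // E; move: k0; rewrite E. Qed.

(** The products a a', b b', c c' are nonnegative integers with sum 4, and none of them is 4, as s
    lies on no axis. Up to order they are (0,1,3), (0,2,2) or (1,1,2), which [sys_hex], [sys_diag]
    and [sys_112] handle. *)
Lemma frame_extra x y z s : root x -> root y -> root z -> root s ->
  B x y = 0 -> B x z = 0 -> B y z = 0 -> ~ par s x -> ~ par s y -> ~ par s z ->
  (exists x y z, B2sys S N x y z) \/ (exists e f z, G2sys S N e f z).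
Proof.
move=> rx ry rz rs xy xz yz nx ny nz.
have [yx zx zy] : [/\ B y x = 0, B z x = 0 & B z y = 0].
  by rewrite (bformC pS y) !(bformC pS z).
have [a [b [c [a' [b' [c' [sE [ha hb hc] [pa pb pc] sum]]]]]]] :=
  frame_coords pS lN rx ry rz rs xy xz yz.
have aZ := coord0 rx rs ha; have bZ := coord0 ry rs hb; have cZ := coord0 rz rs hc.
have a4 : a * a' <> 4.
  move=> e4; have [b0 _] := bZ ltac:(lia); have [c0 _] := cZ ltac:(lia); apply: nx.
  by exists (a%:~R / 2); rewrite sE b0 c0 !mul0r !scale0r !addr0.
have b4 : b * b' <> 4.
  move=> e4; have [b0 _] := aZ ltac:(lia); have [c0 _] := cZ ltac:(lia); apply: ny.
  by exists (b%:~R / 2); rewrite sE b0 c0 !mul0r !scale0r !addr0 add0r.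
have c4 : c * c' <> 4.
  move=> e4; have [b0 _] := aZ ltac:(lia); have [c0 _] := bZ ltac:(lia); apply: nz.
  by exists (c%:~R / 2); rewrite sE b0 c0 !mul0r !scale0r !add0r.
have diag t u v (i j i' : int) : root t -> root u -> root v -> B t u = 0 -> B t v = 0 -> B u v = 0 ->
    s = (i%:~R / 2) *: u + (j%:~R / 2) *: v -> i%:~R * Q u = i'%:~R * Q s -> i * i' = 2 ->
    exists x y z, B2sys S N x y z.
  move=> rt ru rv tu tv uv E hi ii.
  have [QE [k [hk r1 r2 _]]] := sys_diag pS lN ru rv rs uv E hi ii.
  exact: (B2_of pS rt ru rv tu tv uv QE hk r1 r2).
have skew t u v (i j i' j' l l' : int) : root t -> root u -> root v -> B t u = 0 -> B t v = 0 -> B u v = 0 ->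
    s = (i%:~R / 2) *: t + (j%:~R / 2) *: u + (l%:~R / 2) *: v ->
    i%:~R * Q t = i'%:~R * Q s -> j%:~R * Q u = j'%:~R * Q s -> l%:~R * Q v = l'%:~R * Q s ->
    i * i' = 1 -> j * j' = 1 -> l * l' = 2 -> exists x y z, B2sys S N x y z.
  move=> rt ru rv tu tv uv E hi hj hl ii jj ll.
  have [QE [k [hk r1 r2 _]]] := sys_112 rt ru rv rs tu tv uv E hi hj hl ii jj ll.
  by apply: (B2_of pS rv rt ru _ _ tu QE hk r1 r2); rewrite (bformC pS).
have sEa : a = 0 -> s = (b%:~R / 2) *: y + (c%:~R / 2) *: z.
  by move=> e0; rewrite sE e0 mul0r scale0r add0r.
have sEb : b = 0 -> s = (a%:~R / 2) *: x + (c%:~R / 2) *: z.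
  by move=> e0; rewrite sE e0 mul0r scale0r addr0.
have sEc : c = 0 -> s = (a%:~R / 2) *: x + (b%:~R / 2) *: y.
  by move=> e0; rewrite sE e0 mul0r scale0r addr0.
have sEr : s = (b%:~R / 2) *: y + (c%:~R / 2) *: z + (a%:~R / 2) *: x by rewrite sE -addrA addrC.
have sEm : s = (a%:~R / 2) *: x + (c%:~R / 2) *: z + (b%:~R / 2) *: y by rewrite sE addrAC.
have [A|[A|[A|A]]] : a * a' = 0 \/ a * a' = 1 \/ a * a' = 2 \/ a * a' = 3 by lia.
- have [a0 _] := aZ A; have [[Bb C]|[[Bb C]|[Bb C]]] : b * b' = 1 /\ c * c' = 3 \/ b * b' = 2 /\ c * c' = 2
    \/ b * b' = 3 /\ c * c' = 1 by lia.
  + by right; apply: (sys_hex pS lN rx ry rz rs _ _ _ (sEa a0) hb hc).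
  + by left; apply: (diag x y z b c b') => //; exact: sEa.
  + right; apply: (sys_hex pS lN rx rz ry rs _ _ _ _ hc hb) => //.
    by rewrite addrC; exact: sEa.
- have [[Bb C]|[[Bb C]|[[Bb C]|[Bb C]]]] : b * b' = 0 /\ c * c' = 3 \/ b * b' = 3 /\ c * c' = 0
    \/ b * b' = 1 /\ c * c' = 2 \/ b * b' = 2 /\ c * c' = 1 by lia.
  + by right; apply: (sys_hex pS lN ry rx rz rs _ _ _ (sEb (bZ Bb).1) ha hc).
  + by right; apply: (sys_hex pS lN rz rx ry rs _ _ _ (sEc (cZ C).1) ha hb).
  + by left; apply: (skew x y z a b a' b' c c').
  + by left; apply: (skew x z y a c a' c' b b').
- have [[Bb C]|[[Bb C]|[Bb C]]] : b * b' = 0 /\ c * c' = 2 \/ b * b' = 2 /\ c * c' = 0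
    \/ b * b' = 1 /\ c * c' = 1 by lia.
  + by left; apply: (diag y x z a c a') => //; exact: (sEb (bZ Bb).1).
  + by left; apply: (diag z x y a b a') => //; exact: (sEc (cZ C).1).
  + by left; apply: (skew y z x b c b' c' a a').
- have [[Bb C]|[Bb C]] : b * b' = 0 /\ c * c' = 1 \/ b * b' = 1 /\ c * c' = 0 by lia.
  + right; apply: (sys_hex pS lN ry rz rx rs _ _ _ _ hc ha) => //.
    by rewrite addrC; exact: (sEb (bZ Bb).1).
  + right; apply: (sys_hex pS lN rz ry rx rs _ _ _ _ hb ha) => //.
    by rewrite addrC; exact: (sEc (cZ C).1).
Qed.

Lemma cross_coord x y s (a b a' b' : int) : root s -> Q x = Q y ->
  a%:~R * Q x = a'%:~R * Q s -> b%:~R * Q y = b'%:~R * Q s -> a' * b = a * b'.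
Proof.
move=> rs QE ha hb; apply: (@intr_inj rat); rewrite !intrM; apply: (mulIf (lt0r_neq0 (rgt0 rs))).
by rewrite mulrAC -ha -[RHS]mulrA -hb QE; ring.
Qed.

(* Integrality of [2 B(s, s') / Q(s)] for the mirror image [s'] of [s] in [x - y]. *)
Lemma parity k x y z s (a b c a' c' : int) : root x -> root y -> root z -> root s ->
  B x y = 0 -> B x z = 0 -> B y z = 0 -> Q x = Q y -> root (k *: (x - y)) ->
  s = (a%:~R / 2) *: x + (b%:~R / 2) *: y + (c%:~R / 2) *: z ->
  a%:~R * Q x = a'%:~R * Q s -> c%:~R * Q z = c'%:~R * Q s ->
  exists n : int, 2 * (a' * b) + c * c' = 2 * n.
Proof.
move=> rx ry rz rs xy xz yz QE rk sE ha hc.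
have [yx zx zy] : [/\ B y x = 0, B z x = 0 & B z y = 0].
  by rewrite (bformC pS y) !(bformC pS z).
have k0 : k != 0 by apply: contraNneq (root_neq0 rk) => ->; rewrite scale0r.
have Qd : Q (x - y) = 2 * Q x by rewrite (qformB pS) xy -QE; ring.
have X0 := lt0r_neq0 (rgt0 rx).
have sT : s *m tau S (k *: (x - y)) = (b%:~R / 2) *: x + (a%:~R / 2) *: y + (c%:~R / 2) *: z.
  rewrite tau_scale// tauE Qd.
  have -> : 2 * B (x - y) s / (2 * Q x) = a%:~R / 2 - b%:~R / 2.
    by rewrite sE !bformE xy xz yz yx -/(Q y) -QE /qform; field; exact: X0.
  by rewrite sE; apply/rowP=> j; rewrite !mxE; ring.
have Ns' : N (s *m tau S (k *: (x - y))).
  by apply: (@isog_in S); [case: rk|exact: root_in rs].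
have /intrP [n hn] := root_int lN rs Ns'; exists n.
apply: (@intr_inj rat); rewrite intrD !intrM -hn.
have s0 := lt0r_neq0 (rgt0 rs); apply: (mulIf s0); rewrite -[RHS]mulrA divfK//.
have -> : 2 * (2 * B s (s *m tau S (k *: (x - y)))) =
   2 * (b%:~R * (a%:~R * Q x)) + c%:~R * (c%:~R * Q z).
  by rewrite sT {1}sE !bformE xy xz yz yx zx zy -/(Q y) -QE /qform; field.
by rewrite ha hc; ring.
Qed.

Lemma sq_not (k : int) : k * k <> 2 /\ k * k <> 3.
Proof.
split=> H; have : (`|k| <= 3)%N.
- by apply: leq_trans (_ : (2 <= 3)%N) => //; exact: (absz_factor _ H).
- by case: k H => [[|[|[|[|n]]]]|[|[|[|n]]]]//; lia.
- exact: (absz_factor _ H).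
- by case: k H => [[|[|[|[|n]]]]|[|[|[|n]]]]//; lia.
Qed.

Lemma diag_par (a b a' b' : int) : a' * b = a * b' -> a * a' = 2 -> b * b' = 2 ->
  b = a \/ b = - a.
Proof.
move=> E aa bb; case: (mul_eq2 aa) => -[ea ea']; case: (mul_eq2 bb) => -[eb eb'];
  rewrite ea ea' eb eb' in E *; lia.
Qed.

(** By [sys_diag] the vectors k (y + z) and k (y - z) are roots. Reflections then make both x + z
    and k (x + z) roots, whence k = 1. *)
Lemma B3_of x y z s (b c b' : int) : B2sys S N x y z -> root s ->
  s = (b%:~R / 2) *: y + (c%:~R / 2) *: z -> b%:~R * Q y = b'%:~R * Q s -> b * b' = 2 ->
  B3sys S N 1 x y z.
Proof.
move=> [[rx ry rz] [xy xz yz] QE [r1 r2]] rs E hb bb.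
have [yx zx zy] : [/\ B y x = 0, B z x = 0 & B z y = 0].
  by rewrite (bformC pS y) !(bformC pS z).
have [QE' [k [hk d1 d2 _]]] := sys_diag pS lN ry rz rs yz E hb bb.
have k0 : 0 < k by case: hk => ->.
have h1 : root (x + z).
  have : root (x + y - k^-1 *: (k *: (y - z))).
    apply: (root_refl pS) => //; rewrite qform_scale (qformB pS) !bformE yx yz zx zy -QE' /qform.
    by field; exact: lt0r_neq0.
  move=> h; apply: (req h); rewrite scalerA mulVf ?lt0r_neq0// scale1r.
  by apply/rowP=> j; rewrite !mxE; ring.
have h2 : root (k *: (x + z)).
  have : root (k *: (y + z) - (- k) *: (x - y)).
    by apply: (root_refl pS) => //; rewrite (qformB pS) !bformE xy xz yz QE /qform; ring.
  by move=> h; apply: (req h); apply/rowP=> j; rewrite !mxE; ring.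
have k1 := k_unique h1 h2 k0.
split; [by split|by split|by rewrite QE|by left|rewrite !scale1r; split; first exact: (conj r1 r2)].
- split; first exact: h1.
  rewrite -[z]scale1r; apply: (root_flip pS) => //; first by rewrite scale1r.
- by move: d1 d2; rewrite k1 !scale1r.
Qed.

(** By [parity] the product c c' is even. If it is 0, then (a a')(b b') = (a' b)^2 is a square,
    which excludes (1,3) and leaves the axes and diagonals of the plane; if it is 4, s lies on the
    axis z; if it is 2, s produces a system of type B3. *)
Lemma B2_cover x y z : B2sys S N x y z ->
  covered [:: x; y; x + y; x - y; z] \/ exists k x y z, B3sys S N k x y z.
Proof.
move=> sys; have [[rx ry rz] [xy xz yz] QE [r1 r2]] := sys.
have [yx zx zy] : [/\ B y x = 0, B z x = 0 & B z y = 0].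
  by rewrite (bformC pS y) !(bformC pS z).
case: (pselect (exists k x y z, B3sys S N k x y z)) => [|nB3]; [by right|left] => s rs.
have [a [b [c [a' [b' [c' [sE [ha hb hc] [pa pb pc] sum]]]]]]] :=
  frame_coords pS lN rx ry rz rs xy xz yz.
have aZ := coord0 rx rs ha; have bZ := coord0 ry rs hb; have cZ := coord0 rz rs hc.
have r2' : root (1 *: (x - y)) by rewrite scale1r.
have [n hn] := parity rx ry rz rs xy xz yz QE r2' sE ha hc.
have cr := cross_coord rs QE ha hb.
have sq : (a' * b) * (a' * b) = (a * a') * (b * b') by rewrite {2}cr; ring.
have [C|[C|C]] : c * c' = 0 \/ c * c' = 2 \/ c * c' = 4 by lia.
- have [c0 _] := cZ C; have sE' : s = (a%:~R / 2) *: x + (b%:~R / 2) *: y.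
    by rewrite sE c0 mul0r scale0r addr0.
  have [A|[A|[A|[A|A]]]] : a * a' = 0 \/ a * a' = 1 \/ a * a' = 2 \/ a * a' = 3 \/ a * a' = 4 by lia.
  + exists y; first by rewrite !inE eqxx !orbT.
    by exists (b%:~R / 2); rewrite sE' (aZ A).1 mul0r scale0r add0r.
  + by have := (sq_not (a' * b)).2; rewrite sq A; lia.
  + have [e|e] := diag_par cr A ltac:(lia).
      exists (x + y); first by rewrite !inE eqxx !orbT.
      by exists (a%:~R / 2); rewrite sE' e scalerDr.
    exists (x - y); first by rewrite !inE eqxx !orbT.
    by exists (a%:~R / 2); rewrite sE' e mulrNz mulNr scaleNr scalerBr.
  + by have := (sq_not (a' * b)).2; rewrite sq A; lia.
  + exists x; first by rewrite !inE eqxx.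
    by exists (a%:~R / 2); rewrite sE' (bZ _).1 ?mul0r ?scale0r ?addr0//; lia.
- case: nB3; have [A|[A|A]] : a * a' = 0 \/ a * a' = 1 \/ a * a' = 2 by lia.
  + exists 1, x, y, z; apply: (B3_of sys rs _ hb); last by lia.
    by rewrite sE (aZ A).1 mul0r scale0r add0r.
  (* For the products (1,1,2) the norm of z is 2 Q(x), so x + y, x - y and z are orthogonal of equal
     norm. The half-sums and half-differences of any two of them are roots: type B3 with k = 1/2. *)
  + have Bb : b * b' = 1 by lia.
    have [_ [k [hk d1 _ ck]]] := sys_112 rx ry rz rs xy xz yz sE ha hb hc A Bb C.
    have k1 : k = 1 by apply: (k_unique r1 d1); case: hk => ->.
    have c1 : `|c'| = 2 by apply: (@intr_inj rat); rewrite -ck k1 mulr1.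
    have QX : Q x = Q s by case: (mul_eq1 A) => -[e1 e2]; move: ha; rewrite e1 e2; lra.
    have [cc QZ] : `|c| = 1 /\ Q z = 2 * Q x.
      by rewrite QX; case: (mul_eq2 C) => -[e1 e2]; move: hc c1; rewrite e1 e2//; split=> //; lra.
    have [d3 d4] : [/\ root (1 / 2 *: (x + y + z)), root (1 / 2 *: (x + y - z)) &
      root (1 / 2 *: (x - y + z))] /\ root (1 / 2 *: (x - y - z)).
      have nc (t u : rat) : `|t / 2| = `|t| / 2 by rewrite normrM normfV.
      have fl (u v w : rat) : root (u *: x + v *: y + w *: z) ->
        [/\ root (u *: x + v *: y - w *: z), root (u *: x - v *: y + w *: z) &
         root (- u *: x + v *: y + w *: z)].
        move=> h; split.
        - by apply: (root_flip pS) => //; rewrite !bformE zx zy !mulr0 addr0.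
        - rewrite addrAC; apply: (root_flip pS) => //; first by rewrite addrAC.
          by rewrite !bformE yx yz !mulr0 addr0.
        - rewrite -addrA addrC scaleNr; apply: (root_flip pS) => //; first by apply: (req h); rewrite -[RHS]addrA [RHS]addrC.
          by rewrite !bformE xy xz !mulr0 addr0.
      have main : root (1 / 2 *: x + 1 / 2 *: y + 1 / 2 *: z).
        have [a1 b1 c1'] : [/\ a = 1 \/ a = -1, b = 1 \/ b = -1 & c = 1 \/ c = -1].
          split; [by case: (mul_eq1 A) => -[]; auto|by case: (mul_eq1 Bb) => -[]; auto|lia].
        have hs := rs; rewrite sE in hs.
        have {}hs : root (1 / 2 *: x + (b%:~R / 2) *: y + (c%:~R / 2) *: z).
          case: a1 => a1; rewrite a1 in hs; first by [].
          by have [_ _ h] := fl _ _ _ hs; apply: (req h); rewrite mulrNz mulNr opprK.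
        have {}hs : root (1 / 2 *: x + 1 / 2 *: y + (c%:~R / 2) *: z).
          case: b1 => b1; rewrite b1 in hs; first by [].
          by have [_ h _] := fl _ _ _ hs; apply: (req h); rewrite mulrNz mulNr scaleNr opprK.
        case: c1' => c1'; rewrite c1' in hs; first by [].
        by have [h _ _] := fl _ _ _ hs; apply: (req h); rewrite mulrNz mulNr scaleNr opprK.
      have [h1 h2 _] := fl _ _ _ main; rewrite -scaleNr in h1; have [_ h3 _] := fl _ _ _ h1.
      split; last by apply: (req h3); apply/rowP=> j; rewrite !mxE; ring.
      by split; [apply: (req main)|apply: (req h1)|apply: (req h2)]; apply/rowP=> j; rewrite !mxE; ring.
    case: d3 => d3 d5 d6.
    exists (1 / 2), (x + y), (x - y), z; split; first exact: (And3 r1 r2 rz).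
    * by rewrite !bformE xy xz yx yz -/(Q x) -/(Q y) QE; split; ring.
    * by rewrite (qformD pS) (qformB pS) xy QZ -QE; split; ring.
    * by right.
    * split; first by split; [apply: (req rx)|apply: (req ry)]; apply/rowP=> j; rewrite !mxE; by field.
      by split. by split.
  + exists 1, y, x, z; apply: (@B3_of y x z s a c a') => //.
      split=> //; split; first by rewrite addrC.
      by apply: (rN r2); rewrite opprB.
    by rewrite sE (bZ _).1 ?mul0r ?scale0r ?addr0//; lia.
- exists z; first by rewrite !inE eqxx !orbT.
  have [a0 _] := aZ ltac:(lia); have [b0 _] := bZ ltac:(lia).
  by exists (c%:~R / 2); rewrite sE a0 b0 !mul0r !scale0r !add0r.
Qed.

(** [parity] for the three pairs of axes makes all three products even, which leaves (4,0,0), an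
    axis, and (2,2,0), a diagonal, up to order. *)
Lemma B3_cover k x y z : B3sys S N k x y z ->
  covered [:: x; y; z; x + y; x - y; x + z; x - z; y + z; y - z].
Proof.
move=> [[rx ry rz] [xy xz yz] [QE QE'] hk [[r1 r2] [r3 r4] [r5 r6]]] s rs.
have [yx zx zy] : [/\ B y x = 0, B z x = 0 & B z y = 0].
  by rewrite (bformC pS y) !(bformC pS z).
have QE2 : Q y = Q z by rewrite -QE QE'.
have [a [b [c [a' [b' [c' [sE [ha hb hc] [pa pb pc] sum]]]]]]] :=
  frame_coords pS lN rx ry rz rs xy xz yz.
have aZ := coord0 rx rs ha; have bZ := coord0 ry rs hb; have cZ := coord0 rz rs hc.
have sEr : s = (b%:~R / 2) *: y + (c%:~R / 2) *: z + (a%:~R / 2) *: x by rewrite sE -addrA addrC.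
have sEm : s = (a%:~R / 2) *: x + (c%:~R / 2) *: z + (b%:~R / 2) *: y by rewrite sE addrAC.
have [n1 h1] := parity rx ry rz rs xy xz yz QE r2 sE ha hc.
have [n2 h2] := parity rx rz ry rs xz xy zy QE' r4 sEm ha hb.
have [n3 h3] := parity ry rz rx rs yz yx zx QE2 r6 sEr hb ha.
have cov (u v : 'rV[rat]_3) (i j : int) (l : seq 'rV[rat]_3) : u + v \in l -> u - v \in l ->
    s = (i%:~R / 2) *: u + (j%:~R / 2) *: v -> j = i \/ j = - i -> exists2 r, r \in l & par s r.
  move=> l1 l2 E [ej|ej]; [exists (u + v) => //|exists (u - v) => //]; exists (i%:~R / 2).
    by rewrite E ej scalerDr.
  by rewrite E ej mulrNz mulNr scaleNr scalerBr.
have [A|[A|A]] : a * a' = 0 \/ a * a' = 2 \/ a * a' = 4 by lia.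
- have [a0 _] := aZ A; have [Bb|[Bb|Bb]] : b * b' = 0 \/ b * b' = 2 \/ b * b' = 4 by lia.
  + have [b0 _] := bZ Bb; exists z; first by rewrite !inE eqxx !orbT.
    by exists (c%:~R / 2); rewrite sE a0 b0 !mul0r !scale0r !add0r.
  + apply: (cov y z b c); rewrite ?inE ?eqxx ?orbT//.
      by rewrite sE a0 mul0r scale0r add0r.
    by apply: (diag_par (cross_coord rs QE2 hb hc)) => //; lia.
  + have [c0 _] := cZ ltac:(lia); exists y; first by rewrite !inE eqxx !orbT.
    by exists (b%:~R / 2); rewrite sE a0 c0 !mul0r !scale0r !addr0 add0r.
- have [Bb|Bb] : b * b' = 0 \/ b * b' = 2 by lia.
  + have [b0 _] := bZ Bb; apply: (cov x z a c); rewrite ?inE ?eqxx ?orbT//.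
      by rewrite sE b0 mul0r scale0r addr0.
    by apply: (diag_par (cross_coord rs QE' ha hc)) => //; lia.
  + have [c0 _] := cZ ltac:(lia); apply: (cov x y a b); rewrite ?inE ?eqxx ?orbT//.
      by rewrite sE c0 mul0r scale0r addr0.
    by apply: (diag_par (cross_coord rs QE ha hb)) => //; lia.
- have [b0 _] := bZ ltac:(lia); have [c0 _] := cZ ltac:(lia).
  exists x; first by rewrite !inE eqxx.
  by exists (a%:~R / 2); rewrite sE b0 c0 !mul0r !scale0r !addr0.
Qed.

(** In the frame e, y = 2 f - e, z one has Q(y) = 3 Q(e), so (a a')(b b') is three times a
    square. *)
Lemma G2_cover e f z : G2sys S N e f z ->
  covered [:: e; f; e - f; e + f; 2 *: e - f; 2 *: f - e; z].
Proof.
move=> [[re rf rz] [ez fz Qf ef] r1 [r2 r3 r4]] s rs.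
have [ze zf] : B z e = 0 /\ B z f = 0 by rewrite !(bformC pS z).
have fe : 2 * B f e = Q e by rewrite (bformC pS).
pose y := 2 *: f - e.
have ey : B e y = 0 by rewrite /y !bformE ef subrr.
have yz : B y z = 0 by rewrite /y !bformE ez fz; ring.
have Qy : Q y = 3 * Q e.
  by rewrite /y (qformB pS) qform_scale Qf !bformE fe; ring.
have yE : y = 2 *: f - e by [].
rewrite -/y in r4 *; clearbody y.
(* For c c' > 0 the other two products have sum at most 3, and three times a square then leaves only
   0. *)
have key t : root t -> B z t <> 0 -> B e t = 0 \/ B y t = 0.
  move=> rt zt.
  have [a [b [c [a' [b' [c' [tE [ha hb hc] [pa pb pc] sum]]]]]]] :=
    frame_coords pS lN re r4 rz rt ey ez yz.
  have aZ := coord0 re rt ha; have bZ := coord0 r4 rt hb; have cZ := coord0 rz rt hc.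
  have C : c * c' <> 0.
    move=> C; by apply: zt; rewrite tE (cZ C).1 !bformE ze (bformC pS z y) yz mul0r; ring.
  have cr : a * b' = 3 * (a' * b).
    apply: (@intr_inj rat); rewrite !intrM; apply: (mulIf (lt0r_neq0 (rgt0 rt))).
    by rewrite -mulrA -hb Qy; transitivity (3 * (b%:~R * (a%:~R * Q e))); [ring|rewrite ha; ring].
  have sq : (a * a') * (b * b') = 3 * ((a' * b) * (a' * b)) by rewrite [RHS]mulrA -cr; ring.
  have : a * a' = 0 \/ b * b' = 0.
    have : a' * b = 0 by nia.
    nia.
  case=> [A|Bb]; [left|right].
    by rewrite tE (aZ A).1 !bformE ez mul0r ey; ring.
  by rewrite tE (bZ Bb).1 !bformE yz mul0r (bformC pS y e) ey; ring.
have eT : e *m tau S f = e - f.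
  by rewrite tauE fe Qf divff ?scale1r// (lt0r_neq0 (rgt0 re)).
have yT : y *m tau S f = - (e + f).
  rewrite yE mulmxBl -scalemxAl (tau_self pS) eT; apply/rowP=> j; rewrite !mxE; ring.
have zT : z *m tau S f = z by rewrite tauE fz mulr0 mul0r scale0r subr0.
(* If s is not orthogonal to z, [key] applied to s and to its mirror image in f makes s orthogonal
   to two independent vectors of the plane, so s lies on the line of z. *)
have [zs|zs] := pselect (B z s = 0); last first.
  have rs' : root (s *m tau S f) by case: rf => _ _ hf; exact: (root_isog pS hf rs).
  have H1 := key s rs zs.
  have H2 : B (e - f) s = 0 \/ B (e + f) s = 0.
    have := key _ rs'; rewrite -!(bform_tau pS) zT eT yT bformNl => /(_ zs) [|h]; first by left.
    by right; apply/eqP; rewrite -oppr_eq0 h.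
  have [es fs] : B e s = 0 /\ B f s = 0.
    by move: H1 H2; rewrite yE !bformE => -[h1|h1] [h2|h2]; split; lra.
  exists z; first by rewrite !inE eqxx !orbT.
  exists (B z s / Q z); rewrite {1}(orth_frame pS (root_neq0 re) (root_neq0 r4) (root_neq0 rz) ey ez yz s).
  by rewrite yE !bformE es fs mulr0 subr0 !mul0r !scale0r !add0r.
have [a [b [c [a' [b' [c' [sE [ha hb hc] [pa pb pc] sum]]]]]]] :=
  frame_coords pS lN re r4 rz rs ey ez yz.
have aZ := coord0 re rs ha; have bZ := coord0 r4 rs hb.
have c0 : c = 0.
  have : c%:~R / 2 * Q z = 0 by rewrite -zs {1}sE !bformE ze (bformC pS z y) yz /qform; ring.
  by move=> /eqP; rewrite mulf_eq0 (gt_eqF (rgt0 rz)) orbF mulf_eq0 intr_eq0 orbF => /eqP.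
have cr : a * b' = 3 * (a' * b).
  apply: (@intr_inj rat); rewrite !intrM; apply: (mulIf (lt0r_neq0 (rgt0 rs))).
  by rewrite -mulrA -hb Qy; transitivity (3 * (b%:~R * (a%:~R * Q e))); [ring|rewrite ha; ring].
have sq : (a * a') * (b * b') = 3 * ((a' * b) * (a' * b)) by rewrite [RHS]mulrA -cr; ring.
move: sE; rewrite c0 mul0r scale0r addr0 => sE.
have [A|[A|[A|[A|A]]]] : a * a' = 0 \/ a * a' = 1 \/ a * a' = 2 \/ a * a' = 3 \/ a * a' = 4 by nia.
- exists y; first by rewrite !inE eqxx !orbT.
  by exists (b%:~R / 2); rewrite sE (aZ A).1 mul0r scale0r add0r.
- have h : (a' * b) * (a' * b) = 1 by nia.
  have [[a1 _]|[a1 _]] := mul_eq1 A; have [b1|b1] : b = 1 \/ b = -1.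
  + by have := mul_eq1 h; have := mul_eq1 A; nia.
  + exists f; first by rewrite !inE eqxx !orbT.
    exists 1; rewrite sE a1 b1 yE; apply/rowP=> j; rewrite !mxE; by field.
  + exists (e - f); first by rewrite !inE eqxx !orbT.
    exists 1; rewrite sE a1 b1 yE; apply/rowP=> j; rewrite !mxE; by field.
  + by have := mul_eq1 h; have := mul_eq1 A; nia.
  + exists (e - f); first by rewrite !inE eqxx !orbT.
    exists (-1); rewrite sE a1 b1 yE; apply/rowP=> j; rewrite !mxE; by field.
  + exists f; first by rewrite !inE eqxx !orbT.
    exists (-1); rewrite sE a1 b1 yE; apply/rowP=> j; rewrite !mxE; by field.
- by exfalso; nia.
- have Bb : b * b' = 1 by nia.
  have h : (a' * b) * (a' * b) = 1 by nia.
  have a3 : a = 3 \/ a = -3.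
    by case: (mul_eq3 A) => -[e1 e2]; [exfalso|left|exfalso|right]; rewrite ?e1 ?e2 // in h *; nia.
  have b1 : b = 1 \/ b = -1 by case: (mul_eq1 Bb) => -[]; auto.
  case: a3 => a3; case: b1 => b1.
  + exists (e + f); first by rewrite !inE eqxx !orbT.
    exists 1; rewrite sE a3 b1 yE; apply/rowP=> j; rewrite !mxE; by field.
  + exists (2 *: e - f); first by rewrite !inE eqxx !orbT.
    exists 1; rewrite sE a3 b1 yE; apply/rowP=> j; rewrite !mxE; by field.
  + exists (2 *: e - f); first by rewrite !inE eqxx !orbT.
    exists (-1); rewrite sE a3 b1 yE; apply/rowP=> j; rewrite !mxE; by field.
  + exists (e + f); first by rewrite !inE eqxx !orbT.
    exists (-1); rewrite sE a3 b1 yE; apply/rowP=> j; rewrite !mxE; by field.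
- exists e; first by rewrite !inE eqxx.
  by exists (a%:~R / 2); rewrite sE (bZ _).1 ?mul0r ?scale0r ?addr0//; nia.
Qed.

End Classification2.

(** * Type A2, the list of types, and the rhombohedral basis *)

Section Classification3.
Variables (S : 'M[rat]_3) (N : set 'rV[rat]_3).
Hypotheses (pS : posdef_space S) (lN : integral_lattice S N).
Local Notation B := (bform S).
Local Notation Q := (qform S).
Local Notation root := (root S N).
Local Notation covered := (covered S N).
Let gN : subgroup N := il_sub lN.
Implicit Types (x y z s e f u v : 'rV[rat]_3).
Local Notation rgt0 := (root_Qgt0 pS).
Local Notation req := (@root_eqv S N _ _).
Local Notation rN := (rootNK pS lN).

(** The last clause separates this type from G2 A1 and B3, which contain A2 as a subsystem but also
    orthogonal roots. *)
Definition A2sys e f := [/\ [/\ root e, root f & root (e - f)], Q f = Q e, 2 * B e f = Q e &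
  forall u v, root u -> root v -> B u v != 0].

(** m n is four times the squared cosine of the angle, hence 1, 2 or 3. For 2 the mirror image of v
    in u is orthogonal to v; for 3 the two roots generate a G2, which contains orthogonal roots.
    Only 1 remains. *)
Lemma acute_pair u v : (forall u v, root u -> root v -> B u v != 0) ->
  root u -> root v -> ~ par v u -> Q u = Q v /\ (2 * B u v = Q u \/ 2 * B u v = - Q u).
Proof.
move=> no ru rv np; have [u0 v0] := (rgt0 ru, rgt0 rv).
have /intrP [m hm] := root_int lN ru (root_in rv).
have /intrP [n hn] := root_int lN rv (root_in ru).
have e1 : 2 * B u v = m%:~R * Q u by rewrite -hm divfK ?gt_eqF.
have e2 : 2 * B u v = n%:~R * Q v by rewrite -hn divfK ?gt_eqF// (bformC pS).
have lt4 : m * n < 4.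
  rewrite -(ltr_int rat) intrM -(ltr_pM2r (mulr_gt0 u0 v0)).
  have -> : m%:~R * n%:~R * (Q u * Q v) = 4 * B u v ^+ 2.
    by transitivity ((m%:~R * Q u) * (n%:~R * Q v)); [ring|rewrite -e1 -e2; ring].
  rewrite ltr_pM2l// lt_neqAle cauchy// andbT; apply/eqP=> E; apply: np.
  by exists (B u v / Q u); apply: (cauchy_eq pS (root_neq0 ru) E).
have ge0 : 0 < m * n.
  rewrite -(ltr_int rat) intrM -(pmulr_lgt0 _ (mulr_gt0 u0 v0)).
  have -> : m%:~R * n%:~R * (Q u * Q v) = 4 * B u v ^+ 2.
    by transitivity ((m%:~R * Q u) * (n%:~R * Q v)); [ring|rewrite -e1 -e2; ring].
  by rewrite mulr_gt0// exprn_even_gt0// no.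
have vu : B v u = B u v by rewrite (bformC pS).
have [M|[M|M]] : m * n = 1 \/ m * n = 2 \/ m * n = 3 by lia.
- by case: (mul_eq1 M) => -[e3 e4]; move: e1 e2; rewrite e3 e4 => e1 e2; split; lra.
- have r1 : root (v - m%:~R *: u) by exact: (root_refl pS ru rv e1).
  have := no _ _ r1 rv; rewrite !bformE -/(Q v).
  have -> : m%:~R * B u v = Q v; last by rewrite subrr eqxx.
  have e3 : m%:~R * n%:~R = 2 :> rat by rewrite -intrM M.
  have -> : B u v = n%:~R * Q v / 2 by rewrite -e2; field.
  by rewrite !mulrA e3; field.
have long a b : root a -> root b -> Q a = 3 * Q b -> 2 * B a b = Q a -> False.
  move=> ra rb Qa ab.
  have ba : 2 * B b a = Q a by rewrite (bformC pS).
  have r1 : root (b - 1 *: a) by apply: (root_refl pS) => //; rewrite mul1r.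
  have Q1 : Q (b - 1 *: a) = Q b by rewrite scale1r (qformB pS) ba Qa; ring.
  have r2 : root (b - (-1) *: (b - 1 *: a)).
    apply: (root_refl pS) => //; rewrite Q1 scale1r !bformE mulrBr ab Qa /qform; ring.
  have := no _ _ ra r2; rewrite scale1r scaleN1r opprK !bformE -/(Q a).
  by have -> : B a b + (B a b - Q a) = 0; [rewrite addrA -mulr2n -mulr_natl ab subrr|rewrite eqxx].
have Nv := rN rv (erefl (- v)); have Nu := rN ru (erefl (- u)).
have QN t : Q (- t) = Q t by rewrite -scaleN1r qform_scale sqrrN expr1n mul1r.
exfalso; case: (mul_eq3 M) => -[e3 e4]; move: e1 e2; rewrite e3 e4 => e1 e2.
- by apply: (@long u v); rewrite ?(bformC pS v u)//; lra.
- by apply: (@long v u); rewrite ?(bformC pS v u)//; lra.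
- by apply: (@long u (- v)); rewrite ?QN ?bformE//; lra.
- by apply: (@long v (- u)); rewrite ?QN ?bformE ?vu//; lra.
Qed.

Lemma A2_cover u v : (forall u v, root u -> root v -> B u v != 0) ->
  root u -> root v -> ~ par v u ->
  exists e f, A2sys e f /\ covered [:: e; f; e - f].
Proof.
move=> no ru rv np; have [QE ang] := acute_pair no ru rv np.
have [f [rf Qf uf]] : exists f, [/\ root f, Q f = Q u & 2 * B u f = Q u].
  case: ang => ang; first by exists v.
  exists (- v); split; first exact: (rN rv).
    by rewrite -scaleN1r qform_scale sqrrN expr1n mul1r.
  by rewrite bformNr mulrN ang opprK.
have rd : root (u - f).
  have : root (f - 1 *: u) by apply: (root_refl pS) => //; rewrite mul1r.
  by move=> h; apply: (rN h); rewrite scale1r opprB.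
exists u, f; split; first by split.
have Qd : Q (u - f) = Q u by rewrite (qformB pS) uf Qf; ring.
move=> s rs.
have [p1|n1] := pselect (par s u); first by exists u; rewrite // !inE eqxx.
have [p2|n2] := pselect (par s f); first by exists f; rewrite // !inE eqxx !orbT.
have [p3|n3] := pselect (par s (u - f)); first by exists (u - f); rewrite // !inE eqxx !orbT.
have := rgt0 ru.
(* A root off the three lines has 2 B(s, .) equal to Q(u) or -Q(u) at each of u, f and u - f, but
   the third value is the difference of the first two. *)
have [_ h1] := acute_pair no ru rs n1; have [_ h2] := acute_pair no rf rs n2.
have [_ h3] := acute_pair no rd rs n3.
by move: h1 h2 h3; rewrite Qd Qf !bformE; case=> h1; case=> h2; case=> h3; lra.
Qed.

(** A digit in a constructor name is the number of symmetries; [RTA] is the second type with three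
    of them. *)
Inductive root_types : Prop :=
| RT0 of covered [::]
| RT1 x of root x & covered [:: x]
| RT3 x y z of [/\ root x, root y & root z] & [/\ B x y = 0, B x z = 0 & B y z = 0] &
    covered [:: x; y; z]
| RTA e f of A2sys e f & covered [:: e; f; e - f]
| RT5 x y z of B2sys S N x y z & covered [:: x; y; x + y; x - y; z]
| RT7 e f z of G2sys S N e f z & covered [:: e; f; e - f; e + f; 2 *: e - f; 2 *: f - e; z]
| RT9 k x y z of B3sys S N k x y z &
    covered [:: x; y; z; x + y; x - y; x + z; x - z; y + z; y - z].

Theorem classification : root_types.
Proof.
have [[x rx]|no] := pselect (exists x, root x); last first.
  by apply: RT0 => s rs; case: no; exists s.
have [[y [ry nyx]]|all1] := pselect (exists y, root y /\ ~ par y x); last first.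
  apply: (RT1 rx) => s rs; exists x; first by rewrite inE.
  by apply: contrapT => h; apply: all1; exists s.
have [[u [v [ru rv uv]]]|noo] := pselect (exists u v, [/\ root u, root v & B u v = 0]); last first.
  have no u v : root u -> root v -> B u v != 0.
    by move=> ru rv; apply/eqP=> h; apply: noo; exists u, v.
  by have [e [f [sys cov]]] := A2_cover no rx ry nyx; exact: (RTA sys).
have [w [rw uw vw]] := root_orth_cross pS lN ru rv uv.
have [[s [rs n1 n2 n3]]|all3] := pselect (exists s, [/\ root s, ~ par s u, ~ par s v & ~ par s w]); last first.
  apply: (@RT3 u v w) => // s rs.
  have [p1|n1] := pselect (par s u); first by exists u; rewrite // !inE eqxx.
  have [p2|n2] := pselect (par s v); first by exists v; rewrite // !inE eqxx !orbT.
  have [p3|n3] := pselect (par s w); first by exists w; rewrite // !inE eqxx !orbT.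
  by case: all3; exists s.
have [[x' [y' [z' sys]]]|[e [f [z' sys]]]] := frame_extra pS lN ru rv rw rs uv uw vw n1 n2 n3.
  have [cov|[k [x2 [y2 [z2 sys2]]]]] := B2_cover pS lN sys; first exact: (RT5 sys).
  exact: (RT9 sys2 (B3_cover pS lN sys2)).
exact: (RT7 sys (G2_cover pS lN sys)).
Qed.

(** N is rhombohedral: the basis is an orbit under the symmetries and the roots are its differences.
    What forces this is that the direction 2 f - e, orthogonal to e, carries no root. *)
Lemma A2_basis e f : A2sys e f -> exists g0 g1 g2,
  [/\ [/\ N g0, N g1 & N g2],
   (forall n, N n -> exists a b c : int, n = a%:~R *: g0 + b%:~R *: g1 + c%:~R *: g2),
   [/\ Q g1 = Q g0, Q g2 = Q g0, B g0 g2 = B g0 g1 & B g1 g2 = B g0 g1],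
   f = g0 - g1 & e = g2 - g1].
Proof.
move=> [[re rf red] Qf ef no].
have [q0 e0] := (rgt0 re, root_neq0 re); have q0' := lt0r_neq0 q0.
have fe : 2 * B f e = Q e by rewrite (bformC pS).
have [y yE] : exists y, y = 2 *: f - e by eexists.
have ey : B e y = 0 by rewrite yE !bformE ef subrr.
have Qy : Q y = 3 * Q e by rewrite yE (qformB pS) qform_scale Qf !bformE fe; ring.
have y0 : y != 0 by rewrite -(qform_eq0 pS) Qy mulf_neq0.
have [a' a'0 [ea' ya']] := orth_ex pS e y.
have [a [pa a0 [t t0 aE]]] := ex_prim pS lN a'0.
have ea : B e a = 0 by rewrite aE bformZr ea' mulr0.
have ya : B y a = 0 by rewrite aE bformZr ya' mulr0.
have fa : B f a = 0 by move: ya; rewrite yE !bformE ea; lra.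
have frame := orth_frame pS e0 y0 a0 ey ea ya.
have axis n : N n -> B e n = 0 -> B f n = 0 -> exists j : int, n = j%:~R *: a.
  move=> Nn en fn.
  have yn : B y n = 0 by rewrite yE !bformE en fn; ring.
  have E : n = (B a n / Q a) *: a by rewrite {1}(frame n) en yn !mul0r !scale0r !add0r.
  have /intrP [j hj] : B a n / Q a \is a Num.int by apply: (prim_int gN pa); rewrite -E.
  by exists j; rewrite -hj.
have ints n : N n -> exists m1 m2 : int, 2 * B e n = m1%:~R * Q e /\ 2 * B f n = m2%:~R * Q e.
  move=> Nn; have /intrP [m1 h1] := root_int lN re Nn; have /intrP [m2 h2] := root_int lN rf Nn.
  by exists m1, m2; rewrite -h1 -h2 Qf !divfK.
have decomp n (m1 m2 u : int) : N n -> 2 * B e n = m1%:~R * Q e -> 2 * B f n = m2%:~R * Q e ->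
    m1 + m2 = 3 * u -> exists j : int, n = (m1 - u)%:~R *: e + (m2 - u)%:~R *: f + j%:~R *: a.
  move=> Nn h1 h2 hu.
  have hu' : m1%:~R + m2%:~R = 3 * u%:~R :> rat by rewrite -intrD hu intrM.
  have [] := axis (n - ((m1 - u)%:~R *: e + (m2 - u)%:~R *: f)).
  - by apply: subB => //; apply: subD => //; apply: subZ => //; [exact: root_in re|exact: root_in rf].
  - rewrite !bformE !intrD !mulrNz -/(Q e).
    have -> : B e n = m1%:~R * Q e / 2 by rewrite -h1; field.
    have -> : B e f = Q e / 2 by rewrite -ef; field.
    have -> : m2%:~R = 3 * u%:~R - m1%:~R :> rat by rewrite -hu'; ring.
    by field.
  - rewrite !bformE !intrD !mulrNz -/(Q f) Qf.
    have -> : B f n = m2%:~R * Q e / 2 by rewrite -h2; field.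
    have -> : B f e = Q e / 2 by rewrite -fe; field.
    have -> : m1%:~R = 3 * u%:~R - m2%:~R :> rat by rewrite -hu'; ring.
    by field.
  by move=> j hj; exists j; rewrite -hj addrC subrK.
(* A symmetry in the direction of y would give a root orthogonal to e. *)
have noy v : v = y \/ v = (1 / 3) *: y -> N v ->
    (forall n, N n -> 2 * B v n / Q v \is a Num.int) -> False.
  move=> vy Nv hv.
  have v0 : v != 0 by case: vy => -> //; rewrite scaler_eq0 negb_or y0.
  have [x [rx [k k0 xk]]] := root_of pS lN v0 (tau_isog pS lN Nv hv).
  have := no _ _ re rx; rewrite xk bformZr.
  by case: vy => ->; rewrite ?bformZr ey !mulr0 eqxx.
have Ny : N y.
  by rewrite yE; apply: subB => //; [rewrite -[2]/(2%:~R); apply: subZ => //; exact: root_in rf|exact: root_in re].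
(* If m1 + m2 were divisible by 3 for all vectors of N, then 2 B(y,n)/Q(y) would always be an
   integer and y would give a symmetry. *)
have [k [m1 [m2 [Nk h1 h2 h3]]]] : exists k (m1 m2 : int), [/\ N k, 2 * B e k = m1%:~R * Q e,
   2 * B f k = m2%:~R * Q e & ~ (exists u : int, m1 + m2 = 3 * u)].
  apply: contrapT => H; apply: (noy y); [by left|by []|] => n Nn.
  have [m1 [m2 [h1 h2]]] := ints n Nn.
  have [u hu] : exists u : int, m1 + m2 = 3 * u.
    by apply: contrapT => h; apply: H; exists n, m1, m2.
  apply/intrP; exists (m2 - u).
  have hu' : m1%:~R + m2%:~R = 3 * u%:~R :> rat by rewrite -intrD hu intrM.
  rewrite Qy yE !bformE intrD mulrNz.
  have -> : 2 * (2 * B f n - B e n) = 2 * (2 * B f n) - 2 * B e n by ring.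
  rewrite h1 h2; have -> : m1%:~R = 3 * u%:~R - m2%:~R :> rat by rewrite -hu'; ring.
  by field.
have [Ne Nf] := (root_in re, root_in rf).
(* Subtracting m1 f kills the product with e; a multiple of y and a sign then normalise the product
   with f. *)
have [k1 [Nk1 e1 f1]] : exists k, [/\ N k, 2 * B e k = 0 & 2 * B f k = Q e].
  pose r := m2 - 2 * m1; have [k' k'E] : exists k', k' = k - m1%:~R *: f by eexists.
  have Nk' : N k' by rewrite k'E; apply: subB => //; exact: subZ.
  have ek' : 2 * B e k' = 0.
    by rewrite k'E !bformE mulrBr h1 mulrCA ef subrr.
  have fk' : 2 * B f k' = r%:~R * Q e.
    by rewrite k'E !bformE -/(Q f) Qf mulrBr h2 /r intrD mulrNz intrM; ring.
  have [[w hr]|[w hr]] : (exists w : int, r = 3 * w + 1) \/ (exists w : int, r = 3 * w - 1).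
    have hm := divz_eq r 3; have h4 : ((r %% 3)%Z < 3) by rewrite ltz_pmod.
    have h5 : (0 <= (r %% 3)%Z) by rewrite modz_ge0.
    have h6 : (r %% 3)%Z <> 0.
      by move=> h; apply: h3; exists ((r %/ 3)%Z + m1); move: hm; rewrite h /r; lia.
    have [h|h] : (r %% 3)%Z = 1 \/ (r %% 3)%Z = 2 by lia.
      by left; exists (r %/ 3)%Z; lia.
    by right; exists ((r %/ 3)%Z + 1); lia.
  - exists (k' - w%:~R *: y); split; first by apply: subB => //; exact: subZ.
      by rewrite !bformE ey mulr0 subr0.
    rewrite !bformE mulrBr fk' hr intrD intrM yE !bformE -/(Q f) Qf.
    have -> : B f e = Q e / 2 by rewrite -fe; field.
    by field.
  - exists (w%:~R *: y - k'); split; first by apply: subB => //; exact: subZ.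
      by rewrite !bformE ey mulr0 sub0r mulrN ek' oppr0.
    rewrite !bformE mulrBr fk' hr intrD intrM yE !bformE -/(Q f) Qf.
    have -> : B f e = Q e / 2 by rewrite -fe; field.
    by field.
have [j hj] := @decomp (3%:~R *: k1) 0 3 1 (subZ gN 3 Nk1) ltac:(rewrite bformZr mulrCA e1; ring)
  ltac:(rewrite bformZr mulrCA f1; ring) erefl.
(* 3 k1 is 2 f - e + j a. Here j is prime to 3, as otherwise y/3 would lie in N and give a symmetry;
   shifting by multiples of a makes j equal to 1 or -1. *)
have [k2 [a2 [Nk2 e2 f2 [a2E kE]]]] : exists k a2, [/\ N k, 2 * B e k = 0, 2 * B f k = Q e &
   (a2 = a \/ a2 = - a) /\ 3 *: k = 2 *: f - e + a2].
  have e0j w : 2 * B e (k1 - w%:~R *: a) = 0 by rewrite !bformE ea mulr0 subr0.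
  have f0j w : 2 * B f (k1 - w%:~R *: a) = Q e by rewrite !bformE fa mulr0 subr0.
  have Nkj (w : int) : N (k1 - w%:~R *: a) by apply: subB => //; apply: subZ => //; case: pa.
  have kj (w i : int) : j = 3 * w + i -> 3 *: (k1 - w%:~R *: a) = 2 *: f - e + i%:~R *: a.
    move=> jE; have -> : 3 *: (k1 - w%:~R *: a) = 3%:~R *: k1 - (3 * w%:~R) *: a by rewrite scalerBr scalerA.
    rewrite hj jE; apply/rowP=> l; rewrite !mxE; ring.
  have hm := divz_eq j 3; have h4 : ((j %% 3)%Z < 3) by rewrite ltz_pmod.
  have h5 : (0 <= (j %% 3)%Z) by rewrite modz_ge0.
  have [h|[h|h]] : (j %% 3)%Z = 0 \/ (j %% 3)%Z = 1 \/ (j %% 3)%Z = 2 by lia.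
  - exfalso; pose v := k1 - (j %/ 3)%Z%:~R *: a.
    have vE : v = (1 / 3) *: y.
      apply: (scalerI (_ : 3 != 0 :> rat)) => //; rewrite (kj _ 0); last by lia.
      by rewrite yE scale0r addr0 scalerA (_ : 3 * (1 / 3) = 1) ?scale1r.
    apply: (noy v); [by right|exact: Nkj|] => n Nn.
    have [n1 [n2 [h7 h8]]] := ints n Nn; apply/intrP; exists (2 * n2 - n1).
    rewrite vE qform_scale Qy yE !bformE intrD mulrNz intrM.
    have -> : B f n = n2%:~R * Q e / 2 by rewrite -h8; field.
    have -> : B e n = n1%:~R * Q e / 2 by rewrite -h7; field.
    by field.
  - exists (k1 - (j %/ 3)%Z%:~R *: a), a; split=> //; split; first by left.
    by rewrite (kj _ 1) ?scale1r//; lia.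
  - exists (k1 - ((j %/ 3)%Z + 1)%:~R *: a), (- a); split=> //; split; first by right.
    by rewrite (kj _ (-1)) ?scaleN1r//; lia.
(* k2, its mirror image in f, and the mirror image of that one in e. *)
exists k2, (k2 - f), (k2 - f + e).
have [ke kf] : B k2 e = 0 /\ B k2 f = Q e / 2.
  by rewrite !(bformC pS k2); split; [move: e2; lra|rewrite -f2; field].
have [ek fk] : B e k2 = 0 /\ B f k2 = Q e / 2 by rewrite (bformC pS e) (bformC pS f).
have efE : B e f = Q e / 2 by rewrite -ef; field.
have feE : B f e = Q e / 2 by rewrite -fe; field.
split.
- by split=> //; [apply: subB|apply: subD => //; apply: subB].
- move=> n Nn; have [n1 [n2 [h7 h8]]] := ints n Nn.
  have hm := divz_eq (n1 + n2) 3.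
  have Nn' : N (n - ((n1 + n2) %% 3)%Z%:~R *: k2) by apply: subB => //; exact: subZ.
  have [|||i hi] := @decomp _ n1 (n2 - ((n1 + n2) %% 3)%Z) ((n1 + n2) %/ 3)%Z Nn'.
  + by rewrite !bformE ek mulr0 subr0.
  + by rewrite !bformE fk intrD mulrNz mulrBr h8; field.
  + by lia.
  have {}hi : n = (n1 - ((n1 + n2) %/ 3)%Z)%:~R *: e + (n2 - ((n1 + n2) %% 3)%Z - ((n1 + n2) %/ 3)%Z)%:~R *: f
    + ((n1 + n2) %% 3)%Z%:~R *: k2 + i%:~R *: a.
    by rewrite addrAC -hi subrK.
  have [i' hi'] : exists i' : int, i%:~R *: a = i'%:~R *: a2.
    by case: a2E => ->; [exists i|exists (- i); rewrite mulrNz scaleNr scalerN opprK].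
  rewrite hi hi'.
  set A1 := n1 - _; set A3 := ((n1 + n2) %% 3)%Z; set A2 := n2 - A3 - _.
  clearbody A2; clearbody A1 A3.
  exists (A2 + A3 + i'), (- A1 - A2 + i'), (A1 + i').
  have -> : a2 = 3 *: k2 - (2 *: f - e) by rewrite kE addrC addKr.
  by apply/rowP=> l; rewrite !mxE; ring.
- by rewrite /qform !bformE ke kf ek fk efE feE -/(Q f) -/(Q e) Qf; split; field.
- by rewrite opprB addrC subrK.
- by rewrite (addrC _ e) addrK.
Qed.

End Classification3.

(** * Congruences and localization *)

Section Congruences.
Variable m : int.
Implicit Types a b c d : int.

Definition cg a b := (m %| a - b)%Z.

Lemma cg_refl a : cg a a. Proof. by rewrite /cg subrr dvdz0. Qed.
Lemma cg_sym a b : cg a b -> cg b a. Proof. by rewrite /cg -opprB rpredN. Qed.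
Lemma cg_trans b a c : cg a b -> cg b c -> cg a c.
Proof.
rewrite /cg => h1 h2; have -> : a - c = (a - b) + (b - c) by ring.
exact: rpredD.
Qed.
Lemma cgD a b c d : cg a b -> cg c d -> cg (a + c) (b + d).
Proof.
rewrite /cg => h1 h2; have -> : a + c - (b + d) = (a - b) + (c - d) by ring.
exact: rpredD.
Qed.
Lemma cgM a b c d : cg a b -> cg c d -> cg (a * c) (b * d).
Proof.
rewrite /cg => h1 h2; have -> : a * c - b * d = (a - b) * c + b * (c - d) by ring.
by apply: rpredD; [exact: dvdz_mulr|exact: dvdz_mull].
Qed.
Lemma cg_mod a : cg (a %% m)%Z a.
Proof. by apply: cg_sym; rewrite /cg {1}(divz_eq a m) addrK dvdz_mull. Qed.

Lemma cg_mx k l n (A A' : 'M[int]_(k, l)) (C C' : 'M[int]_(l, n)) :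
  (forall i j, cg (A i j) (A' i j)) -> (forall i j, cg (C i j) (C' i j)) ->
  forall i j, cg ((A *m C) i j) ((A' *m C') i j).
Proof.
move=> hA hC i j; rewrite !mxE; elim/big_ind2: _ => //; first exact: cg_refl.
  by move=> *; exact: cgD.
by move=> *; exact: cgM.
Qed.

Lemma cg_det n (A A' : 'M[int]_n) : (forall i j, cg (A i j) (A' i j)) -> cg (\det A) (\det A').
Proof.
move=> hA; rewrite /determinant; elim/big_ind2: _ => //; first exact: cg_refl.
  by move=> *; exact: cgD.
move=> s _; apply: cgM; first exact: cg_refl.
elim/big_ind2: _ => //; first exact: cg_refl.
by move=> *; exact: cgM.
Qed.
End Congruences.

Lemma cg_dvd (m m' a b : int) : (m %| m')%Z -> cg m' a b -> cg m a b.
Proof. exact: dvdz_trans. Qed.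

Lemma cg_coprime (m a b : int) : cg m a b -> coprimez a m -> coprimez b m.
Proof.
move=> /dvdzP[k h] /coprimezP[[u v] /= H]; apply/coprimezP; exists (u, v + u * k) => /=.
have -> : b = a - k * m by rewrite -h; ring.
by rewrite -H; ring.
Qed.

(** Membership of a rational number in dZ: values of the form are rational, and integrality and
    divisibility are wanted together. *)
Definition dvr (d : int) (r : rat) := exists m : int, r = (d * m)%:~R.

Section Dvr.
Variable d : int.
Implicit Types r s : rat.
Lemma dvr0 : dvr d 0. Proof. by exists 0; rewrite mulr0. Qed.
Lemma dvrD r s : dvr d r -> dvr d s -> dvr d (r + s).
Proof. by move=> [m ->] [n ->]; exists (m + n); rewrite mulrDr intrD. Qed.
Lemma dvrN r : dvr d r -> dvr d (- r).
Proof. by move=> [m ->]; exists (- m); rewrite mulrN mulrNz. Qed.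
Lemma dvrB r s : dvr d r -> dvr d s -> dvr d (r - s).
Proof. by move=> h1 h2; apply: dvrD => //; exact: dvrN. Qed.
Lemma dvrM r s : r \is a Num.int -> dvr d s -> dvr d (r * s).
Proof. by move=> /intrP[n ->] [m ->]; exists (n * m); rewrite -intrM mulrCA. Qed.
Lemma dvrZ (n : int) s : dvr d s -> dvr d (n%:~R * s).
Proof. by apply: dvrM; rewrite intr_int. Qed.
Lemma dvr_int r : dvr d r -> r \is a Num.int.
Proof. by move=> [m ->]; rewrite intr_int. Qed.
Lemma dvrE (m : int) : dvr d m%:~R <-> (d %| m)%Z.
Proof.
split=> [[k /intr_inj ->]|/dvdzP[k ->]]; first exact: dvdz_mulr.
by exists k; rewrite mulrC.
Qed.
Lemma dvr_gauss (n : int) r : coprimez n d -> r \is a Num.int -> dvr d (n%:~R * r) -> dvr d r.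
Proof.
move=> co /intrP[k ->]; rewrite -intrM !dvrE Gauss_dvdzr//.
by rewrite coprimez_sym.
Qed.
Lemma dvr_mul (c : int) r : dvr d r -> dvr (c * d) (c%:~R * r).
Proof. by move=> [m ->]; exists m; rewrite -intrM mulrA. Qed.
Lemma dvr_cancel (c : int) r : c != 0 -> dvr (c * d) (c%:~R * r) -> dvr d r.
Proof.
move=> c0 [m h]; exists m; apply: (mulfI (_ : c%:~R != 0)); first by rewrite intr_eq0.
by rewrite h -intrM mulrA.
Qed.
End Dvr.

Lemma dvr_trans (d d' : int) r : (d %| d')%Z -> dvr d' r -> dvr d r.
Proof. by move=> /dvdzP[k ->] [m ->]; exists (k * m); congr _%:~R; ring. Qed.

Lemma int_coprime2 (a b : int) (r : rat) : coprimez a b ->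
  a%:~R * r \is a Num.int -> b%:~R * r \is a Num.int -> r \is a Num.int.
Proof.
move=> /coprimezP[[u v] /= H] ha hb.
have -> : r = u%:~R * (a%:~R * r) + v%:~R * (b%:~R * r).
  by rewrite !mulrA -!intrM -mulrDl -intrD H mul1r.
by apply: rpredD; apply: rpredM => //; exact: intr_int.
Qed.

(** * Bases of lattices and subgroups of finite index *)

Section Bases.
Variable n : nat.
Implicit Types (L M : set 'rV[rat]_n) (A : 'M[rat]_n).

Lemma gramE (S : 'M[rat]_n) A i j : gram S A i j = bform S (row i A) (row j A).
Proof.
rewrite /gram /bform -row_mul tr_row [LHS]mxE [RHS]mxE; apply: eq_bigr => k _.
by rewrite [row _ _ _ _]mxE [col _ _ _ _]mxE.
Qed.

Lemma basis_row L A i : lattice_basis L A -> L (row i A).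
Proof.
move=> [_ ->]; exists (delta_mx 0 i) => //.
by rewrite rowE; congr (_ *m _); apply/matrixP=> j k; rewrite !mxE; case: (_ && _).
Qed.

Lemma basis_sub L A : lattice_basis L A -> subgroup L.
Proof.
move=> [_ ->]; split; first by exists 0 => //; rewrite map_mx0 mul0mx.
move=> _ _ [z _ <-] [z' _ <-]; exists (z - z') => //.
by rewrite map_mxB mulmxBl.
Qed.

Lemma basis_rows L A m (X : 'M[rat]_(m, n)) : lattice_basis L A -> (forall i, L (row i X)) ->
  exists P : 'M[int]_(m, n), X = map_mx intr P *m A.
Proof.
move=> [_ LE] H.
have /choice [f hf] : forall i, exists z : 'rV[int]_n, map_mx intr z *m A = row i X.
  by move=> i; have := H i; rewrite LE => -[z _ E]; exists z.
exists (\matrix_i f i); apply/row_matrixP=> i; rewrite row_mul -hf; congr (_ *m _).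
by apply/rowP=> j; rewrite !mxE.
Qed.

(** M is generated by m times the basis of L together with the reduced vectors mod m that lie in M.
    A Smith normal form of this tall generating matrix leaves n generators, and they are independent
    because M contains m L. *)
Lemma lattice_between L M A (m : nat) : (0 < m)%N -> lattice_basis L A -> subgroup M ->
  (forall x, M x -> L x) -> (forall x, L x -> M (m%:R *: x)) -> is_lattice M.
Proof.
move=> m0 bA gM ML LM; have [uA LE] := bA.
pose H (z : 'rV[int]_n) := M (map_mx intr z *m A).
pose T := {ffun 'I_n -> 'I_m}.
pose red (t : T) : 'rV[int]_n := \row_i (t i : nat)%:Z.
(* All reduced coordinate vectors, with 0 in place of those outside M, so that the number of rows is
   known in advance. *)
pose X1 : 'M[int]_(#|T|, n) := \matrix_i (if pselect (H (red (enum_val i))) then red (enum_val i) else 0).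
pose X : 'M[int]_(#|T| + n, n) := col_mx X1 (m%:Z)%:M.
have H0 : H 0 by rewrite /H /= map_mx0 mul0mx; case: gM.
have HB z z' : H z -> H z' -> H (z - z').
  by rewrite /H /= map_mxB mulmxBl; case: gM => _; apply.
have HD z z' : H z -> H z' -> H (z + z').
  by move=> h1 h2; rewrite -[z']opprK; apply: (HB) => //; rewrite -sub0r; exact: HB.
have HZ (c : int) z : H z -> H (c *: z).
  move=> h; rewrite /H /= (_ : map_mx intr (c *: z) = c%:~R *: map_mx intr z).
    by rewrite -scalemxAl; exact: subZ.
  by apply/rowP=> j; rewrite !mxE intrM.
have Hm z : H (m%:Z *: z).
  rewrite /H /= (_ : map_mx intr (m%:Z *: z) = m%:R *: map_mx intr z).
    by rewrite -scalemxAl; apply: LM; rewrite LE; exists z.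
  by apply/rowP=> j; rewrite !mxE intrM.
have HX w : H (w *m X).
  rewrite mulmx_sum_row; apply: (big_ind H); [exact: H0|exact: HD|] => i _.
  apply: HZ; case: (splitP i) => j ij.
    have -> : i = lshift n j by exact: val_inj.
    rewrite rowKu /X1 rowK; case: pselect => //.
  have -> : i = rshift #|T| j by exact: val_inj.
  rewrite rowKd rowE mul_mx_scalar; exact: Hm.
have XH z : H z -> exists w, z = w *m X.
  move=> Hz; pose t : T := [ffun i => Ordinal (ltn_pmod (absz (modz (z 0 i) m)) m0)].
  pose q : 'rV[int]_n := \row_i (divz (z 0 i) m).
  have E : z = red t + m%:Z *: q.
    apply/rowP=> j; rewrite !mxE ffunE /= addrC mulrC {1}(divz_eq (z 0 j) m); congr (_ + _).
    have h1 : 0 <= (modz (z 0 j) m) by rewrite modz_ge0// eqz_nat -lt0n.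
    have h2 : (modz (z 0 j) m) < m by rewrite ltz_pmod// ltz_nat.
    case: (modz (z 0 j) m) h1 h2 => // k _; rewrite ltz_nat /= => km.
    by rewrite modn_small.
  have Ht : H (red t).
    have -> : red t = z - m%:Z *: q by rewrite {1}E addrK.
    exact: HB.
  exists (row_mx (delta_mx 0 (enum_rank t)) q).
  rewrite mul_row_col -rowE rowK enum_rankK; case: pselect => [h|nh] /=; last by case: nh.
  by rewrite mul_mx_scalar.
have [P uP [R uR [d _ XE]]] := int_Smith_normal_form X.
pose D := \matrix_(i < #|T| + n, j < n) (d`_i *+ (i == j :> nat)) : 'M[int]_(_, _).
pose Bz : 'M[int]_n := diag_mx (\row_j d`_j) *m R.
have wide (j : 'I_n) : (j < #|T| + n)%N by rewrite ltn_addl.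
have E1 (v : 'rV[int]_n) j : (v *m diag_mx (\row_j d`_j)) 0 j = v 0 j * d`_j.
  by rewrite mul_mx_diag !mxE.
have E2 (w : 'rV[int]_(#|T| + n)) j : (w *m D) 0 j = w 0 (Ordinal (wide j)) * d`_j.
  rewrite mxE (bigD1 (Ordinal (wide j))) //= big1 ?addr0 ?mxE ?eqxx ?mulr1n//.
  move=> i ij; rewrite mxE; case: eqP => [e|_]; last by rewrite mulr0n mulr0.
  by case/negP: ij; apply/eqP/val_inj.
have DB w : exists v : 'rV[int]_n, w *m D *m R = v *m Bz.
  exists (\row_j w 0 (Ordinal (wide j))); rewrite mulmxA; congr (_ *m R).
  by apply/rowP=> j; rewrite E1 E2 mxE.
have BD (v : 'rV[int]_n) : exists w, v *m Bz = w *m D *m R.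
  exists (\row_(i < #|T| + n) (if insub (i : nat) is Some j then v 0 (j : 'I_n) else 0)).
  rewrite mulmxA; congr (_ *m R); apply/rowP=> j; rewrite E1 E2 mxE /= insubT//= => jn.
  by congr (v 0 _ * _); exact: val_inj.
have HE z : H z <-> exists v, z = v *m Bz.
  split=> [/XH [w ->]|[v ->]].
    by rewrite XE !mulmxA; have [v hv] := DB (w *m P); exists v.
  have [w ->] := BD v; have -> : w *m D *m R = (w *m invmx P) *m X; last exact: HX.
  by rewrite XE !mulmxA mulmxKV.
(* m times every unit vector is a combination of the rows of [Bz], so its determinant is nonzero. *)
have uB : map_mx intr Bz \in @unitmx rat n.
  have /choice [f hf] : forall i : 'I_n, exists v : 'rV[int]_n, m%:Z *: delta_mx 0 i = v *m Bz.
    by move=> i; apply/HE.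
  have E : (\matrix_i f i) *m Bz = (m%:Z)%:M.
    apply/row_matrixP=> i; rewrite row_mul rowK -hf rowE mul_mx_scalar //.
  have := congr1 (fun Y => map_mx intr Y : 'M[rat]_n) E; rewrite map_mxM map_scalar_mx /= => E'.
  rewrite unitmxE unitfE; apply/negP=> /eqP d0; have := congr1 determinant E'.
  rewrite det_mulmx d0 mulr0 det_scalar => /esym/eqP; rewrite expf_eq0 pnatr_eq0.
  by rewrite (gtn_eqF m0) andbF.
exists (map_mx intr Bz *m A); split; first by rewrite unitmx_mul uB.
apply/seteqP; split=> [x Mx|_ [z _ <-]].
  have := ML x Mx; rewrite LE => -[z _ zx]; have /HE [v hv] : H z by rewrite /H /= zx.
  by exists v => //; rewrite mulmxA -map_mxM -hv.
by rewrite mulmxA -map_mxM; apply/HE; exists z.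
Qed.

End Bases.

(** * Between p-adic matrices and integer matrices *)

Section Padic.
Variable p : nat.
Hypothesis pp : prime p.
Notation pz k := (p ^ k)%N%:Z.

Lemma res_intr (m : int) k : res (m%:~R : padicInt p) k = (m %% pz k)%Z.
Proof.
have -> : m%:~R = padic_const p m; last by [].
have cD a b : padic_const p (a + b) = padic_const p a + padic_const p b.
  by apply: padicInt_eq => i /=; rewrite modzDm.
have cN a : padic_const p (- a) = - padic_const p a.
  by apply: padicInt_eq => i /=; rewrite modzNm.
have cn (a : nat) : a%:R = padic_const p a :> padicInt p.
  elim: a => [|a IH]; first by rewrite mulr0n.
  by rewrite mulrS IH -[1]/(padic_const p 1) -cD.
case: m => a; first by rewrite -pmulrn cn.
by rewrite NegzE mulrNz cN -pmulrn cn.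
Qed.

Lemma coprime_pk (d : int) k : coprimez d p -> coprimez d (pz k).
Proof. by rewrite !coprimezE /= => h; rewrite coprimeXr. Qed.

(** The inverses of d mod p^k come from Bezout coefficients; reduced mod p^k they are unique, hence
    coherent. *)
Lemma padic_unit (d : int) : coprimez d p -> exists y : padicInt p, d%:~R * y = 1.
Proof.
move=> co; pose i k := ((egcdz d (pz k)).1 %% pz k)%Z.
have hi k : cg (pz k) (d * i k) 1.
  apply: (@cg_trans _ (d * (egcdz d (pz k)).1)).
    by apply: cgM; [exact: cg_refl|exact: cg_mod].
  case: egcdzP => u v /= uv _; rewrite /cg -(_ : gcdz d (pz k) = 1); last first.
    by apply/eqP; exact: coprime_pk.
  rewrite -uv mulrC opprD addrA subrr sub0r rpredN; exact: dvdz_mull.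
have coh k : i k = (i k.+1 %% pz k)%Z.
  have h : cg (pz k) (i k) (i k.+1).
    rewrite /cg -(Gauss_dvdzr (n := d)); last by rewrite coprimez_sym; exact: coprime_pk.
    rewrite mulrBr; apply: (@cg_trans _ 1); first exact: hi.
    by apply: cg_sym; apply: cg_dvd (hi k.+1); rewrite dvdzE /= dvdn_exp2l.
  transitivity (i k %% pz k)%Z; first by rewrite /i modz_mod.
  by apply/eqP; rewrite eqz_mod_dvd; exact: h.
exists (PadicInt coh); apply: padicInt_eq => k /=; rewrite res_intr.
by apply/eqP; rewrite modzMml eqz_mod_dvd; exact: hi.
Qed.

Lemma padic_iso_sym n (G H : 'M[padicInt p]_n) : padic_isometric G H -> padic_isometric H G.
Proof.
move=> [T [T' [h1 h2 h3]]]; exists T', T; split=> //.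
by rewrite -h3 !mulmxA h2 mul1mx -mulmxA -trmx_mul h2 trmx1 mulmx1.
Qed.
Lemma padic_iso_trans n (G H K : 'M[padicInt p]_n) :
  padic_isometric G H -> padic_isometric H K -> padic_isometric G K.
Proof.
move=> [T [T' [h1 h2 h3]]] [U [U' [k1 k2 k3]]]; exists (U *m T), (T' *m U'); split.
- by rewrite mulmxA -(mulmxA U) h1 mulmx1.
- by rewrite mulmxA -(mulmxA T') k2 mulmx1.
- by rewrite trmx_mul -k3 -h3 !mulmxA.
Qed.

Variables (S : 'M[rat]_3).

(** The integer matrices P1 of dT and P2 of d T^(-1) have product d^2, and d is a p-adic unit, so
    P2/d is invertible over Z_p and transports one Gram matrix to the other. *)
Lemma padic_of_local (L M : set 'rV[rat]_3) A A' (G0 H0 : 'M[int]_3) T (d : int) :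
  lattice_basis L A -> lattice_basis M A' -> gram S A = map_mx intr G0 ->
  gram S A' = map_mx intr H0 -> isometry S T -> T \in unitmx -> coprimez d p ->
  (forall x, L x -> M (d%:~R *: (x *m T))) ->
  (forall x, M x -> L (d%:~R *: (x *m invmx T))) ->
  padic_isometric (map_mx intr G0 : 'M[padicInt p]_3) (map_mx intr H0).
Proof.
move=> bA bA' gA gA' iT uT co LM ML.
have [P1 h1] : exists P : 'M[int]_3, d%:~R *: (A *m T) = map_mx intr P *m A'.
  apply: (basis_rows bA') => i; rewrite rowE -scalemxAr mulmxA -rowE.
  by apply: LM; exact: (basis_row _ bA).
have [P2 h2] : exists P : 'M[int]_3, d%:~R *: (A' *m invmx T) = map_mx intr P *m A.
  apply: (basis_rows bA) => i; rewrite rowE -scalemxAr mulmxA -rowE.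
  by apply: ML; exact: (basis_row _ bA').
have [[uA _] [uA' _]] := (bA, bA').
have inj n : injective (fun X : 'M[int]_n => map_mx intr X : 'M[rat]_n).
  by move=> X Y /matrixP h; apply/matrixP=> i j; have := h i j; rewrite !mxE => /intr_inj.
have e12 : P1 *m P2 = (d * d)%:M.
  apply: inj; rewrite map_mxM map_scalar_mx /=; apply: (can_inj (mulmxK uA)).
  by rewrite -mulmxA -h2 -scalemxAr mulmxA -h1 -scalemxAl mulmxK// scalerA -intrM mul_scalar_mx.
have e21 : P2 *m P1 = (d * d)%:M.
  apply: inj; rewrite map_mxM map_scalar_mx /=; apply: (can_inj (mulmxK uA')).
  by rewrite -mulmxA -h1 -scalemxAr mulmxA -h2 -scalemxAl mulmxKV// scalerA -intrM mul_scalar_mx.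
have e3 : P2 *m G0 *m P2^T = (d * d) *: H0.
  apply: inj; rewrite !map_mxM -map_trmx -gA /gram.
  have -> : map_mx intr ((d * d) *: H0) = (d%:~R * d%:~R) *: gram S A' :> 'M[rat]_3.
    by rewrite gA'; apply/matrixP=> i j; rewrite !mxE !intrM.
  rewrite !mulmxA -h2 -!mulmxA -trmx_mul -h2 linearZ /= -!scalemxAl -!scalemxAr scalerA /gram.
  congr (_ *: _); rewrite trmx_mul !mulmxA; congr (_ *m _); rewrite -!mulmxA; congr (_ *m _).
  have E : T *m S *m T^T = S := iT.
  by rewrite -{1}E !mulmxA mulVmx// mul1mx -mulmxA -trmx_mul mulVmx// trmx1 mulmx1.
have [y hy] := padic_unit co.
have yy : y * y * (d%:~R * d%:~R) = 1 by rewrite mulrACA !(mulrC y) hy mulr1.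
pose m2 (X : 'M[int]_3) : 'M[padicInt p]_3 := map_mx intr X.
have m2M X Y : m2 (X *m Y) = m2 X *m m2 Y by rewrite /m2 map_mxM.
have m2S (c : int) : m2 c%:M = (c%:~R)%:M by rewrite /m2 map_scalar_mx.
exists (y *: m2 P2), (y *: m2 P1); split.
- by rewrite -scalemxAl -scalemxAr scalerA -m2M e21 m2S intrM scale_scalar_mx yy.
- by rewrite -scalemxAl -scalemxAr scalerA -m2M e12 m2S intrM scale_scalar_mx yy.
- rewrite linearZ /= -!scalemxAl -!scalemxAr scalerA -/(m2 G0) -/(m2 H0).
  have -> : (m2 P2)^T = m2 P2^T by rewrite /m2 map_trmx.
  rewrite -!m2M e3 (_ : m2 ((d * d) *: H0) = (d%:~R * d%:~R) *: m2 H0).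
    by rewrite scalerA yy scale1r.
  by apply/matrixP=> i j; rewrite !mxE !intrM.
Qed.

Definition approx K (x : padicInt p) (m : int) := cg (pz K) (res x K) m.

Lemma approx_mx K k l n (A : 'M[padicInt p]_(k, l)) (A0 : 'M[int]_(k, l))
    (C : 'M[padicInt p]_(l, n)) (C0 : 'M[int]_(l, n)) :
  (forall i j, approx K (A i j) (A0 i j)) -> (forall i j, approx K (C i j) (C0 i j)) ->
  forall i j, approx K ((A *m C) i j) ((A0 *m C0) i j).
Proof.
move=> hA hC i j; rewrite !mxE; elim/big_ind2: _.
- by rewrite /approx -[0]/(padic_const p 0) /=; exact: cg_mod.
- move=> x a y b h1 h2; rewrite /approx /=.
  by apply: (cg_trans (cg_mod _ _)); exact: cgD.
- move=> t _; rewrite /approx /=; apply: (cg_trans (cg_mod _ _)).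
  by apply: cgM; [exact: hA|exact: hC].
Qed.

(** The p-adic change of basis is truncated mod p^K. The integer matrix [T0] obtained has
    determinant prime to p, and its adjugate expresses det(T0) x in the new vectors. From here on,
    p-adic matrices can be forgotten. *)
Lemma approx_basis K (M : set 'rV[rat]_3) A (H0 : 'M[int]_3) (D : 'I_3 -> nat) : (0 < K)%N ->
  lattice_basis M A -> gram S A = map_mx intr H0 ->
  padic_isometric (map_mx intr H0 : 'M[padicInt p]_3) (diag_mx (\row_i (D i)%:R)) ->
  exists W : 'M[rat]_3, exists T0 : 'M[int]_3,
  [/\ W = map_mx intr T0 *m A, coprimez (\det T0) p,
    (forall i, M (row i W)),
    (forall i j, cg (pz K) ((T0 *m H0 *m T0^T) i j) ((D i)%:Z *+ (i == j))) &
    (forall i j, exists2 m : int, bform S (row i W) (row j W) = m%:~R &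
       cg (pz K) m ((D i)%:Z *+ (i == j)))] /\
    (forall x, M x -> exists2 d : int, coprimez d p &
       exists z : 'rV[int]_3, d%:~R *: x = map_mx intr z *m W).
Proof.
move=> K0 bA gA [T [T' [h1 h2 h3]]].
pose tr (X : 'M[padicInt p]_3) : 'M[int]_3 := \matrix_(i, j) res (X i j) K.
have atr (X : 'M[padicInt p]_3) i j : approx K (X i j) (tr X i j) by rewrite /approx mxE; exact: cg_refl.
have aint (m : int) : approx K m%:~R m by rewrite /approx res_intr; exact: cg_mod.
pose T0 := tr T; exists (map_mx intr T0 *m A), T0.
have T0row i : M (row i (map_mx intr T0 *m A)).
  by rewrite row_mul; case: (bA) => _ ->; exists (row i T0) => //; rewrite map_row.
have codet : coprimez (\det T0) p.
  have c1 : cg (pz K) (\det (T0 *m tr T')) (\det (1%:M : 'M[int]_3)).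
    apply: cg_det => i j; have := approx_mx (atr T) (atr T') i j; rewrite h1 => /cg_sym h.
    apply: (cg_trans h); rewrite !mxE; have := aint (i == j)%:Z.
    by case: (i == j); rewrite /= ?mulr1n ?mulr0n.
  have c2 : cg p (\det T0 * \det (tr T')) 1.
    rewrite -det_mulmx -(det1 int 3); apply: cg_dvd c1; rewrite dvdzE /=.
    by rewrite -{1}(expn1 p) dvdn_exp2l.
  have : coprimez (\det T0 * \det (tr T')) p.
    by apply: cg_coprime (cg_sym c2) _; rewrite coprimezE /= coprime1n.
  by rewrite coprimezMl => /andP[].
have grm i j : cg (pz K) ((T0 *m H0 *m T0^T) i j) ((D i)%:Z *+ (i == j)).
  have a0 : forall k l, approx K ((map_mx intr H0 : 'M[padicInt p]_3) k l) (H0 k l).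
    by move=> k l; rewrite mxE; exact: aint.
  have a1 := approx_mx (atr T) a0.
  have a2 : forall i j, approx K (T^T i j) (T0^T i j) by move=> k l; rewrite mxE [X in approx _ _ X]mxE; exact: atr.
  have := approx_mx a1 a2 i j; rewrite h3 => /cg_sym h; apply: (cg_trans h).
  rewrite !mxE; have := aint ((D i)%:Z *+ (i == j)).
  by case: (i == j); rewrite /= ?mulr1n ?mulr0n.
split; last first.
  move=> x; case: (bA) => uA -> [z _ <-]; exists (\det T0) => //.
  exists (z *m \adj T0); rewrite mulmxA -map_mxM -mulmxA mul_adj_mx.
  by rewrite mul_mx_scalar map_mxZ -scalemxAl.
split=> // i j; exists ((T0 *m H0 *m T0^T) i j); last exact: grm.
have -> : bform S (row i (map_mx intr T0 *m A)) (row j (map_mx intr T0 *m A)) =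
  (map_mx intr T0 *m gram S A *m (map_mx intr T0)^T) i j.
  by rewrite -gramE /gram trmx_mul !mulmxA.
by rewrite gA map_trmx -!map_mxM mxE.
Qed.

End Padic.

(** * The lattices with a given Lambda *)

Lemma ord3P (i : 'I_3) : [\/ i = 0, i = 1 | i = 2].
Proof.
by case: i => [[|[|[|//]]] hi]; [apply: Or31|apply: Or32|apply: Or33]; exact: val_inj.
Qed.

Section Gamma.
Variables (S : 'M[rat]_3) (p : nat).
Hypotheses (pS : posdef_space S) (pp : prime p) (op : odd p).
Local Notation B := (bform S).
Local Notation Q := (qform S).
Implicit Types (L M N : set 'rV[rat]_3) (x y u h : 'rV[rat]_3).
Notation pz k := (p ^ k)%N%:Z.

Let p0 : (0 < p)%N := prime_gt0 pp.
Let pR0 : p%:R != 0 :> rat. Proof. by rewrite pnatr_eq0 -lt0n. Qed.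
Let pZ0 k : pz k != 0. Proof. by rewrite eqz_nat expn_eq0 negb_and -lt0n p0. Qed.

Lemma coprimez_p (a : int) : coprimez a p = ~~ (p %| a)%Z.
Proof. by rewrite coprimezE dvdzE /= coprime_sym prime_coprime. Qed.

Lemma coprime2p : coprimez 2 p.
Proof. by rewrite coprimezE /= coprime2n. Qed.

Definition integral M := forall x y, M x -> M y -> B x y \is a Num.int.

(** Comparing the defining congruence at y and at 0 gives p | 2 B(x,y), and p is odd: Lambda_p(M)
    consists of the vectors of M in p times its dual. *)
Lemma LambdaP M x : subgroup M -> integral M ->
  Lambda S p M x <-> M x /\ forall y, M y -> dvr p (B x y).
Proof.
move=> gM iM; split=> [[Mx H]|[Mx H]]; split=> // y My.
  have [m hm] := H y My; have [k hk] := H 0 (sub0 gM).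
  apply: (dvr_gauss coprime2p); first exact: iM.
  have -> : 2%:~R * B x y = (Q (x + y) - Q y) - (Q (x + 0) - Q 0).
    by rewrite !(qformD pS) /qform !bformE; ring.
  by rewrite hm hk; apply: dvrB; eexists.
have -> : Q (x + y) - Q y = B x x + 2%:~R * B x y by rewrite (qformD pS) /qform; ring.
have [m ->] : dvr p (B x x + 2%:~R * B x y) by apply: dvrD; [exact: H|apply: dvrZ; exact: H].
by exists m.
Qed.

(** [r1] tells that the unimodular component has rank 1. *)
Definition Mset (r1 : bool) e N u : set 'rV[rat]_3 := fun x =>
  if r1 then exists2 n, N n & exists c : int, x = n + (c%:~R / p%:R) *: u
  else N (p%:R *: x) /\ dvr (pz e) (B x u).

Definition okv e (cc : int) N u :=
  [/\ N u, (forall n, N n -> dvr (pz e) (B u n)) &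
   exists2 s : int, coprimez s p & dvr (pz e.+1) (Q u - (cc * s ^+ 2 * pz e)%:~R)].

Section OnN.
Variables (N : set 'rV[rat]_3) (r1 : bool) (e : nat).
Hypotheses (gN : subgroup N) (e0 : (0 < e)%N).
Local Notation Ms := (Mset r1 e N).

Lemma Mset_pN u x : N u -> Ms u x -> N (p%:R *: x).
Proof.
move=> Nu; rewrite /Mset; case: r1 => [[n Nn [c ->]]|[]//].
rewrite scalerDr scalerA mulrCA divff// mulr1; apply: subD => //.
  by rewrite -[p%:R]/(p%:~R); exact: subZ.
exact: subZ.
Qed.

Lemma Mset_N u n : (forall n, N n -> dvr (pz e) (B u n)) -> N n -> Ms u n.
Proof.
move=> Hu Nn; rewrite /Mset; case: r1.
  by exists n => //; exists 0; rewrite mul0r scale0r addr0.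
split; first by rewrite -[p%:R]/(p%:~R); exact: subZ.
by rewrite (bformC pS); exact: Hu.
Qed.

Lemma Mset_sub u : subgroup (Ms u).
Proof.
rewrite /Mset; case: r1; split.
- by exists 0; [exact: sub0|exists 0; rewrite mul0r scale0r addr0].
- move=> x y [n Nn [c ->]] [n' Nn' [c' ->]]; exists (n - n'); first exact: subB.
  by exists (c - c'); rewrite intrD mulrNz; apply/rowP=> j; rewrite !mxE; ring.
- by rewrite scaler0 bform0l; split; [exact: sub0|exact: dvr0].
- move=> x y [h1 h2] [h3 h4]; rewrite scalerBr !bformE; split; first exact: subB.
  exact: dvrB.
Qed.

(** This freedom lets two vectors whose norms have the same square class be rescaled to congruent
    norms. *)
Lemma Mset_scale u (s : int) : N u -> (forall n, N n -> dvr (pz e) (B u n)) -> coprimez s p ->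
  Ms (s%:~R *: u) = Ms u.
Proof.
move=> Nu Hu co; apply/seteqP; rewrite /Mset; case: r1; split=> x.
- by move=> [n Nn [c ->]]; exists n => //; exists (c * s); rewrite scalerA intrM; congr (_ + _ *: _); ring.
- move=> [n Nn [c ->]]; have /coprimezP[[a b] /= ab] := co.
  exists (n + (c * b)%:~R *: u); first by apply: subD => //; exact: subZ.
  exists (c * a); rewrite scalerA -addrA -scalerDl; congr (_ + _ *: _).
  have ab' : a%:~R * s%:~R + b%:~R * p%:R = 1 :> rat by rewrite -[p%:R]/(p%:~R) -!intrM -intrD ab.
  transitivity (c%:~R / p%:R * (a%:~R * s%:~R + b%:~R * p%:R) : rat); first by rewrite ab' mulr1.
  by rewrite !intrM; field.
- move=> [h1 h2]; split=> //; move: h2; rewrite bformZr => h2.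
  apply: (dvr_gauss (coprime_pk e co)) h2.
  have h3 : dvr (p%:Z * pz e.-1) (p%:Z%:~R * B x u).
    rewrite -PoszM -expnS prednK// -bformZl (bformC pS); exact: Hu.
  by apply: dvr_int (dvr_cancel _ h3); rewrite eqz_nat -lt0n.
- by move=> [h1 h2]; split=> //; rewrite bformZr; exact: dvrZ.
Qed.

(** With h = u - y, the coefficient 2 B(h,x)/Q(h) is (2 B(h,x)/p^e)/eta, so eta times the reflection
    is integral on N. Because Q(u) and Q(y) agree mod p^(e+1), it sends u to eta y up to a multiple
    of p h, and likewise y to eta u. *)
Lemma swap0 u y (eta : int) : N u -> N y ->
  (forall n, N n -> dvr (pz e) (B u n)) -> (forall n, N n -> dvr (pz e) (B y n)) ->
  dvr (pz e.+1) (Q u - Q y) -> Q (u - y) = (pz e * eta)%:~R -> eta != 0 ->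
  (forall n, N n -> N (eta%:~R *: (n *m tau S (u - y)))) /\
  (forall x, Ms y x -> Ms u (eta%:~R *: (x *m tau S (u - y)))).
Proof.
move=> Nu Ny Hu Hy [k hk] hQ eta0.
have pe0 : (pz e)%:~R != 0 :> rat by rewrite intr_eq0.
have eta0' : eta%:~R != 0 :> rat by rewrite intr_eq0.
have [h hE] : exists h, h = u - y by eexists.
rewrite -hE in hQ *.
have Nh : N h by rewrite hE; exact: subB.
have Hh n : N n -> dvr (pz e) (B h n) by move=> Nn; rewrite hE !bformE; apply: dvrB; [exact: Hu|exact: Hy].
have tE x : eta%:~R *: (x *m tau S h) = eta%:~R *: x - (2 * B h x / (pz e)%:~R) *: h.
  rewrite tauE scalerBr scalerA hQ intrM; congr (_ - _ *: _); field.
  by rewrite pe0 eta0'.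
have part1 n : N n -> N (eta%:~R *: (n *m tau S h)).
  move=> Nn; rewrite tE; apply: subB => //; first exact: subZ.
  have [m ->] := Hh n Nn; apply: subZint => //.
  by rewrite intrM mulrA mulrAC mulfK//; apply: rpredM; rewrite ?intr_int//.
have uE : u = y + h by rewrite hE addrC subrK.
have hu : 2 * B h u = ((pz e) * (eta + p%:Z * k))%:~R.
  have -> : 2 * B h u = Q h + (Q u - Q y).
    by rewrite hE (qformB pS) !bformE (bformC pS y u) /qform; ring.
  by rewrite hQ hk -intrD expnS PoszM; congr _%:~R; ring.
have hy : 2 * B h y = ((pz e) * (- eta + p%:Z * k))%:~R.
  have -> : 2 * B h y = - Q h + (Q u - Q y).
    by rewrite hE (qformB pS) !bformE /qform; ring.
  by rewrite hQ hk -mulrNz -intrD expnS PoszM; congr _%:~R; ring.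
have uT : eta%:~R *: (u *m tau S h) = eta%:~R *: y - (p%:Z * k)%:~R *: h.
  rewrite tE hu intrM mulrAC divff// mul1r {1}uE intrD.
  by apply/rowP=> j; rewrite !mxE; ring.
have yT : eta%:~R *: (y *m tau S h) = eta%:~R *: u - (p%:Z * k)%:~R *: h.
  rewrite tE hy intrM mulrAC divff// mul1r uE intrD mulrNz.
  by apply/rowP=> j; rewrite !mxE; ring.
split=> // x; rewrite /Mset; case: r1.
  move=> [n Nn [c ->]]; exists (eta%:~R *: (n *m tau S h) - (c * k)%:~R *: h).
    by apply: subB => //; [exact: part1|exact: subZ].
  exists (c * eta); rewrite mulmxDl -scalemxAl scalerDr -addrA; congr (_ + _).
  transitivity ((c%:~R / p%:R) *: (eta%:~R *: (y *m tau S h))); first by rewrite !scalerA mulrC.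
  by rewrite yT !intrM -[p%:Z%:~R]/(p%:R); apply/rowP=> j; rewrite !mxE; field.
move=> [h1 h2]; split.
  by rewrite scalerA mulrC -scalerA scalemxAl; exact: part1.
rewrite bformZl (bform_tau pS) -bformZr uT !bformE; apply: dvrB; first exact: dvrZ.
rewrite intrM mulrAC mulrC; apply: dvrZ.
by rewrite -[_ * _]bformZl (bformC pS); exact: Hh.
Qed.

(** Q(u - y) + Q(u + y) = 4 Q(u) - 2 (Q(u) - Q(y)) has order exactly e at p. So eta is prime to p
    for y or for -y, and both define the same lattice. *)
Lemma swap u y (t : int) : N u -> N y ->
  (forall n, N n -> dvr (pz e) (B u n)) -> (forall n, N n -> dvr (pz e) (B y n)) ->
  dvr (pz e.+1) (Q u - Q y) -> Q u = (pz e * t)%:~R -> coprimez t p ->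
  exists h, exists2 eta : int, coprimez eta p &
  [/\ forall n, N n -> N (eta%:~R *: (n *m tau S h)),
   forall x, Ms y x -> Ms u (eta%:~R *: (x *m tau S h)) &
   forall x, Ms u x -> Ms y (eta%:~R *: (x *m tau S h))].
Proof.
move=> Nu Ny Hu Hy huy Qu cot.
have both y' (eta : int) : N y' -> (forall n, N n -> dvr (pz e) (B y' n)) -> Ms y' = Ms y ->
    dvr (pz e.+1) (Q u - Q y') -> Q (u - y') = (pz e * eta)%:~R -> coprimez eta p ->
    exists h, exists2 eta : int, coprimez eta p &
    [/\ forall n, N n -> N (eta%:~R *: (n *m tau S h)),
     forall x, Ms y x -> Ms u (eta%:~R *: (x *m tau S h)) &
     forall x, Ms u x -> Ms y (eta%:~R *: (x *m tau S h))].
  move=> Ny' Hy' ME hQ hE co.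
  have eta0 : eta != 0.
    by apply: contraTneq co => ->; rewrite coprimez_p dvdz0.
  exists (u - y'), eta => //.
  have [H1 H2] := swap0 Nu Ny' Hu Hy' hQ hE eta0.
  have [||_ H3] := @swap0 y' u eta Ny' Nu Hy' Hu _ _ eta0.
  - by rewrite -opprB; exact: dvrN.
  - by rewrite -hE -[y' - u]opprB -scaleN1r qform_scale sqrrN expr1n mul1r.
  have tN : tau S (y' - u) = tau S (u - y') by rewrite -opprB -scaleN1r tau_scale// oppr_eq0 oner_eq0.
  by rewrite tN ME in H3; rewrite ME in H2.
have QN v : Q (- v) = Q v by rewrite -scaleN1r qform_scale sqrrN expr1n mul1r.
have div y' : N y' -> (forall n, N n -> dvr (pz e) (B y' n)) -> exists eta : int, Q (u - y') = (pz e * eta)%:~R.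
  move=> Ny' Hy'; have : dvr (pz e) (Q (u - y')).
    by rewrite /qform bformDl bformNl; apply: dvrB; [apply: Hu|apply: Hy']; exact: subB.
  by move=> [m ->]; exists m.
have NNy : N (- y) by exact: subN.
have HNy n : N n -> dvr (pz e) (B (- y) n) by move=> Nn; rewrite bformNl; apply: dvrN; exact: Hy.
have [e1 h1] := div y Ny Hy; have [e2 h2] := div (- y) NNy HNy.
have [c1|c1] := boolP (coprimez e1 p); first exact: (both y e1).
have co2 : coprimez e2 p.
  have [k hk] := huy.
  have E : e1 + e2 = 4 * t - 2 * (p%:Z * k).
    have : Q (u - y) + Q (u - - y) = 4 * Q u - 2 * (Q u - Q y).
      by rewrite !(qformB pS) QN bformNr; ring.
    rewrite h1 h2 hk Qu -intrD => E; have {}E : pz e * e1 + pz e * e2 = 4 * (pz e * t) - 2 * (pz e.+1 * k).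
      by apply: (@intr_inj rat); rewrite E [RHS]intrD mulrNz !intrM.
    apply: (mulfI (pZ0 e)); rewrite mulrDr E expnS PoszM; ring.
  move: c1; rewrite !coprimez_p negbK => d1; apply/negP=> d2.
  move: cot; rewrite coprimez_p => /negP; apply.
  have d4 : (p %| 4 * t)%Z.
    have -> : 4 * t = e1 + e2 + 2 * (p%:Z * k) by rewrite E; ring.
    by apply: rpredD; [exact: rpredD|rewrite dvdz_mull// dvdz_mulr].
  have c4 : coprimez p (2 * 2) by rewrite coprimezMr coprimez_sym coprime2p.
  by rewrite -(Gauss_dvdzr t c4).
apply: (both (- y) e2) => //; last by rewrite QN.
by rewrite -scaleN1r -[-1]/((-1)%:~R); apply: Mset_scale => //; rewrite coprimezE /= coprime1n.
Qed.

End OnN.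

Lemma int_gram M A : integral M -> lattice_basis M A -> exists H0 : 'M[int]_3, gram S A = map_mx intr H0.
Proof.
move=> iM bA; exists (\matrix_(i, j) numq (gram S A i j)); apply/matrixP=> i j.
rewrite !mxE; have : gram S A i j \is a Num.int.
  by rewrite gramE; apply: iM; exact: (basis_row _ bA).
rewrite mxE => /intrP[m hm]; rewrite hm numq_int //.
Qed.

(** At p the reflection of [swap] carries L to M. At the other primes L and M coincide, since both
    contain N and p times each of them lies in N. *)
Lemma Gamma_back L N A r1 e (cc : int) u0 u : lattice_basis L A -> integral L ->
  Lambda S p L = N -> (0 < e)%N -> coprimez cc p ->
  okv e cc N u0 -> L = Mset r1 e N u0 -> okv e cc N u ->
  Gamma S p L N (Mset r1 e N u).
Proof.
move=> bA iL LN e0 coc ok0 LE ok.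
have gL := basis_sub bA.
have NP n : N n <-> L n /\ forall y, L y -> dvr p (B n y) by rewrite -LN; exact: LambdaP.
have NL n : N n -> L n by move=> /NP[].
have gN : subgroup N.
  split; first by apply/NP; split; [exact: sub0|move=> y _; rewrite bform0l; exact: dvr0].
  move=> x y /NP[Lx Hx] /NP[Ly Hy]; apply/NP; split; first exact: subB.
  by move=> z Lz; rewrite !bformE; apply: dvrB; [exact: Hx|exact: Hy].
have [Nu0 Hu0 [s0 cs0 hs0]] := ok0; have [Nu Hu [s cs hs]] := ok.
set M := Mset r1 e N u.
have gM : subgroup M by exact: Mset_sub.
have NM n : N n -> M n by exact: Mset_N.
have pMN x : M x -> N (p%:R *: x) by exact: Mset_pN.
have pLN x : L x -> N (p%:R *: x) by rewrite LE; exact: Mset_pN.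
have [h [eta ceta [T1 T2 T3]]] : exists h, exists2 eta : int, coprimez eta p &
  [/\ forall n, N n -> N (eta%:~R *: (n *m tau S h)),
   forall x, L x -> M (eta%:~R *: (x *m tau S h)) &
   forall x, M x -> L (eta%:~R *: (x *m tau S h))].
  (* Scaling u by s0 and u0 by s makes their norms agree mod p^(e+1). *)
  have ME : M = Mset r1 e N (s0%:~R *: u) by rewrite /M Mset_scale.
  have LE' : L = Mset r1 e N (s%:~R *: u0) by rewrite LE Mset_scale.
  rewrite ME {1 2}LE'; have [k hk] := hs; have [k0 hk0] := hs0.
  have Hs (v : 'rV[rat]_3) (i : int) : (forall n, N n -> dvr (pz e) (B v n)) ->
     forall n, N n -> dvr (pz e) (B (i%:~R *: v) n).
    by move=> H n Nn; rewrite bformZl; apply: dvrZ; exact: H.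
  have QuE : Q u = (pz e * (cc * s ^+ 2 + p%:Z * k))%:~R.
    by rewrite -[Q u](subrK (cc * s ^+ 2 * pz e)%:~R) hk -intrD expnS PoszM; congr _%:~R; ring.
  have Qu0E : Q u0 = (pz e * (cc * s0 ^+ 2 + p%:Z * k0))%:~R.
    by rewrite -[Q u0](subrK (cc * s0 ^+ 2 * pz e)%:~R) hk0 -intrD expnS PoszM; congr _%:~R; ring.
  apply: (@swap N r1 e gN e0 _ _ (s0 ^+ 2 * (cc * s ^+ 2 + p%:Z * k))).
  - exact: subZ. - exact: subZ. - exact: Hs. - exact: Hs.
  - exists (s0 ^+ 2 * k - s ^+ 2 * k0); rewrite !qform_scale QuE Qu0E -!rmorphXn /= -!intrM -mulrNz -intrD.
    by rewrite expnS PoszM; congr _%:~R; ring.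
  - by rewrite qform_scale QuE -rmorphXn /= -intrM; congr _%:~R; ring.
  - rewrite coprimezMl coprimezXl//=; rewrite coprimez_p; apply/negP=> d.
    have : (p %| cc * s ^+ 2)%Z.
      by rewrite -(addrK (p%:Z * k) (cc * s ^+ 2)) rpredB// dvdz_mulr.
    apply/negP; rewrite -coprimez_p coprimezMl coc /= coprimezXl//.
have cop : coprimez (eta ^+ 2) (p%:Z ^+ 2) by rewrite coprimezXl// coprimezXr.
have isoT := isometry_tau pS h; have /isometryP isoB := isoT.
have iM : integral M.
  (* eta^2 B(x,y) is a value of the form on L and p^2 B(x,y) a value on N, and the two factors are
     coprime. *)
  move=> x y Mx My; apply: (int_coprime2 cop).
    rewrite (_ : _ * _ = B (eta%:~R *: (x *m tau S h)) (eta%:~R *: (y *m tau S h))).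
      by apply: iL; exact: T3.
    by rewrite !bformE isoB rmorphXn /=; ring.
  rewrite (_ : _ * _ = B (p%:R *: x) (p%:R *: y)); last by rewrite !bformE rmorphXn /=; ring.
  by apply: iL; apply: NL; exact: pMN.
have LM : Lambda S p M = N.
  apply/seteqP; split=> x.
    move=> /(LambdaP _ gM iM)[Mx Hx].
    have N1 : N (eta%:~R *: (x *m tau S h)).
      apply/NP; split; first exact: T3.
      by move=> y Ly; rewrite bformZl (bform_tau pS) -bformZr; apply: Hx; exact: T2.
    have N2 := T1 _ N1; rewrite -scalemxAl (tau_inv pS) scalerA -intrM in N2.
    apply: (sub_coprime gN (a := eta * eta) (b := p)) => //; last exact: pMN.
    by rewrite coprimezMl ceta.
  move=> Nx; apply/(LambdaP _ gM iM); split; first exact: NM.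
  move=> y My; apply: (@dvr_gauss p (eta ^+ 2)); first by rewrite coprimezXl.
    by apply: iM => //; exact: NM.
  rewrite (_ : _ * _ = B (eta%:~R *: (x *m tau S h)) (eta%:~R *: (y *m tau S h))).
    have /NP[_ H] := T1 _ Nx; apply: H; exact: T3.
  by rewrite !bformE isoB rmorphXn /=; ring.
have [A' bA'] : is_lattice M.
  (* M lies in p^(-1) L and contains p^2 times it, because p L is contained in N. *)
  apply: (@lattice_between _ [set x | L (p%:R *: x)]%classic M (p%:R^-1 *: A) (p ^ 2)) => //.
  - by rewrite expn_gt0 p0.
  - case: (bA) => uA LE2; split; first by rewrite unitmxZ// unitfE invr_eq0.
    apply/seteqP; split=> x /=; rewrite LE2.
      move=> [z _ zE]; exists z => //; rewrite -scalemxAr zE scalerA mulVf// scale1r //.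
    by move=> [z _ <-]; exists z => //; rewrite -scalemxAr scalerA divff// scale1r.
  - by move=> x Mx /=; apply: NL; exact: pMN.
  - move=> x /= Lx; apply: NM; rewrite natrX expr2 -scalerA; exact: pLN.
have [G0 hG] := int_gram iL bA; have [H0 hH] := int_gram iM bA'.
have uT := isometry_unit pS isoT.
have invT : invmx (tau S h) = tau S h.
  by apply: (can_inj (mulmxK uT)); rewrite tauK// mulVmx.
split=> //; split; first by exists A'.
move=> q pq; exists (map_mx intr G0), (map_mx intr H0); split.
- by exists A, G0. - by exists A', H0.
have [qp|qp] := eqVneq q p.
  subst q; have := padic_of_local bA bA' hG hH isoT uT ceta; rewrite invT.
  by move=> /(_ T2 T3).
apply: (padic_of_local bA bA' hG hH (isometry1 S) (unitmx1 _ _) (d := p)).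
- by rewrite coprimezE /= prime_coprime// dvdn_prime2// eq_sym.
- by move=> x Lx; rewrite mulmx1; apply: NM; exact: pLN.
- by move=> x Mx; rewrite invmx1 mulmx1; apply: NL; exact: pMN.
Qed.

Definition approx_jordan M (D : 'I_3 -> nat) K := exists W : 'M[rat]_3,
  [/\ (forall i, M (row i W)),
    (forall i j, exists2 m : int, B (row i W) (row j W) = m%:~R & cg (pz K) m ((D i)%:Z *+ (i == j))) &
    (forall x, M x -> exists2 d : int, coprimez d p &
       exists z : 'rV[int]_3, d%:~R *: x = map_mx intr z *m W)].

Lemma row_mul3 (z : 'rV[int]_3) (W : 'M[rat]_3) : map_mx intr z *m W =
  (z 0 0)%:~R *: row 0 W + (z 0 1)%:~R *: row 1 W + (z 0 2)%:~R *: row 2 W.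
Proof.
rewrite mulmx_sum_row !big_ord_recl big_ord0 addr0 !mxE addrA.
by congr ((z 0 _)%:~R *: row _ W + (z 0 _)%:~R *: row _ W + (z 0 _)%:~R *: row _ W); exact: val_inj.
Qed.

Lemma approx_dvr M (W : 'M[rat]_3) k v : integral M -> M v ->
  (forall x, M x -> exists2 d : int, coprimez d p &
       exists z : 'rV[int]_3, d%:~R *: x = map_mx intr z *m W) ->
  (forall j, dvr (pz k) (B v (row j W))) -> forall x, M x -> dvr (pz k) (B v x).
Proof.
move=> iM Mv spn H x Mx; have [d cd [z hz]] := spn x Mx.
apply: (dvr_gauss (coprime_pk k cd)); first exact: iM.
rewrite -bformZr hz row_mul3 !bformE.
by apply: dvrD; [apply: dvrD|]; apply: dvrZ; exact: H.
Qed.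

Lemma dvr_cg (k K : nat) (r : rat) (m m' : int) : r = m%:~R -> cg (pz K) m m' -> (k <= K)%N ->
  (pz k %| m')%Z -> dvr (pz k) r.
Proof.
move=> -> c kK d; apply/dvrE; rewrite -[m](subrK m'); apply: rpredD => //.
by apply: dvdz_trans c; rewrite dvdzE /= dvdn_exp2l.
Qed.

(** u is p w, where w is the first Jordan vector, so that M = N + Zw. Then Q(u) = p^2 Q(w), which is
    why e is 2 in this case. *)
Lemma Gamma_forth1 M N D : subgroup M -> integral M -> Lambda S p M = N ->
  approx_jordan M D 1 -> coprime p (D 0) -> (p %| D 1%R)%N -> (p %| D 2%R)%N ->
  exists2 u, okv 2 (D 0) N u & M = Mset true 2 N u.
Proof.
move=> gM iM LM [W [WM gr spn]] c0 d1 d2.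
have NP n : N n <-> M n /\ forall y, M y -> dvr p (B n y) by rewrite -LM; exact: LambdaP.
have dv v : M v -> (forall j, dvr p (B v (row j W))) -> N v.
  move=> Mv H; apply/NP; split=> // y My.
  by have := @approx_dvr M W 1 v iM Mv spn; rewrite expn1; apply.
have gW i j : (i != 0) || (j != 0) -> dvr p (B (row i W) (row j W)).
  move=> ij; have [m h1 h2] := gr i j; have := dvr_cg (k := 1) h1 h2 (leqnn _); rewrite expn1; apply.
  case: (eqVneq i j) ij => [<-|_ _]; last by rewrite /= mulr0n dvdz0.
  by rewrite orbb /= mulr1n dvdzE /=; case: (ord3P i) => ->.
have Nw j : j != 0 -> N (row j W).
  by move=> j0; apply: dv => // i; apply: gW; rewrite j0.
have [a ha ca] := gr 0 0; rewrite eqxx mulr1n expn1 in ca.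
pose w := row 0 W.
exists (p%:R *: w).
  split.
  - apply/NP; split; first exact: (subZ gM p (WM 0)).
    move=> y My; rewrite bformZl; have /intrP[m ->] := iM _ _ (WM 0) My.
    by rewrite -[p%:R]/(p%:Z%:~R) -intrM; exists m.
  - move=> n /NP[Mn Hn]; rewrite bformZl (bformC pS) expnS expn1 PoszM -[p%:R]/(p%:Z%:~R).
    by apply: dvr_mul; exact: (Hn _ (WM 0)).
  - exists 1; first by rewrite coprimezE /= coprime1n.
    have /dvdzP[k hk] := ca; exists k; rewrite qform_scale /qform ha.
    have -> : a = (D 0)%:Z + k * p%:Z by rewrite -hk; ring.
    by rewrite -[p%:R]/(p%:Z%:~R) -rmorphXn /= -intrM -mulrNz -intrD !expnS expn0 muln1 !PoszM; congr _%:~R; ring.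
apply/seteqP; split=> x; last first.
  move=> [n /NP[Mn _] [c ->]]; apply: subD => //.
  by rewrite scalerA divfK//; exact: (subZ gM c (WM 0)).
move=> Mx; have /intrP[b hb] := iM _ _ Mx (WM 0).
have co : coprimez (D 0%R) p by rewrite coprimezE /= coprime_sym.
(* s inverts the unit Q(w) mod p, so b s w has the same product with w as x mod p. *)
have /coprimezP[[s t] /= st] := co.
exists (x - (b * s)%:~R *: w); last by exists (b * s); rewrite scalerA divfK// subrK.
apply: dv; first by apply: subB => //; exact: (subZ gM _ (WM 0)).
move=> j; have [->|j0] := eqVneq j 0; last first.
  rewrite !bformE; apply: dvrB; last by apply: dvrZ; apply: gW; rewrite j0 orbT.
  by have /NP[_ H] := Nw j j0; rewrite (bformC pS); exact: H.
rewrite !bformE hb ha -intrM -mulrNz -intrD; apply/dvrE.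
have /dvdzP[k hk] := ca.
have -> : b + - (b * s * a) = b * t * p%:Z - b * s * (k * p%:Z).
  by rewrite -hk -{1}[b]mulr1 -{1}st; ring.
by rewrite rpredB// ?dvdz_mull// mulrA dvdz_mull.
Qed.

(** u is the last Jordan vector. If x satisfies the two conditions, the coordinates of p x (times d)
    are divisible by p: the first two since p x is in Lambda_p(M), the last since B(p x, u) is in
    p^(e+1) Z. *)
Lemma Gamma_forth2 M N D e (cc : nat) : subgroup M -> integral M -> Lambda S p M = N ->
  approx_jordan M D e.+1 -> coprime p (D 0) -> coprime p (D 1) -> (0 < e)%N -> coprime p cc ->
  D 2 = (p ^ e * cc)%N ->
  exists2 u, okv e cc N u & M = Mset false e N u.
Proof.
move=> gM iM LM [W [WM gr spn]] c0 c1 e0 coc d2.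
have NP n : N n <-> M n /\ forall y, M y -> dvr p (B n y) by rewrite -LM; exact: LambdaP.
have g2 j : dvr (pz e) (B (row 2 W) (row j W)).
  have [m h1 h2] := gr 2 j; apply: (dvr_cg h1 h2 (leqnSn _)).
  case: eqP => _; last by rewrite /= mulr0n dvdz0.
  by rewrite /= mulr1n d2 dvdzE /= dvdn_mulr.
have H2 := approx_dvr iM (WM 2) spn g2.
have pe : (p %| pz e)%Z by rewrite dvdzE /= dvdn_exp.
have [a ha ca] := gr 2 2; rewrite eqxx mulr1n d2 in ca.
exists (row 2 W).
  split.
  - by apply/NP; split=> // y My; apply: (dvr_trans pe); exact: H2.
  - by move=> n /NP[Mn _]; exact: H2.
  - exists 1; first by rewrite coprimezE /= coprime1n.
    rewrite /qform ha -mulrNz -intrD; apply/dvrE; move: ca; rewrite /cg.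
    by rewrite PoszM expr1n mulr1 mulrC.
apply/seteqP; split=> x.
  move=> Mx; split; last by rewrite (bformC pS); exact: H2.
  apply/NP; split; first by rewrite -[p%:R]/(p%:~R); exact: subZ.
  move=> y My; rewrite bformZl; have /intrP[m ->] := iM _ _ Mx My.
  by rewrite -[p%:R]/(p%:Z%:~R) -intrM; exists m.
move=> [Nx Bx]; have /NP[Mpx Hpx] := Nx; have [d cd [z hz]] := spn _ Mpx.
have zB j : dvr (pz 1) (d%:~R * B (p%:R *: x) (row j W)) by rewrite expn1; apply: dvrZ; exact: Hpx.
have low (j : 'I_3) : j != 2 -> coprime p (D j) -> (p %| z 0%R j)%Z.
  move=> j2 cj; have := zB j; rewrite -bformZl hz row_mul3 !bformE.
  have [[m0 h0 k0] [m1 h1 k1] [m2 h2 k2]] := And3 (gr 0 j) (gr 1 j) (gr 2 j).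
  rewrite h0 h1 h2 -!intrM -!intrD dvrE expn1 => H.
  have kp m m' : cg (pz e.+1) m m' -> cg p m m'.
    by apply: cg_dvd; rewrite dvdzE /= dvdn_exp.
  have cz := cgD (cgD (cgM (cg_refl p (z 0 0)) (kp _ _ k0)) (cgM (cg_refl p (z 0 1)) (kp _ _ k1)))
     (cgM (cg_refl p (z 0 2)) (kp _ _ k2)).
  have : (p %| (z 0 j * (D j)%:Z)%R)%Z.
    have := rpredB H cz; rewrite opprB addrC subrK.
    by case: (ord3P j) j2 => ->; rewrite ?eqxx //= => _; rewrite ?mulr1n ?mulr0n ?mulr0 ?addr0 ?add0r.
  by rewrite mulrC Gauss_dvdzr// coprimezE.
have z0 := low 0 isT c0; have z1 := low 1 isT c1.
have z2 : (p %| z 0%R 2%R)%Z.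
  have : dvr (pz e.+1) (d%:~R * B (p%:R *: x) (row 2 W)).
    by apply: dvrZ; rewrite bformZl expnS PoszM -[p%:R]/(p%:Z%:~R); exact: dvr_mul.
  rewrite -bformZl hz row_mul3 !bformE.
  have [[m0 h0 k0] [m1 h1 k1] [m2 h2 k2]] := And3 (gr 0 2) (gr 1 2) (gr 2 2).
  rewrite h0 h1 h2 -!intrM -!intrD dvrE => H.
  have cz := cgD (cgD (cgM (cg_refl _ (z 0 0)) k0) (cgM (cg_refl _ (z 0 1)) k1))
     (cgM (cg_refl _ (z 0 2)) k2).
  have := rpredB H cz; rewrite opprB addrC subrK /= mulr1n !mulr0n !mulr0 !add0r d2.
  rewrite expnSr !PoszM mulrCA dvdz_mul2l//.
  by rewrite mulrC Gauss_dvdzr// coprimezE.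
apply: (sub_coprime gM cd); last by exact: Mpx.
have /dvdzP[y0 e0'] := z0; have /dvdzP[y1 e1'] := z1; have /dvdzP[y2 e2'] := z2.
have -> : d%:~R *: x = y0%:~R *: row 0 W + y1%:~R *: row 1 W + y2%:~R *: row 2 W.
  apply: (scalerI pR0); rewrite scalerA mulrC -scalerA hz row_mul3 e0' e1' e2' !scalerDr !scalerA.
  by rewrite !intrM -[p%:R]/(p%:Z%:~R) !(mulrC p%:Z%:~R).
by apply: subD => //; [apply: subD => //|]; exact: subZ.
Qed.

End Gamma.

Lemma image_byM n (T T' : 'M[rat]_n) M : image_by (T *m T') M = image_by T' (image_by T M).
Proof.
apply/seteqP; split=> [_ [x Mx <-]|_ [_ [x Mx <-] <-]].
  by exists (x *m T); [exists x|rewrite mulmxA].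
by exists x => //; rewrite mulmxA.
Qed.

Lemma image_byK n (T : 'M[rat]_n) M : T \in unitmx -> image_by (invmx T) (image_by T M) = M.
Proof.
move=> uT; rewrite -image_byM mulmxV//; apply/seteqP; split=> [_ [x Mx <-]|x Mx].
  by rewrite mulmx1.
by exists x => //; rewrite mulmx1.
Qed.

Lemma image_byN n (T : 'M[rat]_n) M : subgroup M -> image_by (- T) M = image_by T M.
Proof.
move=> gM; apply/seteqP; split=> _ [x Mx <-]; exists (- x); rewrite ?mulmxN ?mulNmx ?opprK//;
  exact: subN.
Qed.

(** * Admissible vectors and the action of O(N) on them *)

Section Points.
Variables (S : 'M[rat]_3) (p : nat) (N : set 'rV[rat]_3) (r1 : bool) (e : nat) (cc : int).
Hypotheses (pS : posdef_space S) (pp : prime p) (lN : integral_lattice S N).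
Hypotheses (e0 : (0 < e)%N) (coc : coprimez cc p).
Local Notation B := (bform S).
Local Notation Q := (qform S).
Local Notation ON := (isometry_group S N).
Local Notation Ms := (Mset S p r1 e N).
Local Notation ok := (okv S p e cc N).
Notation pz k := (p ^ k)%N%:Z.
Implicit Types (x y u v n : 'rV[rat]_3) (T : 'M[rat]_3).
Let gN : subgroup N := il_sub lN.
Let p0 : (0 < p)%N := prime_gt0 pp.
Let pR0 : p%:R != 0 :> rat. Proof. by rewrite pnatr_eq0 -lt0n. Qed.
Let pZ0 k : pz k != 0. Proof. by rewrite eqz_nat expn_eq0 negb_and -lt0n p0. Qed.

Lemma Lambda_image T M : isometry S T -> T \in unitmx ->
  Lambda S p (image_by T M) = image_by T (Lambda S p M).
Proof.
move=> /isometryP iT uT.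
have iQ x : Q (x *m T) = Q x by rewrite /qform iT.
apply/seteqP; split=> [_ [[x Mx <-] H]|_ [x [Mx H] <-]].
  exists x => //; split=> // y My; have [m hm] := H (y *m T) (ex_intro2 _ _ y My erefl).
  by exists m; rewrite -hm -mulmxDl !iQ.
split; first by exists x.
by move=> _ [y My <-]; have [m hm] := H y My; exists m; rewrite -mulmxDl !iQ.
Qed.

Lemma okv_in u : ok u -> N u. Proof. by case. Qed.
Lemma okv_dv u n : ok u -> N n -> dvr (pz e) (B u n). Proof. by case=> _ H _; exact: H. Qed.

Lemma okv_unit u : ok u -> exists2 t : int, coprimez t p & Q u = (pz e * t)%:~R.
Proof.
move=> [_ _ [s cs [k hk]]]; exists (cc * s ^+ 2 + p%:Z * k); last first.
  by rewrite -[Q u](subrK (cc * s ^+ 2 * pz e)%:~R) hk -intrD expnS PoszM; congr _%:~R; ring.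
rewrite (coprimez_p pp); apply/negP=> d.
have : (p %| cc * s ^+ 2)%Z.
  by rewrite -(addrK (p%:Z * k) (cc * s ^+ 2)) rpredB// dvdz_mulr.
by apply/negP; rewrite -(coprimez_p pp) coprimezMl coc /= coprimezXl.
Qed.

(** Q(u) = B(u,u) itself has order exactly e at p. *)
Lemma okv_nd u : ok u -> ~ (forall n, N n -> dvr (pz e.+1) (B u n)).
Proof.
move=> ou H; have [t ct ht] := okv_unit ou.
have := H u (okv_in ou); rewrite -/(Q u) ht dvrE expnSr PoszM dvdz_mul2l//.
by apply/negP; rewrite -(coprimez_p pp).
Qed.

Lemma okv_isog T u : ON T -> ok u -> ok (u *m T).
Proof.
move=> hT [Nu Hu [s cs hs]]; have /isometryP iT := hT.1; split.
- exact: (isog_in hT).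
- move=> n Nn; have uT := isometry_unit pS hT.1.
  rewrite -(mulmxKV uT n) iT; apply: Hu; apply: isog_in Nn; exact: (isogV pS).
- by exists s => //; rewrite /qform iT.
Qed.

Lemma okv_mod u v n : ok u -> N n -> v = u + (pz e.+1)%:~R *: n -> ok v.
Proof.
move=> [Nu Hu [s cs hs]] Nn ->; split.
- by apply: subD => //; exact: subZ.
- move=> x Nx; rewrite bformDl bformZl; apply: dvrD; first exact: Hu.
  have /intrP[m ->] := il_int lN Nn Nx; rewrite -intrM expnSr PoszM -mulrA; by eexists.
- exists s => //; rewrite (qformD pS) qform_scale !bformE.
  have /intrP[m hm] := il_int lN Nn Nn; have /intrP[k hk] := il_int lN Nu Nn.
  rewrite /qform hm hk -rmorphXn /= [X in dvr _ X](_ : _ = Q u - (cc * s ^+ 2 * pz e)%:~R +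
    (pz e.+1 * (2 * k + pz e.+1 * m))%:~R); last by rewrite /qform !(intrM, intrD) rmorphXn /=; ring.
  by apply: dvrD => //; eexists.
Qed.

Lemma Mset_image T u : ON T -> image_by T (Ms u) = Ms (u *m T).
Proof.
have half T' v x : ON T' -> Ms v x -> Ms (v *m T') (x *m T').
  move=> hT; have /isometryP iT := hT.1; rewrite /Mset; case: r1.
    move=> [n Nn [c ->]]; exists (n *m T'); first exact: (isog_in hT).
    by exists c; rewrite mulmxDl scalemxAl.
  by move=> [h1 h2]; rewrite scalemxAl iT; split=> //; exact: (isog_in hT).
move=> hT; have uT := isometry_unit pS hT.1.
apply/seteqP; split=> [_ [x Mx <-]|x Mx]; first exact: half.
exists (x *m invmx T); last by rewrite mulmxKV.
by have := half _ _ _ (isogV pS hT) Mx; rewrite mulmxK.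
Qed.

(** In rank 1 the lattice is determined by the line of u in N/pN, otherwise by the functional B(u,
    .)/p^e mod p up to units. Either can be tested on coordinates mod p^(e+1). *)
Lemma Mset_eq u v : ok u -> ok v -> Ms u = Ms v <->
  exists2 l : int, coprimez l p &
    if r1 then exists2 n, N n & v - l%:~R *: u = p%:R *: n
    else forall n, N n -> dvr (pz e.+1) (B (l%:~R *: u - v) n).
Proof.
move=> ou ov.
have [Nu Nv] := (okv_in ou, okv_in ov).
have [Hu Hv] := ((fun n => @okv_dv u n ou), (fun n => @okv_dv v n ov)).
have sc l : coprimez l p -> Ms (l%:~R *: u) = Ms u by exact: Mset_scale.
split=> [E|[l cl H]].
  case: (boolP r1) (E) => hr; rewrite ?hr /= => _.
    have : Ms v (p%:R^-1 *: v).
      by rewrite /Mset hr; exists 0; [exact: sub0|exists 1; rewrite add0r mul1r].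
    rewrite -E /Mset hr => -[n Nn [c hc]]; have vE : v - c%:~R *: u = p%:R *: n.
      have -> : v = p%:R *: (p%:R^-1 *: v) by rewrite scalerA divff// scale1r.
      by rewrite hc scalerDr scalerA mulrCA divff// mulr1 addrK.
    exists c; last by exists n.
    rewrite (coprimez_p pp); apply/negP=> /dvdzP[k ck].
    have vp : v = p%:R *: (n + k%:~R *: u).
      by rewrite scalerDr -vE scalerA ck intrM -[p%:R]/(p%:Z%:~R) (mulrC p%:Z%:~R) subrK.
    have [t ct ht] := okv_unit ov.
    have : dvr (pz e.+1) (Q v).
      rewrite /qform {2}vp bformZr expnS PoszM -[p%:R]/(p%:Z%:~R); apply: dvr_mul; apply: Hv.
      by apply: subD => //; exact: subZ.
    rewrite ht dvrE expnSr PoszM dvdz_mul2l//.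
    by apply/negP; rewrite -(coprimez_p pp).
  have [t ct ht] := okv_unit ou.
  have [b hb] : dvr (pz e) (B v u) by exact: Hv.
  have /coprimezP[[a c] /= ac] := ct.
  (* x = (t n - k u)/p satisfies B(x,u) = 0, so it belongs to the lattice of u and hence to that of
     v. This makes B(u, .) and B(v, .) proportional mod p^(e+1). *)
  have key n : N n -> dvr (pz e.+1) (t%:~R * B v n - b%:~R * B u n).
    move=> Nn; have [k hk] := Hu n Nn.
    pose x := p%:R^-1 *: (t%:~R *: n - k%:~R *: u).
    have px : p%:R *: x = t%:~R *: n - k%:~R *: u by rewrite scalerA divff// scale1r.
    have : Ms u x.
      rewrite /Mset (negbTE hr) px; split; first by apply: subB => //; exact: subZ.
      rewrite bformZl !bformE (bformC pS n u) -/(Q u) hk ht -!intrM.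
      have -> : t * (pz e * k) = k * (pz e * t) by ring.
      by rewrite subrr mulr0; exact: dvr0.
    rewrite E /Mset (negbTE hr) => -[_ h].
    have : dvr (p%:Z * pz e) (p%:Z%:~R * B x v) by exact: dvr_mul.
    rewrite -PoszM -expnS -[p%:Z%:~R]/(p%:R) -bformZl px !bformE (bformC pS n v) (bformC pS u v) hb hk.
    by congr dvr; rewrite !intrM; ring.
  have H n : N n -> dvr (pz e.+1) (B ((a * b)%:~R *: u - v) n).
    move=> Nn; rewrite !bformE; have [k hk] := key n Nn; have [j hj] := Hv n Nn.
    have -> : (a * b)%:~R * B u n - B v n = - (a%:~R * (t%:~R * B v n - b%:~R * B u n)) - (c * p%:Z)%:~R * B v n.
      have E1 : a%:~R * t%:~R + (c * p%:Z)%:~R = 1 :> rat by rewrite -intrM -intrD ac.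
      transitivity (a%:~R * b%:~R * B u n - (a%:~R * t%:~R + (c * p%:Z)%:~R) * B v n).
        by rewrite E1 mul1r intrM.
      by ring.
    apply: dvrB; first by apply: dvrN; apply: dvrZ; exists k.
    by rewrite hj -intrM; exists (c * j); rewrite expnSr PoszM; congr _%:~R; ring.
  exists (a * b); last exact: H.
  rewrite (coprimez_p pp); apply/negP=> /dvdzP[k ck]; apply: (okv_nd ov) => n Nn.
  have -> : B v n = (a * b)%:~R * B u n - B ((a * b)%:~R *: u - v) n by rewrite !bformE; ring.
  apply: dvrB; last exact: H.
  have [j ->] := Hu n Nn; rewrite ck -intrM; exists (k * j); rewrite expnSr PoszM; congr _%:~R; ring.
rewrite -(sc l cl); move: H; case: (boolP r1) => hr.
  move=> [n Nn vE]; have vE' : v = l%:~R *: u + p%:R *: n by rewrite -vE addrC subrK.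
  apply/seteqP; rewrite /Mset /=; split=> _ [m Nm [c ->]].
    exists (m - c%:~R *: n); first by apply: subB => //; exact: subZ.
    by exists c; rewrite vE'; apply/rowP=> j; rewrite !mxE; field.
  exists (m + c%:~R *: n); first by apply: subD => //; exact: subZ.
  by exists c; rewrite vE'; apply/rowP=> j; rewrite !mxE; field.
move=> H.
have H' x : N (p%:R *: x) -> dvr (pz e) (B x (l%:~R *: u - v)).
  move=> Nx; have := H _ Nx; rewrite (bformC pS) bformZl expnS PoszM -[p%:R]/(p%:Z%:~R) => h.
  by apply: dvr_cancel h; rewrite eqz_nat -lt0n.
apply/seteqP; rewrite /Mset /=; split=> x [h1 h2]; split=> //.
  have -> : B x v = B x (l%:~R *: u) - B x (l%:~R *: u - v) by rewrite !bformE; ring.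
  by apply: dvrB => //; exact: H'.
have -> : B x (l%:~R *: u) = B x v + B x (l%:~R *: u - v) by rewrite !bformE; ring.
by apply: dvrD => //; exact: H'.
Qed.

(** As p M lies in N, the primitive vector of M on the line of x is, up to sign, x or x/p. *)
Lemma QK_over M x : subgroup M -> (forall n, N n -> M n) -> (forall y, M y -> N (p%:R *: y)) ->
  root S N x ->
  QK S M (tau S x) (Q x) /\ ~ M (p%:R^-1 *: x) \/
  QK S M (tau S x) (Q x / p%:R ^+ 2) /\ M (p%:R^-1 *: x).
Proof.
move=> gM NM MN rx; have [[Nx px] x0 _] := rx.
have [Mx|nMx] := pselect (M (p%:R^-1 *: x)); [right|left]; split=> //.
  exists (p%:R^-1 *: x); split.
  - split=> // m y My xy; apply: (px m (p%:R *: y)); first exact: MN.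
    by rewrite scalerA mulrC -scalerA -xy scalerA divff// scale1r.
  - by rewrite tau_scale// invr_eq0.
  - by rewrite qform_scale exprVn mulrC.
exists x; split=> //; split; first exact: NM.
move=> m y My xy; have [co|nco] := boolP (coprimez m p).
  apply: (px m y) => //; apply: (sub_coprime gN co); first by rewrite -xy.
  exact: MN.
move: nco; rewrite (coprimez_p pp) negbK => /dvdzP[k mk]; exfalso; apply: nMx.
have -> : p%:R^-1 *: x = k%:~R *: y.
  by rewrite xy mk intrM scalerA mulrC -[p%:Z%:~R]/(p%:R) mulfK.
exact: subZ.
Qed.

Lemma isog_over M T : T \in unitmx -> isometry S T -> Lambda S p M = N -> image_by T M = M -> ON T.
Proof. by move=> uT iT LM E; split=> //; rewrite -LM -Lambda_image// E. Qed.

End Points.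

(** * Enumeration of the isometry classes *)

Definition dig (P z i : nat) : nat := ((z %/ P ^ i) %% P)%N.
(** A natural number congruent to c mod P: -(n + 1) becomes (P - 1)(n + 1). *)
Definition rz (P : nat) (c : int) : nat :=
  match c with Posz n => n | Negz n => (P.-1 * n.+1)%N end.
Definition vdot (u v : 'I_3 -> nat) : nat :=
  addn (addn (muln (u 0) (v 0)) (muln (u 1) (v 1))) (muln (u 2) (v 2)).
Definition vmul (u : 'I_3 -> nat) (A : 'I_3 -> 'I_3 -> nat) (j : 'I_3) : nat :=
  vdot u (fun i => A i j).
Definition all3 (b : 'I_3 -> bool) := [&& b 0, b 1 & b 2].

Fixpoint undup_pm (s : seq 'M[int]_3) :=
  if s is A :: s' then
    if (A \in s') || (- A \in s') then undup_pm s' else A :: undup_pm s'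
  else [::].

(** When [Rs] lists the symmetries, [isom_decomp] says that this represents O(N) modulo its centre
    element -1, each entry standing for two isometries. *)
Definition group_reps (Rs : seq 'M[int]_3) :=
  undup_pm (1%:M :: Rs ++ [seq A *m C | A <- Rs, C <- Rs]).

(** * The finite enumeration, on natural numbers *)

Section Program.
Variables (r1 : bool) (p e cc : nat) (g : 'I_3 -> 'I_3 -> nat).
Definition pt (z : nat) (i : 'I_3) := dig (p ^ e.+1) z i.
Definition okb (z : nat) : bool :=
  all3 (fun j => (p ^ e %| vmul (pt z) g j)%N) &&
  has (fun s => (0 < s)%N &&
    (vdot (vmul (pt z) g) (pt z) == cc * (s * s) * p ^ e %[mod p ^ e.+1])%N) (iota 0 p).
Definition mat (R : 'M[int]_3) i j := rz (p ^ e.+1) (R i j).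
(** The criterion of [Mset_eq], with l running over the units mod p: does R carry the lattice of z
    to that of z'? *)
Definition relb (R : 'M[int]_3) (z z' : nat) : bool :=
  has (fun l => (0 < l)%N &&
    (if r1 then all3 (fun j => (l * vmul (pt z) (mat R) j == pt z' j %[mod p])%N)
     else all3 (fun j => (l * vmul (vmul (pt z) (mat R)) g j == vmul (pt z') g j %[mod p ^ e.+1])%N)))
  (iota 0 p).
(** Decides whether the root with coordinates [rt] becomes divisible by p in the lattice of z, so
    that its norm drops by p^2. *)
Definition divb (rt : 'rV[int]_3) (z : nat) : bool :=
  if r1 then has (fun l => all3 (fun j => (l * pt z j == rz (p ^ e.+1) (rt 0%R j) %[mod p])%N)) (iota 0 p)
  else (p ^ e.+1 %| vdot (vmul (pt z) g) (fun j => rz (p ^ e.+1) (rt 0%R j)))%N.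

Variables (Rs : seq 'M[int]_3) (rts : seq 'rV[int]_3) (qs : seq nat).
Definition qval (i z : nat) : nat :=
  if divb (nth 0 rts i) z then (nth 0%N qs i %/ p ^ 2)%N else nth 0%N qs i.
Definition hcard (z : nat) : nat := (2 * count (fun R => relb R z z) (group_reps Rs))%N.
(** An index m stands for the norm m %/ t and the symmetry of number m %% t, with t the number of
    symmetries. Running through m in increasing order makes the list sorted by construction. *)
Definition qlist (z : nat) : seq nat :=
  [seq (m %/ size Rs)%N | m <- iota 0 ((sumn qs).+1 * size Rs) &
    has (fun i => [&& (m %% size Rs == i)%N, relb (nth 0 Rs i) z z & qval i z == (m %/ size Rs)%N])
      (iota 0 (size Rs))].
(** Each isometry class is represented by its smallest code. *)
Definition minb (z : nat) : bool :=
  all (fun z' => okb z' ==> ~~ has (fun R => relb R z z') (group_reps Rs)) (iota 0 z).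
Definition labels_of : seq label :=
  [seq (hcard z, qlist z) | z <- iota 0 ((p ^ e.+1) ^ 3) & okb z && minb z].
End Program.

Lemma undup_pm_sub s : {subset undup_pm s <= s}.
Proof.
elim: s => //= A s IH C; case: ifP => _; first by move=> /IH; rewrite inE orbC => ->.
by rewrite !inE => /orP[->//|/IH ->]; rewrite orbT.
Qed.

Lemma undup_pm_cover s A : A \in s -> A \in undup_pm s \/ - A \in undup_pm s.
Proof.
elim: s A => //= C s IH A; rewrite inE => /orP[/eqP ->|/IH [h|h]].
- case: ifP => [/orP[/IH//|/IH[h|h]]|_]; [by right|by left; rewrite opprK in h|].
  by left; rewrite inE eqxx.
- by left; case: ifP => // _; rewrite inE h orbT.
- by right; case: ifP => // _; rewrite inE h orbT.
Qed.

Lemma undup_pm_uniq s : uniq (undup_pm s).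
Proof.
elim: s => //= A s IH; case: ifPn => //; rewrite negb_or => /andP[h _] /=.
by rewrite IH andbT; apply: contra h; exact: undup_pm_sub.
Qed.

Lemma undup_pm_opp s A : A \in undup_pm s -> - A \in undup_pm s -> A = - A.
Proof.
elim: s A => //= C s IH A; case: ifPn => [_|]; first exact: IH.
rewrite negb_or => /andP[h1 h2]; rewrite !inE => /orP[/eqP ->|h3] /orP[/eqP h4|h4] //.
- by case/negP: h2; exact: undup_pm_sub.
- by case/negP: h2; rewrite -h4 opprK; exact: undup_pm_sub.
- exact: IH.
Qed.

Lemma cg_nat (m a b : nat) : (a == b %[mod m])%N = cg m a b.
Proof. by rewrite /cg -eqz_mod_dvd !modz_nat eqz_nat. Qed.

Lemma rz_cg (P : nat) c : (0 < P)%N -> cg P (rz P c) c.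
Proof.
move=> P0; case: c => n /=; first exact: cg_refl.
rewrite /cg NegzE opprK PoszM.
have -> : P.-1%:Z * n.+1 + n.+1 = P%:Z * n.+1.
  have -> : P%:Z = P.-1%:Z + 1 by lia.
  by ring.
exact: dvdz_mulr.
Qed.

Section Vectors.
Definition rowz (u : 'I_3 -> nat) : 'rV[int]_3 := \row_i (u i)%:Z.
Definition matz (A : 'I_3 -> 'I_3 -> nat) : 'M[int]_3 := \matrix_(i, j) (A i j)%:Z.

Lemma sum3 (R : nmodType) (f : 'I_3 -> R) : \sum_i f i = f 0 + f 1 + f 2.
Proof.
rewrite !big_ord_recl big_ord0 addr0 addrA.
by congr (f _ + f _ + f _); exact: val_inj.
Qed.

Lemma vdotE u v : (vdot u v)%:Z = (rowz u *m (rowz v)^T) 0 0.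
Proof. by rewrite mxE sum3 !mxE /vdot !PoszD !PoszM. Qed.

Lemma vmulE u A j : (vmul u A j)%:Z = (rowz u *m matz A) 0 j.
Proof. by rewrite mxE sum3 !mxE /vmul /vdot !PoszD !PoszM. Qed.

Lemma rowz_vmul u A : rowz (vmul u A) = rowz u *m matz A.
Proof. by apply/rowP=> j; rewrite mxE vmulE. Qed.

Lemma all3P (b : 'I_3 -> bool) : reflect (forall j, b j) (all3 b).
Proof.
apply: (iffP and3P) => [[h0 h1 h2] j|H]; last by split.
by case: (ord3P j) => ->.
Qed.

Lemma dig_code (P : nat) (v : 'I_3 -> nat) : (forall i, (v i < P)%N) ->
  exists2 z : nat, (z < P ^ 3)%N & forall i : 'I_3, dig P z i = v i.
Proof.
move=> vP; pose a := v 0; pose b := v 1; pose c := v 2.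
have [ha hb hc] : [/\ (a < P)%N, (b < P)%N & (c < P)%N] by split; exact: vP.
have P0 : (0 < P)%N by exact: leq_ltn_trans (leq0n _) ha.
exists (a + P * (b + P * c))%N.
  by rewrite !expnS expn0 muln1; clear -ha hb hc; nia.
move=> i; case: (ord3P i) => ->; rewrite /dig /=.
- by rewrite expn0 divn1 addnC mulnC modnMDl modn_small.
- rewrite expn1 addnC mulnC divnMDl// (divn_small ha) addn0 addnC mulnC modnMDl modn_small//.
- rewrite expnS expn1 divnMA addnC mulnC divnMDl// (divn_small ha) addn0 addnC mulnC divnMDl//.
  by rewrite (divn_small hb) addn0 modn_small.
Qed.
End Vectors.

Lemma has_label_intro S K h (prs : seq ('M[rat]_3 * nat)) :
  (isometry_group S K #= `I_h)%card -> uniq (unzip1 prs) ->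
  (forall T, T \in unzip1 prs <-> symmetry_of S K T) ->
  (forall pr, pr \in prs -> QK S K pr.1 pr.2%:R) -> sorted leq (unzip2 prs) ->
  has_label S K (h, unzip2 prs).
Proof.
move=> hh hu hs hq so; split=> //=.
have sz : size (unzip1 prs) == size (unzip2 prs) by rewrite !size_map.
exists (Tuple sz); split=> // i.
have ip : (i < size prs)%N by case: i => i /=; rewrite size_map.
have x0 : 'M[rat]_3 * nat := (0, 0%N).
rewrite !(tnth_nth (0 : 'M[rat]_3)) (tnth_nth 0%N) /= !(nth_map x0)//.
by apply: hq; exact: mem_nth.
Qed.

Lemma card_seq (T : choiceType) (A : set T) (s : seq T) : uniq s -> (forall x, A x <-> x \in s) ->
  (A #= `I_(size s))%card.
Proof.
move=> us H; have -> : A = [set` [fset x in s]%fset]%classic.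
  by apply/seteqP; split=> x /=; rewrite inE /= => /H.
by apply/card_eq_fsetP; rewrite card_fseq undup_id.
Qed.

Lemma unit_residue (p : nat) (l : int) : prime p -> coprimez l p ->
  exists2 k : nat, (0 < k < p)%N & cg p k l.
Proof.
move=> pp cl; have p0 := prime_gt0 pp.
have h1 : 0 <= (l %% p)%Z by rewrite modz_ge0// eqz_nat -lt0n.
have h2 : (l %% p)%Z < p by rewrite ltz_pmod// ltz_nat.
have E : `|(l %% p)%Z|%N = (l %% p)%Z :> int by rewrite gez0_abs.
exists `|(l %% p)%Z|%N; last by rewrite E; exact: cg_mod.
rewrite -!ltz_nat E h2 andbT lt_neqAle h1 andbT eq_sym; apply/eqP=> h.
by move: cl; rewrite (coprimez_p pp) => /negP; apply; apply/dvdz_mod0P.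
Qed.

(** A unit l matters only mod p, because p a' vanishes mod m; hence the residues 0 < k < p exhaust
    all units. *)
Lemma has_unit (p : nat) (m : int) (a a' b b' : 'I_3 -> int) (t : nat -> 'I_3 -> bool) : prime p ->
  (forall j, cg m (a j) (a' j)) -> (forall j, cg m (b j) (b' j)) -> (forall j, (m %| p%:Z * a' j)%Z) ->
  (forall k j, t k j = cg m (k%:Z * a j) (b j)) ->
  has (fun k => (0 < k)%N && all3 (t k)) (iota 0 p) <->
  exists2 l : int, coprimez l p & forall j, cg m (l * a' j) (b' j).
Proof.
move=> pp ha hb hp ht; split.
  move=> /hasP[k]; rewrite mem_iota add0n /= => kp /andP[k0 /all3P H].
  exists k%:Z; first by rewrite coprimezE /= coprime_sym prime_coprime// gtnNdvd.
  move=> j; have := H j; rewrite ht => h.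
  apply: cg_trans (hb j); apply: cg_trans h; apply: cgM; first exact: cg_refl.
  exact: cg_sym.
move=> [l cl H]; have [k /andP[k0 kp] kl] := unit_residue pp cl.
apply/hasP; exists k; first by rewrite mem_iota add0n.
rewrite k0; apply/all3P=> j; rewrite ht.
apply: cg_trans (cg_sym (hb j)); apply: cg_trans (H j).
apply: (@cg_trans _ (k%:Z * a' j)); first by apply: cgM => //; exact: cg_refl.
rewrite /cg -mulrBl; have /dvdzP[w ->] := kl; rewrite -mulrA; apply: dvdz_mull; exact: hp.
Qed.

(** * Correctness of the enumeration, given a basis of N at p *)

Section Semantics.
Variables (S : 'M[rat]_3) (p : nat) (N : set 'rV[rat]_3) (r1 : bool) (e cc : nat).
Variables (g : 'I_3 -> 'I_3 -> nat) (F : 'M[rat]_3) (Gf : 'M[int]_3).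
Variables (Rs : seq 'M[int]_3) (rts : seq 'rV[int]_3) (qs : seq nat) (xs : seq 'rV[rat]_3).
Variable X : set (set 'rV[rat]_3).
Hypotheses (pS : posdef_space S) (pp : prime p) (lN : integral_lattice S N).
Hypotheses (e0 : (0 < e)%N) (coc : coprime p cc).
Hypotheses (FN : forall i, N (row i F)) (uF : F \in unitmx).
Hypothesis Fspan : forall x, N x -> exists2 d : int, coprimez d p &
  exists z : 'rV[int]_3, d%:~R *: x = map_mx intr z *m F.
Notation P := (p ^ e.+1)%N.
Notation pz k := (p ^ k)%N%:Z.
Hypotheses (gF : gram S F = map_mx intr Gf) (HG : forall i j, cg P (Gf i j) (g i j)).
Hypothesis XP : forall M, X M <-> exists2 u, okv S p e cc N u & M = Mset S p r1 e N u.
Hypothesis XI : forall M, X M -> integral S M.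
Hypothesis XL : forall M, X M -> Lambda S p M = N.
Hypotheses (sR : size Rs = size xs) (sr : size rts = size xs) (sq : size qs = size xs).
Hypothesis Hx : forall i, (i < size xs)%N ->
  [/\ root S N (nth 0 xs i), F *m tau S (nth 0 xs i) = map_mx intr (nth 0 Rs i) *m F,
    (exists2 c : int, coprimez c p & map_mx intr (nth 0 rts i) *m F = c%:~R *: nth 0 xs i) &
    qform S (nth 0 xs i) = (nth 0%N qs i)%:R].
Hypothesis ux : uniq [seq tau S x | x <- xs].
Hypothesis cx : forall x, root S N x -> tau S x \in [seq tau S y | y <- xs].

Local Notation B := (bform S).
Local Notation Q := (qform S).
Local Notation ON := (isometry_group S N).
Local Notation Ms := (Mset S p r1 e N).
Local Notation ok := (okv S p e cc N).
Let gN : subgroup N := il_sub lN.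
Let p0 : (0 < p)%N := prime_gt0 pp.
Let P0 : (0 < P)%N. Proof. by rewrite expn_gt0 p0. Qed.
Let pR0 : p%:R != 0 :> rat. Proof. by rewrite pnatr_eq0 -lt0n. Qed.
Let ccz : coprimez cc p. Proof. by rewrite coprimezE /= coprime_sym. Qed.
Let pP : (p%:Z %| P%:Z)%Z. Proof. by rewrite dvdzE /= dvdn_exp. Qed.
Let peP : (pz e %| P%:Z)%Z. Proof. by rewrite dvdzE /= dvdn_exp2l. Qed.

Definition nvec (u : 'rV[int]_3) : 'rV[rat]_3 := map_mx intr u *m F.
(** The linear map whose matrix in the basis [F] is R. *)
Definition gm (R : 'M[int]_3) : 'M[rat]_3 := invmx F *m map_mx intr R *m F.

Lemma nvecN u : N (nvec u).
Proof.
by rewrite /nvec row_mul3; apply: subD => //; [apply: subD => //|]; exact: subZ.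
Qed.

Lemma nvecB u v : nvec (u - v) = nvec u - nvec v.
Proof. by rewrite /nvec map_mxB mulmxBl. Qed.
Lemma nvecZ (c : int) u : nvec (c *: u) = c%:~R *: nvec u.
Proof. by rewrite /nvec map_mxZ scalemxAl. Qed.

Lemma nvec_inj u v : nvec u = nvec v -> u = v.
Proof.
move=> /(can_inj (mulmxK uF)) /rowP h; apply/rowP=> j; have := h j.
by rewrite !mxE => /intr_inj.
Qed.

Lemma nvec_gm u R : nvec u *m gm R = nvec (u *m R).
Proof. by rewrite /nvec /gm !mulmxA mulmxK// map_mxM. Qed.

Lemma BnE u v : B (nvec u) (nvec v) = ((u *m Gf *m v^T) 0 0)%:~R.
Proof.
rewrite /bform /nvec trmx_mul !mulmxA.
have -> : map_mx intr u *m F *m S *m F^T = map_mx intr (u *m Gf).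
  by rewrite map_mxM -gF /gram !mulmxA.
by rewrite map_trmx -map_mxM mxE.
Qed.

Lemma BnR u j : B (nvec u) (row j F) = ((u *m Gf) 0 j)%:~R.
Proof.
have -> : row j F = nvec (delta_mx 0 j).
  rewrite rowE /nvec; congr (_ *m _); apply/matrixP=> i k.
  by rewrite !mxE; case: (_ && _).
by rewrite BnE trmx_delta -colE mxE.
Qed.

Lemma dvN k u : (forall n, N n -> dvr (pz k) (B (nvec u) n)) <->
  forall j, (pz k %| (u *m Gf) 0%R j)%Z.
Proof.
split=> [H j|H n Nn]; first by apply/dvrE; rewrite -BnR; exact: H.
have [d cd [z hz]] := Fspan Nn.
apply: (dvr_gauss (coprime_pk k cd)); first by apply: (il_int lN) => //; exact: nvecN.
rewrite -bformZr hz row_mul3 !bformE !BnR.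
by apply: dvrD; [apply: dvrD|]; apply: dvrZ; apply/dvrE; exact: H.
Qed.

Lemma pN u : (exists2 n, N n & nvec u = p%:R *: n) <-> forall j, (p %| u 0%R j)%Z.
Proof.
split=> [[n Nn E] j|H].
  have [d cd [z hz]] := Fspan Nn.
  have E2 : d *: u = p%:Z *: z.
    by apply: nvec_inj; rewrite !nvecZ E scalerA mulrC -scalerA hz.
  have : (p %| d * u 0%R j)%Z by move/rowP: E2 => /(_ j); rewrite !mxE => ->; exact: dvdz_mulr.
  by rewrite Gauss_dvdzr// coprimez_sym.
exists (nvec (\row_j (divz (u 0 j) p))); first exact: nvecN.
rewrite -[p%:R]/(p%:Z%:~R) -nvecZ; congr nvec; apply/rowP=> j; rewrite !mxE.
by rewrite mulrC divzK.
Qed.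

Lemma cg_uG (u : 'rV[int]_3) j : cg P ((u *m Gf) 0 j) ((u *m matz g) 0 j).
Proof. by apply: cg_mx => a b; [exact: cg_refl|rewrite mxE; exact: HG]. Qed.

Lemma cg_uGv (u v : 'rV[int]_3) : cg P ((u *m Gf *m v^T) 0 0) ((u *m matz g *m v^T) 0 0).
Proof.
apply: cg_mx => a b; last exact: cg_refl.
by rewrite (ord1 a); exact: cg_uG.
Qed.

Local Notation Uz z := (rowz (pt p e z)).
Local Notation MM z := (Ms (nvec (Uz z))).
Local Notation okz := (okb p e cc g).
Local Notation relz := (relb r1 p e g).
Local Notation dvz := (divb r1 p e g).
Local Notation Gl := (group_reps Rs).

Lemma dvd_cg (m a b : int) : cg m a b -> (m %| a)%Z = (m %| b)%Z.
Proof.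
move=> h; apply/idP/idP => k; first by have := rpredB k h; rewrite opprB addrC subrK.
by have := rpredD h k; rewrite subrK.
Qed.

Lemma okbP z : okz z <-> ok (nvec (Uz z)).
Proof.
have dvE : all3 (fun j => (p ^ e %| vmul (pt p e z) g j)%N) <->
    forall n, N n -> dvr (pz e) (B (nvec (Uz z)) n).
  rewrite dvN; have E j : (p ^ e %| vmul (pt p e z) g j)%N = (pz e %| (Uz z *m Gf) 0%R j)%Z.
    by rewrite (dvd_cg (cg_dvd peP (cg_uG _ j))) -vmulE.
  by split=> [/all3P H j|H]; [rewrite -E; exact: H|apply/all3P=> j; rewrite E; exact: H].
have sE (s : nat) : (vdot (vmul (pt p e z) g) (pt p e z) == cc * (s * s) * p ^ e %[mod P])%N =
    cg P ((Uz z *m Gf *m (Uz z)^T) 0 0) (cc%:Z * s%:Z ^+ 2 * pz e).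
  have -> : cc%:Z * s%:Z ^+ 2 * pz e = (cc * (s * s) * p ^ e)%N by rewrite !PoszM expr2.
  rewrite cg_nat vdotE rowz_vmul; have h := cg_uGv (Uz z) (Uz z).
  apply/idP/idP => h2; first exact: cg_trans h h2.
  by apply: cg_trans (cg_sym h) h2.
rewrite /okb; split.
  move=> /andP[/dvE H1 /hasP[s]]; rewrite mem_iota add0n /= => sp /andP[s0].
  rewrite sE => hs; split=> //; first exact: nvecN.
  exists s%:Z; first by rewrite coprimezE /= coprime_sym prime_coprime// gtnNdvd.
  by rewrite /qform BnE -mulrNz -intrD; apply/dvrE.
move=> [_ /dvE -> [s cs]]; rewrite /qform BnE -mulrNz -intrD dvrE => hs /=.
have [k /andP[k0 kp] ks] := unit_residue pp cs.
apply/hasP; exists k; first by rewrite mem_iota add0n.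
rewrite k0 sE; apply: cg_trans hs _; apply: cg_sym.
rewrite /cg -mulrBl expnSr PoszM mulrC dvdz_mul2l; last by rewrite eqz_nat expn_eq0 negb_and -lt0n p0.
rewrite -mulrBr; apply: dvdz_mull; have -> : k%:Z ^+ 2 - s ^+ 2 = (k%:Z - s) * (k%:Z + s) by ring.
exact: dvdz_mulr.
Qed.

Lemma Rz_cg z R j : cg P ((rowz (vmul (pt p e z) (mat p e R))) 0 j) ((Uz z *m R) 0 j).
Proof.
rewrite rowz_vmul; apply: cg_mx => a b; first exact: cg_refl.
by rewrite mxE; exact: rz_cg.
Qed.

Lemma relbP R z z' : ON (gm R) -> okz z -> okz z' ->
  relz R z z' <-> image_by (gm R) (MM z) = MM z'.
Proof.
move=> hR oz oz'; have [kz kz'] := ((okbP z).1 oz, (okbP z').1 oz').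
have kR := okv_isog pS hR kz; rewrite nvec_gm in kR.
rewrite (Mset_image p r1 e pS _ hR) nvec_gm (Mset_eq r1 pS pp lN e0 ccz kR kz').
rewrite /relb; case: (r1).
  rewrite (@has_unit p p (rowz (vmul (pt p e z) (mat p e R)) 0) ((Uz z *m R) 0) (Uz z' 0) (Uz z' 0)) //.
  - split=> -[l cl H]; exists l => //.
      have [] := (pN (Uz z' - l *: (Uz z *m R))).2.
        by move=> j; have := cg_sym (H j); rewrite /cg !mxE.
      by move=> n Nn E; exists n => //; rewrite -E nvecB nvecZ.
    case: H => n Nn E j; apply: cg_sym; have := (pN (Uz z' - l *: (Uz z *m R))).1.
    by rewrite /cg nvecB nvecZ => /(_ (ex_intro2 _ _ n Nn E) j); rewrite !mxE.
  - by move=> j; apply: cg_dvd (Rz_cg z R j).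
  - by move=> j; exact: cg_refl.
  - by move=> j; exact: dvdz_mulr.
  - by move=> k j; rewrite cg_nat PoszM !mxE.
rewrite (@has_unit p P (rowz (vmul (vmul (pt p e z) (mat p e R)) g) 0) ((Uz z *m R *m Gf) 0)
  (rowz (vmul (pt p e z') g) 0) ((Uz z' *m Gf) 0)) //.
- have E l : (l *: (Uz z *m R) - Uz z') *m Gf = l *: (Uz z *m R *m Gf) - Uz z' *m Gf.
    by rewrite mulmxBl -scalemxAl.
  split=> -[l cl H]; exists l => //.
    rewrite -nvecZ -nvecB; apply/dvN => j.
    by have := H j; rewrite /cg E !mxE.
  by move: H; rewrite -nvecZ -nvecB => /dvN H j; have := H j; rewrite /cg E !mxE.
- move=> j; rewrite rowz_vmul; apply: cg_sym; apply: cg_trans (cg_uG _ j) _.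
  by apply: cg_mx => a b; [rewrite (ord1 a); apply: cg_sym; exact: Rz_cg|exact: cg_refl].
- by move=> j; rewrite rowz_vmul; apply: cg_sym; exact: cg_uG.
- move=> j; rewrite expnS PoszM dvdz_mul2l ?eqz_nat -?lt0n//.
  by apply: (dvN e _).1; case: kR.
- by move=> k j; rewrite cg_nat PoszM !mxE.
Qed.

Lemma divbP i z : (i < size xs)%N -> okz z ->
  dvz (nth 0 rts i) z <-> MM z (p%:R^-1 *: nth 0 xs i).
Proof.
move=> hi oz; have kz := (okbP z).1 oz; have [rx _ [c cc' hc] _] := Hx hi.
set rt := nth 0 rts i in hc *; set x := nth 0 xs i in rx hc *.
have gM : subgroup (MM z) by exact: Mset_sub.
have NM n : N n -> MM z n by apply: Mset_N => //; case: kz.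
have -> : MM z (p%:R^-1 *: x) <-> MM z (p%:R^-1 *: nvec rt).
  rewrite /nvec hc scalerA mulrC -scalerA; split=> h; first exact: subZ.
  apply: (sub_coprime gM cc' h); rewrite scalerA divff// scale1r; apply: NM; exact: root_in rx.
rewrite /divb /Mset; case: (r1).
  have Hl (l : int) : (forall j, cg p (l * Uz z 0 j) (rt 0 j)) <->
      exists2 n, N n & p%:R^-1 *: nvec rt = n + (l%:~R / p%:R) *: nvec (Uz z).
    have -> : (forall j, cg p (l * Uz z 0 j) (rt 0 j)) <-> forall j, (p %| (rt - l *: Uz z) 0%R j)%Z.
      by split=> H j; [have := cg_sym (H j)|apply: cg_sym; have := H j]; rewrite /cg !mxE.
    rewrite -pN nvecB nvecZ; split=> -[n Nn E]; exists n => //.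
      apply: (scalerI pR0); rewrite scalerDr -E !scalerA divff// scale1r mulrCA divff// mulr1.
      by rewrite subrK.
    move: (congr1 (fun v => p%:R *: v) E); rewrite scalerDr !scalerA divff// scale1r mulrCA divff// mulr1.
    by move=> ->; rewrite addrK.
  have tE (k : nat) j : (k * pt p e z j == rz P (rt 0%R j) %[mod p])%N = cg p (k%:Z * Uz z 0 j) (rt 0 j).
    rewrite cg_nat PoszM !mxE; have h := cg_dvd pP (rz_cg (rt 0 j) P0).
    by apply/idP/idP => h2; [exact: cg_trans h2 h|exact: cg_trans h2 (cg_sym h)].
  split.
    move=> /hasP[k _ /all3P H]; have [n Nn E] := (Hl k%:Z).1 (fun j => etrans (esym (tE k j)) (H j)).
    by exists n => //; exists k%:Z.
  move=> [n Nn [l E]]; have H := (Hl l).2 (ex_intro2 _ _ n Nn E).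
  have h1 : 0 <= (l %% p)%Z by rewrite modz_ge0// eqz_nat -lt0n.
  have h2 : (l %% p)%Z < p by rewrite ltz_pmod// ltz_nat.
  have Ek : `|(l %% p)%Z|%N = (l %% p)%Z :> int by rewrite gez0_abs.
  apply/hasP; exists `|(l %% p)%Z|%N; first by rewrite mem_iota add0n /= -ltz_nat Ek.
  apply/all3P=> j; rewrite tE Ek; apply: cg_trans (H j).
  by apply: cgM; [exact: cg_mod|exact: cg_refl].
have E : p%:R *: (p%:R^-1 *: nvec rt) = nvec rt by rewrite scalerA divff// scale1r.
rewrite E; have -> : (P %| vdot (vmul (pt p e z) g) (fun j => rz P (rt 0%R j)))%N =
    (P %| (Uz z *m Gf *m rt^T) 0%R 0%R)%Z.
  have -> : (P %| vdot (vmul (pt p e z) g) (fun j => rz P (rt 0%R j)))%N =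
    (P %| (vdot (vmul (pt p e z) g) (fun j => rz P (rt 0%R j)))%:Z)%Z by [].
  rewrite vdotE rowz_vmul; apply/esym/dvd_cg; apply: cg_mx => a b.
    by rewrite (ord1 a); exact: cg_uG.
  by rewrite !mxE (ord1 b); apply: cg_sym; exact: rz_cg.
have h : dvr P (p%:R * B (p%:R^-1 *: nvec rt) (nvec (Uz z))) <-> (P %| (Uz z *m Gf *m rt^T) 0%R 0%R)%Z.
  by rewrite -bformZl E (bformC pS) BnE dvrE.
rewrite -h expnS PoszM -[p%:R]/(p%:Z%:~R); split=> [/dvr_cancel|[_ h2]].
  by rewrite eqz_nat -lt0n p0 => /(_ isT) h2; split=> //; exact: nvecN.
exact: dvr_mul.
Qed.

Lemma gmM A C : gm (A *m C) = gm A *m gm C.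
Proof. by rewrite /gm map_mxM !mulmxA mulmxK. Qed.
Lemma gm1 : gm 1%:M = 1%:M.
Proof. by rewrite /gm map_mx1 mulmx1 mulVmx. Qed.
Lemma gmN A : gm (- A) = - gm A.
Proof. by rewrite /gm map_mxN mulmxN mulNmx. Qed.
Lemma gm_inj : injective gm.
Proof.
move=> A C /(can_inj (mulmxK uF)) /(can_inj (mulKmx _)) h.
have /matrixP {}h : map_mx intr A = map_mx intr C :> 'M[rat]_3 by apply: h; rewrite unitmx_inv.
by apply/matrixP=> i j; have := h i j; rewrite !mxE => /intr_inj.
Qed.
Lemma gm_tau i : (i < size xs)%N -> gm (nth 0 Rs i) = tau S (nth 0 xs i).
Proof. by move=> /Hx [_ E _ _]; rewrite /gm -mulmxA -E mulKmx. Qed.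

Lemma tau_gm x : root S N x -> exists2 i, (i < size xs)%N & tau S x = gm (nth 0 Rs i).
Proof.
move=> /cx /(nthP 0) [i]; rewrite size_map => hi E; exists i => //.
by rewrite gm_tau// -E (nth_map 0).
Qed.

Lemma ON_gm R : R \in Gl -> ON (gm R).
Proof.
move=> /undup_pm_sub; have HR i : (i < size xs)%N -> ON (gm (nth 0 Rs i)).
  by move=> hi; rewrite gm_tau//; have [[]] := Hx hi.
rewrite inE mem_cat => /or3P[/eqP ->|/(nthP 0)[i hi <-]|/allpairsP[[A C] /= [/(nthP 0)[i hi <-] /(nthP 0)[j hj <-] ->]]].
- by rewrite gm1; exact: isog1.
- by apply: HR; rewrite -sR.
- by rewrite gmM; apply: (isogM pS); apply: HR; rewrite -sR.
Qed.

Lemma gm_ON T : ON T -> exists2 R, R \in Gl & T = gm R \/ T = - gm R.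
Proof.
move=> hT; have [T' [TT' _ H]] := isom_decomp pS lN hT.
have [A hA TA] : exists2 A, A \in 1%:M :: Rs ++ [seq A *m C | A <- Rs, C <- Rs] & T' = gm A.
  case: H => [->|[x rx ->]|[x [y [rx ry ->]]]].
  - by exists 1%:M; [rewrite inE eqxx|rewrite gm1].
  - have [i hi ->] := tau_gm rx; exists (nth 0 Rs i) => //.
    by rewrite inE mem_cat mem_nth ?sR ?orbT.
  - have [i hi ->] := tau_gm rx; have [j hj ->] := tau_gm ry.
    exists (nth 0 Rs i *m nth 0 Rs j); last by rewrite gmM.
    rewrite inE mem_cat; apply/or3P; apply: Or33; apply/allpairsP.
    by exists (nth 0 Rs i, nth 0 Rs j); rewrite /= !mem_nth ?sR.
have [h|h] := undup_pm_cover hA.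
  by exists A => //; case: TT' => TT'; [left|right]; rewrite -TA TT' ?opprK.
by exists (- A) => //; rewrite gmN -TA opprK; case: TT' => ->; [right|left]; rewrite ?opprK.
Qed.

Lemma gm_neqN R R' : R \in Gl -> R' \in Gl -> gm R <> - gm R'.
Proof.
move=> h h' E; have E2 : R = - R' by apply: gm_inj; rewrite gmN.
rewrite E2 in h; have E3 := undup_pm_opp h' h.
have uT := isometry_unit pS (ON_gm h').1.
have : gm R' = - gm R' by rewrite {1}E3 gmN.
move=> E4; have : gm R' + gm R' = 0 by rewrite {1}E4 addNr.
rewrite -mulr2n -scaler_nat => /eqP; rewrite scaler_eq0 /= => /eqP z0.
by move: uT; rewrite z0 unitmxE det0 unitr0.
Qed.

(** [Gl] meets each pair of opposite isometries exactly once, and no isometry is its own opposite,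
    so counts are doubled. *)
Lemma card_group (A : set 'M[rat]_3) (b : pred 'M[int]_3) :
  (forall T, A T -> ON T) -> (forall R, R \in Gl -> b R <-> A (gm R)) ->
  (forall T, A T <-> A (- T)) ->
  (A #= `I_(2 * count b Gl))%card.
Proof.
move=> AO bA AN; pose s := [seq R <- Gl | b R].
have -> : (2 * count b Gl)%N = size ([seq gm R | R <- s] ++ [seq - gm R | R <- s]).
  by rewrite size_cat !size_map size_filter mul2n addnn.
apply: card_seq.
  have ug : uniq [seq gm R | R <- s].
    by rewrite map_inj_uniq ?filter_uniq ?undup_pm_uniq//; exact: gm_inj.
  rewrite cat_uniq ug /=; apply/andP; split.
    apply/hasPn=> T /mapP[R]; rewrite mem_filter => /andP[_ hR] ->; apply/negP=> /mapP[R'].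
    by rewrite mem_filter => /andP[_ hR'] E; apply: (gm_neqN hR' hR); rewrite -E.
  by rewrite (map_comp (fun T => - T) gm) map_inj_uniq//; exact: oppr_inj.
move=> T; rewrite mem_cat; split.
  move=> AT; have [R hR [E|E]] := gm_ON (AO _ AT).
    by apply/orP; left; apply/mapP; exists R => //; rewrite mem_filter hR andbT; apply/bA => //; rewrite -E.
  apply/orP; right; apply/mapP; exists R => //; rewrite mem_filter hR andbT; apply/bA => //.
  by apply/AN; rewrite -E.
move=> /orP[] /mapP[R]; rewrite mem_filter => /andP[bR hR] ->; first exact/bA.
by apply/AN; rewrite opprK; exact/bA.
Qed.

Lemma card_ON : (ON #= `I_(2 * size Gl))%card.
Proof.
rewrite -(count_predT Gl); apply: card_group => //.
  by move=> R hR; split=> // _; exact: ON_gm.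
by move=> T; split=> h; [|rewrite -[T]opprK]; exact: (isogN pS).
Qed.

Lemma XMM z : okz z -> X (MM z).
Proof. by move=> /okbP kz; apply/XP; exists (nvec (Uz z)). Qed.

Lemma image_ON M T : X M -> isometry S T -> image_by T M = M -> ON T.
Proof.
move=> XM iT E; apply: (@isog_over S p N M T) => //; first exact: (isometry_unit pS).
exact: XL.
Qed.

Local Notation t := (size Rs).
Local Notation qvz := (qval r1 p e g rts qs).

Lemma qvalQK i z : (i < size xs)%N -> okz z -> QK S (MM z) (tau S (nth 0 xs i)) (qvz i z)%:R.
Proof.
move=> hi oz; have kz := (okbP z).1 oz; have [rx _ _ hq] := Hx hi.
have gM : subgroup (MM z) by exact: Mset_sub.
have NM n : N n -> MM z n by apply: Mset_N => //; case: kz.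
have MN y : MM z y -> N (p%:R *: y) by apply: Mset_pN => //; exact: nvecN.
rewrite /qval; case: (QK_over pS pp lN gM NM MN rx) => -[hK hM].
  by have -> : dvz (nth 0 rts i) z = false; [apply/negP=> /(divbP hi oz)|rewrite -hq].
have -> : dvz (nth 0 rts i) z by apply/divbP.
have [y [pry ty Qy]] := hK; have My := pry.1.
have qi : Q y \is a Num.int by apply: (XI (XMM oz)).
have /natrP[k hk] : Q y \is a Num.nat by rewrite natrEint qi (qform_ge0 pS).
suff -> : (nth 0%N qs i %/ p ^ 2)%N = k by exists y; split.
have : (nth 0%N qs i)%:R = (k * p ^ 2)%N%:R :> rat.
  rewrite natrM natrX -hk -hq Qy mulfVK// expf_neq0//.
by move=> /eqP; rewrite eqr_nat => /eqP ->; rewrite mulnK// expn_gt0 p0.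
Qed.

Lemma qval_le i z : (qvz i z <= sumn qs)%N.
Proof.
have h : (nth 0%N qs i <= sumn qs)%N.
  elim: qs i => [|q l IH] [|i] //=; first exact: leq_addr.
  exact: leq_trans (IH i) (leq_addl _ _).
rewrite /qval; case: ifP => // _; exact: leq_trans (leq_div _ _) h.
Qed.

Lemma gmR_ON i : (i < size xs)%N -> ON (gm (nth 0 Rs i)).
Proof. by move=> hi; rewrite gm_tau//; have [[]] := Hx hi. Qed.

Local Notation hcard := (hcard r1 p e g Rs).
Local Notation qlist := (qlist r1 p e g Rs rts qs).

Lemma MM_label z : okz z -> has_label S (MM z) (hcard z, qlist z).
Proof.
move=> oz; have XM := XMM oz; have kz := (okbP z).1 oz.
have gM : subgroup (MM z) by exact: Mset_sub.
(* Symmetry i has index q t + i, where q is its norm in the new lattice. This norm is at most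
   [sumn qs], so the range of m reaches every index. *)
pose ms := [seq m <- iota 0 ((sumn qs).+1 * t) |
    has (fun i => [&& (m %% t == i)%N, relz (nth 0 Rs i) z z & qvz i z == (m %/ t)%N]) (iota 0 t)].
have msP m : m \in ms -> [/\ (m %% t < t)%N, relz (nth 0 Rs (m %% t)%N) z z & qvz (m %% t)%N z = (m %/ t)%N].
  rewrite mem_filter => /andP[/hasP[i]]; rewrite mem_iota add0n => /andP[_ hi] /and3P[/eqP E hr /eqP hq] _.
  by rewrite E.
have msI i : (i < t)%N -> relz (nth 0 Rs i) z z -> (qvz i z * t + i)%N \in ms.
  move=> hi hr; have t0 : (0 < t)%N by exact: leq_ltn_trans (leq0n _) hi.
  rewrite mem_filter mem_iota add0n leq0n /=; apply/andP; split.
    apply/hasP; exists i; first by rewrite mem_iota add0n.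
    by rewrite modnMDl modn_small// eqxx hr divnMDl// divn_small// addn0 eqxx.
  rewrite mulSn; have := leq_mul (qval_le i z) (leqnn t); lia.
pose prs := [seq (tau S (nth 0 xs (m %% t)%N), (m %/ t)%N) | m <- ms].
have -> : qlist z = unzip2 prs by rewrite /unzip2 -map_comp.
have E1 : unzip1 prs = [seq tau S (nth 0 xs (m %% t)%N) | m <- ms] by rewrite /unzip1 -map_comp.
apply: has_label_intro.
- apply: card_group.
  + by move=> T [iT E]; exact: image_ON E.
  + move=> R hR; rewrite (relbP (ON_gm hR) oz oz); split=> [h|[]//].
    by split=> //; have [] := ON_gm hR.
  + move=> T; have h T' : isometry_group S (MM z) T' -> isometry_group S (MM z) (- T').
      by move=> [iT E]; split; [exact: isometryN|rewrite image_byN].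
    by split=> /h; rewrite ?opprK.
- rewrite E1 map_inj_in_uniq; first by rewrite filter_uniq ?iota_uniq.
  move=> m m' hm hm' E; have [a1 b1 c1] := msP _ hm; have [a2 b2 c2] := msP _ hm'.
  have E2 : (m %% t)%N = (m' %% t)%N.
    apply/eqP; rewrite -(nth_uniq (tau S 0) _ _ ux) ?size_map -?sR//.
    by rewrite !(nth_map 0) -?sR// E.
  by rewrite (divn_eq m t) (divn_eq m' t) -c1 -c2 E2.
- move=> T; rewrite E1; split.
    move=> /mapP[m /msP[hi hr _] ->]; have hi' : (m %% t < size xs)%N by rewrite -sR.
    have [[_ x0 ox] _ _ _] := Hx hi'; split; last by exists (nth 0 xs (m %% t)%N).
    split; first by case: ox.
    by rewrite -gm_tau//; apply/relbP => //; exact: gmR_ON.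
  move=> [[iT E] [x x0 Tx]].
  have [y ry Ty] : exists2 y, root S N y & T = tau S y.
    by apply: (sym_root pS lN); split; [exact: image_ON E|exists x].
  have := cx ry; rewrite -Ty => /(nthP 0) [i]; rewrite size_map => hi; rewrite (nth_map 0)// => hT.
  apply/mapP; exists (qvz i z * t + i)%N; last first.
    have t0 : (0 < t)%N by rewrite sR; exact: leq_ltn_trans (leq0n _) hi.
    by rewrite modnMDl modn_small ?sR.
  apply: msI; first by rewrite sR.
  by apply/relbP => //; [exact: gmR_ON|rewrite gm_tau// hT].
- move=> pr /mapP[m /msP[hi _ E] ->] /=; rewrite -E; apply: qvalQK => //; by rewrite -sR.
- rewrite /unzip2 -map_comp; apply: (homo_sorted (e := leq)).
    by move=> a b h; exact: leq_div2r.
  by apply: sorted_filter; [exact: leq_trans|exact: iota_sorted].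
Qed.

(** For some d prime to p, d u has integer coordinates w. Multiplying w by the inverse of d mod
    p^(e+1) and reducing gives a vector congruent to u mod p^(e+1) N, which defines the same
    lattice. *)
Lemma ok_point u : ok u -> exists z, [/\ (z < P ^ 3)%N, okz z & MM z = Ms u].
Proof.
move=> ku; have Nu := okv_in ku; have [d cd [w hw]] := Fspan Nu.
have [d' dd'] : exists d' : int, cg P (d' * d) 1.
  have := coprime_pk e.+1 cd => /coprimezP[[a b] /= E].
  exists a; rewrite /cg; have -> : a * d - 1 = - b * P by rewrite -E; ring.
  exact: dvdz_mull.
pose v (j : 'I_3) := `|(d' * w 0%R j %% P)%Z|%N.
have P0z : P%:Z != 0 by rewrite eqz_nat -lt0n.
have vE j : (v j)%:Z = (d' * w 0%R j %% P)%Z by rewrite /v gez0_abs// modz_ge0.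
have [z zP hz] : exists2 z : nat, (z < P ^ 3)%N & forall i : 'I_3, dig P z i = v i.
  by apply: dig_code => j; rewrite -ltz_nat vE ltz_pmod// ltz_nat.
have [n Nn hn] : exists2 n, N n & nvec (Uz z) = u + (pz e.+1)%:~R *: n.
  have /dvdzP[m Em] := dd'.
  exists (m%:~R *: u - nvec (\row_j (d' * w 0%R j %/ P)%Z)).
    by apply: subB => //; [exact: subZ|exact: nvecN].
  have -> : Uz z = d' *: w - P%:Z *: \row_j (d' * w 0%R j %/ P)%Z.
    apply/rowP=> j; rewrite !mxE /pt hz vE {2}(divz_eq (d' * w 0 j) P).
    by rewrite [_ * P%:Z]mulrC addrAC subrr add0r.
  rewrite nvecB !nvecZ {1}/nvec -hw scalerBr addrA; congr (_ - _).
  rewrite !scalerA -{2}[u]scale1r -scalerDl; congr (_ *: _).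
  by rewrite -intrM -[d' * d](subrK 1) Em intrD intrM; ring.
have kz : ok (nvec (Uz z)) by exact: okv_mod hn.
exists z; split=> //; first by apply/okbP.
apply/esym/(Mset_eq r1 pS pp lN e0 ccz ku kz); exists 1; first by rewrite coprimezE /= coprime1n.
rewrite scale1r hn; case: (r1).
  exists ((pz e)%:~R *: n); first exact: subZ.
  by rewrite addrAC subrr add0r scalerA expnS PoszM intrM.
move=> y Ny; rewrite opprD addrA subrr add0r bformNl bformZl; apply: dvrN.
have /intrP[k ->] := il_int lN Nn Ny; rewrite -intrM; apply/dvrE; exact: dvdz_mulr.
Qed.

Lemma isometric_sym A C : isometric S A C -> isometric S C A.
Proof.
move=> [T [iT <-]]; exists (invmx T); split; first exact: (isometryV pS).
by rewrite image_byK//; exact: isometry_unit iT.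
Qed.
Lemma isometric_trans A C D : isometric S A C -> isometric S C D -> isometric S A D.
Proof.
move=> [T [iT <-]] [T' [iT' <-]]; exists (T *m T'); split; first exact: isometryM.
by rewrite image_byM.
Qed.

(** An isometry between two lattices of [X] maps their common Lambda_p, which is N, to itself, so up
    to sign it is one of the listed matrices. *)
Lemma isometric_rel z z' : okz z -> okz z' -> isometric S (MM z) (MM z') ->
  has (fun R => relz R z z') Gl.
Proof.
move=> oz oz' [T [iT E]]; have gM : subgroup (MM z) by exact: Mset_sub.
have hT : ON T.
  split=> //; rewrite -{1}(XL (XMM oz)) -(Lambda_image p _ iT) ?E; first exact: XL (XMM oz').
  exact: isometry_unit iT.
have [R hR TR] := gm_ON hT; apply/hasP; exists R => //.
apply/relbP => //; first exact: ON_gm.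
by rewrite -E; case: TR => ->; rewrite // image_byN.
Qed.

Lemma rel_isometric z z' : okz z -> okz z' -> has (fun R => relz R z z') Gl ->
  isometric S (MM z) (MM z').
Proof.
move=> oz oz' /hasP[R hR hr]; exists (gm R); split; first by have [] := ON_gm hR.
by apply/relbP => //; exact: ON_gm.
Qed.

Local Notation minb := (minb r1 p e cc g Rs).

Theorem labels_ofP : class_labels S X (labels_of r1 p e cc g Rs rts qs).
Proof.
pose zs := [seq z <- iota 0 (P ^ 3) | okz z && minb z].
have zsP z : z \in zs -> okz z /\ minb z by rewrite mem_filter => /andP[/andP[]].
have sz : size (labels_of r1 p e cc g Rs rts qs) = size zs by rewrite size_map.
pose f (i : 'I_(size (labels_of r1 p e cc g Rs rts qs))) := nth 0%N zs i.
have fz i : f i \in zs by apply: mem_nth; rewrite -sz.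
exists (fun i => MM (f i)); split.
- by move=> i; apply: XMM; case: (zsP _ (fz i)).
- move=> i j hij; have [oi mi] := zsP _ (fz i); have [oj mj] := zsP _ (fz j).
  have nlt z z' : okz z -> minb z -> okz z' -> isometric S (MM z) (MM z') -> (z' < z)%N -> False.
    move=> oz mz oz' h lt; have /allP /(_ z') := mz; rewrite mem_iota add0n lt => /(_ isT).
    by rewrite oz' isometric_rel.
  have E : f i = f j.
    case: (ltngtP (f i) (f j)) => // h; [case: (nlt (f j) (f i))|case: (nlt (f i) (f j))] => //.
    exact: isometric_sym.
  have uz : uniq zs by rewrite filter_uniq// iota_uniq.
  have hi : (i < size zs)%N by rewrite -sz.
  have hj : (j < size zs)%N by rewrite -sz.
  by apply/val_inj/eqP; rewrite -(nth_uniq 0%N hi hj uz); apply/eqP.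
- move=> M /XP[u ku ->]; have [z0 [lz oz0 <-]] := ok_point ku.
  have ex : exists z, okz z && `[< isometric S (MM z0) (MM z) >].
    exists z0; rewrite oz0; apply/asboolP; exists 1%:M; split; first exact: isometry1.
    by rewrite /image_by; under eq_imagel do rewrite mulmx1; rewrite image_id.
  case: (ex_minnP ex) => z /andP[oz /asboolP hz] hmin.
  have zz : z \in zs.
    rewrite mem_filter oz mem_iota add0n (leq_ltn_trans _ lz) ?andbT /=; last first.
      apply: hmin; rewrite oz0; apply/asboolP; exact: isometric_trans hz (isometric_sym hz).
    apply/allP=> z'; rewrite mem_iota add0n => /andP[_ lt]; apply/implyP=> oz'.
    apply/negP=> /(rel_isometric oz oz') h.
    have : (z <= z')%N by apply: hmin; rewrite oz'; apply/asboolP; exact: isometric_trans hz h.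
    by rewrite leqNgt lt.
  have iz : (index z zs < size (labels_of r1 p e cc g Rs rts qs))%N by rewrite sz index_mem.
  exists (Ordinal iz); rewrite /f /= nth_index//; exact: isometric_sym.
- move=> i; rewrite (tnth_nth (0%N, [::])) /= (nth_map 0%N) -?sz//.
  by apply: MM_label; case: (zsP _ (fz i)).
Qed.
End Semantics.

(** * Local models of the root systems *)

Definition mx9 (l : seq int) : 'M[int]_3 := \matrix_(i, j) nth 0 l (3 * i + j)%N.
Definition rw3 (l : seq int) : 'rV[int]_3 := \row_j nth 0 l j.
Definition rows3 (x y z : 'rV[rat]_3) : 'M[rat]_3 := \matrix_(i < 3) nth 0 [:: x; y; z] i.
Definition gl (l : seq nat) (i j : 'I_3) : nat := nth 0%N l (3 * i + j)%N.

Lemma mx9_inj : {in [pred l | size l == 9%N] &, injective mx9}.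
Proof.
move=> a b; rewrite !inE => /eqP sa /eqP sb E; apply: (@eq_from_nth _ 0); first by rewrite sa.
rewrite sa => m hm.
have h1 : (m %/ 3 < 3)%N by rewrite ltn_divLR.
have h2 : (m %% 3 < 3)%N by rewrite ltn_pmod.
move/matrixP: E => /(_ (Ordinal h1) (Ordinal h2)); rewrite !mxE /= mulnC -divn_eq //.
Qed.

(** Matrices as lists of entries, where products and removal of duplicates reduce by evaluation. The
    order of each group is computed in this way. *)
Definition lmul (a b : seq int) : seq int :=
  [seq nth 0 a (3 * (m %/ 3))%N * nth 0 b (m %% 3)%N +
       nth 0 a (3 * (m %/ 3) + 1)%N * nth 0 b (3 + m %% 3)%N +
       nth 0 a (3 * (m %/ 3) + 2)%N * nth 0 b (6 + m %% 3)%N | m <- iota 0 9].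
Definition lopp (a : seq int) : seq int := [seq - c | c <- a].
Fixpoint undup_pml (s : seq (seq int)) :=
  if s is A :: s' then
    if (A \in s') || (lopp A \in s') then undup_pml s' else A :: undup_pml s'
  else [::].

Lemma mx9_mul a b : mx9 (lmul a b) = mx9 a *m mx9 b.
Proof.
apply/matrixP=> i j; rewrite !mxE sum3 !mxE.
have hm : (3 * i + j < 9)%N by have := ltn_ord i; have := ltn_ord j; lia.
rewrite (nth_map 0%N) ?size_iota// nth_iota// add0n.
have -> : ((3 * i + j) %/ 3)%N = i by rewrite mulnC divnMDl// divn_small// addn0.
have -> : ((3 * i + j) %% 3)%N = j by rewrite mulnC modnMDl modn_small.
by rewrite /= !addn0.
Qed.

Lemma mx9_opp a : mx9 (lopp a) = - mx9 a.
Proof.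
apply/matrixP=> i j; rewrite !mxE; elim: a (3 * i + j)%N => [|c a IH] [|m] //=.
Qed.

Lemma undup_pm_mx9 s : all (fun l => size l == 9%N) s ->
  undup_pm (map mx9 s) = map mx9 (undup_pml s).
Proof.
elim: s => //= A s IH /andP[sA ss]; rewrite IH//.
have memE C : size C == 9%N -> (mx9 C \in map mx9 s) = (C \in s).
  move=> sC; apply/mapP/idP => [[D hD E]|h]; last by exists C.
  by rewrite (mx9_inj _ _ E) //; have := allP ss _ hD.
by rewrite -mx9_opp !memE ?size_map//; case: ifP.
Qed.

Lemma size_group Rl : all (fun l => size l == 9%N) Rl ->
  size (group_reps (map mx9 Rl)) =
  size (undup_pml ([:: 1; 0; 0; 0; 1; 0; 0; 0; 1] :: Rl ++ [seq lmul A C | A <- Rl, C <- Rl])).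
Proof.
move=> sR; rewrite -(size_map mx9) -undup_pm_mx9.
  rewrite /= /group_reps; congr (size (undup_pm (_ :: _))).
    by apply/matrixP=> i j; rewrite !mxE; case: (ord3P i) => ->; case: (ord3P j) => ->.
  rewrite map_cat; congr (_ ++ _); rewrite map_allpairs allpairs_mapl allpairs_mapr.
  by apply: eq_allpairs => // a b; rewrite mx9_mul.
rewrite /= all_cat sR; apply/allP=> l /allpairsP[[a b] /= [_ _ ->]].
by rewrite size_map size_iota.
Qed.

Definition pspan (p : nat) (N : set 'rV[rat]_3) (F : 'M[rat]_3) := forall x, N x ->
  exists2 d : int, coprimez d p & exists z : 'rV[int]_3, d%:~R *: x = map_mx intr z *m F.

(** What the enumeration reads of N: a Gram matrix mod p^k in some basis at p, and in that basis the
    matrices, the coordinates up to factors prime to p, and the norms of the symmetries. The basis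
    and the roots stay existential, since the program has no access to them. *)
Definition model S (p k : nat) N (g : 'I_3 -> 'I_3 -> nat) (Rs : seq 'M[int]_3)
    (rts : seq 'rV[int]_3) (qs : seq nat) :=
  exists (F : 'M[rat]_3) (Gf : 'M[int]_3) (xs : seq 'rV[rat]_3),
  [/\ [/\ forall i, N (row i F), F \in unitmx, pspan p N F & gram S F = map_mx intr Gf],
    forall i j, cg (p ^ k)%N (Gf i j) (g i j),
    [/\ size Rs = size xs, size rts = size xs & size qs = size xs],
    forall i, (i < size xs)%N ->
      [/\ root S N (nth 0 xs i), F *m tau S (nth 0 xs i) = map_mx intr (nth 0 Rs i) *m F,
      (exists2 c : int, coprimez c p & map_mx intr (nth 0 rts i) *m F = c%:~R *: nth 0 xs i) &
      qform S (nth 0 xs i) = (nth 0%N qs i)%:R] &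
    uniq [seq tau S x | x <- xs] /\
    forall x, root S N x -> tau S x \in [seq tau S y | y <- xs]].

(** The reflection in the vector r, in coordinates, multiplied by the norm [nt] of r to avoid
    division. In each concrete model it is a polynomial identity. *)
Definition reflects (G : 'M[int]_3) (R r : seq int) := forall i j : 'I_3,
  let v (m : 'I_3) := G m 0 * nth 0 r 0 + G m 1 * nth 0 r 1 + G m 2 * nth 0 r 2 in
  let nt := nth 0 r 0 * v 0 + nth 0 r 1 * v 1 + nth 0 r 2 * v 2 in
  nt * nth 0 R (3 * i + j)%N = nt *+ (i == j :> nat) - 2 * v i * nth 0 r j.

Lemma row_rows3 x y z i : row i (rows3 x y z) = nth 0 [:: x; y; z] i.
Proof. exact: rowK. Qed.

Lemma rw3_rows3 a b c x y z : map_mx intr (rw3 [:: a; b; c]) *m rows3 x y z =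
  a%:~R *: x + b%:~R *: y + c%:~R *: z.
Proof. by rewrite row_mul3 !row_rows3 !mxE. Qed.

Lemma nth_Posz l m : nth 0 [seq Posz c | c <- l] m = (nth 0%N l m)%:Z.
Proof. by elim: l m => [|c l IH] [|m] /=. Qed.

(** * Models of the types other than A1 and A2 *)

Section Models.
Variables (S : 'M[rat]_3) (p k : nat) (N : set 'rV[rat]_3).
Hypotheses (pS : posdef_space S) (pp : prime p) (op : odd p) (lN : integral_lattice S N).
Local Notation B := (bform S).
Local Notation Q := (qform S).
Local Notation root := (root S N).
Let gN : subgroup N := il_sub lN.

Lemma pspan_unit F : pspan p N F -> F \in unitmx.
Proof.
move=> sF; have h i : exists z : 'rV[rat]_3, z *m F = delta_mx 0 i.
  have [m m0 Nm] := il_full lN (delta_mx 0 i).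
  have [d cd [z hz]] := sF _ Nm; exists ((d * m)%:~R^-1 *: map_mx intr z).
  rewrite -scalemxAl -hz !scalerA intrM mulVf ?scale1r// mulf_neq0 ?intr_eq0//.
  by apply/eqP=> d0; move: cd; rewrite d0 (coprimez_p pp) dvdz0.
pose Y : 'M[rat]_3 := \matrix_i xget 0 [set z | z *m F = delta_mx 0 i]%classic.
have : Y *m F = 1%:M.
  apply/row_matrixP=> i; rewrite row_mul rowK row1.
  by have [z hz] := h i; exact: (@xgetPex _ 0 [set z | z *m F = delta_mx 0 i]%classic (ex_intro _ z hz)).
by move=> /mulmx1_unit[].
Qed.

Lemma int_gramF (F : 'M[rat]_3) : (forall i, N (row i F)) ->
  exists Gf : 'M[int]_3, gram S F = map_mx intr Gf.
Proof.
move=> FN; exists (\matrix_(i, j) Num.floor (gram S F i j)); apply/matrixP=> i j; rewrite [RHS]mxE mxE.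
have : gram S F i j \is a Num.int by rewrite gramE; apply: (il_int lN).
by rewrite intrEfloor => /eqP ->.
Qed.

Lemma mk_model F (Gf : 'M[int]_3) (g : 'I_3 -> 'I_3 -> nat) (Rl rl : seq (seq int)) (qs : seq nat) (xs : seq 'rV[rat]_3) :
  (forall i, N (row i F)) -> pspan p N F -> gram S F = map_mx intr Gf ->
  (forall i j, cg (p ^ k)%N (Gf i j) (g i j)) ->
  all (fun l => size l == 9%N) Rl -> uniq Rl ->
  size Rl = size xs -> size rl = size xs -> size qs = size xs ->
  (forall i, (i < size xs)%N -> [/\ root (nth 0 xs i),
     (exists2 c : int, coprimez c p & map_mx intr (rw3 (nth [::] rl i)) *m F = c%:~R *: nth 0 xs i),
     reflects Gf (nth [::] Rl i) (nth [::] rl i) &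
     Q (nth 0 xs i) = (nth 0%N qs i)%:R]) ->
  covered S N xs -> model S p k N g (map mx9 Rl) (map rw3 rl) qs.
Proof.
move=> FN sF gF HG s9 uR sR sr sq H cov; have uF := pspan_unit sF.
exists F, Gf, xs.
have HT i : (i < size xs)%N ->
    F *m tau S (nth 0 xs i) = map_mx intr (nth 0 (map mx9 Rl) i) *m F.
  move=> hi; have [rx [c cc hc] ref _] := H i hi; set x := nth 0 xs i in rx hc *.
  rewrite (nth_map [::]) ?sR//; set R := nth [::] Rl i in ref *.
  set r := nth [::] rl i in ref hc.
  have c0 : c%:~R != 0 :> rat.
    rewrite intr_eq0; apply/eqP=> c0; move: cc; rewrite c0 (coprimez_p pp) dvdz0 //.
  pose v (m : 'I_3) := Gf m 0 * nth 0 r 0 + Gf m 1 * nth 0 r 1 + Gf m 2 * nth 0 r 2.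
  have GfC a b : B (row a F) (row b F) = (Gf a b)%:~R by rewrite -gramE gF mxE.
  have cxE : c%:~R *: x = (nth 0 r 0)%:~R *: row 0 F + (nth 0 r 1)%:~R *: row 1 F + (nth 0 r 2)%:~R *: row 2 F.
    by rewrite -hc row_mul3 !mxE.
  have vE m : B (row m F) (c%:~R *: x) = (v m)%:~R.
    by rewrite cxE !bformE !GfC /v !(intrD, intrM); ring.
  pose nt := nth 0 r 0 * v 0 + nth 0 r 1 * v 1 + nth 0 r 2 * v 2.
  have ntE : Q (c%:~R *: x) = nt%:~R.
    by rewrite /qform {1}cxE !bformDl !bformZl !vE /nt !(intrD, intrM).
  have x0 := root_neq0 rx.
  have nt0 : nt%:~R != 0 :> rat by rewrite -ntE (qform_eq0 pS) scaler_eq0 negb_or c0.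
  apply/row_matrixP=> m; rewrite !row_mul -(tau_scale pS x c0) tauE ntE (bformC pS) vE.
  apply: (scalerI nt0); rewrite scalerBr [nt%:~R *: (_ *: (c%:~R *: x))]scalerA [nt%:~R * (_ / _)]mulrC mulfVK// cxE.
  have refm (j : 'I_3) : nt%:~R * (nth 0 R (3 * m + j)%N)%:~R =
      nt%:~R *+ (m == j) - 2 * (v m)%:~R * (nth 0 r j)%:~R :> rat.
    have := congr1 (fun n : int => n%:~R : rat) (ref m j); rewrite -/v -/nt /= intrM => ->.
    by rewrite intrB !intrM -[m == j]val_eqE /=; case: (_ == _).
  have -> : row m (map_mx intr (mx9 R)) = map_mx intr (row m (mx9 R)) :> 'rV[rat]_3 by apply/rowP=> j; rewrite !mxE.
  rewrite row_mul3 !scalerDr !scalerA !mxE !refm !scalerBl.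
  have -> : row m F = (m == 0)%:R *: row 0 F + (m == 1)%:R *: row 1 F + (m == 2)%:R *: row 2 F.
    by case: (ord3P m) => -> /=; rewrite !scale0r scale1r ?addr0 ?add0r.
  rewrite !scalerDr !scalerA !mulr_natr !opprD.
  by rewrite ![_ + (_ + _)]addrA; apply/rowP=> j; rewrite !mxE; ring.
split=> //.
- by rewrite !size_map.
- move=> i hi; have [rx hc _ hq] := H i hi; split=> //; first exact: HT.
  by rewrite (nth_map [::]) ?sr.
split.
  apply/(uniqP 0) => i j; rewrite !inE size_map => hi hj; rewrite !(nth_map 0)// => E.
  have := HT i hi; rewrite E HT// => /(can_inj (mulmxK uF)) E2.
  have : nth 0 (map mx9 Rl) j = nth 0 (map mx9 Rl) i.
    by apply/matrixP=> a b; move/matrixP: E2 => /(_ a b); rewrite !mxE => /intr_inj.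
  rewrite !(nth_map [::]) ?sR// => /mx9_inj h.
  apply/eqP; rewrite -(nth_uniq [::] _ _ uR) ?sR//; apply/eqP/esym/h;
    by rewrite inE; apply: (allP s9); rewrite mem_nth ?sR.
move=> x rx; have [y hy [a E]] := cov x rx; apply/mapP; exists y => //.
rewrite E tau_scale//; apply/eqP=> a0; move: (root_neq0 rx).
by rewrite E a0 scale0r eqxx.
Qed.

Lemma int_half x n : root x -> N n -> exists a : int, B x n / Q x = a%:~R / 2.
Proof.
move=> rx Nn; have /intrP[a ha] := root_int lN rx Nn; exists a; rewrite -ha.
have q0 : Q x != 0 by rewrite (qform_eq0 pS); exact: root_neq0 rx.
by field.
Qed.

Lemma pspan3 x y z : (forall n, N n -> exists2 d : int, coprimez d p &
  exists a b c : int, d%:~R *: n = a%:~R *: x + b%:~R *: y + c%:~R *: z) -> pspan p N (rows3 x y z).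
Proof.
move=> H n Nn; have [d cd [a [b [c E]]]] := H n Nn; exists d => //.
by exists (rw3 [:: a; b; c]); rewrite rw3_rows3.
Qed.

(** The coefficients B(x,n)/Q(x) are half-integers by [root_int]. Since 2 is a unit at p, an
    orthogonal frame of roots is a basis at p. *)
Lemma frame_span x y z n : root x -> root y -> root z -> B x y = 0 -> B x z = 0 -> B y z = 0 ->
  N n -> exists a b c : int, (2 : int)%:~R *: n = a%:~R *: x + b%:~R *: y + c%:~R *: z.
Proof.
move=> rx ry rz xy xz yz Nn.
have [a ha] := int_half rx Nn; have [b hb] := int_half ry Nn; have [c hc] := int_half rz Nn.
exists a, b, c; rewrite {1}(orth_frame pS (root_neq0 rx) (root_neq0 ry) (root_neq0 rz) xy xz yz n).
rewrite ha hb hc !scalerDr !scalerA.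
by congr (_ *: _ + _ *: _ + _ *: _); field.
Qed.

Lemma orth_pspan x y z : root x -> root y -> root z -> B x y = 0 -> B x z = 0 -> B y z = 0 ->
  pspan p N (rows3 x y z).
Proof.
move=> rx ry rz xy xz yz; apply: pspan3 => n Nn; exists 2; first exact: coprime2p.
exact: frame_span.
Qed.

Lemma rows3N x y z : N x -> N y -> N z -> forall i, N (row i (rows3 x y z)).
Proof. by move=> Nx Ny Nz i; rewrite row_rows3; case: (ord3P i) => ->. Qed.

Lemma gram_rows3 x y z (q1 q2 q3 b : int) : Q x = q1%:~R -> Q y = q2%:~R -> Q z = q3%:~R ->
  B x y = b%:~R -> B x z = 0 -> B y z = 0 ->
  gram S (rows3 x y z) = map_mx intr (mx9 [:: q1; b; 0; b; q2; 0; 0; 0; q3]).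
Proof.
move=> hx hy hz xy xz yz; apply/matrixP=> i j; rewrite gramE !row_rows3 !mxE.
by case: (ord3P i) => ->; case: (ord3P j) => -> /=; rewrite ?(bformC pS z) ?(bformC pS y x) ?xz ?yz ?xy.
Qed.

Lemma cg_gl l i j : cg (p ^ k)%N (mx9 (map Posz l) i j) (gl l i j).
Proof. by rewrite mxE nth_Posz; exact: cg_refl. Qed.

Definition R3 : seq (seq int) := [:: [:: -1; 0; 0; 0; 1; 0; 0; 0; 1];
  [:: 1; 0; 0; 0; -1; 0; 0; 0; 1]; [:: 1; 0; 0; 0; 1; 0; 0; 0; -1]].
Definition r3 : seq (seq int) := [:: [:: 1; 0; 0]; [:: 0; 1; 0]; [:: 0; 0; 1]].

Let cop1 : coprimez 1 p. Proof. by rewrite coprimezE /= coprime1n. Qed.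

Ltac refl_tac := by let i := fresh "i" in let j := fresh "j" in
  move=> i j; case: (ord3P i) => ->; case: (ord3P j) => ->; rewrite /= ?mxE /=; ring.
Ltac coef_tac := exists 1; [exact: cop1|]; rewrite rw3_rows3 /= ?(mulrNz, mulr1z, mulr0z);
  apply/rowP=> ?; rewrite !mxE; ring.

Lemma model3 x y z (q1 q2 q3 : nat) : root x -> root y -> root z ->
  B x y = 0 -> B x z = 0 -> B y z = 0 -> Q x = q1%:R -> Q y = q2%:R -> Q z = q3%:R ->
  covered S N [:: x; y; z] ->
  model S p k N (gl [:: q1; 0; 0; 0; q2; 0; 0; 0; q3]%N) (map mx9 R3) (map rw3 r3) [:: q1; q2; q3].
Proof.
move=> rx ry rz xy xz yz hx hy hz cov.
apply: (@mk_model (rows3 x y z) (mx9 (map Posz [:: q1; 0; 0; 0; q2; 0; 0; 0; q3]%N))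
   _ _ _ _ [:: x; y; z]) => //.
- by apply: rows3N; [exact: root_in rx|exact: root_in ry|exact: root_in rz].
- exact: orth_pspan.
- exact: (@gram_rows3 _ _ _ q1 q2 q3 0).
- exact: cg_gl.
- by case=> [|[|[|[]]]] //= _; split=> //; try coef_tac; refl_tac.
Qed.

Definition R5 : seq (seq int) := [:: [:: -1; 0; 0; 0; 1; 0; 0; 0; 1];
  [:: 1; 0; 0; 0; -1; 0; 0; 0; 1]; [:: 0; -1; 0; -1; 0; 0; 0; 0; 1];
  [:: 0; 1; 0; 1; 0; 0; 0; 0; 1]; [:: 1; 0; 0; 0; 1; 0; 0; 0; -1]].
Definition r5 : seq (seq int) := [:: [:: 1; 0; 0]; [:: 0; 1; 0]; [:: 1; 1; 0]; [:: 1; -1; 0]; [:: 0; 0; 1]].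

Lemma model5 x y z (q1 q0 : nat) : B2sys S N x y z -> Q x = q1%:R -> Q z = q0%:R ->
  covered S N [:: x; y; x + y; x - y; z] ->
  model S p k N (gl [:: q1; 0; 0; 0; q1; 0; 0; 0; q0]%N) (map mx9 R5) (map rw3 r5)
   [:: q1; q1; 2 * q1; 2 * q1; q0]%N.
Proof.
move=> [[rx ry rz] [xy xz yz] Qxy [rp rm]] hx hz cov; have hy : Q y = q1%:R by rewrite -Qxy.
apply: (@mk_model (rows3 x y z) (mx9 (map Posz [:: q1; 0; 0; 0; q1; 0; 0; 0; q0]%N))
   _ _ _ _ [:: x; y; x + y; x - y; z]) => //.
- by apply: rows3N; [exact: root_in rx|exact: root_in ry|exact: root_in rz].
- exact: orth_pspan.
- exact: (@gram_rows3 _ _ _ q1 q1 q0 0).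
- exact: cg_gl.
- case=> [|[|[|[|[|[]]]]]] //= _; split=> //; try coef_tac; try refl_tac.
  + by rewrite (qformD pS) xy hx hy natrM; ring.
  + by rewrite (qformB pS) xy hx hy natrM; ring.
Qed.

Definition R7 : seq (seq int) := [:: [:: -1; 0; 0; -1; 1; 0; 0; 0; 1];
  [:: 1; -1; 0; 0; -1; 0; 0; 0; 1]; [:: 0; 1; 0; 1; 0; 0; 0; 0; 1];
  [:: 0; -1; 0; -1; 0; 0; 0; 0; 1]; [:: -1; 1; 0; 0; 1; 0; 0; 0; 1];
  [:: 1; 0; 0; 1; -1; 0; 0; 0; 1]; [:: 1; 0; 0; 0; 1; 0; 0; 0; -1]].
Definition r7 : seq (seq int) := [:: [:: 1; 0; 0]; [:: 0; 1; 0]; [:: 1; -1; 0]; [:: 1; 1; 0];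
  [:: 2; -1; 0]; [:: -1; 2; 0]; [:: 0; 0; 1]].

Lemma model7 e f z (b q0 : nat) : G2sys S N e f z -> B e f = b%:R -> Q z = q0%:R ->
  covered S N [:: e; f; e - f; e + f; 2 *: e - f; 2 *: f - e; z] ->
  model S p k N (gl [:: 2 * b; b; 0; b; 2 * b; 0; 0; 0; q0]%N) (map mx9 R7) (map rw3 r7)
   [:: 2 * b; 2 * b; 2 * b; 6 * b; 6 * b; 6 * b; q0]%N.
Proof.
move=> [[re rf rz] [ez fz Qfe Bef] rm [rp r1 r2]] hb hz cov.
have he : Q e = (2 * b)%N%:R by rewrite -Bef hb natrM.
have hf : Q f = (2 * b)%N%:R by rewrite Qfe.
apply: (@mk_model (rows3 e f z) (mx9 (map Posz [:: 2 * b; b; 0; b; 2 * b; 0; 0; 0; q0]%N))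
   _ _ _ _ [:: e; f; e - f; e + f; 2 *: e - f; 2 *: f - e; z]) => //.
- by apply: rows3N; [exact: root_in re|exact: root_in rf|exact: root_in rz].
- apply: pspan3 => n Nn; exists 2; first exact: coprime2p.
  have [||a [c [d E]]] := frame_span (n := n) re r2 rz _ ez _ Nn.
  + by rewrite !bformE Bef /qform subrr.
  + by rewrite !bformE ez fz; ring.
  exists (a - c), (2 * c), d; rewrite E intrB intrM.
  by apply/rowP=> ?; rewrite !mxE; ring.
- exact: (@gram_rows3 _ _ _ (2 * b)%N (2 * b)%N q0 b).
- exact: cg_gl.
- case=> [|[|[|[|[|[|[|[]]]]]]]] //= _; split=> //; try coef_tac; try refl_tac.
  + by rewrite (qformB pS) Bef he hf; ring.
  + by rewrite (qformD pS) Bef he hf !natrM; ring.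
  + by rewrite (qformB pS) qform_scale bformZl he hf hb !natrM; ring.
  + by rewrite (qformB pS) qform_scale bformZl (bformC pS) he hf hb !natrM; ring.
Qed.

Definition R9 : seq (seq int) := R3 ++ [:: [:: 0; -1; 0; -1; 0; 0; 0; 0; 1];
  [:: 0; 1; 0; 1; 0; 0; 0; 0; 1]; [:: 0; 0; -1; 0; 1; 0; -1; 0; 0]; [:: 0; 0; 1; 0; 1; 0; 1; 0; 0];
  [:: 1; 0; 0; 0; 0; -1; 0; -1; 0]; [:: 1; 0; 0; 0; 0; 1; 0; 1; 0]].
Definition r9 : seq (seq int) := r3 ++ [:: [:: 1; 1; 0]; [:: 1; -1; 0]; [:: 1; 0; 1]; [:: 1; 0; -1];
  [:: 0; 1; 1]; [:: 0; 1; -1]].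

Lemma model9 t x y z (q q' : nat) : B3sys S N t x y z -> Q x = q%:R -> Q (t *: (x + y)) = q'%:R ->
  covered S N [:: x; y; z; x + y; x - y; x + z; x - z; y + z; y - z] ->
  model S p k N (gl [:: q; 0; 0; 0; q; 0; 0; 0; q]%N) (map mx9 R9) (map rw3 r9)
   [:: q; q; q; q'; q'; q'; q'; q'; q'].
Proof.
move=> [[rx ry rz] [xy xz yz] [Qxy Qxz] ht [[r1 r2] [r3 r4] [r5 r6]]] hx hq' cov.
have hy : Q y = q%:R by rewrite -Qxy. have hz : Q z = q%:R by rewrite -Qxz.
have qE : q'%:R = t ^+ 2 * (2 * q%:R) by rewrite -hq' qform_scale (qformD pS) xy hx hy; ring.
have t0 : t != 0 by case: ht => ->.
(* 1/t is 1 or 2, prime to p, so the coordinates of x + y serve for the root t (x + y), and one list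
   [r9] covers both forms of the type. *)
have [c cc hc] : exists2 c : int, coprimez c p & c%:~R * t = 1.
  by case: ht => ->; [exists 1; rewrite ?mulr1|exists 2; [exact: coprime2p|by field]].
have hT w : c%:~R *: (t *: w) = w by rewrite scalerA hc scale1r.
apply: (@mk_model (rows3 x y z) (mx9 (map Posz [:: q; 0; 0; 0; q; 0; 0; 0; q]%N)) _ _ _ _
   [:: x; y; z; t *: (x + y); t *: (x - y); t *: (x + z); t *: (x - z); t *: (y + z); t *: (y - z)]) => //.
- by apply: rows3N; [exact: root_in rx|exact: root_in ry|exact: root_in rz].
- exact: orth_pspan.
- exact: (@gram_rows3 _ _ _ q q q 0).
- exact: cg_gl.
- case=> [|[|[|[|[|[|[|[|[|[]]]]]]]]]] //= _; split=> //; try coef_tac; try refl_tac;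
  first [by exists c => //; rewrite hT rw3_rows3 /= ?(mulrNz, mulr1z, mulr0z);
    apply/rowP=> ?; rewrite !mxE; ring |
    by rewrite qE qform_scale ?(qformB pS) ?(qformD pS) ?xy ?xz ?yz hx ?hy ?hz; ring |
    by rewrite qE qform_scale ?(qformB pS) ?(qformD pS) ?xy ?xz ?yz hy ?hx ?hz; ring].
- have par_t s w : par s w -> par s (t *: w).
    by move=> [a ->]; exists (a / t); rewrite scalerA mulfVK.
  move=> s rs; have [r hr pr] := cov s rs; move: hr; rewrite !inE.
  case/or4P=> [/eqP E|/eqP E|/eqP E|h]; try by exists r => //; rewrite E !inE eqxx ?orbT.
  have : t *: r \in [:: t *: (x + y); t *: (x - y); t *: (x + z); t *: (x - z); t *: (y + z); t *: (y - z)].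
    by move: h; rewrite !inE => /or4P[/eqP->|/eqP->|/eqP->|/or3P[]/eqP->]; rewrite eqxx ?orbT.
  by move=> h2; exists (t *: r); [rewrite in_cons in_cons in_cons h2 !orbT|exact: par_t].
Qed.

Lemma model0 F (D : 'I_3 -> nat) : (forall i, N (row i F)) ->
  (forall i j, exists2 m : int, B (row i F) (row j F) = m%:~R & cg (p ^ k)%N m ((D i)%:Z *+ (i == j))) ->
  pspan p N F -> covered S N [::] ->
  model S p k N (fun i j => (D i * (i == j))%N) (map mx9 [::]) (map rw3 [::]) [::].
Proof.
move=> FN gF sF cov; have [Gf hG] := int_gramF FN.
apply: (@mk_model F Gf _ [::] [::] [::] [::]) => // i j.
have [m hm cm] := gF i j; suff -> : Gf i j = m by move: cm; case: (i == j); rewrite ?muln1 ?muln0.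
by apply: (@intr_inj rat); rewrite -hm -gramE hG mxE.
Qed.
End Models.

Lemma det3 (R : comNzRingType) (A : 'M[R]_3) : \det A =
  A 0 0 * (A 1 1 * A 2 2 - A 1 2 * A 2 1) - A 0 1 * (A 1 0 * A 2 2 - A 1 2 * A 2 0)
  + A 0 2 * (A 1 0 * A 2 1 - A 1 1 * A 2 0).
Proof.
pose C m n := A (inord m) (inord n).
have E i j : A i j = C (val i) (val j) by rewrite /C !inord_val.
rewrite (expand_det_row _ 0) sum3 /cofactor !(expand_det_row _ 0) !big_ord_recl !big_ord0 /cofactor.
rewrite !det_mx11 !mxE !E /= /bump /=; ring.
Qed.

Lemma dig_codeN (P n : nat) (v : nat -> nat) : (0 < P)%N -> (forall i, (i < n)%N -> (v i < P)%N) ->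
  exists2 z : nat, (z < P ^ n)%N & forall i, (i < n)%N -> dig P z i = v i.
Proof.
move=> P0; elim: n v => [|n IH] v vP; first by exists 0%N.
have [z zP hz] := IH (fun i => v i.+1) (fun i hi => vP i.+1 hi).
have v0 := vP 0%N isT; exists (z * P + v 0)%N.
  by rewrite expnSr; have := leq_mul zP (leqnn P); lia.
case=> [|i] hi; rewrite /dig; first by rewrite expn0 divn1 modnMDl modn_small.
by rewrite expnS divnMA divnMDl// (divn_small v0) addn0; exact: hz.
Qed.

Lemma row_diag (d : 'rV[rat]_3) (A : 'M[rat]_3) i : row i (diag_mx d *m A) = d 0 i *: row i A.
Proof. by apply/rowP=> j; rewrite mul_diag_mx !mxE. Qed.

(** * Bases at p and their transition matrices *)

Section Unimodular.
Variables (p : nat) (N : set 'rV[rat]_3).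
Hypotheses (pp : prime p).
Notation pz k := (p ^ k)%N%:Z.

Lemma coprime_inv k (d : int) : coprimez d p -> exists2 d' : int, coprimez d' p & cg (pz k) (d' * d) 1.
Proof.
move=> cd; have := coprime_pk k.+1 cd => /coprimezP[[a b] /= E].
have h : cg (pz k.+1) (a * d) 1.
  rewrite /cg; have -> : a * d - 1 = - b * pz k.+1 by rewrite -E; ring.
  exact: dvdz_mull.
exists a; last by apply: cg_dvd h; rewrite dvdzE /= dvdn_exp2l.
rewrite (coprimez_p pp); apply/negP=> pa.
have : (p %| 1%:Z)%Z.
  have -> : 1%:Z = a * d - (a * d - 1) by ring.
  apply: rpredB; first exact: dvdz_mulr.
  by apply: dvdz_trans h; rewrite dvdzE /= dvdn_exp.
by rewrite dvdzE /= dvdn1 => /eqP p1; move: pp; rewrite p1.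
Qed.

Lemma digit_of (P : nat) (m : int) : (0 < P)%N -> exists2 k : nat, (k < P)%N & cg P k m.
Proof.
move=> P0; have h1 : 0 <= (m %% P)%Z by rewrite modz_ge0// eqz_nat -lt0n.
exists `|(m %% P)%Z|%N; first by rewrite -ltz_nat gez0_abs// ltz_pmod// ltz_nat.
by rewrite gez0_abs//; exact: cg_mod.
Qed.

Lemma coprime_prod3 (d : 'I_3 -> int) : (forall i, coprimez (d i) p) -> coprimez (\prod_i d i) p.
Proof.
move=> H; elim/big_ind: _ => //; first by rewrite coprimezE /= coprime1n.
by move=> a b ha hb; rewrite coprimezMl ha.
Qed.

Lemma map_int_inj : injective (map_mx intr : 'M[int]_3 -> 'M[rat]_3).
Proof. by move=> A C /matrixP E; apply/matrixP=> i j; have := E i j; rewrite !mxE => /intr_inj. Qed.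

Lemma adj_map (A : 'M[int]_3) : map_mx intr (\adj A) *m map_mx intr A = (\det A)%:~R%:M :> 'M[rat]_3.
Proof. by rewrite -map_mxM mul_adj_mx map_scalar_mx. Qed.

(** Nakayama's lemma. The relations for the rows of [W] read A W = Z F, where A is mod p a diagonal
    matrix of units; so det(A) is prime to p and the adjugate of A recovers the span of [W] from
    [F]. *)
Lemma nakayama (F W : 'M[rat]_3) : pspan p N W -> (forall i, N (row i W)) ->
  (forall n, N n -> exists2 d : int, coprimez d p & exists z : 'rV[int]_3,
     exists2 n', N n' & d%:~R *: n = map_mx intr z *m F + p%:R *: n') -> pspan p N F.
Proof.
move=> sW WN H.
have /choice[f Hf] : forall i : 'I_3, exists t : int * 'rV[int]_3 * 'rV[int]_3, coprimez t.1.1 p /\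
   t.1.1%:~R *: row i W = map_mx intr t.1.2 *m F + p%:R *: (map_mx intr t.2 *m W).
  move=> i.
  have [d cd [z [n' Nn E]]] := H _ (WN i); have [d' cd' [y E']] := sW _ Nn.
  exists (d' * d, d' *: z, y); split; first by rewrite /= coprimezMl cd' cd.
  rewrite /= intrM -scalerA E scalerDr map_mxZ -scalemxAl; congr (_ + _).
  by rewrite -E' !scalerA mulrC.
pose Dg : 'M[int]_3 := diag_mx (\row_i (f i).1.1).
pose Z : 'M[int]_3 := \matrix_i (f i).1.2; pose Y : 'M[int]_3 := \matrix_i (f i).2.
pose A := Dg - p%:Z *: Y.
have AW : map_mx intr A *m W = map_mx intr Z *m F.
  rewrite /A map_mxB mulmxBl map_mxZ -scalemxAl map_diag_mx; apply/row_matrixP=> i.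
  rewrite linearB linearZ /= row_diag !row_mul !mxE; have [_ ->] := Hf i.
  by rewrite -!map_row !rowK -pmulrn addrK.
have cA : coprimez (\det A) p.
  have h : cg p (\det A) (\det Dg).
    by apply: cg_det => i j; rewrite /cg !mxE addrAC subrr add0r rpredN; exact: dvdz_mulr.
  apply: (cg_coprime (cg_sym h)); rewrite det_diag; under eq_bigr do rewrite mxE.
  by apply: coprime_prod3 => i; case: (Hf i).
move=> n Nn; have [d cd [z E]] := sW _ Nn.
exists (\det A * d); first by rewrite coprimezMl cA.
exists (z *m \adj A *m Z); rewrite intrM -scalerA E !map_mxM -mulmxA -AW mulmxA.
by rewrite -(mulmxA (map_mx intr z)) adj_map mul_mx_scalar scalemxAl.
Qed.

Lemma pspan_mx (F W : 'M[rat]_3) : pspan p N W -> (forall i, N (row i F)) ->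
  exists2 d : int, coprimez d p & exists Z : 'M[int]_3, d%:~R *: F = map_mx intr Z *m W.
Proof.
move=> sW FN.
have /choice[f Hf] : forall i : 'I_3, exists t : int * 'rV[int]_3, coprimez t.1 p /\
   t.1%:~R *: row i F = map_mx intr t.2 *m W.
  move=> i.
  by have [d cd [z E]] := sW _ (FN i); exists (d, z).
pose Dg : 'M[int]_3 := diag_mx (\row_i (f i).1); pose Z : 'M[int]_3 := \matrix_i (f i).2.
have DF : map_mx intr Dg *m F = map_mx intr Z *m W.
  rewrite map_diag_mx; apply/row_matrixP=> i; rewrite row_diag !mxE row_mul.
  by have [_ ->] := Hf i; rewrite -map_row rowK.
exists (\det Dg).
  rewrite det_diag; under eq_bigr do rewrite mxE.
  by apply: coprime_prod3 => i; case: (Hf i).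
by exists (\adj Dg *m Z); rewrite map_mxM -mulmxA -DF mulmxA adj_map mul_scalar_mx.
Qed.

(** The two transition matrices are inverse to each other up to the scalar d d', so their
    determinants are prime to p. *)
Lemma transition (F W : 'M[rat]_3) : W \in unitmx -> pspan p N W -> pspan p N F ->
  (forall i, N (row i F)) -> (forall i, N (row i W)) ->
  exists2 d : int, coprimez d p & exists2 Z : 'M[int]_3, coprimez (\det Z) p &
    d%:~R *: F = map_mx intr Z *m W.
Proof.
move=> uW sW sF FN WN; have [d cd [Z hZ]] := pspan_mx sW FN; have [d' cd' [Z' hZ']] := pspan_mx sF WN.
exists d => //; exists Z => //.
have : map_mx intr (Z' *m Z) *m W = map_mx intr ((d * d')%:M : 'M[int]_3) *m W.
  rewrite map_mxM -mulmxA -hZ -scalemxAr -hZ' scalerA map_scalar_mx mul_scalar_mx /= intrM //.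
move=> /(can_inj (mulmxK uW)) /map_int_inj /(congr1 (fun A : 'M[int]_3 => \det A)).
rewrite det_mulmx det_scalar => E.
have : coprimez (\det Z' * \det Z) p by rewrite E coprimezXl// coprimezMl cd.
by rewrite coprimezMl => /andP[].
Qed.
End Unimodular.

(** * Witt cancellation for a single symmetry, to finite precision *)

Section A1.
Variables (S : 'M[rat]_3) (p : nat) (N : set 'rV[rat]_3).
Hypotheses (pS : posdef_space S) (pp : prime p) (op : odd p) (lN : integral_lattice S N).
Local Notation B := (bform S).
Local Notation Q := (qform S).
Local Notation root := (root S N).
Notation pz k := (p ^ k)%N%:Z.
Let gN : subgroup N := il_sub lN.
Let p0 : (0 < p)%N := prime_gt0 pp.
Let pZ0 k : pz k != 0. Proof. by rewrite eqz_nat expn_eq0 negb_and -lt0n p0. Qed.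

(** x and y have nearly the same norm, and w1, w2 are nearly orthogonal to y. The reflection in h =
    x - y, made integral by eta, carries y close to eta x and so w1, w2 to vectors nearly orthogonal
    to x. Projecting these exactly onto the complement of x changes their Gram matrix only by
    multiples of p^k. The a extra digits in the hypotheses pay for the division by q. *)
Lemma A1_core x y w1 w2 (q q' a k : nat) (eta : int) : root x -> Q x = q%:R -> q = (q' * p ^ a)%N ->
  coprime p q' -> N y -> N w1 -> N w2 ->
  dvr (pz (a + k)) (Q y - q%:R) -> dvr (pz (a + k)) (B y w1) -> dvr (pz (a + k)) (B y w2) ->
  pspan p N (rows3 y w1 w2) -> Q (x - y) = (pz a * eta)%:~R -> coprimez eta p -> (0 < k)%N ->
  exists f1 f2, [/\ N f1 /\ N f2, B x f1 = 0 /\ B x f2 = 0, pspan p N (rows3 x f1 f2) &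
    [/\ dvr (pz k) (B f1 f1 - B w1 w1), dvr (pz k) (B f1 f2 - B w1 w2) & dvr (pz k) (B f2 f2 - B w2 w2)]].
Proof.
move=> rx Qx qE cq' Ny Nw1 Nw2 hQy hyw1 hyw2 sW Qh ce k0.
have Nx := root_in rx; have x0 := root_neq0 rx.
have q0 : q%:R != 0 :> rat by rewrite -Qx (qform_eq0 pS).
have cq'z : coprimez q' p by rewrite coprimezE /= coprime_sym.
have pak : (pz a %| pz (a + k))%Z by rewrite dvdzE /= dvdn_exp2l// leq_addr.
have dq : dvr (pz a) q%:R by exists q'; rewrite -PoszM mulnC -qE -pmulrn.
(* 2 B(x,n) is an integer multiple of q because x is a root, and p^a divides q. *)
have dvx n : N n -> dvr (pz a) (B x n).
  move=> Nn; apply: (@dvr_gauss _ 2%R); first exact: (coprime_pk a (coprime2p op)).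
    exact: (il_int lN).
  have /intrP[m hm] := root_int lN rx Nn.
  have -> : 2%:~R * B x n = m%:~R * q%:R by rewrite -hm Qx mulfVK.
  exact: dvrZ.
have dvy n : N n -> dvr (pz a) (B y n).
  move=> Nn; apply: (@approx_dvr S p N (rows3 y w1 w2)) => //; first exact: (il_int lN).
  move=> j; rewrite row_rows3; case: (ord3P j) => -> /=; last 2 first.
  - exact: dvr_trans hyw1. - exact: dvr_trans hyw2.
  by rewrite -[B y y](subrK q%:R); apply: dvrD => //; exact: dvr_trans hQy.
have [h hE] : exists h, h = x - y by eexists.
have Nh : N h by rewrite hE; exact: subB.
rewrite -hE in Qh.
have dvh n : N n -> dvr (pz a) (B h n).
  by move=> Nn; rewrite hE !bformE; apply: dvrB; [exact: dvx|exact: dvy].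
have e0 : eta%:~R != 0 :> rat.
  by rewrite intr_eq0; apply/eqP=> E; move: ce; rewrite E (coprimez_p pp) dvdz0.
have pa0 : (pz a)%:~R != 0 :> rat by rewrite intr_eq0.
have tauh n (b : int) : B h n = (pz a * b)%:~R -> eta%:~R *: (n *m tau S h) = eta%:~R *: n - (2 * b)%:~R *: h.
  move=> hb; rewrite tauE scalerBr scalerA Qh hb; congr (_ - _ *: _).
  by rewrite !intrM; field; rewrite e0 pa0.
have TN n : N n -> N (eta%:~R *: (n *m tau S h)).
  by move=> Nn; have [b hb] := dvh n Nn; rewrite (tauh _ _ hb); apply: subB => //; exact: subZ.
have [m hm] := hQy.
have ytau : eta%:~R *: (y *m tau S h) = eta%:~R *: x + (pz k * m)%:~R *: h.
  have [b hb] := dvh y Ny; rewrite (tauh _ _ hb).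
  have E : (2 * b)%:~R = - (pz k * m)%:~R - eta%:~R :> rat.
    apply: (mulfI pa0); rewrite intrM mulrCA -intrM -hb mulrBr -intrM -Qh mulrN -!intrM mulrA.
    rewrite -PoszM -expnD -hm -Qx hE (qformB pS) !bformE /qform; ring.
  rewrite E hE; apply/rowP=> j; rewrite !mxE; ring.
have /isometryP isoB := isometry_tau pS h.
have [v vE] : exists v : 'rV[rat]_3 -> 'rV[rat]_3, forall w, v w = eta%:~R *: (w *m tau S h).
  by exists (fun w => eta%:~R *: (w *m tau S h)).
have vN w : N w -> N (v w) by move=> Nw; rewrite vE; exact: TN.
(* c undoes, mod p^k, the factor 2 eta that clearing the denominators of the projection and of the
   reflection introduces. *)
have [c cc hc] : exists2 c : int, coprimez c p & cg (pz k) (c * (2 * eta)) 1.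
  by apply: coprime_inv => //; rewrite coprimezMl (coprime2p op).
(* 2 B(x, v w)/q is an integer since x is a root; after the division by q the precision a + k still
   leaves it divisible by p^k. *)
have step w : N w -> dvr (pz (a + k)) (B y w) -> exists2 cw : int, dvr (pz k) cw%:~R &
    2 * B x (v w) = cw%:~R * q%:R.
  move=> Nw hw; have /intrP[cw hcw] := root_int lN rx (vN _ Nw).
  have E : 2 * B x (v w) = cw%:~R * q%:R by rewrite -hcw -Qx mulfVK// Qx.
  exists cw => //.
  have h1 : dvr (pz (a + k)) (B x (v w)).
    apply: (@dvr_gauss _ eta); first exact: coprime_pk.
      by apply: (il_int lN) => //; exact: vN.
    have -> : eta%:~R * B x (v w) = eta%:~R * (eta%:~R * B y w) - (pz k * m)%:~R * B h (v w).
      have := congr1 (fun u => B u (v w)) ytau; rewrite !vE !bformE isoB => ->; ring.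
    apply: dvrB; first by do 2!apply: dvrZ.
    have [b hb] := dvh _ (vN _ Nw); rewrite hb -intrM; apply/dvrE.
    by rewrite addnC expnD PoszM mulrACA; exact: dvdz_mulr.
  apply: (@dvr_gauss _ q'); [exact: coprime_pk|exact: intr_int|].
  apply: (@dvr_cancel _ (pz a)) => //; rewrite -PoszM -expnD.
  have -> : (pz a)%:~R * (q'%:~R * cw%:~R) = 2 * B x (v w) by rewrite E qE natrM -!pmulrn; ring.
  exact: (@dvrZ _ 2).
have [c1 dc1 E1] := step w1 Nw1 hyw1; have [c2 dc2 E2] := step w2 Nw2 hyw2.
pose fw w (cw : int) := c%:~R *: (2%:~R *: v w - cw%:~R *: x).
have Nf w cw : N w -> N (fw w cw).
  by move=> Nw; apply: subZ => //; apply: subB => //; apply: subZ => //; exact: vN.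
have two : 2%:~R = 2 :> rat by [].
have xf w (cw : int) : 2 * B x (v w) = cw%:~R * q%:R -> B x (fw w cw) = 0.
  move=> E; rewrite /fw bformZr bformDr bformNr !bformZr; rewrite /qform in Qx.
  by rewrite two Qx E subrr mulr0.
have ff w w' (cw cw' : int) : N w -> N w' -> 2 * B x (v w) = cw%:~R * q%:R ->
    2 * B x (v w') = cw'%:~R * q%:R -> dvr (pz k) cw%:~R ->
    dvr (pz k) (B (fw w cw) (fw w' cw') - B w w').
  move=> Nw Nw' E E' dw.
  have -> : B (fw w cw) (fw w' cw') - B w w' =
     ((c * (2 * eta)) ^+ 2 - 1)%:~R * B w w' - (c * c * cw' * q)%:~R * cw%:~R.
    have vv : B (v w) (v w') = eta%:~R * (eta%:~R * B w w') by rewrite !vE !bformE isoB.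
    rewrite {1}/fw bformZl bformDl bformNl !bformZl xf// mulr0 subr0 /fw bformZr bformDr bformNr !bformZr vv.
    rewrite (bformC pS (v w) x).
    have -> : B x (v w) = cw%:~R * q%:R / 2 by rewrite -E; field.
    by rewrite !(intrB, intrM, rmorphXn) /= -?pmulrn; field.
  apply: dvrB; last exact: dvrZ.
  have /intrP[b ->] := il_int lN Nw Nw'; rewrite -intrM; apply/dvrE; apply: dvdz_mulr.
  have -> : (c * (2 * eta)) ^+ 2 - 1 = (c * (2 * eta) - 1) * (c * (2 * eta) + 1) by ring.
  exact: dvdz_mulr.
exists (fw w1 c1), (fw w2 c2); split.
- by split; exact: Nf.
- by split; exact: xf.
(* Expanding the reflected n in y, w1, w2 and reflecting back expresses n in the new vectors up to a
   multiple of p^k h; as k > 0 this error lies in pN. *)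
- refine (nakayama sW (rows3N Ny Nw1 Nw2) _).
  move=> n Nn; have [d cd [z hz]] := sW _ (TN _ Nn).
  exists (2 * c * d * eta ^+ 2).
    by rewrite !coprimezMl (coprime2p op) cc cd ce.
  exists (rw3 [:: 2 * c * z 0 0 * eta + z 0 1 * c * c1 + z 0 2 * c * c2; z 0 1; z 0 2]).
  exists ((2 * c * z 0 0 * (pz k.-1 * m))%:~R *: h); first exact: subZ.
  have E := congr1 (fun u => u *m tau S h) hz.
  rewrite /= row_mul3 !row_rows3 /= !mulmxDl -!scalemxAl (tau_inv pS) in E.
  have -> : (2 * c * d * eta ^+ 2)%:~R *: n = (2 * c * eta)%:~R *: (d%:~R *: (eta%:~R *: n)).
    by rewrite !scalerA -!intrM; congr (_%:~R *: _); ring.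
  have -> : (2 * c * eta)%:~R *: (d%:~R *: (eta%:~R *: n)) = (2 * c)%:~R *: ((z 0 0)%:~R *: (eta%:~R *: (y *m tau S h)) +
     (z 0 1)%:~R *: v w1 + (z 0 2)%:~R *: v w2).
    by rewrite E !vE; apply/rowP=> j; rewrite !mxE !intrM; ring.
  rewrite rw3_rows3.
  rewrite ytau /fw; have -> : pz k = p%:Z * pz k.-1 by rewrite -PoszM -expnS prednK.
  move: (v w1) (v w2) => v1 v2; apply/rowP=> j; rewrite !mxE !(intrD, intrM); ring.
- by split; apply: ff.
Qed.

(** A primitive x has a coordinate in [W] that is a unit at p, so x can replace that basis vector.
    The other two are made orthogonal to x by passing to 2 y - c x, where c = 2 B(x,y)/Q(x) is an
    integer. *)
Lemma A1_basis x (W : 'M[rat]_3) : root x -> pspan p N W -> (forall i, N (row i W)) ->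
  exists f1 f2, [/\ N f1 /\ N f2, B x f1 = 0 /\ B x f2 = 0 & pspan p N (rows3 x f1 f2)].
Proof.
move=> rx sW WN; have Nx := root_in rx; have [d cd [z hz]] := sW _ Nx.
have qx0 : Q x != 0 by rewrite (qform_eq0 pS); exact: root_neq0 rx.
have [y1 [y2 [Ny1 Ny2 sy]]] : exists y1 y2, [/\ N y1, N y2 & pspan p N (rows3 x y1 y2)].
  have pick (i : 'I_3) : coprimez (z 0 i) p -> exists y1 y2, [/\ N y1, N y2 & pspan p N (rows3 x y1 y2)].
    rewrite row_mul3 in hz; move=> ci.
    have [a [b [Na Nb H]]] : exists y1 y2, [/\ N y1, N y2 & forall n, N n -> exists2 d : int, coprimez d p &
        exists a b c : int, d%:~R *: n = a%:~R *: x + b%:~R *: y1 + c%:~R *: y2].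
      case: (ord3P i) ci => -> ci.
      - exists (row 1 W), (row 2 W); split=> // n Nn; have [e ce [t ht]] := sW _ Nn.
        exists (z 0 0 * e); first by rewrite coprimezMl ci.
        exists (t 0 0 * d), (z 0 0 * t 0 1 - t 0 0 * z 0 1), (z 0 0 * t 0 2 - t 0 0 * z 0 2).
        rewrite intrM -scalerA ht row_mul3 [(t 0 0 * d)%:~R]intrM -[(_ * d%:~R) *: x]scalerA hz.
        by apply/rowP=> j; rewrite !mxE !(intrB, intrM); ring.
      - exists (row 0 W), (row 2 W); split=> // n Nn; have [e ce [t ht]] := sW _ Nn.
        exists (z 0 1 * e); first by rewrite coprimezMl ci.
        exists (t 0 1 * d), (z 0 1 * t 0 0 - t 0 1 * z 0 0), (z 0 1 * t 0 2 - t 0 1 * z 0 2).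
        rewrite intrM -scalerA ht row_mul3 [(t 0 1 * d)%:~R]intrM -[(_ * d%:~R) *: x]scalerA hz.
        by apply/rowP=> j; rewrite !mxE !(intrB, intrM); ring.
      - exists (row 0 W), (row 1 W); split=> // n Nn; have [e ce [t ht]] := sW _ Nn.
        exists (z 0 2 * e); first by rewrite coprimezMl ci.
        exists (t 0 2 * d), (z 0 2 * t 0 0 - t 0 2 * z 0 0), (z 0 2 * t 0 1 - t 0 2 * z 0 1).
        rewrite intrM -scalerA ht row_mul3 [(t 0 2 * d)%:~R]intrM -[(_ * d%:~R) *: x]scalerA hz.
        by apply/rowP=> j; rewrite !mxE !(intrB, intrM); ring.
    by exists a, b; split=> //; exact: pspan3.
  case: (boolP (coprimez (z 0 0) p)) => [/pick//|n0].
  case: (boolP (coprimez (z 0 1) p)) => [/pick//|n1].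
  case: (boolP (coprimez (z 0 2) p)) => [/pick//|n2].
  (* If no coordinate were a unit, x would be p times a vector of N. *)
  have dz i : (p %| z 0%R i)%Z.
    by apply/negPn; rewrite -(coprimez_p pp); case: (ord3P i) => ->.
  pose n := map_mx intr (\row_i (z 0%R i %/ p)%Z) *m W.
  have Nn : N n.
    by rewrite /n row_mul3; apply: subD => //; [apply: subD => //|]; exact: subZ.
  have dx : d%:~R *: x = p%:R *: n.
    rewrite hz /n scalemxAl; congr (_ *m _); apply/rowP=> i; rewrite !mxE.
    by rewrite -[p%:R]/(p%:Z%:~R) -intrM mulrC divzK.
  have /coprimezP[[u v] /= uv] := cd.
  have [[_ prim] _ _] := rx.
  have E : x = (p%:Z)%:~R *: (u%:~R *: n + v%:~R *: x).
    have E0 : x = u%:~R *: (d%:~R *: x) + v%:~R *: (p%:R *: x).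
      rewrite !scalerA -scalerDl -[p%:R]/((p%:Z)%:~R) -!intrM -intrD uv scale1r //.
    rewrite {1}E0 dx -pmulrn; apply/rowP=> j; rewrite !mxE; ring.
  have := prim p _ _ E; rewrite absz_nat => p1; move: pp; rewrite p1 //.
  by apply: subD => //; exact: subZ.
have /intrP[c1 h1] := root_int lN rx Ny1; have /intrP[c2 h2] := root_int lN rx Ny2.
exists (2%:~R *: y1 - c1%:~R *: x), (2%:~R *: y2 - c2%:~R *: x); split.
- by split; apply: subB => //; exact: subZ.
- by split; rewrite bformDr bformNr !bformZr -?h1 -?h2 mulfVK// subrr.
apply: pspan3 => n Nn; have [e ce [t ht]] := sy _ Nn; exists (2 * e).
  by rewrite coprimezMl (coprime2p op).
exists (2 * t 0 0 + t 0 1 * c1 + t 0 2 * c2), (t 0 1), (t 0 2).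
rewrite intrM -scalerA ht row_mul3 !row_rows3 /=.
by apply/rowP=> j; rewrite !mxE !(intrD, intrM); ring.
Qed.
End A1.

(** * Bounded searches for Gram matrices *)

Section Search.
Variables (p K : nat) (D : 'I_3 -> nat).
(** t codes a 3 x 3 matrix mod p^K by its nine digits. *)
Definition tent t (i j : 'I_3) : nat := dig (p ^ K) t (3 * i + j).
Definition gA t (i j : 'I_3) : nat := (tent t i 0%R * D 0%R * tent t j 0%R +
  tent t i 1%R * D 1%R * tent t j 1%R + tent t i 2%R * D 2%R * tent t j 2%R)%N.
(** The determinant is split into its positive terms, here, and its negative terms, in [detn], so
    that the test stays within natural numbers. *)
Definition detp t : nat := (tent t 0%R 0%R * tent t 1%R 1%R * tent t 2%R 2%R +
  tent t 0%R 1%R * tent t 1%R 2%R * tent t 2%R 0%R + tent t 0%R 2%R * tent t 1%R 0%R * tent t 2%R 1%R)%N.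
Definition detn t : nat := (tent t 0%R 2%R * tent t 1%R 1%R * tent t 2%R 0%R +
  tent t 0%R 1%R * tent t 1%R 0%R * tent t 2%R 2%R + tent t 0%R 0%R * tent t 1%R 2%R * tent t 2%R 1%R)%N.
(** The matrix coded by t is invertible mod p, and it brings the diagonal form D to one in which a
    vector of norm q splits off mod p^K. *)
Definition okA q t : bool := [&& (gA t 0%R 0%R == q %[mod p ^ K])%N, (gA t 0%R 1%R == 0 %[mod p ^ K])%N,
  (gA t 0%R 2%R == 0 %[mod p ^ K])%N & ~~ (detp t == detn t %[mod p])%N].
(** Digit 0 of z is the off-diagonal entry b, digit 1 a unit. The factor al^2 (al + 3 b) is the
    determinant of the matrix with al + b on the diagonal and b elsewhere, compared with that of D
    up to the square of the unit. *)
Definition okB al z : bool := ~~ (p %| dig (p ^ K) z 1)%N &&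
  (al ^ 2 * (al + 3 * dig (p ^ K) z 0) * (dig (p ^ K) z 1) ^ 2 == D 0%R * D 1%R * D 2%R %[mod p ^ K])%N.
Definition Tz t : 'M[int]_3 := \matrix_(i, j) (tent t i j)%:Z.
Definition Dz : 'M[int]_3 := diag_mx (\row_i (D i)%:Z).

Lemma gAE t i j : (gA t i j)%:Z = (Tz t *m Dz *m (Tz t)^T) i j.
Proof. by rewrite mxE sum3 mul_mx_diag !mxE /gA !PoszD !PoszM. Qed.

Lemma detAE t : prime p -> ~~ (detp t == detn t %[mod p])%N = coprimez (\det (Tz t)) p.
Proof.
move=> pp; rewrite (coprimez_p pp) cg_nat /cg; congr (~~ (p %| _)%Z).
by rewrite det3 !mxE /detp /detn !PoszD !PoszM; ring.
Qed.
End Search.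

Lemma digits (P n : nat) (c : nat -> int) : (0 < P)%N ->
  exists2 z : nat, (z < P ^ n)%N & forall i, (i < n)%N -> cg P (dig P z i) (c i).
Proof.
move=> P0; have /choice[v hv] : forall i, exists k : nat, (k < P)%N /\ cg P k (c i).
  by move=> i; have [k] := digit_of (c i) P0; exists k.
have [z zP hz] := @dig_codeN P n v P0 (fun i _ => (hv i).1).
by exists z => // i hi; rewrite hz//; exact: (hv i).2.
Qed.

(** * Every solution of a search gives a model *)

Section Rigidity.
Variables (S : 'M[rat]_3) (p : nat) (N : set 'rV[rat]_3) (K : nat) (D : 'I_3 -> nat).
Hypotheses (pS : posdef_space S) (pp : prime p) (op : odd p) (lN : integral_lattice S N).
Hypotheses (K0 : (0 < K)%N) (jN : approx_jordan S p N D K).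
Local Notation B := (bform S).
Local Notation Q := (qform S).
Local Notation root := (root S N).
Notation pz k := (p ^ k)%N%:Z.
Notation P := (p ^ K)%N.
Let gN : subgroup N := il_sub lN.
Let p0 : (0 < p)%N := prime_gt0 pp.
Let P0 : (0 < P)%N. Proof. by rewrite expn_gt0 p0. Qed.
Let pP : (p%:Z %| P%:Z)%Z. Proof. by rewrite dvdzE /= dvdn_exp. Qed.

Lemma gramM (Z : 'M[int]_3) (W : 'M[rat]_3) (G : 'M[int]_3) : gram S W = map_mx intr G ->
  gram S (map_mx intr Z *m W) = map_mx intr (Z *m G *m Z^T).
Proof. by move=> gW; rewrite !map_mxM -gW /gram trmx_mul !mulmxA map_trmx. Qed.

Lemma approx_data : exists (W : 'M[rat]_3) (GW : 'M[int]_3),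
  [/\ forall i, N (row i W), pspan p N W, W \in unitmx, gram S W = map_mx intr GW &
    forall i j, cg P (GW i j) (Dz D i j)].
Proof.
have [W [WN gW sW]] := jN; have [GW hG] := int_gramF lN WN.
exists W, GW; split=> //; first exact: (pspan_unit pp lN sW).
move=> i j; have [m hm cm] := gW i j.
have -> : GW i j = m by apply: (@intr_inj rat); rewrite -hm -gramE hG mxE.
by move: cm; rewrite !mxE; case: (i == j).
Qed.

Lemma cg_mx3 (A A' C C' E E' : 'M[int]_3) : (forall i j, cg P (A i j) (A' i j)) ->
  (forall i j, cg P (C i j) (C' i j)) -> (forall i j, cg P (E i j) (E' i j)) ->
  forall i j, cg P ((A *m C *m E) i j) ((A' *m C' *m E') i j).
Proof. by move=> h1 h2 h3; apply: cg_mx => //; exact: cg_mx. Qed.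

(** A solution is the basis of [A1_basis], written in the approximate Jordan basis and multiplied by
    the inverse mod p^K of its common denominator. *)
Lemma A1_exists x (q : nat) : root x -> Q x = q%:R ->
  exists2 t, (t < P ^ 9)%N & okA p K D q t.
Proof.
move=> rx Qx; have [W [GW [WN sW uW gW hG]]] := approx_data.
have [f1 [f2 [[Nf1 Nf2] [xf1 xf2] sF]]] := A1_basis pS pp op lN rx sW WN.
have FN := rows3N (root_in rx) Nf1 Nf2.
have [GF gF] := int_gramF lN FN.
have [d cd [Z cZ hZ]] := transition uW sW sF FN WN.
have [d' cd' hd'] := coprime_inv pp K cd.
have E : d ^+ 2 *: GF = Z *m GW *m Z^T.
  apply: map_int_inj; rewrite -(gramM Z gW) -hZ map_mxZ -gF /gram linearZ /= -!scalemxAl -scalemxAr scalerA.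
  by rewrite expr2 intrM.
have [t tP ht] := digits 9 (fun m => d' * Z (inord (m %/ 3)) (inord (m %% 3))) P0.
have hT i j : cg P (Tz p K t i j) ((d' *: Z) i j).
  rewrite !mxE /tent; have := ht (3 * i + j)%N.
  have -> : ((3 * i + j) %/ 3)%N = i by rewrite mulnC divnMDl// divn_small// addn0.
  have -> : ((3 * i + j) %% 3)%N = j by rewrite mulnC modnMDl modn_small.
  by rewrite !inord_val; apply; have := ltn_ord i; have := ltn_ord j; lia.
have hgA i j : cg P (gA p K D t i j) (GF i j).
  rewrite gAE; apply: (@cg_trans _ (((d' *: Z) *m GW *m (d' *: Z)^T) i j)).
    apply: cg_mx3 => // a b; first by apply: cg_sym; exact: hG.
    by rewrite mxE [X in cg _ _ X]mxE; exact: hT.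
  rewrite linearZ /= -!scalemxAl -scalemxAr scalerA -E scalerA mxE.
  have -> : d' * d' * d ^+ 2 * GF i j = (d' * d) * (d' * d) * GF i j by ring.
  rewrite -[X in cg _ _ X]mul1r -[1]mulr1; apply: cgM; last exact: cg_refl.
  exact: cgM.
have GE i j (m : int) : B (row i (rows3 x f1 f2)) (row j (rows3 x f1 f2)) = m%:~R -> GF i j = m.
  by move=> h; apply: (@intr_inj rat); rewrite -h -gramE gF mxE.
exists t => //; rewrite /okA (detAE _ _ pp) !cg_nat.
have h00 := hgA 0 0; rewrite (GE 0 0 q) ?row_rows3// in h00.
have h01 := hgA 0 1; rewrite (GE 0 1 0) ?row_rows3// in h01.
have h02 := hgA 0 2; rewrite (GE 0 2 0) ?row_rows3// in h02.
rewrite h00 h01 h02 /=; apply: (@cg_coprime _ (\det (d' *: Z))).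
  by apply: cg_dvd pP _; apply: cg_det => i j; apply: cg_sym; exact: hT.
by rewrite detZ coprimezMl coprimezXl.
Qed.

Lemma dvr_cgr (m m' : int) k : (k <= K)%N -> cg P m m' -> dvr (pz k) (m%:~R - m'%:~R).
Proof.
move=> kK h; rewrite -mulrNz -intrD; apply/dvrE; apply: dvdz_trans h.
by rewrite dvdzE /= dvdn_exp2l.
Qed.

(** Whichever solution the search returns, [A1_core] moves its last two vectors into the orthogonal
    complement of x and keeps their Gram matrix mod p^k. The precision q + k is enough because the
    order a of q at p satisfies a < p^a <= q. *)
Lemma A1_model x (q t k : nat) : root x -> Q x = q%:R -> okA p K D q t -> (q + k <= K)%N -> (0 < k)%N ->
  covered S N [:: x] ->
  model S p k N (gA p K D t) (map mx9 [:: [:: -1; 0; 0; 0; 1; 0; 0; 0; 1]])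
    (map rw3 [:: [:: 1; 0; 0]]) [:: q].
Proof.
move=> rx Qx; rewrite /okA (detAE _ _ pp) !cg_nat => /and4P[k00 k01 k02 cT] qK k0 cov.
have [W [GW [WN sW uW gW hG]]] := approx_data.
have x0 := root_neq0 rx; have Nx := root_in rx.
have q0 : (0 < q)%N by rewrite -(ltr_nat rat) -Qx (qform_gt0 pS).
have [q' cq' qE] := pfactor_coprime pp q0; set a := logn p q in qE.
have aq : (a <= q)%N.
  apply: leq_trans (ltnW (ltn_expl a (prime_gt1 pp))) _.
  by rewrite [X in (_ <= X)%N]qE leq_pmull// lt0n; apply: contraTneq q0 => E; rewrite qE E mul0n.
pose T := Tz p K t; pose W' := map_mx intr T *m W.
have gW' := gramM T gW; rewrite -/W' in gW'.
have W'N i : N (row i W').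
  by rewrite row_mul -map_row row_mul3; apply: subD => //; [apply: subD => //|]; exact: subZ.
have sW' : pspan p N W'.
  move=> n Nn; have [d cd [z hz]] := sW _ Nn; exists (\det T * d); first by rewrite coprimezMl cT.
  exists (z *m \adj T); rewrite /W' intrM -scalerA hz map_mxM -!mulmxA.
  by rewrite [map_mx intr (\adj T) *m _]mulmxA adj_map mul_scalar_mx scalemxAr.
have bW' i j : exists2 m : int, B (row i W') (row j W') = m%:~R & cg P m (gA p K D t i j).
  exists ((T *m GW *m T^T) i j); first by rewrite -gramE gW' mxE.
  by rewrite gAE; apply: cg_mx3 => // c b; exact: cg_refl.
have rW' : rows3 (row 0 W') (row 1 W') (row 2 W') = W'.
  by apply/row_matrixP=> i; rewrite row_rows3; case: (ord3P i) => ->.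
set y := row 0 W' in rW'; set w1 := row 1 W' in rW'; set w2 := row 2 W' in rW'.
have akK : (a + k <= K)%N by apply: leq_trans qK; rewrite leq_add2r.
have hy : dvr (pz (a + k)) (Q y - q%:R).
  have [m hm cm] := bW' 0 0; rewrite /qform hm; apply: (@dvr_cgr m q) => //; exact: cg_trans cm k00.
have hy1 : dvr (pz (a + k)) (B y w1).
  have [m hm cm] := bW' 0 1; rewrite hm -[_%:~R]subr0; apply: (@dvr_cgr m 0) => //; exact: cg_trans cm k01.
have hy2 : dvr (pz (a + k)) (B y w2).
  have [m hm cm] := bW' 0 2; rewrite hm -[_%:~R]subr0; apply: (@dvr_cgr m 0) => //; exact: cg_trans cm k02.
have Ny : N y := W'N 0. have Nw1 : N w1 := W'N 1. have Nw2 : N w2 := W'N 2.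
(* Q(x - y) + Q(x + y) is about 4q, so one of the two has the p-adic order of q. *)
have [y' [eta [Ny' ce Qe [hy' hy1' hy2' sy']]]] : exists y' (eta : int),
   [/\ N y', coprimez eta p, Q (x - y') = (pz a * eta)%:~R &
   [/\ dvr (pz (a + k)) (Q y' - q%:R), dvr (pz (a + k)) (B y' w1), dvr (pz (a + k)) (B y' w2) &
     pspan p N (rows3 y' w1 w2)]].
  have pak : (pz a %| pz (a + k))%Z by rewrite dvdzE /= dvdn_exp2l// leq_addr.
  have pa1k : (pz a.+1 %| pz (a + k))%Z by rewrite dvdzE /= dvdn_exp2l//; lia.
  have pa0 : pz a != 0 by rewrite eqz_nat expn_eq0 negb_and -lt0n p0.
  have dq : dvr (pz a) q%:R by exists q'; rewrite -PoszM mulnC -qE -pmulrn.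
  have d2 : dvr (pz a) (2 * B x y).
    have /intrP[m hm] := root_int lN rx Ny.
    have -> : 2 * B x y = m%:~R * q%:R by rewrite -hm Qx mulfVK// pnatr_eq0 -lt0n.
    exact: dvrZ.
  have dy : dvr (pz a) (Q y) by rewrite -[Q y](subrK q%:R); apply: dvrD => //; exact: dvr_trans hy.
  have [e1 h1] : dvr (pz a) (Q (x - y)).
    by rewrite (qformB pS) Qx; apply: dvrD => //; exact: dvrB.
  have [e2 h2] : dvr (pz a) (Q (x - - y)).
    by rewrite opprK (qformD pS) Qx; apply: dvrD => //; exact: dvrD.
  case: (boolP (coprimez e1 p)) => [c1|n1].
    by exists y, e1; split=> //; split=> //; rewrite rW'.
  case: (boolP (coprimez e2 p)) => [c2|n2].
    exists (- y), e2; split=> //; first exact: subN.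
    split.
    - by rewrite /qform bformNl bformNr opprK.
    - by rewrite bformNl; exact: dvrN.
    - by rewrite bformNl; exact: dvrN.
    - apply: pspan3 => n Nn; have [d cd [z hz]] := sW' _ Nn; exists d => //.
      exists (- z 0 0), (z 0 1), (z 0 2); rewrite hz row_mul3 mulrNz scaleNr scalerN opprK //.
  rewrite !(coprimez_p pp) !negbK in n1 n2; exfalso.
  have : dvr (pz a.+1) (4 * q%:R).
    have -> : 4 * q%:R = Q (x - y) + Q (x - - y) - 2 * (Q y - q%:R).
      rewrite opprK (qformB pS) (qformD pS) Qx; ring.
    have dm e' : (p %| e')%Z -> dvr (pz a.+1) (pz a * e')%:~R.
      by move=> h; apply/dvrE; rewrite expnSr PoszM dvdz_mul2l.
    apply: dvrB; first by rewrite h1 h2; apply: dvrD; exact: dm.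
    by apply: (@dvrZ _ 2); exact: dvr_trans hy.
  rewrite -natrM pmulrn dvrE [X in (4 * X)%N]qE mulnA dvdzE /= expnS dvdn_pmul2r ?expn_gt0 ?p0//.
  rewrite Euclid_dvdM// => /orP[|].
    have -> : 4%N = (2 * 2)%N by []. rewrite Euclid_dvdM// orbb dvdn_prime2// => /eqP p2.
    by move: op; rewrite p2.
  by rewrite prime_coprime// in cq'; apply/negP.
have [f1 [f2 [[Nf1 Nf2] [xf1 xf2] sF [h11 h12 h22]]]] :=
  A1_core pS pp op lN rx Qx qE cq' Ny' Nw1 Nw2 hy' hy1' hy2' sy' Qe ce k0.
have FN := rows3N Nx Nf1 Nf2; have [Gf gF] := int_gramF lN FN.
have GE (i j : 'I_3) : (Gf i j)%:~R = B (nth 0 [:: x; f1; f2] i) (nth 0 [:: x; f1; f2] j).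
  by rewrite -!row_rows3 -gramE gF mxE.
have G0 (i j : 'I_3) : B (nth 0 [:: x; f1; f2] i) (nth 0 [:: x; f1; f2] j) = 0 -> Gf i j = 0.
  by move=> h; apply: (@intr_inj rat); rewrite GE h.
have kK : (k <= K)%N by apply: leq_trans qK; exact: leq_addl.
have fin (i j : 'I_3) (m' : nat) r : (Gf i j)%:~R = r -> dvr (pz k) (r - m'%:~R) -> cg (p ^ k)%N (Gf i j) m'.
  by move=> <-; rewrite -mulrNz -intrD => /dvrE.
have fin2 (i j : 'I_3) (f f' w w' : 'rV[rat]_3) : nth 0 [:: x; f1; f2] i = f -> nth 0 [:: x; f1; f2] j = f' ->
   row i W' = w -> row j W' = w' -> dvr (pz k) (B f f' - B w w') -> cg (p ^ k)%N (Gf i j) (gA p K D t i j).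
  move=> ef ef' <- <- h; apply: (fin i j _ (B f f')); first by rewrite GE ef ef'.
  have [m hm cm] := bW' i j; rewrite hm in h; rewrite -[B f f'](subrK m%:~R) -addrA.
  by apply: dvrD => //; exact: dvr_cgr.
have gAC (i j : 'I_3) : gA p K D t i j = gA p K D t j i by rewrite /gA; ring.
have fin0 (i j : 'I_3) : Gf i j = 0 -> cg P (gA p K D t i j) 0 -> cg (p ^ k)%N (Gf i j) (gA p K D t i j).
  move=> -> h; apply: cg_sym; apply: cg_dvd h; by rewrite dvdzE /= dvdn_exp2l.
apply: (@mk_model S p k N pS pp lN (rows3 x f1 f2) Gf _ _ _ _ [:: x]) => //.
- move=> i j; case: (ord3P i) => ->; case: (ord3P j) => ->.
  + apply: (fin 0 0 _ q%:R); first by rewrite GE.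
    rewrite -opprB; apply: dvrN; apply: (@dvr_cgr (gA p K D t 0%R 0%R) q) => //.
  + by apply: fin0 => //; exact: G0.
  + by apply: fin0 => //; exact: G0.
  + by apply: fin0; [apply: G0; rewrite (bformC pS)|rewrite gAC].
  + exact: (@fin2 1 1 f1 f1 w1 w1).
  + exact: (@fin2 1 2 f1 f2 w1 w2).
  + by apply: fin0; [apply: G0; rewrite (bformC pS)|rewrite gAC].
  + by apply: (@fin2 2 1 f2 f1 w2 w1) => //; rewrite (bformC pS f2) (bformC pS w2).
  + exact: (@fin2 2 2 f2 f2 w2 w2).
- case=> //= _; split=> //.
    exists 1; first by rewrite coprimezE /= coprime1n.
    by rewrite rw3_rows3 !mulr1z !mulr0z !scale1r !scale0r !addr0.
  have g10 : Gf 1 0 = 0 by apply: G0; rewrite (bformC pS).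
  have g20 : Gf 2 0 = 0 by apply: G0; rewrite (bformC pS).
  move=> i j; case: (ord3P i) => ->; case: (ord3P j) => ->; rewrite /= ?g10 ?g20; ring.
Qed.

(** Each symmetry exchanges two of the three vectors of [A2_basis]. *)
Definition RA : seq (seq int) := [:: [:: 1; 0; 0; 0; 0; 1; 0; 1; 0]; [:: 0; 1; 0; 1; 0; 0; 0; 0; 1];
  [:: 0; 0; 1; 0; 1; 0; 1; 0; 0]].
Definition rA : seq (seq int) := [:: [:: 0; -1; 1]; [:: 1; -1; 0]; [:: -1; 0; 1]].

Definition circ (a b : int) := [:: a + b; b; b; b; a + b; b; b; b; a + b].

Lemma gram_circ g0 g1 g2 (a b : int) : Q g0 = (a + b)%:~R -> Q g1 = Q g0 -> Q g2 = Q g0 ->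
  B g0 g1 = b%:~R -> B g0 g2 = B g0 g1 -> B g1 g2 = B g0 g1 ->
  gram S (rows3 g0 g1 g2) = map_mx intr (mx9 (circ a b)).
Proof.
move=> h0 h1 h2 h01 h02 h12; apply/matrixP=> i j; rewrite gramE !row_rows3 !mxE.
case: (ord3P i) => ->; case: (ord3P j) => -> /=; rewrite ?(bformC pS g2 g0) ?(bformC pS g1 g0) ?(bformC pS g2 g1);
  by rewrite ?h12 ?h02 -?/(Q _) ?h1 ?h2 ?h0 ?h01.
Qed.

(* Comparing determinants gives the off-diagonal entry up to the square of a p-adic unit. *)
Lemma A2_data e f (al : nat) : A2sys S N e f -> Q e = (2 * al)%N%:R -> exists g0 g1 g2 (b s : int),
  [/\ [/\ N g0, N g1 & N g2], f = g0 - g1 /\ e = g2 - g1,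
   (forall n, N n -> exists a b c : int, n = a%:~R *: g0 + b%:~R *: g1 + c%:~R *: g2),
   [/\ Q g0 = (al%:Z + b)%:~R, Q g1 = Q g0, Q g2 = Q g0 & [/\ B g0 g1 = b%:~R, B g0 g2 = B g0 g1 & B g1 g2 = B g0 g1]] &
   coprimez s p /\ cg P (al%:Z ^+ 2 * (al%:Z + 3 * b) * s ^+ 2) ((D 0)%:Z * (D 1)%:Z * (D 2)%:Z)].
Proof.
move=> sys Qe; have [g0 [g1 [g2 [[N0 N1 N2] sp [Q1 Q2 B02 B12] fE eE]]]] := A2_basis pS lN sys.
have /intrP[b hb] := il_int lN N0 N1.
have hq : Q g0 = (al%:Z + b)%:~R.
  have : 2 * Q g0 = 2 * (al%:Z + b)%:~R.
    have := Qe; rewrite eE (qformB pS) (bformC pS) B12 hb Q1 Q2 natrM intrD -pmulrn => h; lra.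
  by move/mulfI; apply; rewrite pnatr_eq0.
have [W [GW [WN sW uW gW hG]]] := approx_data.
have sF : pspan p N (rows3 g0 g1 g2).
  apply: pspan3 => n Nn; exists 1; first by rewrite coprimezE /= coprime1n.
  by have [a [c [d E]]] := sp n Nn; exists a, c, d; rewrite scale1r.
have FN := rows3N N0 N1 N2.
have gF := gram_circ hq Q1 Q2 hb B02 B12.
have [d cd [Z cZ hZ]] := transition uW sW sF FN WN.
have [z' cz' hz'] := coprime_inv pp K cZ.
have E : d ^+ 2 *: mx9 (circ al b) = Z *m GW *m Z^T.
  apply: map_int_inj; rewrite -(gramM Z gW) -hZ map_mxZ -gF /gram linearZ /= -!scalemxAl -scalemxAr scalerA.
  by rewrite expr2 intrM.
exists g0, g1, g2, b, (d ^+ 3 * z'); split=> //; split.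
  by rewrite coprimezMl coprimezXl.
have dG : cg P (\det GW) ((D 0)%:Z * (D 1)%:Z * (D 2)%:Z).
  have -> : (D 0)%:Z * (D 1)%:Z * (D 2)%:Z = \det (Dz D).
    by rewrite det3 /Dz !mxE /=; ring.
  by apply: cg_det => i j; exact: hG.
apply: cg_trans dG.
have := congr1 (fun A : 'M[int]_3 => \det A) E; rewrite detZ !det_mulmx det_tr det3 !mxE /= => Ed.
have -> : al%:Z ^+ 2 * (al%:Z + 3 * b) * (d ^+ 3 * z') ^+ 2 = (z' * \det Z) * (z' * \det Z) * \det GW.
  have -> : z' * \det Z * (z' * \det Z) * \det GW = z' ^+ 2 * (\det Z * \det GW * \det Z) by ring.
  by rewrite -Ed; ring.
rewrite -[X in cg _ _ X]mul1r -[1]mulr1; apply: cgM; last exact: cg_refl.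
exact: cgM.
Qed.

Lemma A2_exists e f (al : nat) : A2sys S N e f -> Q e = (2 * al)%N%:R ->
  exists2 z, (z < P ^ 2)%N & okB p K D al z.
Proof.
move=> sys Qe; have [g0 [g1 [g2 [b [s [_ _ _ _ [cs hs]]]]]]] := A2_data sys Qe.
have [z zP hz] := digits 2 (fun i => if i is 0%N then b else s) P0.
have h0 := hz 0%N isT; have h1 := hz 1%N isT; exists z => //; rewrite /okB; apply/andP; split.
  have := cg_coprime (cg_dvd pP (cg_sym h1)) cs; rewrite (coprimez_p pp) => /negP h; apply/negP=> h'.
  by apply: h; rewrite dvdzE.
rewrite cg_nat; move: h0 h1; move: (dig P z 0) (dig P z 1) => b0 s0 h0 h1.
have -> : (al ^ 2 * (al + 3 * b0) * s0 ^ 2)%N%:Z = al%:Z ^+ 2 * (al%:Z + 3 * b0%:Z) * s0%:Z ^+ 2.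
  by rewrite -!mulnn !PoszM PoszD PoszM; ring.
rewrite !PoszM; apply: cg_trans hs.
apply: cgM; last by rewrite !expr2; exact: cgM.
apply: cgM; first exact: cg_refl.
apply: cgD; first exact: cg_refl.
by apply: cgM => //; exact: cg_refl.
Qed.

(** For p = 3 one of u and -u is 1 mod 3; otherwise 3 is invertible mod p^K. Factors 1 + 3 t are
    wanted because adding t (g0 + g1 + g2) to each g_i multiplies al + 3 b by (1 + 3 t)^2. *)
Lemma square_1mod3 (u : int) : coprimez u p ->
  exists t : int, coprimez (1 + 3 * t) p /\ cg P ((1 + 3 * t) ^+ 2) (u ^+ 2).
Proof.
move=> cu; have [p3|p3] := eqVneq p 3%N.
  have [t ht] : exists t : int, 1 + 3 * t = u \/ 1 + 3 * t = - u.
    have nd : ~~ (3 %| u)%Z by rewrite -(coprimez_p (p := 3)) // -p3.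
    have [h|h] : (exists m, u = 3 * m + 1) \/ (exists m, u = 3 * m + 2).
      have := divz_eq u 3; have := modz_ge0 u (d := 3) isT; have := @ltz_pmod u 3 isT.
      have : (u %% 3)%Z != 0 by apply: contra nd => /eqP h; apply/dvdz_mod0P.
      move: (u %% 3)%Z (u %/ 3)%Z => r m h1 h2 h3 h4.
      have [E|E] : r = 1 \/ r = 2 by lia.
        by left; exists m; lia.
      by right; exists m; lia.
    - by case: h => m ->; exists m; left; ring.
    - by case: h => m ->; exists (- m - 1); right; ring.
  exists t; case: ht => ->; split=> //; rewrite ?sqrrN; try exact: cg_refl.
  by rewrite coprimeNz.
have c3 : coprimez 3 p by rewrite coprimezE /= coprime_sym prime_coprime// dvdn_prime2.
have [v _ hv] := coprime_inv pp K c3.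
have h : cg P (1 + 3 * (v * (u - 1))) u.
  rewrite /cg; have -> : 1 + 3 * (v * (u - 1)) - u = (v * 3 - 1) * (u - 1) by ring.
  exact: dvdz_mulr.
exists (v * (u - 1)); split; last by rewrite !expr2; exact: cgM.
exact: (cg_coprime (cg_dvd pP (cg_sym h))).
Qed.

(** The search determines al + 3 b up to the square of a unit, and a change of basis at p that
    commutes with the permutations of the g_i realises that square. Cancelling al^2 costs 2
    ord_p(al) <= 2 al digits and cancelling 3 one more when p = 3, whence the precision 2 al + k +
    1. *)
Lemma A2_model e f (al z k : nat) : A2sys S N e f -> Q e = (2 * al)%N%:R -> okB p K D al z ->
  (2 * al + k.+1 <= K)%N -> covered S N [:: e; f; e - f] ->
  model S p k N (gl [:: al + dig P z 0; dig P z 0; dig P z 0; dig P z 0; al + dig P z 0; dig P z 0;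
     dig P z 0; dig P z 0; al + dig P z 0]%N) (map mx9 RA) (map rw3 rA) [:: 2 * al; 2 * al; 2 * al]%N.
Proof.
move=> sys Qe /andP[ns]; set b' := dig P z 0; set s' := dig P z 1 in ns *; rewrite cg_nat => hz alK cov.
have [g0 [g1 [g2 [b [s [[N0 N1 N2] [fE eE] sp [hq Q1 Q2 [hb B02 B12]] [cs hs]]]]]]] := A2_data sys Qe.
have [[re rf ref] Qfe Bef _] := sys.
have al0 : (0 < al)%N.
  have := qform_gt0 pS (root_neq0 re); rewrite Qe ltr0n muln_gt0 => /andP[]//.
have [al' cal alE] := pfactor_coprime pp al0; set a := logn p al in alE.
have aal : (a <= al)%N.
  apply: leq_trans (ltnW (ltn_expl a (prime_gt1 pp))) _.
  by rewrite [X in (_ <= X)%N]alE leq_pmull// lt0n; apply: contraTneq al0 => E; rewrite alE E mul0n.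
have cs' : coprimez s' p by rewrite (coprimez_p pp).
have [v cv hv] := coprime_inv pp K cs'.
have [t [ct ht]] : exists t : int, coprimez (1 + 3 * t) p /\ cg P ((1 + 3 * t) ^+ 2) ((s * v) ^+ 2).
  by apply: square_1mod3; rewrite coprimezMl cs.
have [sg sgE] : exists sg : int, sg = 1 + 3 * t by eexists.
rewrite -sgE in ct ht.
(* The off-diagonal entry of the Gram matrix after g_i is replaced by g_i + t (g0 + g1 + g2). *)
pose b1 := b + (2 * t + 3 * t ^+ 2) * (al%:Z + 3 * b).
have b1E : al%:Z + 3 * b1 = sg ^+ 2 * (al%:Z + 3 * b) by rewrite /b1 sgE; ring.
have main : cg (pz k) b1 b'.
  have h1 : cg P (al%:Z ^+ 2 * (al%:Z + 3 * b1)) (al%:Z ^+ 2 * (al%:Z + 3 * b'%:Z)).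
    rewrite b1E; apply: (@cg_trans _ (al%:Z ^+ 2 * (al%:Z + 3 * b) * s ^+ 2 * v ^+ 2)).
      have -> : al%:Z ^+ 2 * (al%:Z + 3 * b) * s ^+ 2 * v ^+ 2 = al%:Z ^+ 2 * ((s * v) ^+ 2 * (al%:Z + 3 * b)) by ring.
      by apply: cgM; [exact: cg_refl|apply: cgM => //; exact: cg_refl].
    apply: (@cg_trans _ ((al ^ 2 * (al + 3 * b') * s' ^ 2)%N%:Z * v ^+ 2)).
      by apply: cgM; [exact: cg_trans hs (cg_sym hz)|exact: cg_refl].
    have -> : (al ^ 2 * (al + 3 * b') * s' ^ 2)%N%:Z * v ^+ 2 =
       al%:Z ^+ 2 * (al%:Z + 3 * b'%:Z) * ((v * s'%:Z) * (v * s'%:Z)).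
      by rewrite -!mulnn !PoszM PoszD PoszM; ring.
    rewrite -[X in cg _ _ X]mulr1 -[1 in X in cg _ _ X]mulr1; apply: cgM; first exact: cg_refl.
    exact: cgM.
  move: h1; rewrite /cg -mulrBr.
  have -> : al%:Z + 3 * b1 - (al%:Z + 3 * b'%:Z) = 3 * (b1 - b'%:Z) by ring.
  have -> : P = (p ^ (a + a) * p ^ (K - (a + a)))%N by rewrite -expnD subnKC//; lia.
  have -> : al%:Z ^+ 2 * (3 * (b1 - b'%:Z)) = pz (a + a) * ((al'%:Z ^+ 2) * (3 * (b1 - b'%:Z))).
    by rewrite {1}alE expnD !PoszM; ring.
  rewrite PoszM dvdz_mul2l ?eqz_nat ?expn_eq0 ?negb_and -?lt0n ?p0// => h2.
  have h3 : (pz k.+1 %| 3 * (b1 - b'%:Z))%Z.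
    have h4 : (pz k.+1 %| al'%:Z ^+ 2 * (3 * (b1 - b'%:Z)))%Z.
      by apply: dvdz_trans h2; rewrite dvdzE /= dvdn_exp2l//; lia.
    rewrite Gauss_dvdzr // in h4; rewrite coprimez_sym; apply: coprime_pk.
    by rewrite coprimezXl// coprimezE /= coprime_sym.
  have [p3|p3] := eqVneq p 3%N.
    by move: h3; rewrite expnS PoszM {1}p3 dvdz_mul2l.
  have h5 : (pz k.+1 %| b1 - b'%:Z)%Z.
    rewrite Gauss_dvdzr // in h3; rewrite coprimez_sym; apply: coprime_pk.
    by rewrite coprimezE /= coprime_sym prime_coprime// dvdn_prime2.
  by apply: dvdz_trans h5; rewrite dvdzE /= dvdn_exp2l.
have [w wE] : exists w, w = t%:~R *: (g0 + g1 + g2) by eexists.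
have Nw : N w by rewrite wE; apply: subZ => //; apply: subD => //; exact: subD.
have wg : [/\ B g0 w = t%:~R * (al%:Z + 3 * b)%:~R, B g1 w = t%:~R * (al%:Z + 3 * b)%:~R,
   B g2 w = t%:~R * (al%:Z + 3 * b)%:~R & B w w = 3 * t%:~R ^+ 2 * (al%:Z + 3 * b)%:~R].
  rewrite /qform in hq Q1 Q2.
  split; rewrite wE !bformE ?(bformC pS g1 g0) ?(bformC pS g2 g0) ?(bformC pS g2 g1) ?Q1 ?Q2 ?B02 ?B12 ?hq ?hb !(intrD, intrM); ring.
have [w0 w1 w2 ww] := wg.
have c3 : coprimez 1 p by rewrite coprimezE /= coprime1n.
apply: (@mk_model S p k N pS pp lN (rows3 (g0 + w) (g1 + w) (g2 + w)) (mx9 (circ al b1)) _ _ _ _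
   [:: e; f; e - f]) => //.
- by apply: rows3N; exact: subD.
- apply: pspan3 => n Nn; exists sg => //; have [x0 [x1 [x2 ->]]] := sp n Nn.
  exists (sg * x0 - t * (x0 + x1 + x2)), (sg * x1 - t * (x0 + x1 + x2)), (sg * x2 - t * (x0 + x1 + x2)).
  rewrite wE sgE; apply/rowP=> j; rewrite !mxE !(intrB, intrD, intrM); ring.
- apply: gram_circ; rewrite ?(qformD pS) ?Q1 ?Q2 ?bformE ?(bformC pS w g0) ?(bformC pS w g1) ?(bformC pS w g2) ?w0 ?w1 ?w2 ?ww ?B12 ?B02 //.
  + by rewrite hq /qform ww /b1 !(intrD, intrM, rmorphXn) /=; ring.
  + by rewrite hb /b1 !(intrD, intrM, rmorphXn) /=; ring.
- move=> i j; rewrite mxE /gl; case: (ord3P i) => ->; case: (ord3P j) => -> //=;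
  by rewrite PoszD; apply: cgD => //; exact: cg_refl.
- have E0 (x y : 'rV[rat]_3) : x + w - (y + w) = x - y by apply/rowP=> j; rewrite !mxE; ring.
  case=> [|[|[|[]]]] //= _; split=> //;
   try (exists 1 => //; rewrite rw3_rows3 ?eE ?fE /= ?(mulrNz, mulr1z, mulr0z);
     apply/rowP=> ?; rewrite !mxE; ring);
   try (by move=> i j; case: (ord3P i) => ->; case: (ord3P j) => ->; rewrite /= ?mxE /=; ring).
  + by rewrite Qfe.
  + by rewrite (qformB pS) Qfe Bef Qe; ring.
Qed.
End Rigidity.

(** * Jordan decompositions *)

Lemma scale_integral S L : primitive_lattice S L -> integral S L.
Proof.
move=> pL x y Lx Ly; have : scale S L (bform S x y).
  exists [:: (1, (x, y))]; split; last by rewrite big_seq1 mul1r.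
  by move=> t; rewrite inE => /eqP ->.
by rewrite pL => -[m _ <-]; exact: intr_int.
Qed.

Lemma gram_integral S M A (H0 : 'M[int]_3) : lattice_basis M A -> gram S A = map_mx intr H0 ->
  integral S M.
Proof.
move=> [_ ->] gA _ _ [x _ <-] [y _ <-].
rewrite /bform trmx_mul map_trmx !mulmxA.
have -> : map_mx intr x *m A *m S *m A^T = map_mx intr (x *m H0).
  by rewrite map_mxM -gA /gram !mulmxA.
by rewrite -map_mxM mxE; exact: intr_int.
Qed.

Lemma lattice_full M (A : 'M[rat]_3) : lattice_basis M A -> forall v, exists2 m : int, m != 0 & M (m%:~R *: v).
Proof.
move=> [uA ->] v; have [r rE] : exists r : 'rV[rat]_3, r = v *m invmx A by eexists.
pose d i := denq (r 0 i); exists (d 0 * d 1 * d 2); first by rewrite !mulf_neq0 ?denq_neq0.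
have dE i : (d i)%:~R * r 0 i = (numq (r 0 i))%:~R by rewrite numqE mulrC.
exists (rw3 [:: d 1 * d 2 * numq (r 0 0); d 0 * d 2 * numq (r 0 1); d 0 * d 1 * numq (r 0 2)]) => //.
apply: (can_inj (mulmxK (m := 1) (_ : invmx A \in unitmx))); first by rewrite unitmx_inv.
rewrite -mulmxA mulmxV// mulmx1 -scalemxAl -rE.
by apply/rowP=> j; rewrite !mxE !intrM; case: (ord3P j) => -> /=; rewrite !intrM -dE; ring.
Qed.

(** * The Jordan forms of L and N, and the parametrization of Gamma *)

Section Setup.
Variables (S : 'M[rat]_3) (p : nat) (L N : set 'rV[rat]_3) (J : 3.-tuple (nat * nat)).
Hypotheses (pp : prime p) (op : odd p) (pS : posdef_space S).
Hypotheses (latL : is_lattice L) (primL : primitive_lattice S L).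
Hypothesis (ordL : 2 <= ordp p (disc S L)).
Hypotheses (LN : Lambda S p L = N) (jor : jordan_decomposition S p L J).
Notation pz k := (p ^ k)%N%:Z.
Local Notation B := (bform S).
Let p0 : (0 < p)%N := prime_gt0 pp.
Definition jexp (i : 'I_3) := (tnth J i).1.
Definition jcoef (i : 'I_3) := (tnth J i).2.
Definition DL i := (p ^ jexp i * jcoef i)%N.
(** Passing from L to N multiplies the unimodular component by p, hence its form by p^2, and keeps
    the other components. *)
Definition DN i := if jexp i == 0%N then (p ^ 2 * jcoef i)%N else DL i.

Lemma jexp_mono (i j : 'I_3) : (i <= j)%N -> (jexp i <= jexp j)%N.
Proof.
case: jor => srt _ _ ij; rewrite /jexp !(tnth_nth (0, 0)%N).
have := sorted_leq_nth leq_trans leqnn 0%N srt i j; rewrite !inE !size_map size_tuple.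
rewrite !(nth_map (0, 0)%N) ?size_tuple//; exact.
Qed.

Lemma jcoef_coprime i : coprime p (jcoef i).
Proof. by case: jor => _ /allP + _; apply; exact: mem_tnth. Qed.

Lemma local_gram_iso M A A' (G0 H0 : 'M[int]_3) : lattice_basis M A -> lattice_basis M A' ->
  gram S A = map_mx intr G0 -> gram S A' = map_mx intr H0 ->
  padic_isometric (map_mx intr G0 : 'M[padicInt p]_3) (map_mx intr H0).
Proof.
move=> bA bA' gA gA'; apply: (@padic_of_local p S M M A A' G0 H0 1%:M 1) => //.
- exact: isometry1.
- exact: unitmx1.
- by rewrite coprimezE /= coprime1n.
- by move=> x Mx; rewrite scale1r mulmx1.
- by move=> x Mx; rewrite scale1r invmx1 mulmx1.
Qed.

Definition diagL : 'M[padicInt p]_3 := diag_mx (\row_i (DL i)%:R).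

Lemma jordan_basis A (H0 : 'M[int]_3) : lattice_basis L A -> gram S A = map_mx intr H0 ->
  padic_isometric (map_mx intr H0 : 'M[padicInt p]_3) diagL.
Proof.
move=> bA gA; case: jor => _ _ [G [A1 [G1 [bA1 gA1 ->]]] iso].
exact: padic_iso_trans (local_gram_iso bA bA1 gA gA1) iso.
Qed.

Lemma genus_basis M : genus S L M -> exists A, exists2 H0 : 'M[int]_3, lattice_basis M A &
  gram S A = map_mx intr H0 /\ padic_isometric (map_mx intr H0 : 'M[padicInt p]_3) diagL.
Proof.
move=> [_ /(_ p pp)[G [H [[A [G0 [bA gA ->]]] [A' [H0 [bA' gA' ->]]] iso]]]].
exists A', H0 => //; split=> //.
exact: padic_iso_trans (padic_iso_sym iso) (jordan_basis bA gA).
Qed.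

Lemma basis_approx M A (H0 : 'M[int]_3) K : (0 < K)%N -> lattice_basis M A -> gram S A = map_mx intr H0 ->
  padic_isometric (map_mx intr H0 : 'M[padicInt p]_3) diagL -> approx_jordan S p M DL K.
Proof.
move=> K0 bA gA iso; have [W [T0 [[_ _ WM _ gW] sW]]] := approx_basis K0 bA gA iso.
by exists W.
Qed.

Lemma L_basis : exists A, exists2 H0 : 'M[int]_3, lattice_basis L A &
  gram S A = map_mx intr H0 /\ padic_isometric (map_mx intr H0 : 'M[padicInt p]_3) diagL.
Proof.
have [A bA] := latL; have [H0 gA] := int_gram (scale_integral primL) bA.
by exists A, H0 => //; split=> //; exact: (jordan_basis bA gA).
Qed.

Lemma L_approx K : (0 < K)%N -> approx_jordan S p L DL K.
Proof. by move=> K0; have [A [H0 bA [gA iso]]] := L_basis; exact: basis_approx gA iso. Qed.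

Lemma p_DL i : (0 < jexp i)%N -> (p %| DL i)%N.
Proof. by move=> h; apply: dvdn_mulr; rewrite dvdn_exp. Qed.

(** If all exponents were positive, p would divide B(L,L) and the scale could not be Z. *)
Lemma jexp0 : jexp 0 = 0%N.
Proof.
apply/eqP; rewrite -leqn0 leqNgt; apply/negP=> h.
have [W [WM gW sW]] := L_approx (ltn0Sn 0).
have iL := scale_integral primL; have [A bA] := latL; have gL := basis_sub bA.
have dv x y : L x -> L y -> dvr p (B x y).
  have dvi i z : L z -> dvr p (B (row i W) z).
    have := @approx_dvr S p L W 1 (row i W) iL (WM i) sW; rewrite expn1; apply=> j.
    have [m hm cm] := gW i j; rewrite hm; apply/dvrE; rewrite expn1 in cm.
    rewrite (dvd_cg cm); case: (i == j) => //; rewrite mulr1n dvdzE /=; apply: p_DL.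
    by apply: leq_trans h (jexp_mono _).
  move=> Lx Ly; have := @approx_dvr S p L W 1 x iL Lx sW; rewrite expn1; apply=> // j.
  by rewrite (bformC pS); exact: dvi.
have : scale S L 1 by rewrite primL; exists 1.
move=> [s [Hs E]]; have : dvr p 1.
  rewrite E; elim: s Hs {E} => [|t s IH] Hs; first by rewrite big_nil; exact: dvr0.
  rewrite big_cons; apply: dvrD.
    by apply: dvrZ; have [h1 h2] := Hs t (mem_head _ _); exact: dv.
  by apply: IH => t' ht'; apply: Hs; rewrite inE ht' orbT.
rewrite -[1]/(1%:~R) dvrE dvdzE /= dvdn1 => /eqP p1; by move: pp; rewrite p1.
Qed.

(** When the first two exponents vanish, the last one is the order of the discriminant at p. *)
Lemma jexp2 : jexp 1 = 0%N -> (2 <= jexp 2%R)%N.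
Proof.
move=> e1; have iL := scale_integral primL.
set A := xget 1%:M (lattice_basis L).
have bA : lattice_basis L A by have [A0 bA0] := latL; exact: (@xgetPex _ 1%:M _ (ex_intro _ A0 bA0)).
have [H0 gA] := int_gram iL bA.
have [W [T0 [[_ cT _ hT _] _]]] := approx_basis (ltn0Sn 1) bA gA (jordan_basis bA gA).
have hd : (pz 2 %| \det H0)%Z.
  have E : disc S L = (\det H0)%:~R by rewrite /disc -/A gA det_map_mx.
  move: ordL; rewrite E /ordp numq_int denq_int /= logn1 subr0 lez_nat => h.
  have d0 : (0 < `|\det H0|)%N by rewrite lt0n; apply: contraTneq h => ->; rewrite logn0.
  by rewrite dvdzE /= pfactor_dvdn.
have hc : cg (pz 2) (\det (T0 *m H0 *m T0^T)) ((DL 0)%:Z * (DL 1)%:Z * (DL 2)%:Z).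
  have -> : (DL 0)%:Z * (DL 1)%:Z * (DL 2)%:Z = \det (Dz DL) by rewrite det3 /Dz !mxE /=; ring.
  apply: cg_det => i j; apply: cg_trans (hT i j) _; rewrite !mxE; case: (i == j); exact: cg_refl.
have : (pz 2 %| (DL 0%R)%:Z * (DL 1%R)%:Z * (DL 2%R)%:Z)%Z.
  by rewrite -(dvd_cg hc) !det_mulmx; apply: dvdz_mulr; exact: dvdz_mull.
rewrite -!PoszM dvdzE /= /DL jexp0 e1 !expn0 !mul1n.
rewrite mulnCA Gauss_dvdl; last by rewrite coprimeXl// !coprimeMr !jcoef_coprime.
by rewrite dvdn_Pexp2l// prime_gt1.
Qed.

Definition jr1 := jexp 1 != 0%N.
(** [jee] and [jcc] are the order of Q(u) at p and its unit class: u is p times the first Jordan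
    vector in rank 1, and the last Jordan vector otherwise. *)
Definition jee := if jr1 then 2%N else jexp 2.
Definition jcc := if jr1 then jcoef 0 else jcoef 2.

Lemma jee_gt0 : (0 < jee)%N.
Proof. by rewrite /jee /jr1; case: eqP => //= /jexp2; lia. Qed.

Lemma jcc_coprime : coprime p jcc.
Proof. by rewrite /jcc; case: jr1; exact: jcoef_coprime. Qed.

Lemma DL0 : DL 0 = jcoef 0.
Proof. by rewrite /DL jexp0 expn0 mul1n. Qed.

Lemma forth M : subgroup M -> integral S M -> Lambda S p M = N -> (forall K, (0 < K)%N -> approx_jordan S p M DL K) ->
  exists2 u, okv S p jee jcc N u & M = Mset S p jr1 jee N u.
Proof.
move=> gM iM LM aM; rewrite /jee /jcc /jr1; have [e1|e1] /= := eqVneq (jexp 1) 0%N.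
  apply: (Gamma_forth2 pS pp op gM iM LM (aM _ (ltn0Sn (jexp 2)))) => //.
  - by rewrite DL0 jcoef_coprime.
  - by rewrite /DL e1 expn0 mul1n jcoef_coprime.
  - by have := jexp2 e1; lia.
  - exact: jcoef_coprime.
rewrite -DL0; apply: (Gamma_forth1 pS pp op gM iM LM (aM 1%N _)) => //.
- by rewrite DL0 jcoef_coprime.
- by apply: p_DL; rewrite lt0n.
- by apply: p_DL; apply: leq_trans (jexp_mono (i := 1) (j := 2) _); rewrite ?lt0n.
Qed.

Lemma N_integral : integral_lattice S N.
Proof.
have iL := scale_integral primL; have [A bA] := latL; have gL := basis_sub bA.
have NP n : N n <-> L n /\ forall y, L y -> dvr p (B n y) by rewrite -LN; exact: LambdaP.
split.
- split; first by apply/NP; split; [exact: sub0|move=> y _; rewrite bform0l; exact: dvr0].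
  move=> x y /NP[Lx Hx] /NP[Ly Hy]; apply/NP; split; first exact: subB.
  by move=> z Lz; rewrite !bformE; apply: dvrB; [exact: Hx|exact: Hy].
- by move=> x y /NP[Lx _] /NP[Ly _]; exact: iL.
- move=> v; have [m m0 Lm] := lattice_full bA v; exists (p%:Z * m).
    by rewrite mulf_neq0// eqz_nat -lt0n.
  apply/NP; rewrite intrM -scalerA; split; first exact: subZ.
  move=> y Ly; rewrite bformZl; have /intrP[b ->] := iL _ _ Lm Ly.
  by rewrite -intrM; apply/dvrE; exact: dvdz_mulr.
Qed.

Lemma GammaI M : Gamma S p L N M -> integral S M.
Proof. by move=> [/genus_basis[A [H0 bA [gA _]]] _]; exact: gram_integral bA gA. Qed.

Lemma GammaP M : Gamma S p L N M <-> exists2 u, okv S p jee jcc N u & M = Mset S p jr1 jee N u.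
Proof.
have iL := scale_integral primL; have [A bA] := latL; have gL := basis_sub bA.
split.
  move=> GM; have [/genus_basis[A' [H0 bA' [gA' iso]]] LM] := GM.
  apply: forth => //; [exact: basis_sub bA'|exact: GammaI|].
  by move=> K K0; exact: basis_approx gA' iso.
have [u0 ok0 LE] := forth gL iL LN (fun K K0 => L_approx K0).
move=> [u oku ->]; apply: (Gamma_back pS pp op bA iL LN jee_gt0 _ ok0 LE oku).
by rewrite coprimezE /= coprime_sym jcc_coprime.
Qed.

(** The vectors of exponent 0 in an approximate Jordan basis of L are multiplied by p. A vector of N
    has its coordinate along such a vector divisible by p, as one sees by pairing it with that same
    vector. *)
Lemma N_approx K : (0 < K)%N -> approx_jordan S p N DN K.
Proof.
move=> K0; have [W [WL gW sW]] := L_approx K0.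
have iL := scale_integral primL; have [A bA] := latL; have gL := basis_sub bA.
have NP n : N n <-> L n /\ forall y, L y -> dvr p (B n y) by rewrite -LN; exact: LambdaP.
have pK : (p%:Z %| pz K)%Z by rewrite dvdzE /= dvdn_exp.
pose c (i : 'I_3) : int := if jexp i == 0%N then p%:Z else 1.
have DE i j : c i * c j * ((DL i)%:Z *+ (i == j)) = (DN i)%:Z *+ (i == j).
  case: eqP => [<-|_]; last by rewrite !mulr0n mulr0.
  by rewrite /c /DN /DL; case: eqP => [->|_]; rewrite ?mul1r// expn0 mul1n -mulnn !PoszM.
pose W' : 'M[rat]_3 := diag_mx (\row_i (c i)%:~R) *m W.
have rW' i : row i W' = (c i)%:~R *: row i W by rewrite row_diag mxE.
exists W'; split.
- move=> i; rewrite rW' /c; case: eqP => ei.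
    apply/NP; split; first exact: subZ.
    move=> y Ly; rewrite bformZl; have /intrP[b ->] := iL _ _ (WL i) Ly.
    by rewrite -intrM; apply/dvrE; exact: dvdz_mulr.
  rewrite scale1r; apply/NP; split=> //.
  have := @approx_dvr S p L W 1 (row i W) iL (WL i) sW; rewrite expn1; apply=> j.
  have [m hm cm] := gW i j; rewrite hm; apply/dvrE; rewrite (dvd_cg (cg_dvd pK cm)).
  case: (i == j) => //; rewrite mulr1n dvdzE /=; apply: p_DL; rewrite lt0n; exact/eqP.
- move=> i j; have [m hm cm] := gW i j; exists (c i * c j * m).
    by rewrite !rW' bformZl bformZr hm !intrM mulrA.
  by rewrite -DE; apply: cgM => //; exact: cg_refl.
- move=> x Nx; have /NP[Lx dx] := Nx; have [d cd [z hz]] := sW _ Lx; exists d => //.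
  have cz i : (c i %| z 0%R i)%Z.
    rewrite /c; case: eqP => ei; last by rewrite dvd1z.
    have : dvr p (d%:~R * B x (row i W)) by apply: dvrZ; exact: dx.
    rewrite -bformZl hz row_mul3 !bformE.
    have [m0 -> c0] := gW 0 i; have [m1 -> c1] := gW 1 i; have [m2 -> c2] := gW 2 i.
    rewrite -!intrM -!intrD dvrE.
    have -> : (p %| z 0%R 0%R * m0 + z 0%R 1%R * m1 + z 0%R 2%R * m2)%Z = (p %| z 0%R i * (DL i)%:Z)%Z.
      have c0' := cg_dvd pK c0; have c1' := cg_dvd pK c1; have c2' := cg_dvd pK c2.
      apply: dvd_cg; apply: (@cg_trans _ (z 0 0 * ((DL 0)%:Z *+ (0 == i)) + z 0 1 * ((DL 1)%:Z *+ (1 == i))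
         + z 0 2 * ((DL 2)%:Z *+ (2 == i)))).
        by apply: cgD; [apply: cgD|]; apply: cgM => //; exact: cg_refl.
      by case: (ord3P i) => -> /=; rewrite !mulr0n !mulr1n !mulr0 ?addr0 ?add0r; exact: cg_refl.
    rewrite Gauss_dvdzl// coprimezE /= /DL ei expn0 mul1n; exact: jcoef_coprime.
  exists (\row_i (z 0%R i %/ c i)%Z); rewrite hz /W' mulmxA; congr (_ *m _).
  by apply/rowP=> i; rewrite mul_mx_diag !mxE -intrM divzK.
Qed.
End Setup.

(** * Comparison of a model with the label of N *)

Section Label.
Variables (S : 'M[rat]_3) (p k : nat) (N : set 'rV[rat]_3) (lb : label).
Hypotheses (pS : posdef_space S) (lN : integral_lattice S N) (hl : has_label S N lb).

(** Two primitive vectors with the same symmetry are proportional, and both the factor and its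
    inverse are integers. *)
Lemma QK_inj T a b : QK S N T a -> QK S N T b -> a = b.
Proof.
have prim0 x : primitive_vector N x -> x != 0.
  move=> [_ H]; apply/eqP=> x0; have := H 2 0 (sub0 (il_sub lN)); rewrite x0 scaler0 => /(_ erefl).
  by [].
move=> [x [px -> <-]] [y [py Exy <-]].
have [c E] := tau_eq pS (prim0 _ px) (prim0 _ py) Exy.
have c0 : c != 0 by apply: contraTneq (prim0 _ py) => c0; rewrite E c0 scale0r eqxx.
have /intrP[m hm] : c \is a Num.int by apply: (prim_int (il_sub lN) px); rewrite -E; case: py.
have /intrP[m' hm'] : c^-1 \is a Num.int.
  by apply: (prim_int (il_sub lN) py); rewrite E scalerA mulVf// scale1r; case: px.
have mm : m * m' = 1 by apply: (@intr_inj rat); rewrite intrM -hm -hm' divff.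
rewrite E qform_scale hm -rmorphXn /=.
have -> : m ^+ 2 = 1 by have [[->]|[->]] := mul_eq1 mm.
by rewrite mul1r.
Qed.

(** Links the input to the model: the group order and the norms are those of the label. A model
    keeps its norms in the order of its roots while the label is sorted, so the norms agree up to a
    permutation. *)
Lemma model_label g Rs rts qs : model S p k N g Rs rts qs ->
  lb.1 = (2 * size (group_reps Rs))%N /\ perm_eq lb.2 qs.
Proof.
move=> [F [Gf [xs [[FN uF sF gF] HG [sR sr sq] Hx [ux cx]]]]].
have [hc srt [sg [us Hs HQ]]] := hl; split.
  have := card_ON pS lN uF sR Hx cx => h.
  have : (`I_lb.1 #= `I_(2 * size (group_reps Rs)))%card.
    by apply: card_eq_trans h; rewrite card_eq_sym.
  by move/card_eq_II.
pose val T : nat := xget 0%N [set m : nat | QK S N T m%:R]%classic.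
have valE T (m : nat) : QK S N T m%:R -> val T = m.
  move=> h; have h2 : QK S N T (val T)%:R by exact: (@xgetPex _ 0%N [set m : nat | QK S N T m%:R]%classic (ex_intro _ m h)).
  by have /eqP := QK_inj h2 h; rewrite eqr_nat => /eqP.
have E1 : lb.2 = [seq val T | T <- sg].
  apply: (@eq_from_nth _ 0%N); first by rewrite size_map size_tuple.
  move=> i hi; rewrite (nth_map 0) ?size_tuple//; apply/esym/valE.
  by have := HQ (Ordinal hi); rewrite (tnth_nth (0 : 'M[rat]_3)) (tnth_nth 0%N).
have E2 : qs = [seq val T | T <- [seq tau S x | x <- xs]].
  apply: (@eq_from_nth _ 0%N); first by rewrite !size_map.
  move=> i; rewrite sq => hi; rewrite (nth_map 0) ?size_map// (nth_map 0)//; apply/esym/valE.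
  have [rx _ _ <-] := Hx i hi; exists (nth 0 xs i); split=> //; by case: rx.
rewrite E1 E2; apply: perm_map; apply: uniq_perm => // T; apply/idP/idP.
  by move=> /Hs h; have [x rx ->] := sym_root pS lN h; exact: cx.
move=> /mapP[x hx ->]; apply/Hs; have /(nthP 0)[i hi Ei] := hx.
have [[_ x0 ox] _ _ _] := Hx i hi; rewrite -Ei; split=> //; by exists (nth 0 xs i).
Qed.
End Label.

(** * The algorithm *)

Section ComputableLabels.
Local Open Scope nat_scope.
Implicit Types (k : nat) (f n : seq nat -> nat).
Local Notation cb k b := (computable k (fun s => nat_of_bool (b s))).

(** These variants pass the loop variable as a separate argument, which is the shape of the loops in
    the enumeration. *)
Lemma comp_hasv k n (P : nat -> seq nat -> bool) : computable k n ->
  cb k.+1 (fun s => P (nth 0 s 0) (behead s)) -> cb k (fun s => has (fun i => P i s) (iota 0 (n s))).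
Proof. by move=> hn hP; exact: (comp_has hn hP). Qed.

Lemma comp_allv k n (P : nat -> seq nat -> bool) : computable k n ->
  cb k.+1 (fun s => P (nth 0 s 0) (behead s)) -> cb k (fun s => all (fun i => P i s) (iota 0 (n s))).
Proof. by move=> hn hP; exact: (comp_all hn hP). Qed.

Lemma comp_sumv k n (F : nat -> seq nat -> nat) : computable k n ->
  computable k.+1 (fun s => F (nth 0 s 0) (behead s)) -> computable k (fun s => \sum_(i < n s) F i s).
Proof. by move=> hn hF; exact: (comp_sum hn hF). Qed.

Lemma comp_codev k n (c : nat -> seq nat -> bool) (v : nat -> seq nat -> nat) : computable k n ->
  cb k.+1 (fun s => c (nth 0 s 0) (behead s)) -> computable k.+1 (fun s => v (nth 0 s 0) (behead s)) ->
  computable k (fun s => CodeSeq.code [seq v i s | i <- iota 0 (n s) & c i s]).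
Proof. by move=> hn hc hv; exact: (comp_code hn hc hv). Qed.

Lemma comp_hasl (T : Type) k (l : seq T) (P : T -> seq nat -> bool) : (forall x, cb k (P x)) ->
  cb k (fun s => has (P^~ s) l).
Proof.
move=> H; elim: l => [|x l IH] /=; first exact: comp_const.
exact: comp_or.
Qed.

Lemma comp_countl (T : Type) k (l : seq T) (P : T -> seq nat -> bool) : (forall x, cb k (P x)) ->
  computable k (fun s => count (P^~ s) l).
Proof.
move=> H; elim: l => [|x l IH] /=; first exact: comp_const.
exact: comp_add.
Qed.

Lemma comp_sumnl k (qs : seq (seq nat -> nat)) : (forall i, computable k (nth (fun=> 0) qs i)) ->
  computable k (fun s => sumn [seq q s | q <- qs]).
Proof.
elim: qs => [|q qs IH] H /=; first exact: comp_const.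
by apply: comp_add; [exact: (H 0)|apply: IH => i; exact: (H i.+1)].
Qed.

(** The position of the first success is the number of i such that P fails at every j <= i. *)
Lemma comp_find k n (P : nat -> seq nat -> bool) : computable k n ->
  cb k.+1 (fun s => P (nth 0 s 0) (behead s)) ->
  computable k (fun s => find (fun i => P i s) (iota 0 (n s))).
Proof.
move=> hn hP.
have E m s : find (fun i => P i s) (iota 0 m) = \sum_(i < m) (all (fun j => ~~ P j s) (iota 0 i.+1) : nat).
  have F m' : iota 0 m'.+1 = iota 0 m' ++ [:: m'] by rewrite -addn1 iotaD add0n.
  elim: m => [|m IH]; first by rewrite big_ord0.
  rewrite F find_cat size_iota big_ord_recr -IH [in RHS]F all_cat.
  rewrite (_ : all _ (iota 0 _) = ~~ has (fun i => P i s) (iota 0 m)); last by rewrite -all_predC.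
  rewrite /= andbT; case: (boolP (has _ _)) => h /=; first by rewrite addn0.
  by rewrite (hasNfind h) size_iota; case: (P m s); rewrite ?addn0.
apply: (comp_ext (f := fun s => \sum_(i < n s) (all (fun j => ~~ P j s) (iota 0 i.+1) : nat))).
  by move=> s _; rewrite E.
apply: (comp_sumv (F := fun i s => all (fun j => ~~ P j s) (iota 0 i.+1) : nat)) => //.
apply: (comp_allv (P := fun j s => ~~ P j (behead s)) (n := fun s => (nth 0 s 0).+1)).
  by apply: comp_succ; exact: comp_proj.
apply: comp_not.
apply: (comp_ext (f := fun s => (fun s => P (nth 0 s 0) (behead s) : nat) (nth 0 s 0 :: drop 2 s))).
  by case=> [|a [|b s]] //= _; rewrite drop0.
by apply: (comp_push2 hP); exact: comp_proj.
Qed.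

Lemma comp_dig k f (g h : seq nat -> nat) : computable k f -> computable k g -> computable k h ->
  computable k (fun s => dig (f s) (g s) (h s)).
Proof.
move=> hf hg hh; apply: comp_modn => //; apply: comp_divn => //; exact: comp_exp.
Qed.

Lemma comp_rz k f c : computable k f -> computable k (fun s => rz (f s) c).
Proof.
move=> hf; case: c => m /=; first exact: comp_const.
by apply: comp_mul; [exact: comp_pred|exact: comp_const].
Qed.

Lemma comp_vdot k (u v : 'I_3 -> seq nat -> nat) : (forall i, computable k (u i)) ->
  (forall i, computable k (v i)) -> computable k (fun s => vdot (u^~ s) (v^~ s)).
Proof.
by move=> hu hv; apply: comp_add; [apply: comp_add|]; apply: comp_mul.
Qed.

Lemma comp_vmul k (u : 'I_3 -> seq nat -> nat) (A : 'I_3 -> 'I_3 -> seq nat -> nat) j :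
  (forall i, computable k (u i)) -> (forall i j, computable k (A i j)) ->
  computable k (fun s => vmul (u^~ s) (fun i j => A i j s) j).
Proof. by move=> hu hA; exact: (@comp_vdot k u (fun i => A i j)). Qed.

Lemma comp_all3 k (b : 'I_3 -> seq nat -> bool) : (forall j, cb k (b j)) ->
  cb k (fun s => all3 (b^~ s)).
Proof. by move=> H; apply: comp_and => //; apply: comp_and. Qed.

Lemma comp_eqmod k f (g : seq nat -> nat) m : computable k f -> computable k g -> computable k m ->
  cb k (fun s => f s == g s %[mod m s]).
Proof. by move=> hf hg hm; apply: comp_eqn; exact: comp_modn. Qed.

Section Data.
Variables (k : nat) (p e : seq nat -> nat).
Variable g : 'I_3 -> 'I_3 -> seq nat -> nat.
Hypotheses (hp : computable k p) (he : computable k e).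
Hypothesis hg : forall i j, computable k (g i j).

Lemma comp_P : computable k (fun s => p s ^ (e s).+1).
Proof. by apply: comp_exp => //; exact: comp_succ. Qed.

Lemma comp_pt z i : computable k z -> computable k (fun s => pt (p s) (e s) (z s) i).
Proof. by move=> hz; apply: comp_dig => //; [exact: comp_P|exact: comp_const]. Qed.

Lemma comp_ptg z j : computable k z ->
  computable k (fun s => vmul (pt (p s) (e s) (z s)) (fun i j => g i j s) j).
Proof.
move=> hz; apply: (@comp_vmul k (fun i s => pt (p s) (e s) (z s) i) g) => // i; exact: comp_pt.
Qed.

Lemma comp_ptR z R j : computable k z ->
  computable k (fun s => vmul (pt (p s) (e s) (z s)) (mat (p s) (e s) R) j).
Proof.
move=> hz; apply: (@comp_vmul k (fun i s => pt (p s) (e s) (z s) i) (fun i j s => mat (p s) (e s) R i j)).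
  by move=> i; exact: comp_pt.
by move=> i i'; apply: comp_rz; exact: comp_P.
Qed.

Lemma comp_ptRg z R j : computable k z ->
  computable k (fun s => vmul (vmul (pt (p s) (e s) (z s)) (mat (p s) (e s) R)) (fun i j => g i j s) j).
Proof.
move=> hz; apply: (@comp_vmul k (fun i s => vmul (pt (p s) (e s) (z s)) (mat (p s) (e s) R) i) g) => // i.
exact: comp_ptR.
Qed.
End Data.

Lemma comp_okb k p e cc g z : computable k p -> computable k e -> computable k cc ->
  (forall i j, computable k (g i j)) -> computable k z ->
  cb k (fun s => okb (p s) (e s) (cc s) (fun i j => g i j s) (z s)).
Proof.
move=> hp he hc hg hz; apply: comp_and.
  apply: (@comp_all3 k (fun j s => p s ^ e s %| vmul (pt (p s) (e s) (z s)) (fun i j => g i j s) j)) => j.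
  by apply: comp_dvdn; [exact: comp_exp|exact: comp_ptg].
apply: (comp_hasv (P := fun i s => (0 < i) && (vdot (vmul (pt (p s) (e s) (z s)) (fun i j => g i j s)) (pt (p s) (e s) (z s))
   == cc s * (i * i) * p s ^ e s %[mod p s ^ (e s).+1]))) => //.
have [bp be bz] : [/\ computable k.+1 (fun s => p (behead s)), computable k.+1 (fun s => e (behead s)) &
  computable k.+1 (fun s => z (behead s))] by split; apply: comp_behead.
have bg i j : computable k.+1 (fun s => g i j (behead s)) by apply: comp_behead.
apply: comp_and; first by apply: comp_leq; [exact: comp_const|exact: comp_proj].
apply: comp_eqmod.
- apply: (@comp_vdot k.+1 (fun i s => vmul (pt (p (behead s)) (e (behead s)) (z (behead s))) (fun i j => g i j (behead s)) i)
    (fun i s => pt (p (behead s)) (e (behead s)) (z (behead s)) i)) => i.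
    exact: (comp_ptg (g := fun i j s => g i j (behead s))).
  exact: comp_pt.
- apply: comp_mul; last exact: comp_exp.
  by apply: comp_mul; [exact: comp_behead|apply: comp_mul; exact: comp_proj].
- exact: comp_P.
Qed.

Lemma comp_relb k r p e g R z z' : cb k r -> computable k p -> computable k e ->
  (forall i j, computable k (g i j)) -> computable k z -> computable k z' ->
  cb k (fun s => relb (r s) (p s) (e s) (fun i j => g i j s) R (z s) (z' s)).
Proof.
move=> hr hp he hg hz hz'.
have [bp be] : computable k.+1 (fun s => p (behead s)) /\ computable k.+1 (fun s => e (behead s)) by split; apply: comp_behead.
have [bz bz'] : computable k.+1 (fun s => z (behead s)) /\ computable k.+1 (fun s => z' (behead s)) by split; apply: comp_behead.
have bg i j : computable k.+1 (fun s => g i j (behead s)) by apply: comp_behead.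
have br : cb k.+1 (fun s => r (behead s)) by apply: (comp_behead hr).
apply: (comp_hasv (P := fun l s => (0 < l) && (if r s then
   all3 (fun j => (l * vmul (pt (p s) (e s) (z s)) (mat (p s) (e s) R) j == pt (p s) (e s) (z' s) j %[mod p s]))
   else all3 (fun j => (l * vmul (vmul (pt (p s) (e s) (z s)) (mat (p s) (e s) R)) (fun i j => g i j s) j ==
      vmul (pt (p s) (e s) (z' s)) (fun i j => g i j s) j %[mod p s ^ (e s).+1]))))) => //.
apply: comp_and; first by apply: comp_leq; [exact: comp_const|exact: comp_proj].
apply: comp_ifb => //.
  apply: (@comp_all3 k.+1 (fun j s => (nth 0 s 0 * vmul (pt (p (behead s)) (e (behead s)) (z (behead s))) (mat (p (behead s)) (e (behead s)) R) j
     == pt (p (behead s)) (e (behead s)) (z' (behead s)) j %[mod p (behead s)]))) => j.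
  apply: comp_eqmod => //; last exact: comp_pt.
  by apply: comp_mul; [exact: comp_proj|exact: comp_ptR].
apply: (@comp_all3 k.+1 (fun j s => (nth 0 s 0 * vmul (vmul (pt (p (behead s)) (e (behead s)) (z (behead s))) (mat (p (behead s)) (e (behead s)) R))
     (fun i j => g i j (behead s)) j
     == vmul (pt (p (behead s)) (e (behead s)) (z' (behead s))) (fun i j => g i j (behead s)) j %[mod p (behead s) ^ (e (behead s)).+1]))) => j.
apply: comp_eqmod; last exact: comp_P.
  apply: comp_mul; first exact: comp_proj.
  exact: (comp_ptRg (g := fun i j s => g i j (behead s))).
exact: (comp_ptg (g := fun i j s => g i j (behead s))).
Qed.

Lemma comp_divb k r p e g (rt : 'rV[int]_3) z : cb k r -> computable k p -> computable k e ->
  (forall i j, computable k (g i j)) -> computable k z ->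
  cb k (fun s => divb (r s) (p s) (e s) (fun i j => g i j s) rt (z s)).
Proof.
move=> hr hp he hg hz.
have [bp be] : computable k.+1 (fun s => p (behead s)) /\ computable k.+1 (fun s => e (behead s)) by split; apply: comp_behead.
have bz : computable k.+1 (fun s => z (behead s)) by apply: comp_behead.
apply: comp_ifb => //.
  apply: (comp_hasv (P := fun l s => all3 (fun j => (l * pt (p s) (e s) (z s) j == rz (p s ^ (e s).+1) (rt 0%R j) %[mod p s])))) => //.
  apply: (@comp_all3 k.+1 (fun j s => (nth 0 s 0 * pt (p (behead s)) (e (behead s)) (z (behead s)) j ==
    rz (p (behead s) ^ (e (behead s)).+1) (rt 0%R j) %[mod p (behead s)]))) => j.
  apply: comp_eqmod => //; last by apply: comp_rz; exact: comp_P.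
  by apply: comp_mul; [exact: comp_proj|exact: comp_pt].
apply: comp_dvdn; first exact: comp_P.
apply: (@comp_vdot k (fun i s => vmul (pt (p s) (e s) (z s)) (fun i j => g i j s) i)
   (fun j s => rz (p s ^ (e s).+1) (rt 0%R j))) => i; first exact: comp_ptg.
by apply: comp_rz; exact: comp_P.
Qed.

Lemma comp_qval k r p e g rts (qs : seq (seq nat -> nat)) i z : cb k r -> computable k p -> computable k e ->
  (forall i j, computable k (g i j)) -> (forall i, computable k (nth (fun=> 0) qs i)) -> computable k z ->
  computable k (fun s => qval (r s) (p s) (e s) (fun i j => g i j s) rts [seq q s | q <- qs] i (z s)).
Proof.
move=> hr hp he hg hq hz.
have hqi : computable k (fun s => nth 0 [seq q s | q <- qs] i).
  apply: comp_ext (hq i) => s _; elim: qs i {hq} => [|q l IH] i; first by rewrite !nth_nil.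
  by case: i => [|i] //=; exact: IH.
apply: comp_if => //; first exact: comp_divb.
by apply: comp_divn => //; apply: comp_exp => //; exact: comp_const.
Qed.

Lemma comp_qlist k r p e g Rs rts (qs : seq (seq nat -> nat)) z : cb k r -> computable k p -> computable k e ->
  (forall i j, computable k (g i j)) -> (forall i, computable k (nth (fun=> 0) qs i)) -> computable k z ->
  computable k (fun s => CodeSeq.code
    (qlist (r s) (p s) (e s) (fun i j => g i j s) Rs rts [seq q s | q <- qs] (z s))).
Proof.
move=> hr hp he hg hq hz.
have [bp be] : computable k.+1 (fun s => p (behead s)) /\ computable k.+1 (fun s => e (behead s)) by split; apply: comp_behead.
have bz : computable k.+1 (fun s => z (behead s)) by apply: comp_behead.
have bg i j : computable k.+1 (fun s => g i j (behead s)) by apply: comp_behead.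
have br : cb k.+1 (fun s => r (behead s)) by apply: (comp_behead hr).
apply: (comp_codev (v := fun m s => m %/ size Rs)).
- by apply: comp_mul; [apply: comp_succ; exact: comp_sumnl|exact: comp_const].
- apply: comp_hasl => i; apply: comp_and.
    apply: comp_eqn; last exact: comp_const.
    by apply: comp_modn; [exact: comp_proj|exact: comp_const].
  apply: comp_and; first exact: (comp_relb (g := fun i j s => g i j (behead s))).
  apply: comp_eqn; last by apply: comp_divn; [exact: comp_proj|exact: comp_const].
  apply: (comp_ext (f := fun s => qval (r (behead s)) (p (behead s)) (e (behead s)) (fun i j => g i j (behead s)) rts
     [seq q s | q <- [seq (fun s => q (behead s)) | q <- qs]] i (z (behead s)))).
    by move=> s _; rewrite -map_comp.
  apply: (comp_qval rts i br bp be bg) => // i'.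
  have [lt|ge] := ltnP i' (size qs); last by rewrite nth_default ?size_map//; exact: comp_const.
  by rewrite (nth_map (fun=> 0))//; apply: comp_behead.
- by apply: comp_divn; [exact: comp_proj|exact: comp_const].
Qed.

Lemma comp_labels k r p e cc g Rs rts (qs : seq (seq nat -> nat)) : cb k r -> computable k p -> computable k e ->
  computable k cc -> (forall i j, computable k (g i j)) -> (forall i, computable k (nth (fun=> 0) qs i)) ->
  computable k (fun s => encode_labels
    (labels_of (r s) (p s) (e s) (cc s) (fun i j => g i j s) Rs rts [seq q s | q <- qs])).
Proof.
move=> hr hp he hc hg hq.
have [bp be] : computable k.+1 (fun s => p (behead s)) /\ computable k.+1 (fun s => e (behead s)) by split; apply: comp_behead.
have bc : computable k.+1 (fun s => cc (behead s)) by apply: comp_behead.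
have bg i j : computable k.+1 (fun s => g i j (behead s)) by apply: comp_behead.
have br : cb k.+1 (fun s => r (behead s)) by apply: (comp_behead hr).
refine (@comp_ext k (fun s => CodeSeq.code [seq
   encode_label (hcard (r s) (p s) (e s) (fun i j => g i j s) Rs z,
     qlist (r s) (p s) (e s) (fun i j => g i j s) Rs rts [seq q s | q <- qs] z) |
   z <- iota 0 ((p s ^ (e s).+1) ^ 3) & okb (p s) (e s) (cc s) (fun i j => g i j s) z &&
      minb (r s) (p s) (e s) (cc s) (fun i j => g i j s) Rs z]) _ _ _).
  by move=> s _; rewrite /encode_labels /labels_of -map_comp.
apply: (comp_codev (v := fun z s => encode_label (hcard (r s) (p s) (e s) (fun i j => g i j s) Rs z,
     qlist (r s) (p s) (e s) (fun i j => g i j s) Rs rts [seq q s | q <- qs] z))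
   (c := fun z s => okb (p s) (e s) (cc s) (fun i j => g i j s) z &&
      minb (r s) (p s) (e s) (cc s) (fun i j => g i j s) Rs z)).
- by apply: comp_exp; [exact: comp_P|exact: comp_const].
- apply: comp_and; first by apply: (comp_okb (g := fun i j s => g i j (behead s))) => //; exact: comp_proj.
  apply: (comp_allv (P := fun z' s => okb (p (behead s)) (e (behead s)) (cc (behead s)) (fun i j => g i j (behead s)) z' ==>
     ~~ has (fun R => relb (r (behead s)) (p (behead s)) (e (behead s)) (fun i j => g i j (behead s)) R (nth 0 s 0) z') (group_reps Rs))).
    exact: comp_proj.
  have [cp ce] : computable k.+2 (fun s => p (behead (behead s))) /\ computable k.+2 (fun s => e (behead (behead s))).
    by split; [apply: (comp_behead bp)|apply: (comp_behead be)].
  have ccc : computable k.+2 (fun s => cc (behead (behead s))) by apply: (comp_behead bc).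
  have cg i j : computable k.+2 (fun s => g i j (behead (behead s))) by apply: (comp_behead (bg i j)).
  have cr : cb k.+2 (fun s => r (behead (behead s))) by apply: (comp_behead br).
  have cz : computable k.+2 (fun s => nth 0 (behead s) 0) by apply: (comp_behead (comp_proj k.+1 0)).
  apply: (comp_ext (f := fun s => (~~ okb (p (behead (behead s))) (e (behead (behead s))) (cc (behead (behead s)))
      (fun i j => g i j (behead (behead s))) (nth 0 s 0) ||
     ~~ has (fun R => relb (r (behead (behead s))) (p (behead (behead s))) (e (behead (behead s)))
      (fun i j => g i j (behead (behead s))) R (nth 0 (behead s) 0) (nth 0 s 0)) (group_reps Rs) : nat))).
    by move=> s _; rewrite implybE.
  apply: comp_or; apply: comp_not.
    by apply: (comp_okb (g := fun i j s => g i j (behead (behead s)))) => //; exact: comp_proj.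
  apply: (@comp_hasl _ k.+2 _ (fun R s => relb (r (behead (behead s))) (p (behead (behead s))) (e (behead (behead s)))
      (fun i j => g i j (behead (behead s))) R (nth 0 (behead s) 0) (nth 0 s 0))) => R.
  by apply: (comp_relb (g := fun i j s => g i j (behead (behead s)))) => //; exact: comp_proj.
- apply: (comp_ext (f := fun s => 2 ^ hcard (r (behead s)) (p (behead s)) (e (behead s)) (fun i j => g i j (behead s)) Rs (nth 0 s 0) *
    (2 * CodeSeq.code (qlist (r (behead s)) (p (behead s)) (e (behead s)) (fun i j => g i j (behead s)) Rs rts
       [seq q s | q <- [seq (fun s => q (behead s)) | q <- qs]] (nth 0 s 0))).+1)).
    by move=> s _; rewrite -map_comp /encode_label /= mul2n.
  apply: comp_mul.
    apply: comp_exp; first exact: comp_const.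
    apply: comp_mul; first exact: comp_const.
    apply: (@comp_countl _ k.+1 _ (fun R s => relb (r (behead s)) (p (behead s)) (e (behead s)) (fun i j => g i j (behead s)) R
        (nth 0 s 0) (nth 0 s 0))) => R.
    by apply: (comp_relb (g := fun i j s => g i j (behead s))) => //; exact: comp_proj.
  apply: comp_succ; apply: comp_mul; first exact: comp_const.
  apply: (comp_qlist Rs rts br bp be bg); last exact: comp_proj.
  move=> i'; have [lt|ge] := ltnP i' (size qs); last by rewrite nth_default ?size_map//; exact: comp_const.
  by rewrite (nth_map (fun=> 0))//; apply: comp_behead.
Qed.
End ComputableLabels.

(** * The program: reading the input and selecting the model *)

Section MainProgram.
Local Open Scope nat_scope.
Local Notation cb k b := (computable k (fun s => nat_of_bool (b s))).
Implicit Types s : seq nat.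

Lemma comp_tent k (p K t : seq nat -> nat) i j : computable k p -> computable k K -> computable k t ->
  computable k (fun s => tent (p s) (K s) (t s) i j).
Proof. by move=> hp hK ht; apply: comp_dig => //; [exact: comp_exp|exact: comp_const]. Qed.

Lemma comp_gA k (p K t : seq nat -> nat) (D : 'I_3 -> seq nat -> nat) i j :
  computable k p -> computable k K -> computable k t -> (forall i, computable k (D i)) ->
  computable k (fun s => gA (p s) (K s) (fun i => D i s) (t s) i j).
Proof.
move=> hp hK ht hD; do 2?[apply: comp_add]; (apply: comp_mul; [apply: comp_mul => //|]; exact: comp_tent).
Qed.

Lemma comp_okA k (p K q t : seq nat -> nat) (D : 'I_3 -> seq nat -> nat) :
  computable k p -> computable k K -> computable k q -> computable k t -> (forall i, computable k (D i)) ->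
  cb k (fun s => okA (p s) (K s) (fun i => D i s) (q s) (t s)).
Proof.
move=> hp hK hq ht hD; have hP : computable k (fun s => p s ^ K s) by exact: comp_exp.
have hT i j : computable k (fun s => tent (p s) (K s) (t s) i j) by exact: comp_tent.
apply: comp_and; first by apply: comp_eqmod => //; exact: comp_gA.
apply: comp_and; first by apply: comp_eqmod => //; [exact: comp_gA|exact: comp_const].
apply: comp_and; first by apply: comp_eqmod => //; [exact: comp_gA|exact: comp_const].
apply: comp_not; apply: comp_eqmod => //.
  by do 2?[apply: comp_add]; apply: comp_mul => //; exact: comp_mul.
by do 2?[apply: comp_add]; apply: comp_mul => //; exact: comp_mul.
Qed.

Lemma comp_okB k (p K al z : seq nat -> nat) (D : 'I_3 -> seq nat -> nat) :
  computable k p -> computable k K -> computable k al -> computable k z -> (forall i, computable k (D i)) ->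
  cb k (fun s => okB (p s) (K s) (fun i => D i s) (al s) (z s)).
Proof.
move=> hp hK hq hz hD; have hP : computable k (fun s => p s ^ K s) by exact: comp_exp.
have hd m : computable k (fun s => dig (p s ^ K s) (z s) m) by apply: comp_dig => //; exact: comp_const.
have sq f : computable k f -> computable k (fun s => f s ^ 2) by move=> hf; apply: comp_exp => //; exact: comp_const.
apply: comp_and; first by apply: comp_not; exact: comp_dvdn.
apply: comp_eqmod => //; last by do 2?[apply: comp_mul].
apply: comp_mul; last exact: sq.
apply: comp_mul; first exact: sq.
by apply: comp_add => //; apply: comp_mul => //; exact: comp_const.
Qed.

Definition ip s := nth 0 s 0.
Definition ih s := chd (nth 0 s 1).
(** The coded label has the group order as its head, so the norms begin at position 1. *)
Definition il i s := cnth (nth 0 s 1) i.+1.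
Definition iex (i : 'I_3) s := nth 0 s (2 + 2 * i).
Definition ico (i : 'I_3) s := nth 0 s (3 + 2 * i).
Definition ir1 s := iex 1%R s != 0.
Definition iee s := if ir1 s then 2 else iex 2%R s.
Definition icc s := if ir1 s then ico 0%R s else ico 2%R s.
Definition iDN i s := if iex i s == 0 then ip s ^ 2 * ico i s else ip s ^ iex i s * ico i s.
Definition isum n s := sumn [seq q s | q <- [seq il i | i <- iota 0 n]].

Definition lab (g : 'I_3 -> 'I_3 -> seq nat -> nat) Rl rl (qs : seq (seq nat -> nat)) s :=
  encode_labels (labels_of (ir1 s) (ip s) (iee s) (icc s) (fun i j => g i j s)
    (map mx9 Rl) (map rw3 rl) [seq q s | q <- qs]).
Definition glf (fl : seq (seq nat -> nat)) (i j : 'I_3) s := gl [seq f s | f <- fl] i j.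
Local Notation zero := (fun=> 0).

(** The precision q + k of [A1_model] for k = e + 1. *)
Definition K1 s := il 0 s + (iee s).+1.
Definition tA s := find (fun t => okA (ip s) (K1 s) (fun i => iDN i s) (il 0 s) t) (iota 0 ((ip s ^ K1 s) ^ 9)).
Definition ial s := il 0 s %/ 2.
(** The precision 2 al + k + 1 of [A2_model] for k = e + 1. *)
Definition KA s := 2 * ial s + (iee s).+2.
Definition zA s := find (fun z => okB (ip s) (KA s) (fun i => iDN i s) (ial s) z) (iota 0 ((ip s ^ KA s) ^ 2)).
Definition ibe s := dig (ip s ^ KA s) (zA s) 0.
Definition iab s := ial s + ibe s.
Definition ial2 s := 2 * ial s.
(** In type B2 A1 the norms are q, q, 2q, 2q and q0. Wherever q0 falls in the sorted list, its entry
    of index 1 is q, and q0 is the total minus 6q. *)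
Definition q05 s := isum 5 s - 6 * il 1 s.
Definition il12 s := 2 * il 1 s.
(** In type G2 A1 the norms are 2b and 6b, three times each, and q0. The entry of index 1 is 2b
    wherever q0 falls, and the total is 24b + q0. *)
Definition ib7 s := il 1 s %/ 2.
Definition ib72 s := 2 * ib7 s.
Definition ib76 s := 6 * ib7 s.
Definition q07 s := isum 7 s - 12 * il 1 s.
(** In type B3 there are three norms q and six norms q'. Whichever is larger, the entry of index 4
    in the sorted list is q'. *)
Definition q9 s := (isum 9 s - 6 * il 4 s) %/ 3.

Definition R1l : seq (seq int) := [:: [:: -1; 0; 0; 0; 1; 0; 0; 0; 1]]%R.
Definition r1l : seq (seq int) := [:: [:: 1; 0; 0]]%R.

Definition pr0 := lab (fun i j s => iDN i s * (i == j)) [::] [::] [::].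
Definition pr1 := lab (fun i j s => gA (ip s) (K1 s) (fun i => iDN i s) (tA s) i j) R1l r1l [:: il 0].
Definition pr3 := lab (glf [:: il 0; zero; zero; zero; il 1; zero; zero; zero; il 2]) R3 r3 [:: il 0; il 1; il 2].
Definition prA := lab (glf [:: iab; ibe; ibe; ibe; iab; ibe; ibe; ibe; iab]) RA rA [:: ial2; ial2; ial2].
Definition pr5 := lab (glf [:: il 1; zero; zero; zero; il 1; zero; zero; zero; q05]) R5 r5
  [:: il 1; il 1; il12; il12; q05].
Definition pr7 := lab (glf [:: ib72; ib7; zero; ib7; ib72; zero; zero; zero; q07]) R7 r7
  [:: ib72; ib72; ib72; ib76; ib76; ib76; q07].
Definition pr9 := lab (glf [:: q9; zero; zero; zero; q9; zero; zero; zero; q9]) R9 r9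
  [:: q9; q9; q9; il 4; il 4; il 4; il 4; il 4; il 4].

Definition prog s := if ih s == 2 then pr0 s else if ih s == 4 then pr1 s else if ih s == 8 then pr3 s
  else if ih s == 12 then prA s else if ih s == 16 then pr5 s else if ih s == 24 then pr7 s else pr9 s.

Lemma comp_il k i : computable k (il i).
Proof. by apply: comp_cnth; exact: comp_proj. Qed.
Lemma comp_ir1 k : cb k ir1.
Proof. by apply: comp_not; apply: comp_eqn; [exact: comp_proj|exact: comp_const]. Qed.
Lemma comp_iee k : computable k iee.
Proof. by apply: comp_if; [exact: comp_ir1|exact: comp_const|exact: comp_proj]. Qed.
Lemma comp_icc k : computable k icc.
Proof. by apply: comp_if; [exact: comp_ir1|exact: comp_proj|exact: comp_proj]. Qed.
Lemma comp_iDN k i : computable k (iDN i).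
Proof.
apply: comp_if; first by apply: comp_eqn; [exact: comp_proj|exact: comp_const].
  by apply: comp_mul; [apply: comp_exp; [exact: comp_proj|exact: comp_const]|exact: comp_proj].
by apply: comp_mul; [apply: comp_exp|]; exact: comp_proj.
Qed.
Lemma comp_isum k n : computable k (isum n).
Proof.
apply: comp_sumnl => i; have [lt|ge] := ltnP i (size (iota 0 n)).
  by rewrite (nth_map 0)//; exact: comp_il.
by rewrite nth_default ?size_map//; exact: comp_const.
Qed.

Lemma comp_lab k g Rl rl qs : (forall i j, computable k (g i j)) ->
  (forall i, computable k (nth (fun=> 0) qs i)) -> computable k (lab g Rl rl qs).
Proof.
move=> hg hq; apply: comp_labels => //; [exact: comp_ir1|exact: comp_proj|exact: comp_iee|exact: comp_icc].
Qed.

Lemma comp_glf k fl i j : (forall i, computable k (nth (fun=> 0) fl i)) -> computable k (glf fl i j).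
Proof.
move=> H; apply: comp_ext (H (3 * i + j)) => s _; rewrite /glf /gl.
by elim: fl (3 * i + j) {H} => [|f l IH] m; [rewrite !nth_nil|case: m].
Qed.

Lemma comp_nth1 k f fs : computable k f -> (forall i, computable k (nth (fun=> 0) fs i)) ->
  forall i, computable k (nth (fun=> 0) (f :: fs) i).
Proof. by move=> hf hs [|i] /=. Qed.
Lemma comp_nth0 k : forall i, computable k (nth (fun=> 0) [::] i).
Proof. by move=> i; rewrite nth_nil; exact: comp_const. Qed.

Lemma comp_K1 k : computable k K1.
Proof. by apply: comp_add; [exact: comp_il|apply: comp_succ; exact: comp_iee]. Qed.
Lemma comp_ial k : computable k ial.
Proof. by apply: comp_divn; [exact: comp_il|exact: comp_const]. Qed.
Lemma comp_KA k : computable k KA.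
Proof.
apply: comp_add; first by apply: comp_mul; [exact: comp_const|exact: comp_ial].
by do 2!apply: comp_succ; exact: comp_iee.
Qed.

Lemma comp_tA k : computable k tA.
Proof.
have c0 : computable k.+1 (fun s => nth 0 s 0) by exact: comp_proj.
apply: (comp_find (P := fun t s => okA (ip s) (K1 s) (fun i => iDN i s) (il 0 s) t)).
  by do 2?[apply: comp_exp]; [exact: comp_proj|exact: comp_K1|exact: comp_const].
apply: (comp_okA (D := fun i s => iDN i (behead s))) => //.
- by apply: (comp_behead (comp_proj k 0)).
- by apply: (comp_behead (comp_K1 k)).
- by apply: (comp_behead (comp_il k 0)).
- by move=> i; apply: (comp_behead (comp_iDN k i)).
Qed.

Lemma comp_zA k : computable k zA.
Proof.
have c0 : computable k.+1 (fun s => nth 0 s 0) by exact: comp_proj.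
apply: (comp_find (P := fun t s => okB (ip s) (KA s) (fun i => iDN i s) (ial s) t)).
  by do 2?[apply: comp_exp]; [exact: comp_proj|exact: comp_KA|exact: comp_const].
apply: (comp_okB (D := fun i s => iDN i (behead s))) => //.
- by apply: (comp_behead (comp_proj k 0)).
- by apply: (comp_behead (comp_KA k)).
- by apply: (comp_behead (comp_ial k)).
- by move=> i; apply: (comp_behead (comp_iDN k i)).
Qed.

Lemma comp_prog : computable 8 prog.
Proof.
have ch m : cb 8 (fun s => ih s == m).
  by apply: comp_eqn; [apply: comp_chd; exact: comp_proj|exact: comp_const].
have cl i := comp_il 8 i; have c0 := comp_const 8 0.
have cm c f : computable 8 f -> computable 8 (fun s => c * f s).
  by move=> hf; apply: comp_mul => //; exact: comp_const.
have cq5 : computable 8 q05 by apply: comp_sub; [exact: comp_isum|exact: cm].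
have cq7 : computable 8 q07 by apply: comp_sub; [exact: comp_isum|exact: cm].
have cq9 : computable 8 q9.
  by apply: comp_divn; [apply: comp_sub; [exact: comp_isum|exact: cm]|exact: comp_const].
have cb7 : computable 8 ib7 by apply: comp_divn => //; exact: comp_const.
have [cb72 cb76] : computable 8 ib72 /\ computable 8 ib76 by split; exact: cm.
have cl12 : computable 8 il12 by exact: cm.
have cal := comp_ial 8.
have cal2 : computable 8 ial2 by exact: cm.
have cbe : computable 8 ibe.
  apply: comp_dig; [|exact: comp_zA|exact: comp_const].
  by apply: comp_exp; [exact: comp_proj|exact: comp_KA].
have cab : computable 8 iab by exact: comp_add.
have cN := comp_nth0 8.
have h0 : computable 8 pr0.
  by apply: comp_lab => // i j; apply: comp_mul; [exact: comp_iDN|exact: comp_const].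
have h1 : computable 8 pr1.
  apply: comp_lab; last exact: comp_nth1.
  move=> i j; apply: comp_gA; [exact: comp_proj|exact: comp_K1|exact: comp_tA|exact: comp_iDN].
have h3 : computable 8 pr3.
  by apply: comp_lab => [i j|]; [apply: comp_glf|]; do ![apply: comp_nth1 => //].
have hA : computable 8 prA.
  by apply: comp_lab => [i j|]; [apply: comp_glf|]; do ![apply: comp_nth1 => //].
have h5 : computable 8 pr5.
  by apply: comp_lab => [i j|]; [apply: comp_glf|]; do ![apply: comp_nth1 => //].
have h7 : computable 8 pr7.
  by apply: comp_lab => [i j|]; [apply: comp_glf|]; do ![apply: comp_nth1 => //].
have h9 : computable 8 pr9.
  by apply: comp_lab => [i j|]; [apply: comp_glf|]; do ![apply: comp_nth1 => //].
apply: comp_if => //; apply: comp_if => //; apply: comp_if => //; apply: comp_if => //.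
by apply: comp_if => //; apply: comp_if.
Qed.
End MainProgram.

(** * Recovering the norms of the roots from a sorted label *)

Lemma sorted_perm l s : sorted leq l -> sorted leq s -> perm_eq l s -> l = s.
Proof. exact: (sorted_eq leq_trans anti_leq). Qed.

Lemma find_iota (P : nat -> bool) n t : (t < n)%N -> P t -> P (find P (iota 0 n)).
Proof.
move=> tn Pt; have h : has P (iota 0 n) by apply/hasP; exists t => //; rewrite mem_iota.
by have := nth_find 0%N h; rewrite nth_iota ?add0n// -[X in (_ < X)%N](size_iota 0) -has_find.
Qed.

Lemma label5 l (q q0 : nat) : sorted leq l -> perm_eq l [:: q; q; 2 * q; 2 * q; q0]%N ->
  nth 0%N l 1 = q /\ sumn l = (6 * q + q0)%N.
Proof.
move=> sl pl; split; last by rewrite (perm_sumn pl) /=; lia.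
have [h|h] := leqP q0 q.
  rewrite (@sorted_perm l [:: q0; q; q; 2 * q; 2 * q]%N) //=; first by lia.
  by apply: (perm_trans pl); apply/permP=> a /=; lia.
have [h2|h2] := leqP q0 (2 * q).
  rewrite (@sorted_perm l [:: q; q; q0; 2 * q; 2 * q]%N) //=; first by lia.
  by apply: (perm_trans pl); apply/permP=> a /=; lia.
by rewrite (@sorted_perm l [:: q; q; 2 * q; 2 * q; q0]%N) //=; lia.
Qed.

Lemma label7 l (b q0 : nat) : sorted leq l ->
  perm_eq l [:: 2 * b; 2 * b; 2 * b; 6 * b; 6 * b; 6 * b; q0]%N ->
  nth 0%N l 1 = (2 * b)%N /\ sumn l = (12 * (2 * b) + q0)%N.
Proof.
move=> sl pl; split; last by rewrite (perm_sumn pl) /=; lia.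
have [h|h] := leqP q0 (2 * b).
  rewrite (@sorted_perm l [:: q0; 2 * b; 2 * b; 2 * b; 6 * b; 6 * b; 6 * b]%N) //=; first by lia.
  by apply: (perm_trans pl); apply/permP=> a /=; lia.
have [h2|h2] := leqP q0 (6 * b).
  rewrite (@sorted_perm l [:: 2 * b; 2 * b; 2 * b; q0; 6 * b; 6 * b; 6 * b]%N) //=; first by lia.
  by apply: (perm_trans pl); apply/permP=> a /=; lia.
by rewrite (@sorted_perm l [:: 2 * b; 2 * b; 2 * b; 6 * b; 6 * b; 6 * b; q0]%N) //=; lia.
Qed.

Lemma label9 l (q q' : nat) : sorted leq l -> perm_eq l [:: q; q; q; q'; q'; q'; q'; q'; q'] ->
  nth 0%N l 4 = q' /\ sumn l = (6 * q' + 3 * q)%N.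
Proof.
move=> sl pl; split; last by rewrite (perm_sumn pl) /=; lia.
have [h|h] := leqP q q'; first by rewrite (@sorted_perm l [:: q; q; q; q'; q'; q'; q'; q'; q']) //=; lia.
rewrite (@sorted_perm l [:: q'; q'; q'; q'; q'; q'; q; q; q]) //=; first by lia.
by apply: (perm_trans pl); apply/permP=> a /=; lia.
Qed.

(** * Decoding of the input *)

Section Input.
Variables (p : nat) (J : 3.-tuple (nat * nat)) (lb : label).
Notation inp := (encode_input p J lb).

Lemma inp_size : size inp = 8%N.
Proof. by case: J => [[|a [|b [|c []]]]]. Qed.
Lemma inp_ih : ih inp = lb.1.
Proof. by rewrite /ih /= chd_code. Qed.
Lemma inp_il i : (i < size lb.2)%N -> il i inp = nth 0%N lb.2 i.
Proof. by move=> h; rewrite /il /= cnth_code. Qed.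
Lemma inp_iex i : iex i inp = jexp J i.
Proof.
rewrite /iex /jexp (tnth_nth (0, 0)%N); case: J => [[|a [|b [|c []]]]] //= _.
by case: (ord3P i) => ->.
Qed.
Lemma inp_ico i : ico i inp = jcoef J i.
Proof.
rewrite /ico /jcoef (tnth_nth (0, 0)%N); case: J => [[|a [|b [|c []]]]] //= _.
by case: (ord3P i) => ->.
Qed.
Lemma inp_ir1 : ir1 inp = jr1 J.
Proof. by rewrite /ir1 inp_iex. Qed.
Lemma inp_iee : iee inp = jee J.
Proof. by rewrite /iee inp_ir1 inp_iex. Qed.
Lemma inp_icc : icc inp = jcc J.
Proof. by rewrite /icc inp_ir1 !inp_ico. Qed.
Lemma inp_iDN : (fun i => iDN i inp) = DN p J.
Proof. by apply/funext=> i; rewrite /iDN inp_iex inp_ico. Qed.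
Lemma inp_isum n : size lb.2 = n -> isum n inp = sumn lb.2.
Proof.
move=> h; rewrite /isum -map_comp; congr sumn; apply: (@eq_from_nth _ 0%N).
  by rewrite size_map size_iota.
move=> i; rewrite size_map size_iota => hi.
by rewrite (nth_map 0%N) ?size_iota// nth_iota// add0n /= inp_il// h.
Qed.
End Input.

(** * Correctness of the program *)

Section Final.
Variables (p : nat) (S : 'M[rat]_3) (L N : set 'rV[rat]_3) (lb : label) (J : 3.-tuple (nat * nat)).
Hypotheses (pp : prime p) (op : odd p) (pS : posdef_space S) (latL : is_lattice L).
Hypotheses (primL : primitive_lattice S L) (ordL : 2 <= ordp p (disc S L)) (LN : Lambda S p L = N).
Hypotheses (hl : has_label S N lb) (jor : jordan_decomposition S p L J).
Local Notation Q := (qform S).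
Local Notation B := (bform S).
Let lN : integral_lattice S N := N_integral pp op pS latL primL LN.
Local Notation e := (jee J).
Local Notation inp := (encode_input p J lb).

Lemma model_done g Rs rts qs : model S p e.+1 N g Rs rts qs ->
  class_labels S (Gamma S p L N) (labels_of (jr1 J) p e (jcc J) g Rs rts qs).
Proof.
move=> [F [Gf [xs [[FN uF sF gF] HG [sR sr sq] Hx [ux cx]]]]].
apply: (@labels_ofP S p N (jr1 J) e (jcc J) g F Gf Rs rts qs xs) => //.
- exact: (jee_gt0 pp op pS latL primL ordL jor).
- exact: (jcc_coprime jor).
- by move=> M; exact: (GammaP pp op pS latL primL ordL LN jor).
- by move=> M; exact: (GammaI pp jor).
- by move=> M [].
Qed.

Lemma lab_done (g : 'I_3 -> 'I_3 -> seq nat -> nat) Rl rl (qs : seq (seq nat -> nat)) g' qs' (pr : seq nat -> nat) :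
  model S p e.+1 N g' (map mx9 Rl) (map rw3 rl) qs' -> (forall i j, g i j inp = g' i j) ->
  [seq q inp | q <- qs] = qs' -> pr inp = lab g Rl rl qs inp ->
  exists ms, class_labels S (Gamma S p L N) ms /\ pr inp = encode_labels ms.
Proof.
move=> md hg hq hpr; exists (labels_of (jr1 J) p e (jcc J) g' (map mx9 Rl) (map rw3 rl) qs').
split; first exact: model_done.
rewrite hpr /lab inp_ir1 inp_iee inp_icc hq; congr (encode_labels (labels_of _ _ _ _ _ _ _ _)).
by apply/funext=> i; apply/funext=> j; exact: hg.
Qed.

(** For two short roots at 60 degrees the norm is even, and the program recovers its half from the
    label by division by 2. *)
Lemma nat_B x y : root S N x -> N y -> 2 * B x y = Q x -> N x -> exists2 b : nat, B x y = b%:R & Q x = (2 * b)%N%:R.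
Proof.
move=> rx Ny h Nx; have qx := qform_gt0 pS (root_neq0 rx).
have /natrP[b hb] : B x y \is a Num.nat by rewrite natrEint (il_int lN Nx Ny) /=; lra.
by exists b => //; rewrite -h hb natrM.
Qed.

Lemma program_correct : exists ms, class_labels S (Gamma S p L N) ms /\ prog inp = encode_labels ms.
Proof.
have [_ srt _] := hl.
have jN K : (0 < K)%N -> approx_jordan S p N (DN p J) K by exact: (N_approx op pS latL primL LN jor).
have K0 m n : (0 < m + n.+1)%N by rewrite addnS.
have qn x : root S N x -> exists k : nat, Q x = k%:R by move=> rx; exact: (qform_nat pS lN (root_in rx)).
case: (classification pS lN).
- move=> cov; have [W [WN gW sW]] := jN _ (ltn0Sn e).
  have md := model0 pS pp lN WN gW sW cov.
  (* The group order evaluates to a numeral, which selects the branch of [prog]; the same is done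
     for every type. *)
  have [h1 h2] := model_label pS lN hl md; rewrite size_group// in h1.
  apply: (lab_done (g := fun i j s => (iDN i s * (i == j))%N) (qs := [::]) md) => //.
    by move=> i j; rewrite -(inp_iDN p J lb).
  by rewrite /prog inp_ih h1.
- move=> x rx cov; have [q Qx] := qn x rx.
  have [t tP ht] := A1_exists pS pp op lN (K0 q e) (jN _ (K0 q e)) rx Qx.
  have md := A1_model pS pp op lN (K0 q e) (jN _ (K0 q e)) rx Qx (find_iota tP ht) (leqnn _) (ltn0Sn e) cov.
  have [h1 h2] := model_label pS lN hl md; rewrite size_group// in h1.
  have lE : lb.2 = [:: q] by apply: sorted_perm.
  have il0 : il 0 inp = q by rewrite inp_il lE.
  have K1E : K1 inp = (q + e.+1)%N by rewrite /K1 il0 inp_iee.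
  have tE : tA inp = find (okA p (q + e.+1) (DN p J) q) (iota 0 ((p ^ (q + e.+1)) ^ 9)).
    by rewrite /tA K1E il0 inp_iDN.
  apply: (lab_done (g := fun i j s => gA (ip s) (K1 s) (fun i => iDN i s) (tA s) i j) (qs := [:: il 0]) md).
  + by move=> i j; rewrite K1E inp_iDN tE.
  + by rewrite /= il0.
  + by rewrite /prog inp_ih h1.
- move=> x y z [rx ry rz] [xy xz yz] cov.
  (* The label lists the three norms in increasing order, so the frame is permuted accordingly
     before the model is built. *)
  pose fr x y z := [/\ [/\ root S N x, root S N y & root S N z], [/\ B x y = 0, B x z = 0 & B y z = 0] & covered S N [:: x; y; z]].
  have f12 a b c : fr a b c -> fr b a c.
    move=> [[ra rb rc] [ab ac bc] cv]; split=> //; first by split=> //; rewrite (bformC pS).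
    by move=> s /cv[r hr pr]; exists r => //; move: hr; rewrite !inE => /or3P[] ->; rewrite ?orbT.
  have f23 a b c : fr a b c -> fr a c b.
    move=> [[ra rb rc] [ab ac bc] cv]; split=> //; first by split=> //; rewrite (bformC pS).
    by move=> s /cv[r hr pr]; exists r => //; move: hr; rewrite !inE => /or3P[] ->; rewrite ?orbT.
  have f0 : fr x y z by split.
  have [a [b [c [fabc ab bc]]]] : exists a b c, [/\ fr a b c, Q a <= Q b & Q b <= Q c].
    have [h1|h1] := leP (Q x) (Q y); have [h2|h2] := leP (Q y) (Q z); have [h3|h3] := leP (Q x) (Q z).
    + by exists x, y, z.
    + by exists x, y, z.
    + by exists x, z, y; split=> //; [exact: f23|exact: ltW].
    + by exists z, x, y; split=> //; [exact: f12 (f23 _ _ _ f0)|exact: ltW].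
    + by exists y, x, z; split=> //; [exact: f12|exact: ltW].
    + by exists y, z, x; split=> //; [exact: f23 (f12 _ _ _ f0)|exact: ltW].
    + by exists z, y, x; split; [exact: f12 (f23 _ _ _ (f12 _ _ _ f0))|exact: ltW|exact: ltW].
    + by exists z, y, x; split; [exact: f12 (f23 _ _ _ (f12 _ _ _ f0))|exact: ltW|exact: ltW].
  have [[ra rb rc] [oab oac obc] cv] := fabc.
  have [q1 h1] := qn a ra; have [q2 h2] := qn b rb; have [q3 h3] := qn c rc.
  have md := model3 e.+1 pS pp op lN ra rb rc oab oac obc h1 h2 h3 cv.
  have [k1 k2] := model_label pS lN hl md; rewrite size_group// in k1.
  have lE : lb.2 = [:: q1; q2; q3].
    by apply: sorted_perm => //=; rewrite -(ler_nat rat) -(ler_nat rat q2) -h1 -h2 -h3 ab bc.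
  have ilE i : (i < 3)%N -> il i inp = nth 0%N [:: q1; q2; q3] i by move=> hi; rewrite inp_il lE.
  apply: (lab_done (g := glf [:: il 0; (fun=> 0%N); (fun=> 0%N); (fun=> 0%N); il 1; (fun=> 0%N); (fun=> 0%N); (fun=> 0%N); il 2])
    (qs := [:: il 0; il 1; il 2]) md).
  + by move=> i j; rewrite /glf /= !ilE.
  + by rewrite /= !ilE.
  + by rewrite /prog inp_ih k1.
- move=> x y sys cov; have [[rx ry rxy] Qyx Bxy _] := sys.
  have [al hb Qx] := nat_B rx (root_in ry) Bxy (root_in rx).
  have KE : (0 < 2 * al + e.+2)%N by rewrite addnS.
  have [z zP hz] := A2_exists pS pp lN KE (jN _ KE) sys Qx.
  have md := A2_model pS pp op lN KE (jN _ KE) sys Qx (find_iota zP hz) (leqnn _) cov.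
  have [k1 k2] := model_label pS lN hl md; rewrite size_group// in k1.
  have lE : lb.2 = [:: 2 * al; 2 * al; 2 * al]%N by apply: sorted_perm => //=; rewrite !leqnn.
  have il0 : il 0 inp = (2 * al)%N by rewrite inp_il lE.
  have alE : ial inp = al by rewrite /ial il0 mulKn.
  have KAE : KA inp = (2 * al + e.+2)%N by rewrite /KA alE inp_iee.
  have zE : zA inp = find (okB p (2 * al + e.+2) (DN p J) al) (iota 0 ((p ^ (2 * al + e.+2)) ^ 2)).
    by rewrite /zA KAE alE inp_iDN.
  have bE : ibe inp = dig (p ^ (2 * al + e.+2)) (find (okB p (2 * al + e.+2) (DN p J) al) (iota 0 ((p ^ (2 * al + e.+2)) ^ 2))) 0.
    by rewrite /ibe KAE zE.
  apply: (lab_done (g := glf [:: iab; ibe; ibe; ibe; iab; ibe; ibe; ibe; iab]) (qs := [:: ial2; ial2; ial2]) md).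
  + by move=> i j; rewrite /glf /= /iab alE bE.
  + by rewrite /= /ial2 alE.
  + by rewrite /prog inp_ih k1.
- move=> x y z sys cov; have [[rx ry rz] _ _ _] := sys.
  have [q1 h1] := qn x rx; have [q0 h0] := qn z rz.
  have md := model5 e.+1 pS pp op lN sys h1 h0 cov.
  have [k1 k2] := model_label pS lN hl md; rewrite size_group// in k1.
  have [l1 ls] := label5 srt k2; have sz := perm_size k2; rewrite /= in sz.
  have ilE : il 1 inp = q1 by rewrite inp_il ?sz.
  have qE : q05 inp = q0 by rewrite /q05 ilE (inp_isum _ _ sz) ls addKn.
  apply: (lab_done (g := glf [:: il 1; (fun=> 0%N); (fun=> 0%N); (fun=> 0%N); il 1; (fun=> 0%N); (fun=> 0%N); (fun=> 0%N); q05])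
    (qs := [:: il 1; il 1; il12; il12; q05]) md).
  + by move=> i j; rewrite /glf /= ilE qE.
  + by rewrite /= /il12 ilE qE.
  + by rewrite /prog inp_ih k1.
- move=> x y z sys cov; have [[rx ry rz] [_ _ _ Bxy] _ _] := sys.
  have [b hb Qx] := nat_B rx (root_in ry) Bxy (root_in rx); have [q0 h0] := qn z rz.
  have md := model7 e.+1 pS pp op lN sys hb h0 cov.
  have [k1 k2] := model_label pS lN hl md; rewrite size_group// in k1.
  have [l1 ls] := label7 srt k2; have sz := perm_size k2; rewrite /= in sz.
  have ilE : il 1 inp = (2 * b)%N by rewrite inp_il ?sz.
  have qE : q07 inp = q0 by rewrite /q07 ilE (inp_isum _ _ sz) ls addKn.
  have bE : ib7 inp = b by rewrite /ib7 ilE mulKn.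
  apply: (lab_done (g := glf [:: ib72; ib7; (fun=> 0%N); ib7; ib72; (fun=> 0%N); (fun=> 0%N); (fun=> 0%N); q07])
    (qs := [:: ib72; ib72; ib72; ib76; ib76; ib76; q07]) md).
  + by move=> i j; rewrite /glf /= /ib72 bE qE.
  + by rewrite /= /ib72 /ib76 bE qE.
  + by rewrite /prog inp_ih k1.
- move=> t x y z sys cov; have [[rx ry rz] _ _ _ [[rxy _] _ _]] := sys.
  have [q h1] := qn x rx; have [q' h0] := qn _ rxy.
  have md := model9 e.+1 pS pp op lN sys h1 h0 cov.
  have [k1 k2] := model_label pS lN hl md; rewrite size_group// in k1.
  have [l1 ls] := label9 srt k2; have sz := perm_size k2; rewrite /= in sz.
  have ilE : il 4 inp = q' by rewrite inp_il ?sz.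
  have qE : q9 inp = q by rewrite /q9 ilE (inp_isum _ _ sz) ls addKn mulKn.
  apply: (lab_done (g := glf [:: q9; (fun=> 0%N); (fun=> 0%N); (fun=> 0%N); q9; (fun=> 0%N); (fun=> 0%N); (fun=> 0%N); q9])
    (qs := [:: q9; q9; q9; il 4; il 4; il 4; il 4; il 4; il 4]) md).
  + by move=> i j; rewrite /glf /= qE.
  + by rewrite /= ilE qE.
  + by rewrite /prog inp_ih k1.
Qed.
End Final.

Theorem theorem7p7 :
  exists c : mu_code,
  forall (p : nat) (S : 'M[rat]_3) (L N : set 'rV[rat]_3)
         (lN : label) (J : 3.-tuple (nat * nat)),
    prime p -> odd p ->
    posdef_space S -> is_lattice L -> primitive_lattice S L ->
    2 <= ordp p (disc S L) ->
    Lambda S p L = N ->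
    has_label S N lN ->
    jordan_decomposition S p L J ->
    exists ms : seq label,
      class_labels S (Gamma S p L N) ms /\
      mu_eval c (encode_input p J lN) (encode_labels ms).
Proof.
have [c hc] := comp_prog; exists c => p S L N lN J pp op pS latL primL ordL LN hl jor.
have [ms [h1 h2]] := program_correct pp op pS latL primL ordL LN hl jor.
by exists ms; split=> //; rewrite -h2; apply: hc; exact: inp_size.
Qed.
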